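(* Let $n\ge2$. There exists $d_0\in(0,1)$, independent of $\sigma$, such that for every fixed $d\in(0,d_0]$ the following holds with $h=d\sigma$. Let $1\le p\le\infty$ and let $u(\cdot,t)$, $t\in[0,T]$, be the solution of the advection equation $$\frac{\partial u}{\partial t}+(\mathbf a\cdot\nabla)u=0\ \text{ in }\Omega\times[0,T],\qquad u(\cdot,0)=u_0\ \text{ on }\Omega,$$ with initial data $u_0\in L^p(\Omega)$. Let $u_h(t)=\sum_{i=1}^N w_iu_i\delta_{\mathbf x_i(t)}$ be the particle approximation with $u_i:=\bigl(P_\sigma^{n+1}u_0\bigr)(\mathbf x_i(0))$, $i=1,\dots,N$, and let $u_{h,\sigma}(\cdot,t):=A_h^{-1}u_h(t)$, i.e. $u_{h,\sigma}(\cdot,t)\in V_\sigma^n(\Omega)$ is the (unique) solution of $$\sum_{i=1}^N w_i\,u_{h,\sigma}(\mathbf x_i(t),t)\,v_\sigma(\mathbf x_i(t))=\sum_{i=1}^N w_i\,u_i\,v_\sigma(\mathbf x_i(t))\qquad\forall v_\sigma\in V_\sigma^n(\Omega).$$ Then for all $0\le s\le n$ and all $t\in[0,T]$ $$\|u_{h,\sigma}(\cdot,t)-u(\cdot,t)\|_{L^p(\Omega)}\le C\,\sigma^s\,\|u_0\|_{W^{s,p}(\Omega)},$$ with a constant $C>0$ independent of $h$, $\sigma$, $t$ and $u_0$.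
   Context: Setting. $\Omega=(0,1)^D$ with $D\in\mathbb N$ (typically $D\in\{2,3\}$), $T>0$, and $\mathbf a:\Omega\times[0,T]\to\mathbb R^D$ is a given bounded velocity field, smooth up to the boundary (so all its derivatives are bounded), with $\nabla\cdot\mathbf a\equiv0$ and $\mathbf a\cdot\mathbf n=0$ on $\partial\Omega$ ($\mathbf n$ the unit normal). Solution. For $\tau,t\in[0,T]$ let $\boldsymbol\Phi_\tau^t(\mathbf x):=\mathbf X(t)$, where $\mathbf X$ solves $\dot{\mathbf X}(t)=\mathbf a(\mathbf X(t),t)$, $\mathbf X(\tau)=\mathbf x$. The (weak) solution of the advection equation is $u(\mathbf x,t)=u_0(\boldsymbol\Phi_t^0(\mathbf x))$. Spline spaces. For $\sigma>0$ with $1/\sigma\in\mathbb N$, subdivide $\Omega$ into the uniform Cartesian grid of cubes $Q_i^\sigma$ of edge length $\sigma$. For $k\in\mathbb N$, $k\ge2$, $$V_\sigma^k(\Omega):=\{u\in C^{k-2}(\Omega):\ u|_{Q_i^\sigma}\in\mathbb Q_{k-1}\ \text{for all cubes } Q_i^\sigma\},$$ where $\mathbb Q_{k-1}$ is the space of polynomials of coordinate-wise degree at most $k-1$. Quasi-interpolator. $P_\sigma^k:L^1(\Omega)\to V_\sigma^k(\Omega)$ is the standard (linear) tensor-product spline quasi-interpolation operator (Schumaker, *Spline Functions: Basic Theory*, Theorems 12.6 and 12.7). It has the following properties for every cube $Q_i^\sigma$ and every $p\in[1,\infty]$: $$\|P_\sigma^ku\|_{W^{s,p}(Q_i^\sigma)}\le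 C\|u\|_{W^{s,p}(\hat Q_i^\sigma)}\quad(0\le s\le k-1),\qquad \|u-P_\sigma^ku\|_{L^p(Q_i^\sigma)}\le C\sigma^s|u|_{W^{s,p}(\hat Q_i^\sigma)}\quad(0\le s\le k),$$ with $C$ depending only on $k,D,s$. Here $\hat Q_i^\sigma\supset Q_i^\sigma$ is only slightly larger than $Q_i^\sigma$: it is a neighbourhood in $\Omega$ made up of $Q_i^\sigma$ and the grid cubes within a number of layers bounded in terms of $k$, so in particular $\operatorname{meas}_D(\hat Q_i^\sigma)\le C(k,D)\sigma^D$. Particles. For $h>0$ with $1/h\in\mathbb N$, take another uniform Cartesian grid of $\Omega$ with cells $Q_i^h$ of edge length $h$, $i=1,\dots,N=h^{-D}$. In each cell place one particle at an arbitrary position $\mathbf x_i(0)\in Q_i^h$ (not necessarily the centre), with weight $w_i:=h^D$. The particles move according to $\dot{\mathbf x}_i(t)=\mathbf a(\mathbf x_i(t),t)$, $t\in[0,T]$. (When $h=d\sigma$, only those $d,\sigma$ are considered for which both $1/\sigma$ and $1/h$ are integers.) $\delta_{\mathbf x}$ is the Dirac delta at $\mathbf x$, so $\langle u_h(t),v_\sigma\rangle=\sum_i w_iu_iv_\sigma(\mathbf x_i(t))$. Operator. For given $t$, $A_h$ maps $V_\sigma^n(\Omega)$ to its dual via $\langle A_hu_\sigma,v_\sigma\rangle:=\sum_{i=1}^N w_i\,u_\sigma(\mathbf x_i(t))\,v_\sigma(\mathbf x_i(t))$; for $d\le d_0$ it is invertible. Conventions. $W^{s,p}(\Omega)$ is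 the usual Sobolev space (for non-integer $s$, the Sobolev–Slobodeckij space); the estimate is understood as trivial if $\|u_0\|_{W^{s,p}(\Omega)}=\infty$. $d_0$ and $C$ may depend on $\mathbf a$, $T$, $n$, $D$ (and $C$ also on $d$, $s$ and $p$), but not on $\sigma$, $h$, $t$, $u_0$ or the choice of the positions $\mathbf x_i(0)\in Q_i^h$. *)

(* Defs.v *)
From HB Require Import structures.
From mathcomp Require Import all_boot all_order all_algebra.
From mathcomp Require Import all_classical all_reals all_analysis.

Set Implicit Arguments.
Unset Strict Implicit.
Unset Printing Implicit Defensive.

Import Order.TTheory GRing.Theory Num.Theory.
Import numFieldNormedType.Exports.

Local Open Scope classical_set_scope.
Local Open Scope ring_scope.

(** * Lebesgue measure on ['rV[R]_n]

    The library has Lebesgue measure on [R] only. ['rV[R]_n] gets the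
    sigma-algebra generated by the coordinates (the Borel sets), and Lebesgue
    measure is obtained by iterating the binary product. *)

Fact rV_display : measure_display. Proof. exact: default_measure_display. Qed.

Section measurable_rV.
Context {R : realType} (n : nat).

Let coor (i : 'I_n) (x : 'rV[R]_n) : measurableTypeR R := x 0 i.

Let rV_set0 : g_sigma_preimage coor set0.
Proof. exact: sigma_algebra0. Qed.

Let rV_setC A : g_sigma_preimage coor A -> g_sigma_preimage coor (~` A).
Proof. exact: sigma_algebraC. Qed.

Let rV_bigcup (F : (set 'rV[R]_n)^nat) :
  (forall i, g_sigma_preimage coor (F i)) ->
  g_sigma_preimage coor (\bigcup_i (F i)).
Proof. exact: sigma_algebra_bigcup. Qed.

HB.instance Definition _ := @isMeasurable.Build rV_display 'rV[R]_n
  (g_sigma_preimage coor) rV_set0 rV_setC rV_bigcup.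

Lemma measurable_coor (i : 'I_n) :
  measurable_fun [set: 'rV[R]_n] (fun x => x 0 i : measurableTypeR R).
Proof.
move=> _ Y mY; rewrite setTI; apply: sub_sigma_algebra => /=.
rewrite -bigcup_seq/=; exists i => /=; first by rewrite mem_index_enum.
by exists Y => //; rewrite setTI.
Qed.

Lemma measurable_fun_rV d (T : measurableType d) (f : T -> 'rV[R]_n) :
  (forall i, measurable_fun [set: T] (fun x => f x 0 i : measurableTypeR R)) ->
  measurable_fun [set: T] f.
Proof.
move=> mf.
have H : g_sigma_preimage (fun i => coor i \o f) `<=` measurable.
  apply: smallest_sub; first exact: sigma_algebra_measurable.
  rewrite -bigcup_seq => A [i _] [B mB <-].
  exact: mf.
move=> _ A mA; rewrite setTI; apply: H.
by rewrite g_sigma_preimage_comp; exists A => //; rewrite setTI.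
Qed.

End measurable_rV.

Section cons_rV.
Context {R : realType} (n : nat).

Definition cons_rV (z : measurableTypeR R * 'rV[R]_n) : 'rV[R]_n.+1 :=
  \row_j oapp (z.2 0) z.1 (unlift ord0 j).

Definition uncons_rV (x : 'rV[R]_n.+1) : measurableTypeR R * 'rV[R]_n :=
  (x 0 ord0, \row_j x 0 (lift ord0 j)).

Lemma cons_rVK : cancel cons_rV uncons_rV.
Proof.
case=> r y; rewrite /uncons_rV mxE unlift_none/=; congr pair.
by apply/rowP => j; rewrite !mxE liftK.
Qed.

Lemma uncons_rVK : cancel uncons_rV cons_rV.
Proof.
move=> x; apply/rowP => j; rewrite mxE.
by case: unliftP => [k ->|->] /=; rewrite ?mxE.
Qed.

Lemma measurable_cons_rV : measurable_fun setT cons_rV.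
Proof.
apply: measurable_fun_rV => i.
case: (unliftP ord0 i) => [k|] ->.
  rewrite (_ : (fun _ => _) = (fun y : 'rV[R]_n => y 0 k) \o snd); last first.
    by apply/funext => z; rewrite /cons_rV mxE liftK.
  by apply: measurableT_comp => //; exact: measurable_coor.
rewrite (_ : (fun _ => _) = fst)//.
by apply/funext => z; rewrite /cons_rV mxE unlift_none.
Qed.

Lemma measurable_uncons_rV : measurable_fun setT uncons_rV.
Proof.
apply/measurable_fun_pairP; split; first exact: measurable_coor.
apply: measurable_fun_rV => i.
rewrite (_ : (fun _ => _) = (fun y : 'rV[R]_n.+1 => y 0 (lift ord0 i))).
  exact: measurable_coor.
by apply/funext => z; rewrite /= mxE.
Qed.

End cons_rV.

Section lebesgue_cons.
Context {R : realType} (n : nat).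
Variable mu : {sigma_finite_measure set 'rV[R]_n -> \bar R}.
Local Open Scope ereal_scope.

Local Notation nu := (@lebesgue_measure R \x mu).

Let preim_cons (A : set 'rV[R]_n.+1) :
  measurable A -> measurable (@cons_rV R n @^-1` A).
Proof. by move=> mA; rewrite -[X in measurable X]setTI; exact: measurable_cons_rV. Qed.

Definition lebesgue_cons : set 'rV[R]_n.+1 -> \bar R :=
  pushforward nu (@cons_rV R n).

Let lebesgue_cons0 : lebesgue_cons set0 = 0.
Proof. by rewrite /lebesgue_cons /pushforward preimage_set0 measure0. Qed.

Let lebesgue_cons_ge0 A : 0 <= lebesgue_cons A.
Proof. by rewrite /lebesgue_cons /pushforward; exact: measure_ge0. Qed.

Let lebesgue_cons_sigma_additive : semi_sigma_additive lebesgue_cons.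
Proof.
move=> F mF tF mUF; rewrite /lebesgue_cons /pushforward preimage_bigcup.
apply: measure_semi_sigma_additive.
- by move=> k; exact: preim_cons.
- apply/trivIsetP => /= i j _ _ ij; rewrite -preimage_setI.
  by move/trivIsetP : tF => /(_ _ _ _ _ ij) ->//; rewrite preimage_set0.
- by rewrite -preimage_bigcup; exact: preim_cons.
Qed.

HB.instance Definition _ := isMeasure.Build _ _ _ lebesgue_cons
  lebesgue_cons0 lebesgue_cons_ge0 lebesgue_cons_sigma_additive.

Let lebesgue_cons_sigma_finite : sigma_finite setT lebesgue_cons.
Proof.
have /sigma_finiteP[F [TF ndF Foo]] := sigma_finiteT (@lebesgue_measure R).
have /sigma_finiteP[G [TG ndG Goo]] := sigma_finiteT mu.
exists (fun k => @uncons_rV R n @^-1` (F k `*` G k)).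
  rewrite -preimage_bigcup (_ : \bigcup_k _ = setT) ?preimage_setT//.
  apply/seteqP; split => // -[x y] _.
  have [k _ Fkx] : (\bigcup_i F i) x by rewrite -TF.
  have [l _ Gly] : (\bigcup_i G i) y by rewrite -TG.
  exists (maxn k l) => //; split => /=.
  - by move: x Fkx; exact/subsetPset/ndF/leq_maxl.
  - by move: y Gly; exact/subsetPset/ndG/leq_maxr.
move=> k; have [mFk Fk] := Foo k; have [mGk Gk] := Goo k.
have mFG : measurable (F k `*` G k) by exact: measurableX.
split; first by rewrite -[X in measurable X]setTI; exact: measurable_uncons_rV.
rewrite /lebesgue_cons /pushforward -comp_preimage.
rewrite (_ : _ \o _ = id) ?preimage_id; last first.
  by apply/funext => z /=; rewrite cons_rVK.
by rewrite product_measure1E// lte_mul_pinfty// ge0_fin_numE.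
Qed.

HB.instance Definition _ := Measure_isSigmaFinite.Build _ _ _ lebesgue_cons
  lebesgue_cons_sigma_finite.

End lebesgue_cons.

Fixpoint lebesgue_rV (R : realType) (n : nat) :
    {sigma_finite_measure set 'rV[R]_n -> \bar R} :=
  match n with
  | 0 => [the {sigma_finite_measure set 'rV[R]_0 -> \bar R} of dirac (0 : 'rV[R]_0)]
  | n'.+1 => [the {sigma_finite_measure set 'rV[R]_n'.+1 -> \bar R} of
               lebesgue_cons (lebesgue_rV R n')]
  end.

Lemma lebesgue_rV_box (R : realType) (n : nat) (l r : 'rV[R]_n) :
  (forall i, l 0 i <= r 0 i) ->
  lebesgue_rV R n [set x | forall i, x 0 i \in `[l 0 i, r 0 i]] =
  (\prod_i (r 0 i - l 0 i))%:E.
Proof.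
elim: n => [|n IHn] in l r * => lr.
  by rewrite big_ord0 /= diracE mem_set// => -[].
pose B := [set x : 'rV[R]_n | forall i,
  x 0 i \in `[(uncons_rV l).2 0 i, (uncons_rV r).2 0 i]].
have mB : measurable B.
  rewrite (_ : B = \big[setI/setT]_i
    ((fun x : 'rV[R]_n => x 0 i : measurableTypeR R) @^-1`
      `[(uncons_rV l).2 0 i, (uncons_rV r).2 0 i])).
    apply: bigsetI_measurable => i _; rewrite -[X in measurable X]setTI.
    by apply: measurable_coor => //; exact: measurable_itv.
  rewrite -bigcap_seq; apply/seteqP; split => x Bx i => [_|]; first exact: Bx.
  by apply: Bx; rewrite /= mem_index_enum.
rewrite /= /lebesgue_cons /pushforward.
rewrite (_ : _ @^-1` _ = (`[l 0 ord0, r 0 ord0] : set (measurableTypeR R)) `*` B).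
  rewrite product_measure1E//.
  have -> : lebesgue_rV R n B = _ := IHn _ _ _; last first.
    by move=> i; rewrite /= !mxE.
  have lE : lebesgue_measure (`[l 0 ord0, r 0 ord0] : set (measurableTypeR R)) =
            (r 0 ord0 - l 0 ord0)%:E.
    rewrite lebesgue_measure_itv /= lte_fin.
    by case: ltgtP (lr ord0) => // -> _; rewrite subrr.
  rewrite big_ord_recl EFinM; congr (_ * _)%E; first exact: lE.
  by congr EFin; apply: eq_bigr => i _; rewrite !mxE.
apply/seteqP; split => -[x y] /=.
  move=> H; split=> [|i]; first by have := H ord0; rewrite mxE unlift_none.
  by have := H (lift ord0 i); rewrite !mxE liftK.
move=> [Hx Hy] i; case: (unliftP ord0 i) => [j|] ->.
  by have := Hy j; rewrite !mxE liftK.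
by rewrite mxE unlift_none.
Qed.

Section euclidean.
Context {R : realType} {n : nat}.
Implicit Types (U : set 'rV[R]_n) (f : 'rV[R]_n -> R).

(* [`|x|] on ['rV_n] is the sup norm. *)
Definition eucl_norm (x : 'rV[R]_n) : R := Num.sqrt (\sum_i x 0 i ^+ 2).

Definition partial (i : 'I_n) f : 'rV[R]_n -> R :=
  fun x => 'D_(delta_mx 0 i) f x.

Definition partials (l : seq 'I_n) f : 'rV[R]_n -> R := foldr partial f l.

(* [U] is meant to be open. *)
Definition Ck_on (k : nat) U f : Prop :=
  forall l : seq 'I_n,
    ((size l <= k)%N -> forall x, U x -> {for x, continuous (partials l f)}) /\
    ((size l < k)%N -> forall x i, U x -> derivable (partials l f) x (delta_mx 0 i)).

Definition smooth_on U f : Prop := forall k, Ck_on k U f.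

(* [f] belongs to C^oo of the closure of the open set [U]: it is continuous
   there, and every derivative extends continuously from [U] to the closure. *)
Definition smooth_up_to U f : Prop :=
  [/\ smooth_on U f, {within closure U, continuous f} &
      forall l : seq 'I_n, exists2 g : 'rV[R]_n -> R,
        {within closure U, continuous g} & {in U, g =1 partials l f}].

End euclidean.

Section sobolev.
Context {R : realType} {D : nat}.
Implicit Types (A : set 'rV[R]_D) (u v : 'rV[R]_D -> R) (p : \bar R).
Local Notation mu := (lebesgue_rV R D).

Definition Lp_norm A p u : \bar R := 'N[mu]_p[(EFin \o u) \_ A].

Definition in_Lp A p u : Prop := measurable_fun A u /\ (Lp_norm A p u < +oo)%E.

Definition locally_L1 A u : Prop :=
  measurable_fun A u /\
  forall K, K `<=` A° -> compact K -> (\int[mu]_(x in K) `|u x|%:E < +oo)%E.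

Definition multi_index (m : nat) := {ffun 'I_D -> 'I_m.+1}.

Definition multi_indices (m : nat) : seq (multi_index m) :=
  enum [pred al : multi_index m | (\sum_i (al i : nat) == m)%N].

Definition multi_partial m (al : multi_index m) u : 'rV[R]_D -> R :=
  partials (flatten [seq nseq (al i) i | i <- enum 'I_D]) u.

Definition test_function A (phi : 'rV[R]_D -> R) : Prop :=
  [/\ smooth_on setT phi, compact (closure [set x | phi x != 0]) &
      closure [set x | phi x != 0] `<=` A°].

(* [v] is the weak derivative of [u] of order [al] in the interior of [A]. *)
Definition weak_derivative A m (al : multi_index m) u v : Prop :=
  [/\ locally_L1 A u, locally_L1 A v &
      forall phi, test_function A phi ->
        \int[mu]_(x in A) (u x * multi_partial al phi x) =
        (-1) ^+ m * \int[mu]_(x in A) (v x * phi x)].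

(* For [p = +oo] the exponent of the distance is [th]: the Hoelder seminorm. *)
Definition slobodeckij A (th : R) p v : \bar R :=
  'N[(mu \x mu)%E]_p[(fun z => (`|v z.1 - v z.2| /
     eucl_norm (z.1 - z.2) `^ (th + D%:R * fine p^-1))%:E) \_ (A `*` A)].

(* The l^p norm of a finite family of nonnegative extended reals. *)
Definition lp_norm p (s : seq (\bar R)) : \bar R :=
  match p with
  | r%:E => ((\sum_(x <- s) x `^ r) `^ r^-1)%E
  | _ => \big[maxe/0%E]_(x <- s) x
  end.

Definition int_part (s : R) : nat := Num.truncn s.
Definition frac_part (s : R) : R := s - (int_part s)%:R.

(* Weak derivatives are unique up to null sets, so that the infimum below is
   the (semi)norm of the weak derivative if that exists and +oo otherwise. *)
Definition sobolev_seminorm A (s : R) p u : \bar R :=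
  lp_norm p [seq ereal_inf
      [set (if frac_part s == 0 then Lp_norm A p v
            else slobodeckij A (frac_part s) p v) | v in weak_derivative A al u]
    | al <- multi_indices (int_part s)].

Definition sobolev_norm A (s : R) p u : \bar R :=
  lp_norm p ([seq sobolev_seminorm A k%:R p u | k <- iota 0 (int_part s).+1] ++
    if frac_part s == 0 then [::] else [:: sobolev_seminorm A s p u]).

End sobolev.

Section splines.
Context (R : realType) (D : nat).
Implicit Types (u v : 'rV[R]_D -> R).

Definition Omega : set 'rV[R]_D := [set x | forall j, 0 < x 0 j < 1].

Definition cell_index (m : nat) := {ffun 'I_D -> 'I_m}.

(* [m] is the number of cells per direction, i.e. the edge length is [1 / m].
   The cell [i] enlarged by [L] layers of cells of the grid; faces are
   included, except for those on the boundary of [Omega]. *)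
Definition enlarged_cell (L m : nat) (i : cell_index m) : set 'rV[R]_D :=
  [set x | Omega x /\ forall j,
     ((i j)%:R - L%:R) / m%:R <= x 0 j <= ((i j).+1%:R + L%:R) / m%:R].

Definition cell (m : nat) (i : cell_index m) : set 'rV[R]_D := enlarged_cell 0 i.

(* Q_(k-1): the coordinate-wise degree is less than [k]. *)
Definition tensor_poly (k : nat) (c : {ffun 'I_D -> 'I_k} -> R) (x : 'rV[R]_D) : R :=
  \sum_al c al * \prod_j x 0 j ^+ al j.

Definition spline (k m : nat) u : Prop :=
  Ck_on (k - 2) Omega u /\
  forall i : cell_index m, exists c, {in cell i, u =1 @tensor_poly k c}.

(* [P m] is the operator on the grid of edge length [1 / m]. Of the spline
   quasi-interpolants in the literature (Schumaker, Spline Functions: Basic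
   Theory, Theorems 12.6 and 12.7) this records linearity, the range, and local
   stability and approximation, with constants and a number of layers that do
   not depend on the grid, the cell, [p] or [u]. *)
Definition quasi_interpolator (k : nat)
    (P : nat -> ('rV[R]_D -> R) -> 'rV[R]_D -> R) : Prop :=
  (forall m, (0 < m)%N ->
    (forall u, in_Lp Omega 1 u -> spline k m (P m u)) /\
    (forall (b : R) u v, in_Lp Omega 1 u -> in_Lp Omega 1 v ->
       {in Omega, P m (b \*: u \+ v) =1 b \*: P m u \+ P m v})) /\
  exists L : nat,
    (forall s : R, 0 <= s <= k.-1%:R -> exists2 C : R, 0 < C &
       forall m (i : cell_index m) p u, (0 < m)%N -> (1 <= p)%E ->
         in_Lp Omega 1 u ->
         (sobolev_norm (cell i) s p (P m u) <=
          C%:E * sobolev_norm (enlarged_cell L i) s p u)%E) /\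
    (forall s : R, 0 <= s <= k%:R -> exists2 C : R, 0 < C &
       forall m (i : cell_index m) p u, (0 < m)%N -> (1 <= p)%E ->
         in_Lp Omega 1 u ->
         (Lp_norm (cell i) p (u \- P m u)%R <=
          (C * m%:R^-1 `^ s)%:E * sobolev_seminorm (enlarged_cell L i) s p u)%E).

End splines.

Section advection.
Context {R : realType} {D : nat}.
Variables (T : R) (a : 'rV[R]_D -> R -> 'rV[R]_D).

Definition space_time : set 'rV[R]_(D + 1) :=
  [set z | Omega (lsubmx z) /\ 0 < rsubmx z 0 0 < T].

(* On the faces [x_j = 0] and [x_j = 1] the unit normal is, up to sign, the
   [j]-th basis vector. *)
Definition admissible_velocity : Prop :=
  [/\ forall j, smooth_up_to space_time
        (fun z => a (lsubmx z) (rsubmx z 0 0) 0 j),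
      forall x t, Omega x -> 0 <= t <= T ->
        \sum_j partial j (fun y => a y t 0 j) x = 0 &
      forall x t j, closure (@Omega R D) x -> 0 <= t <= T ->
        x 0 j = 0 \/ x 0 j = 1 -> a x t 0 j = 0].

(* X' = a(X, t) on [0, T], the derivative being one-sided at 0 and T. *)
Definition trajectory (X : R -> 'rV[R]_D) : Prop :=
  forall t, 0 <= t <= T -> Omega (X t) /\
    (fun r => (r - t)^-1 *: (X r - X t)) @ within `[0, T] t^' --> a (X t) t.

(* [Phi tau t x] is the position at time [t] of the trajectory that passes
   through [x] at time [tau]. *)
Definition flow (Phi : R -> R -> 'rV[R]_D -> 'rV[R]_D) : Prop :=
  forall tau x, 0 <= tau <= T -> Omega x ->
    Phi tau tau x = x /\ trajectory (fun t => Phi tau t x).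

Definition advection_solution (Phi : R -> R -> 'rV[R]_D -> 'rV[R]_D)
    (u0 : 'rV[R]_D -> R) (x : 'rV[R]_D) (t : R) : R := u0 (Phi t 0 x).

(* One particle for each cell of the grid of edge length [1 / M]. *)
Definition particles (M : nat) (x : cell_index D M -> R -> 'rV[R]_D) : Prop :=
  forall i, trajectory (x i) /\ cell i (x i 0).

End advection.

Section particle_method.
Context {R : realType} {D M : nat}.
Implicit Types (y : cell_index D M -> 'rV[R]_D) (u v : 'rV[R]_D -> R).

(* < sum_i w_i c_i delta_(y_i), v > *)
Definition particle_functional y (c : cell_index D M -> R) v : R :=
  \sum_i (M%:R^-1) ^+ D * c i * v (y i).

Definition A_h y u v : R := particle_functional y (fun i => u (y i)) v.

(* u = A_h^-1 (sum_i w_i c_i delta_(y_i)) in the spline space of order [n] on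
   the grid of edge length [1 / m]. *)
Definition regularization (n m : nat) y (c : cell_index D M -> R) u : Prop :=
  spline n m u /\
  forall v, spline n m v -> A_h y u v = particle_functional y c v.

End particle_method.

(* Main.v *)
Require Import Defs.
From HB Require Import structures.
From mathcomp Require Import all_boot all_order all_algebra.
From mathcomp Require Import all_classical all_reals all_analysis.
From mathcomp Require Import measurable_realfun ess_sup_inf hoelder.
From mathcomp Require Import ring lra zify.

(** Write [g = P m u0] and let [w x = g (Phi t 0 x)], so that the particle data
    are [w (x_i t)] and [w - u = (g - u0) o Phi t 0] is controlled by the
    approximation property of [P] and the Lipschitz bounds of the flow.

    On a cell [q] write [g] as a polynomial in [m x - q].  Testing [g] against
    derivatives of a bump and moving the derivatives to [u0] bounds every
    nonconstant coefficient, scaled by [m^-(n - degree)], by a local quantity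
    [eps q] which is [l^p]-summable over the cells to order [m^-s].  The
    coefficients of degree at least [n] bound the jumps of the spline across the
    faces, so that near any point [g] is one polynomial up to [eps].
    Transporting its part of degree less than [n] along the flow (Taylor
    expansion of the velocity, over small time steps) shows that near any point
    [w] is a polynomial of total degree less than [n], up to [eps].  A tensor
    product quasi-interpolant reproduces such polynomials, hence [w] is close to
    a spline [chi] of order [n].

    If [d] is small, every node of the quasi-interpolant has a particle nearby,
    and the Gram matrix of the B-splines on the particles is coercive and banded;
    conjugating it by geometric weights shows that its inverse decays
    exponentially off the diagonal.  So [u_hs - chi] is bounded by the local
    errors of [w - chi] at the particles through kernels with bounded row and
    column sums, which preserve [l^p] bounds (Schur). *)

Set Implicit Arguments.
Unset Strict Implicit.
Unset Printing Implicit Defensive.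

Import Order.TTheory GRing.Theory Num.Theory.
Import numFieldNormedType.Exports.

Local Open Scope classical_set_scope.
Local Open Scope ring_scope.

(** * Coordinate lines *)

(** The spline [g] has coordinate degree n, the target space only n - 1. No spatial derivative of
    the flow is ever taken: composition with the flow enters through a two-sided Lipschitz bound
    (Gronwall) and through its action on polynomials of total degree below n. The weight m^-(n -
    degree) is natural because, up to a factorial, a coefficient in m x - q is m^-degree times a
    derivative; weighted, every order is on the scale m^-n. The threshold d0 is a density condition,
    delta / (2 L): coercivity tolerates holes of size delta / m, and the flow stretches holes by at
    most L. Representatives of weak derivatives come from an infimum that need not be attained, so
    the estimates are proved for every E strictly above the Sobolev norm, and E is lowered at the
    end. Constants in the l^p inequalities are crude, which avoids Minkowski's inequality. *)

Lemma coord_le_norm (R : realType) n (x : 'rV[R]_n) j : `|x 0 j| <= `|x|.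
Proof.
have -> : `|x| = mx_norm x by [].
rewrite mx_normrE; exact: (le_bigmax 0 (fun ij => `|x ij.1 ij.2|) (ord0, j)).
Qed.

Lemma norm_leP (R : realType) n (x : 'rV[R]_n) (c : R) : 0 <= c ->
  (forall j, `|x 0 j| <= c) -> `|x| <= c.
Proof.
move=> c0 H; have -> : `|x| = mx_norm x by [].
by rewrite mx_normrE; apply: bigmax_le => // -[i j] _ /=; rewrite ord1.
Qed.

Section coordinate_lines.
Context {R : realType} {n : nat}.
Implicit Types (x y : 'rV[R]_n) (f : 'rV[R]_n -> R).

Definition upd x (j : 'I_n) (s : R) : 'rV[R]_n :=
  \row_k (if k == j then s else x 0 k).

Lemma updE x j s : upd x j s = upd x j 0 + s *: delta_mx 0 j.
Proof.
apply/rowP => k; rewrite !mxE eqxx /=.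
by case: eqP => _; rewrite ?mulr1 ?mulr0 ?add0r ?addr0.
Qed.

Lemma upd_id x j : upd x j (x 0 j) = x.
Proof. by apply/rowP => k; rewrite !mxE; case: eqP => // ->. Qed.

Lemma upd_eq x j s : upd x j s 0 j = s.
Proof. by rewrite mxE eqxx. Qed.

Lemma upd_neq x j k s : k != j -> upd x j s 0 k = x 0 k.
Proof. by move=> /negbTE kj; rewrite mxE kj. Qed.

Let line_diff x f j s : (fun h : R => h^-1 *: (((fun r => f (upd x j r)) \o shift s) (h *: (1 : R)) - f (upd x j s)))
  = (fun h : R => h^-1 *: ((f \o shift (upd x j s)) (h *: delta_mx 0 j) - f (upd x j s))).
Proof.
apply/funext => h /=; congr (_ *: (f _ - _)).
by rewrite -[_ *: 1]/(h * 1) mulr1 updE [in RHS]updE scalerDl; rewrite addrCA.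
Qed.

Lemma derivable_line x f j s : derivable f (upd x j s) (delta_mx 0 j) ->
  is_derive s 1 (fun r => f (upd x j r)) (partial j f (upd x j s)).
Proof.
move=> df; apply: DeriveDef; first by rewrite /derivable line_diff.
by rewrite /partial /derive; congr lim; rewrite line_diff.
Qed.

Lemma is_derive_coordinate x f j (s d : R) :
  is_derive s 1 (fun r => f (upd x j r)) d -> is_derive (upd x j s) (delta_mx 0 j) f d.
Proof.
move=> [dr de]; apply: DeriveDef; first by move: dr; rewrite /derivable line_diff.
by move: de; rewrite /derive line_diff.
Qed.

Lemma continuous_upd x j : continuous (upd x j).
Proof.
have -> : upd x j = fun s => upd x j 0 + s *: delta_mx 0 j.
  by apply/funext => s; exact: updE.
move=> s; apply: cvgD; first exact: cvg_cst.
apply: (@continuousZr_tmp _ _ _ id (delta_mx 0 j)); exact: cvg_id.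
Qed.

(** Vertices of the staircase path from [x] to [y], which changes one coordinate at a time. It stays
    in every box that contains both ends, so increments of functions of several variables reduce to
    one-dimensional mean value bounds. *)
Definition hyb x y (k : nat) : 'rV[R]_n :=
  \row_j (if (j < k)%N then y 0 j else x 0 j).

Lemma hyb0 x y : hyb x y 0 = x.
Proof. by apply/rowP => j; rewrite mxE. Qed.

Lemma hyb_end x y : hyb x y n = y.
Proof. by apply/rowP => j; rewrite mxE ltn_ord. Qed.

Lemma hybS x y (k : 'I_n) : hyb x y k.+1 = upd (hyb x y k) k (y 0 k).
Proof.
apply/rowP => j; rewrite !mxE ltnS leq_eqVlt -val_eqE /=.
by case: eqP => [/val_inj ->|] //=.
Qed.

Lemma hyb_coord x y (k : 'I_n) : hyb x y k 0 k = x 0 k.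
Proof. by rewrite mxE ltnn. Qed.

Lemma hyb_telescope f x y :
  f y - f x = \sum_(k < n) (f (hyb x y k.+1) - f (hyb x y k)).
Proof. by rewrite (big_ord_iter_telescope n (fun k => f (hyb x y k))) || rewrite -(big_mkord predT (fun k => f (hyb x y k.+1) - f (hyb x y k))) telescope_sumr // hyb0 hyb_end. Qed.

Definition obox (l r : 'rV[R]_n) : set 'rV[R]_n :=
  [set x | forall j, l 0 j < x 0 j < r 0 j].

Lemma open_obox l r : open (obox l r).
Proof.
rewrite openE => x ox; rewrite /interior.
apply: (@filter_forall _ 'I_n (fun j (y : 'rV[R]_n) => l 0 j < y 0 j < r 0 j) (nbhs x)) => j.
apply: (@coord_continuous R 1 n ord0 j x [set s | l 0 j < s < r 0 j]).
have -> : [set s | l 0 j < s < r 0 j] = `]l 0 j, r 0 j[%classic.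
  by apply/seteqP; split => s; rewrite /= in_itv.
by apply: open_nbhs_nbhs; split; [exact: interval_open|rewrite /= in_itv; exact: ox].
Qed.

Lemma obox_upd l r x j s : obox l r x -> l 0 j < s < r 0 j -> obox l r (upd x j s).
Proof. by move=> ox sj k; rewrite mxE; case: eqP => [->|]. Qed.

Lemma obox_hyb l r x y k : obox l r x -> obox l r y -> obox l r (hyb x y k).
Proof. by move=> ox oy j; rewrite mxE; case: ifP. Qed.

Definition cbox (l r : 'rV[R]_n) : set 'rV[R]_n :=
  [set x | forall j, l 0 j <= x 0 j <= r 0 j].

Lemma closed_cbox l r : closed (cbox l r).
Proof.
rewrite (_ : cbox l r = \bigcap_(j in [set: 'I_n])
    ((fun x : 'rV[R]_n => x 0 j) @^-1` `[l 0 j, r 0 j])); last first.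
  apply/seteqP; split => y /= H j; first by move=> _; rewrite /= in_itv; exact: H.
  by have := H j Logic.I; rewrite /= in_itv.
apply: closed_bigI => j _; apply: preimage_closed; last exact: interval_closed.
by move=> y _; exact: coord_continuous.
Qed.

Lemma closure_obox_bounded l r : bounded_set (closure (obox l r)).
Proof.
exists (`|l| + `|r|); split; first by rewrite num_real.
move=> M lM x cx; apply: ltW; apply: le_lt_trans lM.
have : closure (cbox l r) x.
  by apply: closureS cx => y oy j; case/andP: (oy j) => /ltW -> /ltW ->.
have -> : closure (cbox l r) = cbox l r.
  exact/esym/closure_id/closed_cbox.
move=> H; apply: norm_leP => [|j]; first by rewrite addr_ge0.
have /andP[lx xr] := H j.
have := coord_le_norm l j; have := coord_le_norm r j.
by rewrite !ler_norml; have := normr_ge0 l; have := normr_ge0 r; lra.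
Qed.

(** The continuous extension of the derivative is bounded on the closure, which is compact. *)
Lemma smooth_up_to_bound l r f (w : seq 'I_n) : smooth_up_to (obox l r) f ->
  exists2 C : R, 0 <= C & forall x, obox l r x -> `|partials w f x| <= C.
Proof.
move=> [_ _ /(_ w)[g cg gE]].
have K : compact (closure (obox l r)).
  apply: bounded_closed_compact; first exact: closure_obox_bounded.
  exact: closed_closure.
have [M [Mr HM]] := compact_bounded (continuous_compact cg K).
exists (`|M| + 1) => [|x ox]; first by rewrite addr_ge0.
rewrite -gE ?inE//; apply: (HM (`|M| + 1)).
  by rewrite ltr_pwDr// ler_norm.
by exists x => //; exact: subset_closure.
Qed.

End coordinate_lines.

Lemma MVT_bound (R : realType) (f df : R -> R) (a b C : R) :
  (forall x, x \in `[Num.min a b, Num.max a b] -> is_derive x 1 f (df x)) ->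
  (forall x, x \in `[Num.min a b, Num.max a b] -> `|df x| <= C) ->
  `|f b - f a| <= C * `|b - a|.
Proof.
wlog ab : a b / a <= b.
  move=> H; case/orP: (le_total a b) => [/H//|/H {}H].
  by rewrite minC maxC => d1 d2; rewrite distrC [in leRHS]distrC; exact: H.
rewrite min_l// max_r// => d1 d2.
have d1o x : x \in `]a, b[ -> is_derive x 1 f (df x).
  by rewrite in_itv /= => /andP[ax xb]; apply: d1; rewrite in_itv /= !ltW.
have cf : {within `[a, b], continuous f}.
  apply: continuous_in_subspaceT => x; rewrite inE /= => xab.
  apply: differentiable_continuous; apply/derivable1_diffP.
  by case: (d1 x xab).
have [c cab ->] := MVT_segment ab d1o cf.
by rewrite normrM ler_wpM2r// d2.
Qed.

Section box_lipschitz.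
Context {R : realType} {n : nat} (l r : 'rV[R]_n).
Implicit Types (x y : 'rV[R]_n) (f : 'rV[R]_n -> R).

Lemma box_segment x y (k : 'I_n) s : obox l r x -> obox l r y ->
  s \in `[Num.min (x 0 k) (y 0 k), Num.max (x 0 k) (y 0 k)] ->
  obox l r (upd (hyb x y k) k s).
Proof.
move=> ox oy; rewrite in_itv /= => /andP[s1 s2]; apply: obox_upd.
  exact: obox_hyb.
have := ox k; have := oy k.
by move: s1 s2; rewrite ge_min le_max => /orP[]? /orP[]? /andP[? ?] /andP[? ?]; lra.
Qed.

Lemma box_lipschitz f (C : R) : Ck_on 1 (obox l r) f ->
  (forall j x, obox l r x -> `|partial j f x| <= C) ->
  forall x y, obox l r x -> obox l r y ->
  `|f y - f x| <= C * \sum_j `|y 0 j - x 0 j|.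
Proof.
move=> cf fC x y ox oy; rewrite hyb_telescope mulr_sumr.
apply: (le_trans (ler_norm_sum _ _ _)); apply: ler_sum => k _.
rewrite hybS -[in X in _ - X](upd_id (hyb x y k) k) hyb_coord.
apply: (@MVT_bound R (fun s => f (upd (hyb x y k) k s))
   (fun s => partial k f (upd (hyb x y k) k s))) => s sI.
  apply: derivable_line; apply: (proj2 (cf [::])) => //=.
  exact: box_segment.
by apply: fC; exact: box_segment.
Qed.

End box_lipschitz.

Lemma is_derive_exprS (R : realType) k (t : R) :
  is_derive t 1 (fun s => s ^+ k.+1) (k.+1%:R * t ^+ k).
Proof.
elim: k => [|k IH]; first by rewrite expr0 mulr1; exact: is_derive_id.
have := is_deriveM (is_derive_id t (1 : R)) IH.
rewrite (_ : _ * _ = (fun s => s ^+ k.+2)); last by apply/funext => s; rewrite exprS.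
move=> /is_derive_eq; apply; rewrite -![_ *: _]/(_ * _) mulr1 /= [in RHS]exprS -[k.+2%:R]natr1.
by rewrite [t ^+ k.+1]exprS; ring.
Qed.

(** * Trajectories *)

(** Merges the constants of finitely many components: their sum dominates each of them. *)
Lemma uniform_bound (R : realType) (I : finType) (P : I -> R -> Prop) :
  (forall i, exists2 C, 0 <= C & P i C) ->
  (forall i C C', C <= C' -> P i C -> P i C') ->
  exists2 C, 0 <= C & forall i, P i C.
Proof.
move=> H mono.
have [C HC] := choice (fun i => (let: ex_intro2 C C0 PC := H i in ex_intro (fun C => 0 <= C /\ P i C) C (conj C0 PC))).
exists (\sum_i C i) => [|i]; first by apply: sumr_ge0 => i _; case: (HC i).
apply: mono (proj2 (HC i)); rewrite (bigD1 i)//= lerDl.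
by apply: sumr_ge0 => k _; case: (HC k).
Qed.

Lemma within_continuousB (R : realType) (A : set R) (f g : R -> R) :
  {within A, continuous f} -> {within A, continuous g} ->
  {within A, continuous (fun r => f r - g r)}.
Proof. by move=> cf cg x; apply: cvgB; [exact: cf|exact: cg]. Qed.

Lemma within_continuousM (R : realType) (A : set R) (f g : R -> R) :
  {within A, continuous f} -> {within A, continuous g} ->
  {within A, continuous (fun r => f r * g r)}.
Proof. by move=> cf cg x; apply: cvgM; [exact: cf|exact: cg]. Qed.

Lemma is_derive_expRM (R : realType) (c r : R) :
  is_derive r 1 (fun r => expR (c * r)) (c * expR (c * r)).
Proof.
have d1 : is_derive r 1 (fun r => c * r) c.
  by apply: is_derive_eq; rewrite -[_ *: _]/(_ * _) mulr1.
apply: (is_derive_eq (is_derive1_comp (is_derive_expR _) d1)).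
by rewrite mulrC.
Qed.

(** Gronwall's inequality in both time directions: [expR (- k * r) * N r] decreases and
    [expR (k * r) * N r] increases. The derivative is controlled only inside ]0, T[; continuity
    covers the end points. *)
Lemma exponential_growth (R : realType) (T k : R) (N N' : R -> R) :
  0 < T -> 0 <= k -> (forall r, 0 <= N r) ->
  (forall r, 0 < r < T -> is_derive r 1 N (N' r)) ->
  (forall r, 0 < r < T -> `|N' r| <= k * N r) ->
  {within `[0, T], continuous N} ->
  forall s t, 0 <= s <= T -> 0 <= t <= T -> N t <= expR (k * T) * N s.
Proof.
move=> T0 k0 N0 dN bN' cN s t sT tT.
have itvS (r1 r2 : R) : 0 <= r1 -> r2 <= T -> `[r1, r2] `<=` `[0, T].
  by move=> s0 tT' r; rewrite /= !in_itv /= => /andP[? ?]; apply/andP; split; lra.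
have cE (c : R) : continuous (fun r => expR (c * r)).
  move=> r; apply: differentiable_continuous; apply/derivable1_diffP.
  by case: (is_derive_expRM c r).
have grow (c r1 r2 : R) : `|c| = k -> 0 <= r1 -> r1 <= r2 -> r2 <= T ->
    (0 <= c -> expR (c * r1) * N r1 <= expR (c * r2) * N r2) /\
    (c <= 0 -> expR (c * r2) * N r2 <= expR (c * r1) * N r1).
  move=> ck r10 r12 r2T.
  (* The mean value point ranges over the closed segment, and [N'] carries no information at 0 and
     [T]; the default value 0 there is compatible with both signs needed below. *)
  have [z zI E] : exists2 z, z \in `[r1, r2] & expR (c * r2) * N r2 - expR (c * r1) * N r1
     = (if (0 < z < T) then (c * expR (c * z)) * N z + expR (c * z) * N' z else 0) * (r2 - r1).
    apply: (@MVT_segment R (fun r => expR (c * r) * N r)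
      (fun z => if (0 < z < T) then (c * expR (c * z)) * N z + expR (c * z) * N' z else 0)) => //.
      move=> z; rewrite in_itv /= => /andP[z1 z2].
      have zT : 0 < z < T by apply/andP; split; lra.
      rewrite zT; have := is_derive_expRM c z; have := dN z zT => d1 d2.
      apply: (is_derive_eq (is_deriveM d2 d1)).
      by rewrite -![_ *: _]/(_ * _) addrC; congr (_ + _); rewrite mulrC.
    have cN' := continuous_subspaceW (@itvS r1 r2 r10 r2T) cN.
    have cE' := @continuous_subspaceT _ _ [set` `[r1, r2]] _ (cE c).
    exact: (within_continuousM cE' cN').
  have D0 : 0 <= r2 - r1 by rewrite subr_ge0.
  split => c0.
    rewrite -subr_ge0 E mulr_ge0//; case: ifP => // zT.
    have := bN' z zT; rewrite -ck (ger0_norm c0) ler_norml => /andP[h _].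
    rewrite (_ : _ + _ = expR (c * z) * (c * N z + N' z)); last by ring.
    by rewrite mulr_ge0 ?expR_ge0//; lra.
  rewrite -subr_le0 E mulr_le0_ge0//; case: ifP => // zT.
  have := bN' z zT; rewrite -ck (ler0_norm c0) ler_norml => /andP[_ h].
  rewrite (_ : _ + _ = expR (c * z) * (c * N z + N' z)); last by ring.
  by rewrite mulr_ge0_le0 ?expR_ge0//; lra.
move: sT tT => /andP[s0 sT] /andP[t0 tT].
  case/orP : (le_total s t) => st.
    have kN : `|- k| = k by rewrite normrN ger0_norm.
    have [_] := grow (- k) s t kN s0 st tT.
    rewrite oppr_le0 => /(_ k0) H.
    have := ler_wpM2l (expR_ge0 (k * t)) H; rewrite !mulrA -!expRD.
    rewrite mulNr subrr expR0 mul1r => /le_trans; apply.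
    by rewrite ler_wpM2r// ler_expR ?mulNr -mulrBr ler_wpM2l//; lra.
  have [/(_ k0) H _] := grow k t s (ger0_norm k0) t0 st sT.
  have := ler_wpM2l (expR_ge0 (- (k * t))) H; rewrite !mulrA -!expRD.
  rewrite addNr expR0 mul1r => /le_trans; apply.
  by rewrite ler_wpM2r// ler_expR addrC -mulrBr ler_wpM2l//; lra.
Qed.

Section trajectories.
Context {R : realType} {D : nat} (T : R) (a : 'rV[R]_D -> R -> 'rV[R]_D).
Hypothesis T0 : 0 < T.
Hypothesis adm : admissible_velocity T a.

Local Notation vel j := (fun z : 'rV[R]_(D + 1) => a (lsubmx z) (rsubmx z 0 0) 0 j).

Definition st_point (x : 'rV[R]_D) (t : R) : 'rV[R]_(D + 1) := row_mx x (const_mx t).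

Lemma vel_st_point j x t : vel j (st_point x t) = a x t 0 j.
Proof. by rewrite /st_point /= row_mxKl row_mxKr mxE. Qed.

Definition st_corner : 'rV[R]_(D + 1) := st_point (const_mx 1) T.

(** The space-time cylinder is itself a box in dimension [D + 1], so the staircase bounds apply
    jointly in space and time. *)
Lemma space_time_obox : space_time T = obox 0 st_corner.
Proof.
apply/seteqP; split => z /=.
  move=> [Oz zT] j; rewrite !mxE; case: splitP => k jk.
    have -> : j = lshift 1 k by exact: val_inj.
    by have := Oz k; rewrite !mxE.
  have -> : j = rshift D k by exact: val_inj.
  by move: zT; rewrite !mxE ord1.
move=> oz; split => [k|].
  by have := oz (lshift 1 k); rewrite /st_corner /st_point row_mxEl !mxE.
by have := oz (rshift D ord0); rewrite /st_corner /st_point row_mxEr !mxE.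
Qed.

Lemma st_point_in x t : Omega x -> 0 < t < T -> obox 0 st_corner (st_point x t).
Proof.
move=> Ox tT; rewrite -space_time_obox; split.
  by rewrite row_mxKl.
by rewrite row_mxKr mxE.
Qed.

Lemma velocity_lipschitz : exists2 K : R, 0 <= K & forall j x y s t,
  Omega x -> Omega y -> 0 < s < T -> 0 < t < T ->
  `|a x s 0 j| <= K /\ `|a y t 0 j - a x s 0 j| <= K * (`|y - x| + `|t - s|).
Proof.
have [sm _ _] := adm.
apply: (@uniform_bound R 'I_D (fun j K => forall x y s t,
  Omega x -> Omega y -> 0 < s < T -> 0 < t < T ->
  `|a x s 0 j| <= K /\ `|a y t 0 j - a x s 0 j| <= K * (`|y - x| + `|t - s|))); last first.
  move=> j C C' CC' H x y s t Ox Oy sT tT; have [H1 H2] := H x y s t Ox Oy sT tT.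
  split; first exact: le_trans CC'.
  by apply: le_trans H2 _; rewrite ler_wpM2r// addr_ge0.
move=> j; have := sm j; rewrite space_time_obox => smj.
have [C0 C00 HC0] := smooth_up_to_bound [::] smj.
have [C1 C10 HC1] : exists2 C : R, 0 <= C & forall i z, obox 0 st_corner z ->
    `|partial i (vel j) z| <= C.
  apply: (@uniform_bound R 'I_(D + 1) (fun i C => forall z, obox 0 st_corner z ->
    `|partial i (vel j) z| <= C)).
    by move=> i; have [C ? H] := smooth_up_to_bound [:: i] smj; exists C.
  by move=> i C C' CC' H z oz; apply: le_trans CC'; exact: H.
exists (C0 + C1 * D.+1%:R); first by rewrite addr_ge0// mulr_ge0.
move=> x y s t Ox Oy sT tT; split.
  rewrite -vel_st_point; apply: le_trans (HC0 _ (st_point_in Ox sT)) _.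
  by rewrite lerDl mulr_ge0.
rewrite -(vel_st_point j y t) -(vel_st_point j x s).
have cz : Ck_on 1 (obox 0 st_corner) (vel j) by case: smj => /(_ 1%N).
apply: le_trans (box_lipschitz cz HC1 (st_point_in Ox sT) (st_point_in Oy tT)) _.
have : \sum_j0 `|st_point y t 0 j0 - st_point x s 0 j0| <= D.+1%:R * (`|y - x| + `|t - s|).
  rewrite big_split_ord /= big_ord1 !row_mxEr !mxE.
  under eq_bigr do rewrite !row_mxEl.
  apply: (@le_trans _ _ (D%:R * `|y - x| + `|t - s|)).
    rewrite lerD2r; have -> : D%:R * `|y - x| = \sum_(i < D) `|y - x|.
      by rewrite sumr_const card_ord mulr_natl.
    apply: ler_sum => i _; have := coord_le_norm (y - x) i.
    by rewrite !mxE.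
  rewrite -natr1 mulrDl mul1r mulrDr.
  have : 0 <= D%:R * `|t - s| by rewrite mulr_ge0.
  by have := normr_ge0 (y - x); lra.
move=> /(ler_wpM2l C10) /le_trans; apply; rewrite mulrA ler_wpM2r ?addr_ge0//.
by rewrite lerDr.
Qed.

Lemma trajectory_in X t : trajectory T a X -> 0 <= t <= T -> Omega (X t).
Proof. by move=> tX /tX[]. Qed.

Lemma trajectory_quotient X t : trajectory T a X -> 0 <= t <= T ->
  forall e : R, 0 < e -> exists2 d : R, 0 < d & forall r, 0 <= r <= T -> r != t -> `|r - t| < d ->
  `|a (X t) t - (r - t)^-1 *: (X r - X t)| <= e.
Proof.
move=> tX tT e e0; have [_ /cvgrPdist_le/(_ _ e0)] := tX t tT.
rewrite near_withinE /= near_withinE => /nbhs_ballP[d d0 H].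
exists d => // r rT rt rd; apply: (H r) => //.
by rewrite -ball_normE /= distrC.
Qed.

Lemma trajectory_continuous X j : trajectory T a X ->
  {within `[0, T], continuous (fun r => X r 0 j)}.
Proof.
move=> tX; apply/subspace_continuousP => t; rewrite /= in_itv /= => tT.
have [d d0 H] := trajectory_quotient tX tT ltr01.
apply/cvgrPdist_le => e e0; rewrite near_withinE.
pose c := `|a (X t) t| + 1.
have c0 : 0 < c by rewrite ltr_wpDl.
apply/nbhs_ballP; exists (Num.min d (e / c)).
  by rewrite /= lt_min d0 divr_gt0.
move=> r; rewrite -ball_normE /= lt_min => /andP[rd re].
rewrite in_itv /= => rT.
have [->|rt] := eqVneq r t; first by rewrite subrr normr0 ltW.
rewrite distrC in rd; have {}H := H r rT rt rd.
have rt0 : r - t != 0 by rewrite subr_eq0.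
have -> : X t 0 j - X r 0 j = - ((r - t) * ((r - t)^-1 *: (X r - X t)) 0 j).
  by rewrite !mxE mulrA divff// mul1r opprB.
rewrite normrN normrM distrC.
have : `|((r - t)^-1 *: (X r - X t)) 0 j| <= c.
  apply: le_trans (coord_le_norm _ _) _.
  rewrite -[X in `|X|](subKr (a (X t) t)).
  by apply: le_trans (ler_normB _ _) _; rewrite lerD2l.
move=> /(ler_wpM2l (normr_ge0 (t - r))) /le_trans; apply.
by rewrite -ler_pdivlMr// ltW.
Qed.

Lemma trajectory_derive X j t : trajectory T a X -> 0 < t < T ->
  is_derive t 1 (fun r => X r 0 j) (a (X t) t 0 j).
Proof.
move=> tX /andP[t0 tT].
have tT' : 0 <= t <= T by rewrite !ltW.
suff H : h^-1 *: (((fun r => X r 0 j) \o shift t) (h *: (1 : R)) - X t 0 j) @[h --> 0^'] --> a (X t) t 0 j.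
  by apply: DeriveDef; [apply/cvg_ex; eexists; exact: H|exact: cvg_lim H].
apply/cvgrPdist_le => e e0.
have [d d0 H] := trajectory_quotient tX tT' e0.
rewrite near_withinE; apply/nbhs_ballP; exists (Num.min d (Num.min t (T - t))).
  by rewrite /= !lt_min d0 t0 subr_gt0.
move=> h; rewrite -ball_normE /= sub0r normrN !lt_min => /and3P[hd ht hT] h0.
have rT : 0 <= h + t <= T.
  by move: ht hT; rewrite !ltr_norml => /andP[? ?] /andP[? ?]; lra.
have := H (h + t) rT; rewrite addrK -[h + t == t]subr_eq0 addrK => /(_ h0 hd).
move=> {}H; apply: le_trans H; rewrite -[h *: 1]/(h * 1) mulr1.
by apply: le_trans (coord_le_norm _ j); rewrite !mxE.
Qed.

(** Gronwall's inequality is applied to the sum of squares, which is differentiable where the sup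
    norm is not. As [s] and [t] may come in either order, this yields uniqueness of trajectories and
    Lipschitz bounds for the flow and its inverse. *)
Lemma trajectory_gronwall : exists2 L : R, 1 <= L & forall X Y s t,
  trajectory T a X -> trajectory T a Y -> 0 <= s <= T -> 0 <= t <= T ->
  `|X t - Y t| <= L * `|X s - Y s|.
Proof.
have [K K0 HK] := velocity_lipschitz.
pose k := 2 * D%:R * K.
have k0 : 0 <= k by rewrite !mulr_ge0.
(* [D] is the cost of comparing the sum of squares with the sup norm; adding 1 gives [L <= L ^+ 2],
   which absorbs the squares. *)
pose L := expR (k * T) * D%:R + 1.
have L1 : 1 <= L by rewrite lerDr mulr_ge0// expR_ge0.
exists L => // X Y s t tX tY sT tT.
pose N r := \sum_(j < D) (X r 0 j - Y r 0 j) ^+ 2.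
pose N' r := \sum_(j < D) 2 * (X r 0 j - Y r 0 j) * (a (X r) r 0 j - a (Y r) r 0 j).
have N0 r : 0 <= N r by apply: sumr_ge0 => j _; exact: sqr_ge0.
have NX r : `|X r - Y r| ^+ 2 <= N r.
  have -> : N r = Num.sqrt (N r) ^+ 2 by rewrite sqr_sqrtr.
  rewrite ler_pXn2r ?nnegrE ?sqrtr_ge0//; apply: norm_leP => [|j]; first exact: sqrtr_ge0.
  rewrite -(@ler_pXn2r _ 2) ?nnegrE ?sqrtr_ge0// sqr_sqrtr// real_normK ?num_real//.
  by rewrite /N (bigD1 j)//= !mxE lerDl; apply: sumr_ge0 => i _; exact: sqr_ge0.
have XN r : N r <= D%:R * `|X r - Y r| ^+ 2.
  have -> : D%:R * `|X r - Y r| ^+ 2 = \sum_(j < D) `|X r - Y r| ^+ 2.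
    by rewrite sumr_const card_ord mulr_natl.
  apply: ler_sum => j _; rewrite -[leLHS]real_normK ?num_real//.
  rewrite ler_pXn2r ?nnegrE//; have := coord_le_norm (X r - Y r) j.
  by rewrite !mxE.
have dN r : 0 < r < T -> is_derive r 1 N (N' r).
  move=> rT; have -> : N = \sum_(j < D) (fun r => (X r 0 j - Y r 0 j) ^+ 2).
    by apply/funext => u; rewrite fct_sumE.
  apply: is_derive_sum => j.
  have dX := trajectory_derive j tX rT; have dY := trajectory_derive j tY rT.
  have dXY := is_deriveB dX dY; have dXY2 := is_deriveM dXY dXY.
  rewrite (_ : (fun r0 => (X r0 0 j - Y r0 0 j) ^+ 2) =
    ((fun r => X r 0 j) - (fun r => Y r 0 j)) * ((fun r => X r 0 j) - (fun r => Y r 0 j)));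
    last by apply/funext => u; rewrite expr2.
  apply: (is_derive_eq dXY2).
  by rewrite -[RHS]mulrA mulr_natl mulr2n.
have bN' r : 0 < r < T -> `|N' r| <= k * N r.
  move=> /andP[r0 rT]; have rT' : 0 <= r <= T by rewrite !ltW.
  apply: (@le_trans _ _ (\sum_(j < D) 2 * K * N r)); last first.
    rewrite sumr_const card_ord -[_ *+ D]mulr_natr /k.
    by rewrite (_ : 2 * K * N r * D%:R = 2 * D%:R * K * N r)//; ring.
  apply: le_trans (ler_norm_sum _ _ _) _; apply: ler_sum => j _.
  rewrite !normrM ger0_norm// -!mulrA ler_pM2l//.
  apply: (@le_trans _ _ (`|X r - Y r| * (K * `|X r - Y r|))).
    apply: ler_pM => //; first by have := coord_le_norm (X r - Y r) j; rewrite !mxE.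
    have OX := trajectory_in tX rT'; have OY := trajectory_in tY rT'.
    have rI : 0 < r < T by rewrite r0.
    by have [_] := HK j (Y r) (X r) r r OY OX rI rI; rewrite subrr normr0 addr0.
  by rewrite mulrCA -expr2 ler_wpM2l.
have cN : {within `[0, T], continuous N}.
  have -> : N = \sum_(j < D) (fun r => (X r 0 j - Y r 0 j) ^+ 2).
    by apply/funext => u; rewrite fct_sumE.
  elim/big_ind : _ => [||j _].
  - by move=> x; exact: cvg_cst.
  - by move=> f g cf cg x; apply: cvgD; [exact: cf|exact: cg].
  - have cXY : {within `[0, T], continuous (fun r => X r 0 j - Y r 0 j)}.
      exact: (within_continuousB (trajectory_continuous tX) (trajectory_continuous tY)).
    exact: (within_continuousM cXY cXY).
have Nst : N t <= expR (k * T) * N s := exponential_growth T0 k0 N0 dN bN' cN sT tT.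
rewrite -(@ler_pXn2r _ 2) ?nnegrE ?mulr_ge0//; last exact: le_trans L1.
apply: le_trans (NX t) _; apply: le_trans Nst _.
apply: le_trans (ler_wpM2l (expR_ge0 _) (XN s)) _.
rewrite mulrA exprMn ler_wpM2r ?sqr_ge0//.
apply: (@le_trans _ _ L); first by rewrite lerDl.
by rewrite ler_eXnr.
Qed.

End trajectories.

(** * Polynomials as sums of words *)

Section words.
Context {R : realType} {n : nat}.
Implicit Types (y : 'rV[R]_n) (w : seq 'I_n) (s : seq (R * seq 'I_n)).

(** Monomials are indexed by words rather than exponents: products become concatenation,
    antidifferentiation prepends a letter, and substitution is a recursion on the word. Several
    words may denote the same monomial. *)
Definition mon y w : R := \prod_(i <- w) y 0 i.

Definition word_eval s y : R := \sum_(m <- s) m.1 * mon y m.2.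

(* The words have lengths in [[lo, hi[] and the coefficients sum to at most [M]. *)
Definition word_poly (lo hi : nat) (M : R) (f : 'rV[R]_n -> R) : Prop :=
  exists2 s, all (fun m : R * seq 'I_n => (lo <= size m.2 < hi)%N) s &
    \sum_(m <- s) `|m.1| <= M /\ f =1 word_eval s.

Lemma mon_cons y i w : mon y (i :: w) = y 0 i * mon y w.
Proof. by rewrite /mon big_cons. Qed.

Lemma mon_bound y w (B : R) : `|y| <= B -> `|mon y w| <= B ^+ size w.
Proof.
move=> yB; elim: w => [|i w IH]; first by rewrite /mon big_nil normr1.
rewrite mon_cons normrM exprS ler_pM//.
by apply: le_trans yB; exact: coord_le_norm.
Qed.

Lemma mon_bound_lo y w (r B : R) k : `|y| <= r -> r <= B -> 1 <= B -> (k <= size w)%N ->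
  `|mon y w| <= r ^+ k * B ^+ size w.
Proof.
move=> yr rB B1 kw; apply: le_trans (mon_bound w yr) _.
have r0 : 0 <= r by exact: le_trans yr.
rewrite -{1}(subnKC kw) exprD ler_wpM2l ?exprn_ge0//.
apply: (@le_trans _ _ (B ^+ (size w - k))).
  by rewrite lerXn2r// nnegrE (le_trans r0).
by rewrite ler_weXn2l// leq_subr.
Qed.

Lemma mon_lipschitz y y' w (B : R) : `|y| <= B -> `|y'| <= B -> 1 <= B ->
  `|mon y w - mon y' w| <= (size w)%:R * B ^+ size w * `|y - y'|.
Proof.
move=> yB yB' B1; have B0 : 0 <= B by exact: le_trans B1.
elim: w => [|i w IH]; first by rewrite /mon !big_nil subrr normr0 !mul0r.
rewrite !mon_cons.
have -> : y 0 i * mon y w - y' 0 i * mon y' w =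
  (y 0 i - y' 0 i) * mon y w + y' 0 i * (mon y w - mon y' w) by ring.
apply: le_trans (ler_normD _ _) _; rewrite !normrM /= -natr1 exprS.
have h1 : `|y 0 i - y' 0 i| * `|mon y w| <= `|y - y'| * B ^+ size w.
  apply: ler_pM => //; last exact: mon_bound.
  by have := coord_le_norm (y - y') i; rewrite !mxE.
have h2 : `|y' 0 i| * `|mon y w - mon y' w| <= B * ((size w)%:R * B ^+ size w * `|y - y'|).
  by apply: ler_pM => //; apply: le_trans yB'; exact: coord_le_norm.
have h3 : `|y - y'| * B ^+ size w <= B * (`|y - y'| * B ^+ size w).
  by rewrite ler_peMl// mulr_ge0// exprn_ge0.
apply: le_trans (lerD h1 h2) _.
rewrite [leRHS](_ : _ = B * (`|y - y'| * B ^+ size w) + B * ((size w)%:R * B ^+ size w * `|y - y'|)); last by ring.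
by rewrite lerD2r.
Qed.

Lemma mon_cat y w w' : mon y (w ++ w') = mon y w * mon y w'.
Proof. by rewrite /mon big_cat. Qed.

Lemma mon_upd y i t w :
  mon (upd y i t) w = t ^+ count_mem i w * mon (upd y i 1) w.
Proof.
elim: w => [|j w IH]; first by rewrite /mon !big_nil mul1r.
rewrite !mon_cons IH /= !mxE; case: (j =P i) => _.
  by rewrite add1n exprS; ring.
by rewrite add0n; ring.
Qed.

Lemma mon_hyb y k w : mon (hyb 0 y k) w = (all (fun j : 'I_n => (j < k)%N) w)%:R * mon y w.
Proof.
elim: w => [|j w IH]; first by rewrite /mon !big_nil mul1r.
rewrite !mon_cons IH /= !mxE; case: (j < k)%N => /=; first by ring.
by rewrite !mul0r.
Qed.

Lemma word_poly0 lo hi : word_poly lo hi 0 (fun => 0).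
Proof. by exists [::] => //; split; [rewrite big_nil|move=> y; rewrite /word_eval big_nil]. Qed.

Lemma word_polyD lo hi M N f g : word_poly lo hi M f -> word_poly lo hi N g ->
  word_poly lo hi (M + N) (fun y => f y + g y).
Proof.
move=> [s s1 [s2 s3]] [t t1 [t2 t3]]; exists (s ++ t); first by rewrite all_cat s1.
split; first by rewrite big_cat lerD.
by move=> y; rewrite s3 t3 /word_eval big_cat.
Qed.

Lemma word_poly_le lo hi lo' hi' M M' f : word_poly lo hi M f -> M <= M' ->
  (lo' <= lo)%N -> (hi <= hi')%N -> word_poly lo' hi' M' f.
Proof.
move=> [s /allP s1 [s2 s3]] MM ll hh; exists s; last by split => //; exact: le_trans MM.
apply/allP => m /s1 /andP[h1 h2].
by rewrite (leq_trans ll)// (leq_trans h2).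
Qed.

Lemma word_polyZ lo hi M f (c : R) : word_poly lo hi M f ->
  word_poly lo hi (`|c| * M) (fun y => c * f y).
Proof.
move=> [s s1 [s2 s3]]; exists [seq (c * m.1, m.2) | m <- s].
  by rewrite all_map.
split; first by rewrite big_map /=; under eq_bigr do rewrite normrM; rewrite -mulr_sumr ler_wpM2l.
by move=> y; rewrite s3 /word_eval big_map mulr_sumr; apply: eq_bigr => m _; rewrite mulrA.
Qed.

Lemma word_poly_mon w : word_poly (size w) (size w).+1 1 (mon^~ w).
Proof.
exists [:: (1, w)]; first by rewrite /= leqnn ltnSn.
split; first by rewrite big_seq1 /= normr1.
by move=> y; rewrite /word_eval big_seq1 /= mul1r.
Qed.

Lemma word_polyM lo hi M f lo' hi' N g :
  word_poly lo hi M f -> word_poly lo' hi' N g ->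
  word_poly (lo + lo') (hi + hi').-1 (M * N) (fun y => f y * g y).
Proof.
move=> [s /allP s1 [s2 s3]] [t /allP t1 [t2 t3]].
exists [seq (m.1 * m'.1, m.2 ++ m'.2) | m <- s, m' <- t].
  apply/allP => _ /allpairsP[[m m'] /= [/s1/andP[h1 h2] /t1/andP[h3 h4] ->]] /=.
  by rewrite size_cat; lia.
split=> [|y].
  rewrite big_allpairs_dep /=.
  apply: (@le_trans _ _ ((\sum_(m <- s) `|m.1|) * (\sum_(m <- t) `|m.1|))).
    by rewrite big_distrlr /=; apply: ler_sum => m _; apply: ler_sum => m' _; rewrite normrM.
  by apply: ler_pM => //; apply: sumr_ge0.
rewrite s3 t3 /word_eval big_allpairs_dep /= big_distrlr /=.
by apply: eq_bigr => m _; apply: eq_bigr => m' _; rewrite mon_cat; ring.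
Qed.

Lemma word_poly_sum (I : Type) (r : seq I) lo hi (M : I -> R) (f : I -> 'rV[R]_n -> R) :
  (forall i, word_poly lo hi (M i) (f i)) ->
  word_poly lo hi (\sum_(i <- r) M i) (fun y => \sum_(i <- r) f i y).
Proof.
move=> H; elim: r => [|i r IH].
  rewrite big_nil (_ : (fun _ => _) = fun=> 0); first exact: word_poly0.
  by apply/funext => y; rewrite big_nil.
rewrite big_cons (_ : (fun _ => _) = fun y => f i y + \sum_(i <- r) f i y).
  exact: word_polyD.
by apply/funext => y; rewrite big_cons.
Qed.

Lemma word_poly_norm_ge0 lo hi M f : word_poly lo hi M f -> 0 <= M.
Proof. by move=> [s _ [s2 _]]; apply: le_trans s2; exact: sumr_ge0. Qed.

Lemma word_poly_bound lo hi M f (B : R) : word_poly lo hi M f -> 1 <= B ->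
  forall r y, `|y| <= r -> r <= B -> `|f y| <= M * (r ^+ lo * B ^+ hi).
Proof.
move=> [s /allP s1 [s2 s3]] B1 r y yr rB; rewrite s3 /word_eval.
have r0 : 0 <= r by exact: le_trans yr.
apply: le_trans (ler_norm_sum _ _ _) _.
apply: (@le_trans _ _ ((\sum_(m <- s) `|m.1|) * (r ^+ lo * B ^+ hi))); last first.
  by rewrite ler_wpM2r// mulr_ge0// exprn_ge0// (le_trans _ B1).
rewrite mulr_suml big_seq [leRHS]big_seq; apply: ler_sum => m /s1 /andP[h1 h2].
rewrite normrM ler_wpM2l//; apply: le_trans (mon_bound_lo yr rB B1 h1) _.
by rewrite ler_wpM2l ?exprn_ge0// ler_weXn2l// ltnW.
Qed.

Lemma word_poly_lipschitz lo hi M f (B : R) : word_poly lo hi M f -> 1 <= B ->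
  forall y y', `|y| <= B -> `|y'| <= B ->
  `|f y - f y'| <= M * (hi%:R * B ^+ hi) * `|y - y'|.
Proof.
move=> [s /allP s1 [s2 s3]] B1 y y' yB yB'; rewrite !s3 /word_eval -sumrB.
have B0 : 0 <= B by exact: le_trans B1.
apply: le_trans (ler_norm_sum _ _ _) _.
apply: (@le_trans _ _ ((\sum_(m <- s) `|m.1|) * (hi%:R * B ^+ hi) * `|y - y'|)); last first.
  by rewrite ler_wpM2r// ler_wpM2r// mulr_ge0// exprn_ge0.
rewrite !mulr_suml big_seq [leRHS]big_seq; apply: ler_sum => m /s1 /andP[h1 h2].
rewrite -mulrBr normrM -mulrA ler_wpM2l//.
apply: le_trans (mon_lipschitz _ yB yB' B1) _; rewrite ler_wpM2r//.
apply: ler_pM => //; first by rewrite exprn_ge0.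
  by rewrite ler_nat ltnW.
by rewrite ler_weXn2l// ltnW.
Qed.

Lemma word_poly_trunc lo hi M f k (B : R) : word_poly lo hi M f -> 1 <= B ->
  exists2 f1, word_poly lo k M f1 &
    forall r y, `|y| <= r -> r <= B -> `|f y - f1 y| <= M * (r ^+ k * B ^+ hi).
Proof.
move=> [s /allP s1 [s2 s3]] B1.
exists (word_eval [seq m <- s | (size m.2 < k)%N]).
  exists [seq m <- s | (size m.2 < k)%N].
    apply/allP => m; rewrite mem_filter => /andP[mk /s1 /andP[-> _]].
    by rewrite mk.
  split=> //; apply: le_trans s2; rewrite big_filter big_mkcond /=.
  by apply: ler_sum => m _; case: ifP.
move=> r y yr rB; have r0 : 0 <= r by exact: le_trans yr.
have -> : f y - word_eval [seq m <- s | (size m.2 < k)%N] y =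
    word_eval [seq m <- s | ~~ (size m.2 < k)%N] y.
  rewrite s3 /word_eval !big_filter (bigID (fun m : R * seq 'I_n => (size m.2 < k)%N)) /=.
  by rewrite addrC addrK.
apply: (@word_poly_bound k hi M _ B _ B1 r y yr rB).
exists [seq m <- s | ~~ (size m.2 < k)%N].
  apply/allP => m; rewrite mem_filter -leqNgt => /andP[mk /s1 /andP[_ ->]].
  by rewrite mk.
split=> //; apply: le_trans s2; rewrite big_filter big_mkcond /=.
by apply: ler_sum => m _; case: ifP.
Qed.

End words.

(** A linear operation on polynomials need only be understood on single words: [F] arises from [f]
    by replacing each word [w] by [g w]. The last hypothesis quantifies over representations because
    [word_poly] hides the one it contains. *)
Lemma word_poly_ind (R : realType) n n' lo hi (M : R) (f : 'rV[R]_n -> R) (N : R)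
    (g : seq 'I_n -> 'rV[R]_n' -> R) lo' hi' (F : 'rV[R]_n' -> R) :
  word_poly lo hi M f -> 0 <= N ->
  (forall w, (lo <= size w < hi)%N -> word_poly lo' hi' N (g w)) ->
  (forall s, f =1 word_eval s -> all (fun m : R * seq 'I_n => (lo <= size m.2 < hi)%N) s ->
     F =1 (fun y => \sum_(m <- s) m.1 * g m.2 y)) ->
  word_poly lo' hi' (M * N) F.
Proof.
move=> [s s1 [s2 s3]] N0 H /(_ s s3 s1) HF.
have -> : F = (fun y => \sum_(m <- s) m.1 * g m.2 y) by apply/funext.
suff : word_poly lo' hi' (\sum_(m <- s) `|m.1| * N) (fun y => \sum_(m <- s) m.1 * g m.2 y).
  by move=> /word_poly_le; apply => //; rewrite -mulr_suml ler_wpM2r.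
elim: s s1 {s2 s3 HF F} => [|m s IH] /= s1.
  rewrite big_nil (_ : (fun _ => _) = fun=> 0); first exact: word_poly0.
  by apply/funext => y; rewrite big_nil.
case/andP: s1 => m1 /IH {}IH.
rewrite big_cons (_ : (fun _ => _) = fun y => m.1 * g m.2 y + \sum_(m <- s) m.1 * g m.2 y).
  by apply: word_polyD => //; apply: word_polyZ; exact: H.
by apply/funext => y; rewrite big_cons.
Qed.


(** * Taylor expansion and transport of polynomials *)

Lemma word_poly_row_mx (R : realType) D lo hi (M : R) (f : 'rV[R]_(D + 1) -> R) :
  word_poly lo hi M f -> word_poly lo hi M (fun y : 'rV[R]_D => f (row_mx y 0)).
Proof.
move=> Pf; rewrite -[M]mulr1.
apply: (word_poly_ind (g := fun w (y : 'rV[R]_D) => mon (row_mx y 0) w) Pf) => //.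
  move=> w wI; have : (exists2 w' : seq 'I_D, size w' = size w &
      forall y : 'rV[R]_D, mon (row_mx y 0) w = mon y w') \/
      (forall y : 'rV[R]_D, mon (row_mx y 0) w = 0).
    elim: w {wI} => [|i w IH].
      by left; exists [::] => // y; rewrite /mon !big_nil.
    case: (split_ordP i) => j ->; last by right=> y; rewrite mon_cons row_mxEr mxE mul0r.
    case: IH => [[w' ww' H]|H]; last by right=> y; rewrite mon_cons H mulr0.
    left; exists (j :: w') => [|y]; first by rewrite /= ww'.
    by rewrite !mon_cons row_mxEl H.
  case=> [[w' ww' H]|H].
    have -> : (fun y : 'rV[R]_D => mon (row_mx y 0) w) = mon^~ w' by apply/funext => y.
    by apply: (word_poly_le (word_poly_mon w')); rewrite ?ww'//; lia.
  have -> : (fun y : 'rV[R]_D => mon (row_mx y 0) w) = fun=> 0 by apply/funext => y.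
  exact: (word_poly_le (word_poly0 lo hi)).
by move=> s fs _ y; rewrite fs.
Qed.

Lemma word_poly_hyb (R : realType) n lo hi (M : R) (f : 'rV[R]_n -> R) k :
  word_poly lo hi M f -> word_poly lo hi M (fun y => f (hyb 0 y k)).
Proof.
move=> Pf; rewrite -[M]mulr1.
apply: (word_poly_ind (g := fun w y => mon (hyb 0 y k) w) Pf) => //.
  move=> w wI.
  have -> : (fun y : 'rV[R]_n => mon (hyb 0 y k) w) =
    fun y => (all (fun j : 'I_n => (j < k)%N) w)%:R * mon y w.
    by apply/funext => y; rewrite mon_hyb.
  apply: (word_poly_le (word_polyZ _ (word_poly_mon w))); try lia.
  by case: all; rewrite ?normr1 ?normr0 mulr1.
by move=> s fs _ y; rewrite fs.
Qed.

Section antiderivative.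
Context {R : realType} {n : nat}.
Implicit Types (s : seq (R * seq 'I_n)) (i : 'I_n) (v : 'rV[R]_n) (t : R).

(** Integration in the variable [i] from 0: prepending [i] raises its exponent to
    [(count_mem i m.2).+1], whence the denominator. *)
Definition antideriv i s : seq (R * seq 'I_n) :=
  [seq (m.1 / (count_mem i m.2).+1%:R, i :: m.2) | m <- s].

Lemma word_eval_cons m s v : word_eval (m :: s) v = m.1 * mon v m.2 + word_eval s v.
Proof. by rewrite /word_eval big_cons. Qed.

Lemma antideriv0 i s v : word_eval (antideriv i s) (upd v i 0) = 0.
Proof.
by rewrite /word_eval big_map big1// => m _; rewrite mon_cons upd_eq mul0r mulr0.
Qed.

Lemma is_derive_antideriv i s v t :
  is_derive t 1 (fun t => word_eval (antideriv i s) (upd v i t))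
    (word_eval s (upd v i t)).
Proof.
elim: s => [|m s IH].
  rewrite /word_eval /= big_nil (_ : (fun _ => _) = cst 0); first exact: is_derive_cst.
  by apply/funext => u; rewrite big_nil.
have d1 : is_derive t 1 (fun u => m.1 / (count_mem i m.2).+1%:R * mon (upd v i u) (i :: m.2))
    (m.1 * mon (upd v i t) m.2).
  have := is_deriveZ (m.1 / (count_mem i m.2).+1%:R * mon (upd v i 1) m.2) (is_derive_exprS (count_mem i m.2) t).
  rewrite (_ : _ \*: _ = fun u => m.1 / (count_mem i m.2).+1%:R * mon (upd v i u) (i :: m.2)); last first.
    apply/funext => u; rewrite mon_cons upd_eq (mon_upd v i u) /= exprS.
    rewrite -[LHS]/(m.1 / (count_mem i m.2).+1%:R * mon (upd v i 1) m.2 * (u * u ^+ count_mem i m.2)).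
    by move: (_ / _) => c; ring.
  move=> /is_derive_eq; apply; rewrite [in RHS]mon_upd.
  have c0 : (count_mem i m.2).+1%:R != 0 :> R by rewrite pnatr_eq0.
  move: (_.+1%:R) c0 => c c0.
  rewrite -[LHS]/(m.1 / c * mon (upd v i 1) m.2 * (c * t ^+ count_mem i m.2)).
  by field.
have := is_deriveD d1 IH.
rewrite (_ : _ + _ = fun u => word_eval (antideriv i (m :: s)) (upd v i u)); last first.
  by apply/funext => u; rewrite /= word_eval_cons.
by rewrite word_eval_cons.
Qed.

Lemma antideriv_word_poly i s lo hi (M : R) :
  all (fun m : R * seq 'I_n => (lo <= size m.2 < hi)%N) s ->
  \sum_(m <- s) `|m.1| <= M ->
  word_poly lo.+1 hi.+1 M (word_eval (antideriv i s)).
Proof.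
move=> sa sM; exists (antideriv i s); first by rewrite all_map.
split=> //; rewrite big_map; apply: le_trans sM; apply: ler_sum => m _ /=.
by rewrite normrM ler_piMr// normfV normr_nat invf_le1// ler1n.
Qed.

End antiderivative.

Section taylor.
Context {R : realType} {n : nat} (l r : 'rV[R]_n) (f : 'rV[R]_n -> R).
Hypothesis sf : smooth_up_to (obox l r) f.

Lemma add_hyb (z y : 'rV[R]_n) (i : 'I_n) (t : R) :
  z + upd (hyb 0 y i) i t = upd (hyb z (z + y) i) i (z 0 i + t).
Proof.
apply/rowP => j; rewrite !mxE; case: eqP => [->//|_].
by case: ifP => _; rewrite ?addr0.
Qed.

Lemma norm_upd_hyb (y : 'rV[R]_n) (i : 'I_n) (t : R) : `|t| <= `|y 0 i| ->
  `|upd (hyb 0 y i) i t| <= `|y|.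
Proof.
move=> ty; apply: norm_leP => // j; rewrite !mxE.
case: eqP => [_|_]; first exact: le_trans ty (coord_le_norm _ _).
by case: ifP => _; rewrite ?normr0// coord_le_norm.
Qed.

(** One edge of the staircase: an expansion of the [i]-th derivative is integrated along the edge,
    which gains one power of [|y|]. *)
Lemma taylor_step (F : 'rV[R]_n -> R) (i : 'I_n) (z y : 'rV[R]_n) s k (K : R) : 0 <= K ->
  obox l r z -> obox l r (z + y) ->
  (forall x, obox l r x -> derivable F x (delta_mx 0 i)) ->
  (forall v, obox l r (z + v) -> `|v| <= `|y| ->
     `|partial i F (z + v) - word_eval s v| <= K * `|v| ^+ k) ->
  `|F (hyb z (z + y) i.+1) - F (hyb z (z + y) i) - word_eval (antideriv i s) (hyb 0 y i.+1)|
    <= K * `|y| ^+ k.+1.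
Proof.
move=> K0 oz oy dF H.
pose phi t := F (upd (hyb z (z + y) i) i (z 0 i + t)) - word_eval (antideriv i s) (upd (hyb 0 y i) i t).
have -> : F (hyb z (z + y) i.+1) - F (hyb z (z + y) i) - word_eval (antideriv i s) (hyb 0 y i.+1) =
    phi (y 0 i) - phi 0.
  have E : upd (hyb z (z + y) i) i (z 0 i) = hyb z (z + y) i.
    by rewrite -[X in upd _ _ X](hyb_coord z (z + y) i) upd_id.
  rewrite /phi antideriv0 subr0 addr0 E !hybS mxE; ring.
have seg t : t \in `[Num.min 0 (y 0 i), Num.max 0 (y 0 i)] -> `|t| <= `|y 0 i| /\
    obox l r (z + upd (hyb 0 y i) i t).
  move=> tI; split.
    by move: tI; rewrite in_itv /=; case: (leP 0 (y 0 i)) => y0 /andP[t1 t2];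
      [rewrite !ger0_norm|rewrite !ler0_norm; lra].
  rewrite add_hyb; apply: box_segment => //; rewrite in_itv /= mxE.
  move: tI; rewrite in_itv /= !ge_min !le_max => /andP[/orP h1 /orP h2].
  by apply/andP; split; apply/orP; case: h1; case: h2 => *; (try by left; lra); right; lra.
have d1 t : t \in `[Num.min 0 (y 0 i), Num.max 0 (y 0 i)] ->
    is_derive t 1 phi (partial i F (z + upd (hyb 0 y i) i t) - word_eval s (upd (hyb 0 y i) i t)).
  move=> /seg[_ ob]; apply: is_deriveB; last exact: is_derive_antideriv.
  move: ob; rewrite add_hyb => /dF/derivable_line dl.
  have ds : is_derive t 1 (fun u => z 0 i + u) 1.
    have := is_deriveD (is_derive_cst (z 0 i) t (1 : R)) (is_derive_id t (1 : R)).
    by rewrite add0r.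
  have := is_derive1_comp dl ds; rewrite mulr1; exact.
have d2 t : t \in `[Num.min 0 (y 0 i), Num.max 0 (y 0 i)] ->
  `|partial i F (z + upd (hyb 0 y i) i t) - word_eval s (upd (hyb 0 y i) i t)| <= K * `|y| ^+ k.
  move=> /seg[ty ob]; have vy := norm_upd_hyb ty.
  apply: le_trans (H _ ob vy) _; rewrite ler_wpM2l//.
  by rewrite lerXn2r// nnegrE.
apply: le_trans (MVT_bound d1 d2) _.
by rewrite subr0 exprSr mulrA ler_wpM2l ?mulr_ge0 ?exprn_ge0// coord_le_norm.
Qed.

(** Induction on the order, for all derivatives at once: the expansions of the first derivatives are
    integrated along the staircase from [z] to [z + y] and added up. Coefficients and remainder
    share the constant [K], which is uniform in [z] because all derivatives are bounded on the
    box. *)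
Lemma taylor k (w : seq 'I_n) : exists2 K, 0 <= K & forall z, obox l r z ->
  exists2 g, word_poly 1 k K g & forall y, obox l r (z + y) ->
    `|partials w f (z + y) - partials w f z - g y| <= K * `|y| ^+ k.
Proof.
elim: k w => [|k IH] w.
  have [C C0 HC] := smooth_up_to_bound w sf.
  exists (2 * C) => [|z oz]; first by rewrite mulr_ge0.
  exists (fun=> 0) => [|y oy]; first by apply: (word_poly_le (word_poly0 1 0)); rewrite ?mulr_ge0.
  rewrite subr0 expr0 mulr1 mulr_natl mulr2n.
  by apply: le_trans (ler_normB _ _) _; apply: lerD; exact: HC.
have [K K0 HK] : exists2 K, 0 <= K & forall i, (forall z, obox l r z ->
   exists2 g, word_poly 1 k K g & forall y, obox l r (z + y) ->
    `|partials (i :: w) f (z + y) - partials (i :: w) f z - g y| <= K * `|y| ^+ k).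
  apply: (@uniform_bound R 'I_n (fun i K => (forall z, obox l r z ->
   exists2 g, word_poly 1 k K g & forall y, obox l r (z + y) ->
    `|partials (i :: w) f (z + y) - partials (i :: w) f z - g y| <= K * `|y| ^+ k))).
    by move=> i; exact: IH.
  move=> i C C' CC' H z oz; have [g g1 g2] := H z oz; exists g.
    exact: (word_poly_le g1 CC').
  by move=> y oy; apply: le_trans (g2 y oy) _; rewrite ler_wpM2r ?exprn_ge0.
have [C C0 HC] : exists2 C, 0 <= C & forall i, (forall z, obox l r z ->
    `|partials (i :: w) f z| <= C).
  apply: (@uniform_bound R 'I_n (fun i C => forall z, obox l r z -> `|partials (i :: w) f z| <= C)).
    by move=> i; exact: smooth_up_to_bound.
  by move=> i C C' CC' H z oz; exact: le_trans (H z oz) CC'.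
exists (n%:R * (C + K)) => [|z oz]; first by rewrite mulr_ge0 ?addr_ge0.
have /choice[g Hg] : forall i, exists s, [/\ all (fun m : R * seq 'I_n => (0 <= size m.2 < k)%N) s,
    \sum_(m <- s) `|m.1| <= C + K & forall y, obox l r (z + y) ->
    `|partials (i :: w) f (z + y) - word_eval s y| <= (C + K) * `|y| ^+ k].
  (* At order 0 there is no room for the constant term [partials (i :: w) f z], and the derivative
     itself is the remainder. *)
  move=> i; case: k IH HK => [|k] IH HK.
    exists [::]; split=> //; first by rewrite big_nil addr_ge0.
    move=> y oy; rewrite /word_eval big_nil subr0 expr0 mulr1.
    by apply: le_trans (HC i _ oy) _; rewrite lerDl.
   have [g [s s1 [s2 s3]] Hg] := HK i z oz.
  exists ((partials (i :: w) f z, [::]) :: s); split.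
  - by rewrite /=; apply: sub_all s1 => m /andP[_].
  - by rewrite big_cons /= lerD//; exact: HC.
  - by move=> y oy; rewrite word_eval_cons /mon big_nil mulr1 -s3 opprD addrA; apply: le_trans (Hg y oy) _; rewrite ler_wpM2r ?exprn_ge0// lerDr.
exists (fun y => \sum_i word_eval (antideriv i (g i)) (hyb 0 y i.+1)).
  have -> : n%:R * (C + K) = \sum_(i < n) (C + K) by rewrite sumr_const card_ord mulr_natl.
  apply: word_poly_sum => i; apply: (@word_poly_hyb R n 1 k.+1 _ (word_eval (antideriv i (g i)))).
  have [s1 s2 _] := Hg i; exact: (word_poly_le (antideriv_word_poly i s1 s2)).
move=> y oy; rewrite hyb_telescope -sumrB.
apply: le_trans (ler_norm_sum _ _ _) _.
apply: (@le_trans _ _ (\sum_(i < n) (C + K) * `|y| ^+ k.+1)).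
  apply: ler_sum => i _; have [_ _ s3] := Hg i; apply: taylor_step; rewrite ?addr_ge0//.
    move=> x ox; have [sm _ _] := sf; exact: (proj2 (sm _ w)).
  by move=> v ov _; exact: s3.
rewrite sumr_const card_ord -[_ *+ n]mulr_natl mulrA ler_wpM2r ?exprn_ge0//.
Qed.

End taylor.

Section transport.
Context {R : realType} {D : nat} (T : R) (a : 'rV[R]_D -> R -> 'rV[R]_D).
Hypothesis adm : admissible_velocity T a.

(** The expansion in space-time, restricted to increments [row_mx y 0] without a time component. *)
Lemma velocity_taylor n : exists2 K, 0 <= K & forall j z t, Omega z -> 0 < t < T ->
  exists2 g, word_poly 1 n K g & forall y, Omega (z + y) ->
    `|a (z + y) t 0 j - a z t 0 j - g y| <= K * `|y| ^+ n.
Proof.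
apply: (@uniform_bound R 'I_D (fun j K => forall z t, Omega z -> 0 < t < T ->
  exists2 g, word_poly 1 n K g & forall y, Omega (z + y) ->
    `|a (z + y) t 0 j - a z t 0 j - g y| <= K * `|y| ^+ n)); last first.
  move=> j C C' CC' H z t Oz tT; have [g g1 g2] := H z t Oz tT.
  exists g; first exact: (word_poly_le g1 CC').
  by move=> y Oy; apply: le_trans (g2 y Oy) _; rewrite ler_wpM2r ?exprn_ge0.
move=> j; have [sm _ _] := adm; have := sm j; rewrite space_time_obox => smj.
have [K K0 HK] := taylor smj n [::]; exists K => // z t Oz tT.
have [g g1 g2] := HK _ (st_point_in Oz tT).
exists (fun y => g (row_mx y 0)); first exact: word_poly_row_mx.
move=> y Oy; have E : st_point z t + row_mx y 0 = st_point (z + y) t.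
  by rewrite /st_point add_row_mx addr0.
have := g2 (row_mx y 0); rewrite E => /(_ (st_point_in Oy tT)).
rewrite /partials /= !row_mxKl !row_mxKr !mxE => /le_trans; apply.
rewrite ler_wpM2l// lerXn2r ?nnegrE//; apply: norm_leP => // i.
case: (split_ordP i) => k ->; first by rewrite row_mxEl coord_le_norm.
by rewrite row_mxEr mxE normr0.
Qed.

Lemma trajectory_lipschitz : exists2 K, 0 <= K & forall X s t,
  trajectory T a X -> 0 <= s <= T -> 0 <= t <= T -> `|X t - X s| <= K * `|t - s|.
Proof.
have [K K0 HK] := velocity_lipschitz adm; exists K => // X s t tX sT tT.
apply: norm_leP => [|j]; first by rewrite mulr_ge0.
rewrite !mxE; move: s t sT tT.
suff H s t : 0 <= s -> s < t -> t <= T -> `|X t 0 j - X s 0 j| <= K * `|t - s|.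
  move=> s t /andP[s0 sT] /andP[t0 tT]; case: (ltgtP s t) => st.
  - exact: H.
  - by rewrite distrC [X in _ * X]distrC; exact: H.
  - by rewrite st !subrr normr0 mulr0.
move=> s0 st tT.
have dX r : r \in `]s, t[ -> is_derive r 1 (fun r => X r 0 j) (a (X r) r 0 j).
  by rewrite in_itv /= => /andP[? ?]; apply: (trajectory_derive j tX); lra.
have cX : {within `[s, t], continuous (fun r => X r 0 j)}.
  apply: continuous_subspaceW (trajectory_continuous tX).
  by move=> r; rewrite /= !in_itv /= => /andP[? ?]; apply/andP; split; lra.
have [c + ->] := MVT st dX cX.
rewrite in_itv /= => /andP[c1 c2].
have cT : 0 < c < T by lra.
have Oc : Omega (X c) by apply: (trajectory_in tX); lra.
by rewrite normrM ler_wpM2r//; have [] := HK j _ _ _ _ Oc Oc cT cT.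
Qed.

(** An Euler step backwards in time for the difference of two trajectories. The polynomial [g] is
    the Taylor expansion of the velocity about the reference trajectory [Z], so one [g] serves all
    nearby [X]. Per unit of time the error is [t2 - t1] from freezing the time and [rho ^+ n] from
    the Taylor remainder. *)
Lemma euler_step n (B : R) : 1 <= B -> exists2 K, 0 <= K & forall Z t1 t2,
  trajectory T a Z -> 0 <= t1 -> t1 < t2 -> t2 <= T ->
  exists2 g : 'I_D -> 'rV[R]_D -> R, (forall j, word_poly 1 n K (g j)) &
  forall X rho j, trajectory T a X -> rho <= B ->
    (forall r, 0 <= r <= T -> `|X r - Z r| <= rho) ->
    `|(X t1 - Z t1) 0 j - ((X t2 - Z t2) 0 j - (t2 - t1) * g j (X t2 - Z t2))|
      <= K * (t2 - t1) * (t2 - t1 + rho ^+ n).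
Proof.
move=> B1.
have [K1 K10 HK1] := velocity_lipschitz adm.
have [K2 K20 HK2] := velocity_taylor n.
have [K3 K30 HK3] := trajectory_lipschitz.
pose c1 := 2 * (K1 * (K3 + 1)).
pose c2 := K2 * (n%:R * B ^+ n) * (2 * K3).
have c10 : 0 <= c1 by rewrite !mulr_ge0// addr_ge0.
have c20 : 0 <= c2 by rewrite !mulr_ge0// exprn_ge0// (le_trans _ B1).
exists (c1 + c2 + K2) => [|Z t1 t2 tZ t10 t12 t2T]; first by rewrite !addr_ge0.
(* The expansion is taken at the midpoint because this lies strictly inside ]0, T[, where the
   velocity bounds hold, even if [t1 = 0] or [t2 = T]. *)
pose tau := (t1 + t2) / 2.
have tauT : 0 < tau < T by rewrite /tau; lra.
have tauT' : 0 <= tau <= T by lra.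
have OZ : Omega (Z tau) by exact: (trajectory_in tZ).
have /choice[g Hg] : forall j, exists g, word_poly 1 n K2 g /\ forall y, Omega (Z tau + y) ->
    `|a (Z tau + y) tau 0 j - a (Z tau) tau 0 j - g y| <= K2 * `|y| ^+ n.
  by move=> j; have [g g1 g2] := HK2 j _ _ OZ tauT; exists g.
exists g => [j|X rho j tX rhoB XZ].
  by have [g1 _] := Hg j; apply: (word_poly_le g1) => //; rewrite lerDr addr_ge0.
have dXZ r : r \in `]t1, t2[ ->
    is_derive r 1 (fun r => X r 0 j - Z r 0 j) (a (X r) r 0 j - a (Z r) r 0 j).
  rewrite in_itv /= => /andP[? ?].
  by apply: is_deriveB; [apply: (trajectory_derive j tX)|apply: (trajectory_derive j tZ)]; lra.
have cXZ : {within `[t1, t2], continuous (fun r => X r 0 j - Z r 0 j)}.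
  apply: continuous_subspaceW (within_continuousB (trajectory_continuous tX) (trajectory_continuous tZ)).
  by move=> r; rewrite /= !in_itv /= => /andP[? ?]; apply/andP; split; lra.
have [c + E] := MVT t12 dXZ cXZ.
rewrite in_itv /= => /andP[h1 h2].
have cT : 0 < c < T by lra.
have cT' : 0 <= c <= T by lra.
have t2T' : 0 <= t2 <= T by lra.
have dc : `|c - tau| <= t2 - t1 by rewrite ler_norml /tau; lra.
have dt : `|tau - t2| <= t2 - t1 by rewrite ler_norml /tau; lra.
have d0 : 0 <= t2 - t1 by rewrite subr_ge0 ltW.
have near_tau W : trajectory T a W -> `|a (W c) c 0 j - a (W tau) tau 0 j| <= K1 * (K3 + 1) * (t2 - t1).
  move=> tW; have OWc := trajectory_in tW cT'; have OWt := trajectory_in tW tauT'.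
  have [_ /le_trans->//] := HK1 j _ _ _ _ OWt OWc tauT cT.
  rewrite -mulrA ler_wpM2l// mulrDl mul1r lerD//.
  by apply: le_trans (HK3 W _ _ tW tauT' cT') _; rewrite ler_wpM2l.
have hX := near_tau _ tX; have hZ := near_tau _ tZ.
have EZ : Z tau + (X tau - Z tau) = X tau by rewrite addrC subrK.
have OX : Omega (Z tau + (X tau - Z tau)) by rewrite EZ; exact: (trajectory_in tX).
have [g1 /(_ _ OX)] := Hg j; rewrite EZ => ht.
have rho0 : 0 <= rho by exact: le_trans (XZ tau tauT').
have ht' : K2 * `|X tau - Z tau| ^+ n <= K2 * rho ^+ n.
  by rewrite ler_wpM2l// lerXn2r// ?nnegrE// XZ.
have hg : `|g j (X tau - Z tau) - g j (X t2 - Z t2)| <= c2 * (t2 - t1).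
  apply: le_trans (word_poly_lipschitz g1 B1 _ _) _.
  - exact: le_trans (XZ _ tauT') rhoB.
  - exact: le_trans (XZ _ t2T') rhoB.
  rewrite /c2 -[leRHS]mulrA ler_wpM2l//; first by rewrite !mulr_ge0// exprn_ge0// (le_trans _ B1).
  rewrite (_ : _ - _ - _ = (X tau - X t2) - (Z tau - Z t2)); last by apply/rowP => i; rewrite !mxE; ring.
  apply: le_trans (ler_normB _ _) _; rewrite mulr_natl mulr2n mulrDl.
  by apply: lerD; (apply: le_trans (HK3 _ _ _ _ t2T' tauT') _ => //; rewrite ler_wpM2l).
rewrite !mxE (_ : _ - _ = (t2 - t1) * (g j (X t2 - Z t2) - (a (X c) c 0 j - a (Z c) c 0 j))); last first.
  rewrite mulrBr [_ * (a _ _ _ _ - _)]mulrC -E; ring.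
rewrite normrM (ger0_norm d0) [leRHS]mulrAC mulrC ler_wpM2r//.
move: hX hZ ht hg; set u1 := a (X c) c 0 j; set u2 := a (X tau) tau 0 j.
set v1 := a (Z c) c 0 j; set v2 := a (Z tau) tau 0 j.
set g0 := g j (X tau - Z tau); set g2 := g j (X t2 - Z t2).
rewrite !ler_norml => /andP[? ?] /andP[? ?] /andP[? ?] /andP[? ?].
have : 0 <= K2 * (t2 - t1) by rewrite mulr_ge0.
have : 0 <= (c1 + c2) * rho ^+ n by rewrite mulr_ge0 ?addr_ge0// exprn_ge0.
rewrite /c1 => ? ?; apply/andP; split; lra.
Qed.

(** Expanding the product letter by letter bounds the coefficients of the correction by (1 + K)^size
    - 1; [d <= 1] lets higher powers of [d] be absorbed into the single factor in front of [Q]. *)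
Lemma word_shift n (K d : R) (g : 'I_D -> 'rV[R]_D -> R) (w : seq 'I_D) : (0 < n)%N ->
  0 <= K -> 0 <= d <= 1 -> (forall j, word_poly 1 n K (g j)) ->
  exists2 Q, word_poly 1 (n * size w).+1 ((1 + K) ^+ size w - 1) Q &
    forall y : 'rV[R]_D, mon (\row_j (y 0 j - d * g j y)) w = mon y w + d * Q y.
Proof.
move=> n0 K0 /andP[d0 d1] gK; elim: w => [|i w [Q Q1 Q2]].
  exists (fun=> 0); last by move=> y; rewrite /mon !big_nil mulr0 addr0.
  by apply: (word_poly_le (word_poly0 1 1)); rewrite ?subrr ?muln0.
exists (fun y : 'rV[R]_D => (y 0 i * Q y + (-1) * (g i y * mon y w)) + (- d) * (g i y * Q y)); last first.
  by move=> y; rewrite !mon_cons Q2 mxE; ring.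
have P1 := word_polyM (word_poly_mon [:: i]) Q1.
have P2 := word_polyZ (-1) (word_polyM (gK i) (word_poly_mon w)).
have P3 := word_polyZ (- d) (word_polyM (gK i) Q1).
have Q0 := word_poly_norm_ge0 Q1.
have P1' : word_poly 1 (n * (size w).+1).+1 ((1 + K) ^+ size w - 1) (fun y : 'rV[R]_D => y 0 i * Q y).
  rewrite (_ : (fun y : 'rV[R]_D => y 0 i * Q y) = fun y => mon y [:: i] * Q y); last first.
    by apply/funext => y; rewrite /mon big_seq1.
  by apply: (word_poly_le P1); rewrite ?mul1r //=; nia.
have P2' := word_poly_le P2 (lexx _) (leq_addr _ _ : (1 <= 1 + size w)%N) (_ : ((n + (size w).+1).-1 <= (n * (size w).+1).+1)%N).
have P3' := word_poly_le P3 (lexx _) (leq_addr _ _ : (1 <= 1 + 1)%N) (_ : ((n + (n * size w).+1).-1 <= (n * (size w).+1).+1)%N).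
apply: (word_poly_le (word_polyD (word_polyD P1' (P2' _)) (P3' _))) => //; try nia.
rewrite !normrN normr1 (ger0_norm d0) exprS.
have : d * (K * ((1 + K) ^+ size w - 1)) <= K * ((1 + K) ^+ size w - 1).
  by rewrite ler_piMl// mulr_ge0.
by nra.
Qed.

(** Substituting [y - d * g y] raises the degree; words of length at least [n] are cut off at the
    cost of [r ^+ n]. The growth of the coefficients and the cut both carry a factor [d], so the
    substitution can be iterated over many small steps. *)
Lemma word_poly_shift n (K B : R) : (0 < n)%N -> 0 <= K -> 1 <= B -> exists2 C, 0 <= C &
  forall M d f (g : 'I_D -> 'rV[R]_D -> R), 0 <= d <= 1 ->
  word_poly 1 n M f -> (forall j, word_poly 1 n K (g j)) ->
  exists2 f1, word_poly 1 n (M * (1 + C * d)) f1 &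
    forall (r : R) (y : 'rV[R]_D), `|y| <= r -> r <= B ->
    `|f (\row_j (y 0 j - d * g j y)) - f1 y| <= C * d * M * r ^+ n.
Proof.
move=> n0 K0 B1; pose C1 := (1 + K) ^+ n.
have C10 : 0 <= C1 by rewrite exprn_ge0// addr_ge0.
exists (C1 + C1 * B ^+ (n * n).+1); first by rewrite addr_ge0// mulr_ge0// exprn_ge0// (le_trans _ B1).
move=> M d f g d01 Pf gK; have [d0 d1] := andP d01.
have /choice[Q HQ] : forall w : seq 'I_D, exists Q,
    word_poly 1 (n * size w).+1 ((1 + K) ^+ size w - 1) Q /\
    forall y : 'rV[R]_D, mon (\row_j (y 0 j - d * g j y)) w = mon y w + d * Q y.
  by move=> w; have [Q ? ?] := word_shift w n0 K0 d01 gK; exists Q.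
have [s s1 [s2 s3]] := Pf.
have M0 := word_poly_norm_ge0 Pf.
pose Qf y := \sum_(m <- s) m.1 * Q m.2 y.
have PQ : word_poly 1 (n * n).+1 (M * C1) Qf.
  have Pf' : word_poly 1 n M (word_eval s) by exists s.
  have Qw w : (1 <= size w < n)%N -> word_poly 1 (n * n).+1 C1 (Q w).
    move=> /andP[w1 wn]; have [Q1 _] := HQ w; apply: (word_poly_le Q1) => //.
      rewrite lerBlDr ler_wpDr// ler_weXn2l// ?lerDl//; exact: ltnW.
    by rewrite ltnS leq_mul2l ltnW// orbT.
  have [t t1 [t2 t3]] : word_poly 1 (n * n).+1 ((\sum_(m <- s) `|m.1|) * C1) Qf.
    rewrite /Qf mulr_suml; elim: s s1 {s2 s3 Qf Pf'} => [|m s IH] /= s1.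
      rewrite big_nil (_ : (fun _ => _) = fun=> 0); first exact: word_poly0.
      by apply/funext => y; rewrite big_nil.
    case/andP: s1 => m1 /IH {}IH.
    rewrite big_cons (_ : (fun _ => _) = fun y => m.1 * Q m.2 y + \sum_(m <- s) m.1 * Q m.2 y).
      by apply: word_polyD => //; apply: word_polyZ; exact: Qw.
    by apply/funext => y; rewrite big_cons.
  exists t => //; split=> //; apply: le_trans t2 _; by rewrite ler_wpM2r.
have fE (y : 'rV[R]_D) : f (\row_j (y 0 j - d * g j y)) = f y + d * Qf y.
  rewrite !s3 /word_eval /Qf mulr_sumr -big_split /=; apply: eq_bigr => m _.
  by have [_ ->] := HQ m.2; ring.
have [Q1 PQ1 HQ1] := word_poly_trunc n PQ B1.
exists (fun y => f y + d * Q1 y).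
  apply: (word_poly_le (word_polyD Pf (word_polyZ d PQ1))) => //.
  rewrite ger0_norm// mulrDr mulr1 lerD2l mulrCA ler_wpM2l// mulrC ler_wpM2r//.
  by rewrite lerDl mulr_ge0// exprn_ge0// (le_trans _ B1).
move=> r y yr rB; rewrite fE opprD addrACA subrr add0r -mulrBr normrM ger0_norm//.
have r0 : 0 <= r by exact: le_trans yr.
have h := HQ1 r y yr rB.
apply: le_trans (ler_wpM2l d0 h) _.
have : 0 <= d * M * C1 * r ^+ n by rewrite !mulr_ge0// exprn_ge0.
set b := B ^+ _; set q := r ^+ n; by lra.
Qed.


(** The requirement [t2 - t1 <= rho ^+ n] turns the quadratic local error of the Euler step into a
    multiple of [(t2 - t1) * rho ^+ n]. *)
Lemma transport_step n (B : R) : (0 < n)%N -> 1 <= B -> exists2 C, 0 <= C &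
  forall Z t1 t2 M rho f, trajectory T a Z -> 0 <= t1 -> t1 < t2 -> t2 <= T ->
  t2 - t1 <= 1 -> t2 - t1 <= rho ^+ n -> rho <= B -> word_poly 1 n M f ->
  exists2 f1, word_poly 1 n (M * (1 + C * (t2 - t1))) f1 &
    forall X, trajectory T a X -> (forall r, 0 <= r <= T -> `|X r - Z r| <= rho) ->
    `|f1 (X t2 - Z t2) - f (X t1 - Z t1)| <= C * (t2 - t1) * M * rho ^+ n.
Proof.
move=> n0 B1; have [K K0 HK] := euler_step n B1.
have [C1 C10 HC1] := word_poly_shift n0 K0 B1.
have B0 : 0 <= B by exact: le_trans B1.
pose B' := B + K * (B ^+ 1 * B ^+ n).
have B'1 : 1 <= B' by rewrite (le_trans B1)// lerDl !mulr_ge0// exprn_ge0.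
pose C2 := n%:R * B' ^+ n.
have C20 : 0 <= C2 by rewrite mulr_ge0// exprn_ge0// (le_trans _ B'1).
exists (C1 + C2 * (K * 2)) => [|Z t1 t2 M rho f tZ t10 t12 t2T d1 dr rhoB Pf].
  by apply: addr_ge0 => //; apply: mulr_ge0 => //; exact: mulr_ge0.
set d := t2 - t1 in d1 dr *.
have d0 : 0 <= d by rewrite subr_ge0 ltW.
have d01 : 0 <= d <= 1 by rewrite d0.
have M0 := word_poly_norm_ge0 Pf.
have [g g1 Hg] := HK Z t1 t2 tZ t10 t12 t2T.
have [f1 Pf1 Hf1] := HC1 M d f g d01 Pf g1; exists f1.
  apply: (word_poly_le Pf1) => //; rewrite ler_wpM2l// lerD2l ler_wpM2r//.
  by rewrite lerDl; apply: mulr_ge0 => //; exact: mulr_ge0.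
move=> X tX XZ.
have t2T' : 0 <= t2 <= T by rewrite t2T andbT (le_trans t10)// ltW.
have t1T' : 0 <= t1 <= T by rewrite t10 (le_trans _ t2T)// ltW.
set Y2 := X t2 - Z t2; set Y1 := X t1 - Z t1.
have Y2r : `|Y2| <= rho by exact: XZ.
have Y1r : `|Y1| <= rho by exact: XZ.
pose V : 'rV[R]_D := \row_j (Y2 0 j - d * g j Y2).
have VY1 : `|V - Y1| <= K * 2 * (d * rho ^+ n).
  apply: norm_leP => [|j]; first by rewrite !mulr_ge0// exprn_ge0// (le_trans _ Y1r).
  have := Hg X rho j tX rhoB XZ.
  rewrite -/d -/Y1 -/Y2 distrC !mxE => /le_trans; apply.
  rewrite -mulrA (_ : K * 2 * _ = K * (d * (rho ^+ n + rho ^+ n))); last by ring.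
  by rewrite ler_wpM2l// ler_wpM2l// lerD2r.
have VB : `|V| <= B'.
  apply: norm_leP => [|j]; first exact: le_trans B'1.
  rewrite mxE /B'; apply: le_trans (ler_normB _ _) _; apply: lerD.
    by apply: le_trans (coord_le_norm _ _) (le_trans Y2r rhoB).
  rewrite normrM ger0_norm//; apply: le_trans (ler_piMl _ d1) _ => //.
  exact: (word_poly_bound (g1 j) B1 (le_trans Y2r rhoB)).
have BB' : B <= B' by rewrite lerDl !mulr_ge0// exprn_ge0.
have h1 := Hf1 rho Y2 Y2r rhoB.
have h2 := word_poly_lipschitz Pf B'1 VB (le_trans Y1r (le_trans rhoB BB')).
rewrite -/C2 in h2.
have h3 := ler_wpM2l (mulr_ge0 M0 C20) VY1.
rewrite -/V in h1.
rewrite (_ : _ - _ = - (f V - f1 Y2) + (f V - f Y1)); last by ring.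
apply: le_trans (ler_normD _ _) _; rewrite normrN.
apply: le_trans (lerD h1 (le_trans h2 h3)) _.
by rewrite (_ : _ + _ = (C1 + C2 * (K * 2)) * d * M * rho ^+ n)//; ring.
Qed.

(** Composition of small steps of length [d]: the coefficient factors [1 + C * d] multiply to at
    most [expR (C * T)], and the local errors, each proportional to [d], add up to a multiple of
    [rho ^+ n]. *)
Lemma transport n (B : R) : 0 < T -> (0 < n)%N -> 1 <= B -> exists2 C, 0 <= C &
  forall Z t M rho f, trajectory T a Z -> 0 <= t <= T -> 0 < rho <= B ->
  word_poly 1 n M f -> exists2 f1, word_poly 1 n (C * M) f1 &
    forall X, trajectory T a X -> (forall r, 0 <= r <= T -> `|X r - Z r| <= rho) ->
    `|f1 (X t - Z t) - f (X 0 - Z 0)| <= C * M * rho ^+ n.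
Proof.
move=> T0 n0 B1; have [C C0 HC] := transport_step n0 B1.
pose E := expR (C * T).
have E1 : 1 <= E by rewrite -expR0 ler_expR mulr_ge0// ltW.
have E0 : 0 <= E by exact: le_trans E1.
exists (E + C * T * E) => [|Z t M rho f tZ /andP[t0 tT] /andP[rho0 rhoB] Pf].
  by rewrite addr_ge0// !mulr_ge0// ltW.
have M0 := word_poly_norm_ge0 Pf.
move: t0; rewrite le_eqVlt => /orP[/eqP<-|t0].
  exists f; first by apply: (word_poly_le Pf) => //; rewrite ler_peMl// (le_trans E1)// lerDl !mulr_ge0// ltW.
  by move=> X _ _; rewrite subrr normr0 !mulr_ge0// ?addr_ge0 ?exprn_ge0// ?mulr_ge0// ltW.
have rn0 : 0 < rho ^+ n by rewrite exprn_gt0.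
have m0 : 0 < Num.min 1 (rho ^+ n) by rewrite lt_min ltr01.
(* The number of steps does not enter the final constant, so it may be as large as the smallness of
   [rho] requires. *)
pose N := (Num.truncn (t / Num.min 1 (rho ^+ n))).+1.
have N0 : 0 < N%:R :> R by rewrite ltr0n.
pose d := t / N%:R.
have d0 : 0 < d by rewrite divr_gt0.
have dm : d <= Num.min 1 (rho ^+ n).
  by rewrite /d ler_pdivrMr// mulrC -ler_pdivrMr// ltW// truncnS_gt.
have dt k : (k <= N)%N -> k%:R * d <= t.
  by move=> kN; rewrite /d mulrA ler_pdivrMr// mulrC ler_pM2l// ler_nat.
have pw k : (1 + C * d) ^+ k <= expR (k%:R * (C * d)).
  have Cd : 0 <= C * d by rewrite mulr_ge0// ltW.
  rewrite expRM_natl; apply: lerXn2r; rewrite ?nnegrE ?expR_ge0 ?addr_ge0//.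
  exact: expR_ge1Dx.
have step k : (k <= N)%N -> exists2 f1, word_poly 1 n (M * (1 + C * d) ^+ k) f1 &
    forall X, trajectory T a X -> (forall r, 0 <= r <= T -> `|X r - Z r| <= rho) ->
    `|f1 (X (k%:R * d) - Z (k%:R * d)) - f (X 0 - Z 0)| <= k%:R * (C * d * (M * E) * rho ^+ n).
  elim: k => [|k IH] kN.
    exists f; first by rewrite expr0 mulr1.
    by move=> X _ _; rewrite !mul0r subrr normr0.
  have [f1 Pf1 Hf1] := IH (ltnW kN).
  have sd : k.+1%:R * d - k%:R * d = d by rewrite -mulrBl -natr1 addrAC subrr add0r mul1r.
  have s1 : 0 <= k%:R * d by rewrite mulr_ge0// ltW.
  have s2 : k%:R * d < k.+1%:R * d by rewrite ltr_pM2r// ltr_nat.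
  have s3 : k.+1%:R * d <= T by exact: le_trans (dt _ kN) tT.
  have s4 : k.+1%:R * d - k%:R * d <= 1 by rewrite sd (le_trans dm)// ge_min lexx.
  have s5 : k.+1%:R * d - k%:R * d <= rho ^+ n by rewrite sd (le_trans dm)// ge_min lexx orbT.
  have [f2] := HC Z _ _ _ rho f1 tZ s1 s2 s3 s4 s5 rhoB Pf1.
  rewrite sd -mulrA -exprSr => Pf2 Hf2; exists f2 => // X tX XZ.
  have h1 := Hf1 X tX XZ; have h2 := Hf2 X tX XZ.
  rewrite (_ : _ - _ = (f2 (X (k.+1%:R * d) - Z (k.+1%:R * d)) - f1 (X (k%:R * d) - Z (k%:R * d)))
     + (f1 (X (k%:R * d) - Z (k%:R * d)) - f (X 0 - Z 0))); last by ring.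
  apply: le_trans (ler_normD _ _) _; rewrite addrC -[in leRHS]natr1 [leRHS]mulrDl mul1r.
  apply: lerD => //; apply: le_trans h2 _.
  apply: ler_wpM2r; first exact: ltW.
  apply: ler_wpM2l; first by rewrite mulr_ge0// ltW.
  apply: ler_wpM2l => //.
  apply: le_trans (pw k) _; rewrite ler_expR mulrCA ler_wpM2l// (le_trans _ tT)//.
  exact: dt (ltnW kN).
have Nd : N%:R * d = t by rewrite mulrC divfK// gt_eqF.
have [f1 Pf1 Hf1] := step N (leqnn N); exists f1.
  apply: (word_poly_le Pf1) => //; rewrite mulrC ler_wpM2r//.
  apply: le_trans (pw N) _; rewrite mulrCA Nd (le_trans (_ : _ <= E))//.
    by rewrite ler_expR ler_wpM2l.
  by rewrite lerDl !mulr_ge0// ltW.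
move=> X tX XZ; have := Hf1 X tX XZ; rewrite Nd => /le_trans; apply.
rewrite (_ : N%:R * _ = (N%:R * d) * (C * E * M * rho ^+ n)); last by ring.
have q0 : 0 <= C * E * M * rho ^+ n by rewrite !mulr_ge0// ltW.
rewrite Nd; apply: le_trans (ler_wpM2r q0 tT) _.
rewrite (_ : T * _ = C * T * E * M * rho ^+ n); last by ring.
by rewrite ler_wpM2r ?(ltW rn0)// ler_wpM2r// lerDr.
Qed.

End transport.

(** * B-splines *)

Lemma big_nat_tail0 (V : nmodType) (N M : nat) (F : nat -> V) : (N <= M)%N ->
  (forall j, (N <= j < M)%N -> F j = 0) ->
  \sum_(0 <= j < M) F j = \sum_(0 <= j < N) F j.
Proof.
move=> NM F0; rewrite (@big_cat_nat _ _ _ N)//= [X in _ + X]big_nat_cond.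
by rewrite [X in _ + X]big1 ?addr0// => j; rewrite andbT => /F0.
Qed.

Lemma big_nat_shift (V : nmodType) (q k : nat) (F : nat -> V) :
  \sum_(q <= i < q + k) F i = \sum_(0 <= i < k) F (q + i)%N.
Proof.
have -> : \sum_(q <= i < q + k) F i = \sum_(0 + q <= i < k + q) F i by rewrite add0n addnC.
by rewrite big_addn addnK; apply: eq_bigr => i _; rewrite addnC.
Qed.

Section bspline.
Context {R : realType} (k : nat).
Hypothesis k2 : (1 < k)%N.

Definition tpow (e : nat) (x : R) : R := if 0 <= x then x ^+ e else 0.

Definition bcoef (j : nat) : R := (-1) ^+ j * 'C(k, j)%:R.

(** Up to the factor (k-1)!, the cardinal B-spline of order [k] with knots 0, ..., k, as a
    combination of truncated powers. *)
Definition bspline (x : R) : R := \sum_(j < k.+1) bcoef j * tpow k.-1 (x - j%:R).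

(** The polynomial piece of the B-spline on [r, r + 1], in the local variable of that interval. *)
Definition bpoly (r : nat) : {poly R} :=
  \sum_(j < r.+1) bcoef j *: ('X + (r - j)%:R%:P) ^+ k.-1.

Lemma size_XaddC_exp (c : R) e : size (('X + c%:P) ^+ e) = e.+1.
Proof. by rewrite -[c]opprK polyCN size_exp_XsubC. Qed.

Lemma size_bpoly r : (size (bpoly r) <= k)%N.
Proof.
apply: (leq_trans (size_sum _ _ _)); apply/bigmax_leqP => j _.
by apply: (leq_trans (size_scale_leq _ _)); rewrite size_XaddC_exp; lia.
Qed.

(** In [p(x) - p(x - 1)] the leading coefficients cancel, so each of the [d] backward differences
    lowers the degree. *)
Lemma finite_difference (d : nat) (p : {poly R}) (x : R) : (size p <= d)%N ->
  \sum_(j < d.+1) (-1) ^+ j * 'C(d, j)%:R * p.[x - j%:R] = 0.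
Proof.
elim: d p => [|d IH] p sp.
  have -> : p = 0 by apply/eqP; rewrite -size_poly_eq0; lia.
  by rewrite big1// => j _; rewrite horner0 mulr0.
pose q : {poly R} := p - (p \Po ('X - 1%:P)).
have sq : (size q <= d)%N.
  have [p0|p0] := eqVneq p 0; first by rewrite /q p0 comp_poly0 subr0 size_poly0.
  have sc : size (p \Po ('X - 1%:P)) = size p.
    by apply: size_comp_poly2; rewrite size_XsubC.
  rewrite -ltnS; apply: leq_trans sp.
  have lc : lead_coef (p \Po ('X - 1%:P)) = lead_coef p.
    by rewrite lead_coef_comp ?size_XsubC// lead_coefXsubC expr1n mulr1.
  have := size_polyD p (- (p \Po ('X - 1%:P))); rewrite -/q size_polyN sc maxnn => le1.
  move: le1; rewrite leq_eqVlt => /orP[/eqP sq|//].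
  have : lead_coef q = 0.
    by rewrite lead_coefE sq /q coefB -[X in _ - _`_X.-1]sc -!lead_coefE lc subrr.
  move/eqP; rewrite lead_coef_eq0 => /eqP q0.
  by move: sq; rewrite q0 size_poly0 => /esym/eqP; rewrite size_poly_eq0 (negbTE p0).
have := IH q sq; rewrite big_ord_recl /= bin0 mulr1.
pose c j : R := (-1) ^+ j * 'C(d, j)%:R.
have E : \sum_(j < d.+2) (-1) ^+ j * 'C(d.+1, j)%:R * p.[x - j%:R] =
   \sum_(j < d.+1) c j * p.[x - j%:R] - \sum_(j < d.+1) c j * p.[x - j.+1%:R].
  have -> : \sum_(j < d.+1) c j * p.[x - j%:R] = \sum_(j < d.+2) c j * p.[x - j%:R].
    by rewrite [RHS]big_ord_recr /= /c bin_small// mulr0 mul0r addr0.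
  rewrite big_ord_recl [X in _ = X - _]big_ord_recl /c !bin0 -addrA; congr (_ + _).
  rewrite -sumrB; apply: eq_bigr => j _.
  by rewrite lift0 binS natrD exprS; ring.
rewrite E => H; rewrite -sumrB -[RHS](IH q sq); apply: eq_bigr => j _.
rewrite /q hornerD hornerN horner_comp hornerD hornerX hornerN hornerC -mulrBr.
by congr (_ * (_ - p.[_])); rewrite -natr1; ring.
Qed.

Lemma horner_bpoly r x : (bpoly r).[x] = \sum_(j < r.+1) bcoef j * (x + (r - j)%:R) ^+ k.-1.
Proof.
rewrite horner_sum; apply: eq_bigr => j _.
by rewrite hornerZ horner_exp hornerD hornerX hornerC.
Qed.

Lemma bcoef_small j : (k < j)%N -> bcoef j = 0.
Proof. by move=> kj; rewrite /bcoef bin_small// mulr0. Qed.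

(** Beyond the last knot all truncated powers are active, and their sum is the [k]-th difference of
    a polynomial of degree [k.-1]. *)
Lemma bpoly_big r : (k <= r)%N -> bpoly r = 0.
Proof.
move=> kr; have H x : (bpoly r).[x] = 0.
  rewrite horner_bpoly -[RHS](@finite_difference k ('X ^+ k.-1) (x + r%:R)); last first.
    by rewrite size_polyXn; lia.
  rewrite -(big_mkord predT (fun j => bcoef j * (x + (r - j)%:R) ^+ k.-1)).
  rewrite -(big_mkord predT (fun j => (-1) ^+ j * 'C(k, j)%:R * ('X ^+ k.-1).[x + r%:R - j%:R])).
  rewrite (@big_nat_tail0 _ k.+1)//; last first.
    by move=> j /andP[kj _]; rewrite bcoef_small// mul0r.
  rewrite big_nat [RHS]big_nat; apply: eq_bigr => j /andP[_ jk].
  by rewrite hornerXn natrB ?addrA//; lia.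
apply/eqP; apply: contraT => p0.
have := max_poly_roots p0 (rs := [seq i%:R | i <- iota 0 k]).
have -> : all (root (bpoly r)) [seq i%:R | i <- iota 0 k].
  by rewrite all_map; apply/allP => i _ /=; rewrite rootE H.
rewrite map_inj_uniq ?iota_uniq ?size_map ?size_iota => [/(_ isT isT)|]; last exact: (mulrIn (oner_neq0 R)).
by rewrite ltnNge size_bpoly.
Qed.

Lemma bpoly0 : bpoly 0 = 'X ^+ k.-1.
Proof. by rewrite /bpoly big_ord1 /bcoef expr0 bin0 mulr1 scale1r subnn addr0. Qed.

Lemma bpoly_shift r : bpoly r \Po ('X + 1%:P) = bpoly r.+1 - bcoef r.+1 *: 'X ^+ k.-1.
Proof.
rewrite /bpoly [in RHS]big_ord_recr /= subnn addr0 addrK raddf_sum /=.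
apply: eq_bigr => j _; rewrite comp_polyZ rmorphXn /= comp_polyD comp_polyX comp_polyC.
by rewrite -addrA -polyCD nat1r -subSn// -ltnS.
Qed.

Lemma bspline_local (u : R) r : 0 <= u <= 1 -> bspline (u + r%:R) = (bpoly r).[u].
Proof.
move=> /andP[u0 u1]; rewrite /bspline horner_bpoly.
have tz j : (r < j)%N -> tpow k.-1 (u + r%:R - j%:R) = 0.
  rewrite /tpow => rj; have : (r.+1%:R <= j%:R :> R) by rewrite ler_nat.
  rewrite -natr1 => rj'; case: ifP => // h.
  have -> : u + r%:R - j%:R = 0 by apply/eqP; rewrite eq_le h andbT; lra.
  by rewrite expr0n (_ : (k.-1 == 0)%N = false)//; lia.
rewrite -(big_mkord predT (fun j => bcoef j * tpow k.-1 (u + r%:R - j%:R))).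
rewrite -(big_mkord predT (fun j => bcoef j * (u + (r - j)%:R) ^+ k.-1)).
have ext N : (k < N)%N -> (r < N)%N -> 
   \sum_(0 <= j < N) bcoef j * tpow k.-1 (u + r%:R - j%:R) = \sum_(0 <= j < k.+1) bcoef j * tpow k.-1 (u + r%:R - j%:R).
  move=> kN rN; apply: big_nat_tail0 => // j /andP[kj _].
  by rewrite bcoef_small// mul0r.
rewrite -(ext (k + r).+1) //; try lia.
rewrite (@big_nat_tail0 _ r.+1); [|lia|]; last first.
  by move=> j /andP[rj _]; rewrite tz// mulr0.
rewrite big_nat [RHS]big_nat; apply: eq_bigr => j /andP[_ jr]; congr (_ * _).
rewrite /tpow natrB; last lia.
rewrite addrA ifT// -addrA addr_ge0// subr_ge0 ler_nat; lia.
Qed.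

Lemma bspline_neg (x : R) : x <= 0 -> bspline x = 0.
Proof.
move=> x0; rewrite /bspline big1// => j _; rewrite /tpow; case: ifP => [h|]; last by rewrite mulr0.
have j0 : 0 <= j%:R :> R by [].
have -> : x - j%:R = 0 by apply/eqP; rewrite eq_le h andbT; lra.
by rewrite expr0n (_ : (k.-1 == 0)%N = false) ?mulr0//; lia.
Qed.

Lemma bspline_big (x : R) : k%:R <= x -> bspline x = 0.
Proof.
move=> kx; have x0 : 0 <= x by exact: le_trans kx.
have /andP[h1 h2] := truncn_itv x0.
set r := Num.truncn x in h1 h2.
have -> : x = (x - r%:R) + r%:R by rewrite subrK.
rewrite bspline_local; last by rewrite subr_ge0 h1 /= lerBlDr addrC natr1 ltW.
rewrite bpoly_big ?horner0//.
have : k%:R < r.+1%:R :> R by exact: le_lt_trans h2.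
by rewrite ltr_nat ltnS.
Qed.

(** Comparing coefficients shows that the weights [d] annihilate all powers of degree below [k] at
    the nodes 0, ..., k - 1, hence all polynomials of such degree; the one that vanishes at every
    node except [s] singles out [d s]. *)
Lemma powers_free (d : 'I_k -> R) :
  \sum_(s < k) d s *: ('X + (s : nat)%:R%:P) ^+ k.-1 = 0 :> {poly R} -> forall s, d s = 0.
Proof.
move=> H; have M j : (j < k)%N -> \sum_(s < k) d s * (s : nat)%:R ^+ j = 0.
  move=> jk; have := congr1 (fun p : {poly R} => p`_(k.-1 - j)) H.
  rewrite coef0 coef_sum => E.
  have c0 : 'C(k.-1, k.-1 - j)%:R != 0 :> R by rewrite pnatr_eq0 -lt0n bin_gt0; lia.
  apply: (mulIf c0); rewrite mul0r -[RHS]E mulr_suml; apply: eq_bigr => s _.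
  rewrite coefZ addrC exprDn_comm ?coef_sum; last by apply/commr_polyX || exact: mulrC.
  have jlt : (k.-1 - j < k.-1.+1)%N by lia.
  rewrite (bigD1 (Ordinal jlt)) //= big1 ?addr0 => [|i ij].
    rewrite -polyC_exp coefMn coefCM coefXn eqxx mulr1 (_ : k.-1 - (k.-1 - j) = j)%N; last lia.
    by rewrite -mulrA mulr_natr.
  rewrite -polyC_exp coefMn coefCM coefXn.
  rewrite (_ : (_ == _) = false) ?mulr0 ?mul0rn//.
  by apply/negbTE; apply: contra ij => /eqP ij; apply/eqP/val_inj; rewrite /= ij.
have Q (q : {poly R}) : (size q <= k)%N -> \sum_(s < k) d s * q.[(s : nat)%:R] = 0.
  move=> sq; under eq_bigr do rewrite (horner_coef_wide _ sq) mulr_sumr.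
  rewrite exchange_big /= big1// => i _.
  under eq_bigr do rewrite mulrCA; by rewrite -mulr_sumr M ?mulr0.
move=> s; pose q : {poly R} := \prod_(s' <- [seq s' <- enum 'I_k | s' != s]) ('X - (s' : nat)%:R%:P).
have sq : size q = k.
  rewrite /q (size_prod_XsubC _ (fun s' : 'I_k => (s' : nat)%:R)) size_filter.
  have := count_predC (pred1 s) (enum 'I_k); rewrite size_enum_ord -[X in (X + _)%N]/(count_mem s (enum 'I_k)).
  by rewrite count_uniq_mem ?enum_uniq// mem_enum /= add1n.
have := Q q (eq_leq sq); rewrite (bigD1 s)//= big1 ?addr0.
  move=> /eqP; rewrite mulf_eq0 => /orP[/eqP//|].
  rewrite /q horner_prod prodf_seq_eq0 => /hasP[s' ].
  rewrite mem_filter => /andP[ss' _] /=; rewrite hornerXsubC subr_eq0 eqr_nat eq_sym.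
  by move=> /eqP/val_inj/eqP; rewrite (negbTE ss').
move=> s' ss'; rewrite (_ : q.[_] = 0) ?mulr0//.
apply/eqP; rewrite /q horner_prod prodf_seq_eq0; apply/hasP; exists s'.
  by rewrite mem_filter ss' mem_enum.
by rewrite /= hornerXsubC subrr eqxx.
Qed.

(** In terms of the shifted powers (X + s)^(k-1), the pieces form a triangular system with unit
    diagonal. *)
Lemma bpoly_free (c : nat -> R) :
  \sum_(r < k) c r *: bpoly r = 0 -> forall r, (r < k)%N -> c r = 0.
Proof.
move=> H; pose d (s : 'I_k) := \sum_(r < k | (s <= r)%N) c r * bcoef (r - s).
have E : \sum_(s < k) d s *: ('X + (s : nat)%:R%:P) ^+ k.-1 = 0 :> {poly R}.
  rewrite -[RHS]H /d; under eq_bigr do rewrite scaler_suml big_mkcond /=.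
  rewrite exchange_big /=; apply: eq_bigr => r _.
  rewrite /bpoly scaler_sumr -big_mkcond /=.
  rewrite -(big_ord_widen k (fun s => (c r * bcoef (r - s)) *: ('X + s%:R%:P) ^+ k.-1) (ltn_ord r)).
  rewrite (reindex_inj rev_ord_inj) /=; apply: eq_bigr => j _.
  by rewrite subSS scalerA subKn// -ltnS.
have d0 := powers_free E.
have step N r : (r < k)%N -> (k <= r + N)%N -> c r = 0.
  elim: N r => [|N IH] r rk kN; first by lia.
  have := d0 (Ordinal rk); rewrite /d (bigD1 (Ordinal rk)) //= subnn /bcoef expr0 bin0 mulr1 mulr1.
  rewrite big1 ?addr0// => s /andP[rs sr].
  have rs' : (r < s)%N by rewrite ltn_neqAle rs eq_sym andbT; apply: contra sr => /eqP h; apply/eqP/val_inj.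
  by rewrite IH ?mul0r//; have := ltn_ord s; lia.
by move=> r rk; apply: (step k) => //; lia.
Qed.

End bspline.

Section spline_representation.
Context {R : realType} (k : nat).
Hypothesis k2 : (1 < k)%N.

Lemma bpoly_free_ord (c : 'I_k -> R) :
  \sum_(r < k) c r *: @bpoly R k r = 0 -> forall r, c r = 0.
Proof.
move=> H r; pose c' i := if insub i is Some j then c j else 0.
have c'E (i : 'I_k) : c' i = c i by rewrite /c' valK.
rewrite -c'E; apply: (@bpoly_free R k k2) => //.
by rewrite -[RHS]H; apply: eq_bigr => i _; rewrite c'E.
Qed.

Lemma size_bpoly_comb (c : 'I_k -> R) : (size (\sum_(r < k) c r *: @bpoly R k r)%R <= k)%N.
Proof.
apply: (leq_trans (size_sum _ _ _)); apply/bigmax_leqP => r _.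
by apply: (leq_trans (size_scale_leq _ _)); exact: size_bpoly.
Qed.

Lemma poly_eq0_nodes (xi : 'I_k -> R) (p : {poly R}) : injective xi ->
  (size p <= k)%N -> (forall a, p.[xi a] = 0) -> p = 0.
Proof.
move=> xi_inj sp pxi; apply/eqP; apply: contraT => p0.
have := max_poly_roots p0 (rs := [seq xi a | a <- enum 'I_k]).
rewrite all_map (_ : all _ _); last by apply/allP => a _ /=; rewrite rootE pxi.
rewrite map_inj_uniq// enum_uniq size_map size_enum_ord => /(_ isT isT).
by rewrite ltnNge sp.
Qed.

(** The [k] pieces are independent in a space of dimension [k], so the matrix of their values at [k]
    distinct points is invertible. Its inverse provides coefficient functionals that look at the
    polynomial in one cell only. *)
Lemma dual_basis (xi : 'I_k -> R) : injective xi -> exists om : 'I_k -> 'I_k -> R,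
  forall p : {poly R}, (size p <= k)%N ->
    p = \sum_(r < k) (\sum_(a < k) om r a * p.[xi a]) *: @bpoly R k r.
Proof.
move=> xi_inj.
pose W : 'M[R]_k := \matrix_(r, a) (@bpoly R k r).[xi a].
have WP (c : 'rV[R]_k) a : (c *m W) 0 a = (\sum_(r < k) c 0 r *: @bpoly R k r).[xi a].
  by rewrite mxE horner_sum; apply: eq_bigr => r _; rewrite mxE hornerZ.
have Wu : W \in unitmx.
  rewrite -row_free_unit -kermx_eq0; apply/eqP/row_matrixP => i; rewrite row0.
  set c := row i _.
  have cW : c *m W = 0 by rewrite /c -row_mul mulmx_ker row0.
  have E : \sum_(r < k) c 0 r *: @bpoly R k r = 0.
    apply: (poly_eq0_nodes xi_inj (size_bpoly_comb (c 0))) => a.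
    by rewrite -WP cW mxE.
  by apply/rowP => r; rewrite (bpoly_free_ord E) mxE.
exists (fun r a => invmx W a r) => p sp.
pose pv : 'rV[R]_k := \row_a p.[xi a].
apply/eqP; rewrite -subr_eq0; apply/eqP; apply: (poly_eq0_nodes xi_inj).
  apply: (leq_trans (size_polyD _ _)); rewrite size_polyN geq_max sp /=.
  exact: (size_bpoly_comb (fun r => \sum_(a < k) invmx W a r * p.[xi a])).
move=> a; apply/eqP; rewrite hornerD hornerN subr_eq0; apply/eqP.
have := WP (pv *m invmx W) a; rewrite mulmxKV// mxE => ->.
rewrite !horner_sum; apply: eq_bigr => r _; rewrite !hornerZ mxE; congr (_ * _).
by apply: eq_bigr => b _; rewrite mxE mulrC.
Qed.

Variables (xi : 'I_k -> R) (om : 'I_k -> 'I_k -> R).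
Hypothesis dual : forall p : {poly R}, (size p <= k)%N ->
    p = \sum_(r < k) (\sum_(a < k) om r a * p.[xi a]) *: @bpoly R k r.

(** Extended by 0 to all natural numbers, so that indices can be shifted from cell to cell. *)
Definition bcoord (r : nat) (p : {poly R}) : R :=
  if insub r is Some r' then \sum_(a < k) om r' a * p.[xi a] else 0.

Lemma bcoord_ord (r : 'I_k) p : bcoord r p = \sum_(a < k) om r a * p.[xi a].
Proof. by rewrite /bcoord valK. Qed.

Lemma bcoordP (p : {poly R}) : (size p <= k)%N -> p = \sum_(r < k) bcoord r p *: @bpoly R k r.
Proof. by move=> /dual {1}->; apply: eq_bigr => r _; rewrite bcoord_ord. Qed.

Lemma bcoord_unique (p : {poly R}) (c : nat -> R) : p = \sum_(r < k) c r *: @bpoly R k r ->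
  forall r, (r < k)%N -> bcoord r p = c r.
Proof.
move=> pE r rk.
have sp : (size p <= k)%N by rewrite pE; exact: size_bpoly_comb.
apply/eqP; rewrite -subr_eq0; apply/eqP.
apply: (bpoly_free_ord (c := fun r : 'I_k => bcoord r p - c r) _ (Ordinal rk)).
under eq_bigr do rewrite scalerBl.
by rewrite sumrB -bcoordP// -pE subrr.
Qed.

Variables (m : nat) (p : nat -> {poly R}).
Hypothesis m0 : (0 < m)%N.
Hypothesis sp : forall q, (q < m)%N -> (size (p q) <= k)%N.
Hypothesis jump : forall q, (q.+1 < m)%N ->
  exists g : R, p q.+1 = (p q \Po ('X + 1%:P)) + g *: 'X ^+ k.-1.

(** Across a knot each [bpoly r] continues as [bpoly r.+1] up to a multiple of ['X ^+ k.-1], and the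
    jump is such a multiple too; [bpoly 0] absorbs them all. Hence the old coordinates only move up
    by one place. *)
Lemma bcoord_shift q r : (q.+1 < m)%N -> (r.+1 < k)%N ->
  bcoord r.+1 (p q.+1) = bcoord r (p q).
Proof.
move=> qm rk; have [g pE] := jump qm.
pose g' := g - \sum_(r < k) bcoord r (p q) * @bcoef R k r.+1.
pose c i := if i is i'.+1 then bcoord i' (p q) else g'.
apply: (bcoord_unique (c := c)) => //.
have kE : k = k.-1.+1 by lia.
have E : p q \Po ('X + 1%:P) = \sum_(r < k) bcoord r (p q) *: @bpoly R k r.+1
    - (\sum_(r < k) bcoord r (p q) * @bcoef R k r.+1) *: 'X ^+ k.-1.
  rewrite {1}(bcoordP (sp (ltnW qm))) raddf_sum /= scaler_suml -sumrB.
  apply: eq_bigr => i _; rewrite comp_polyZ bpoly_shift scalerBr scalerA//.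
rewrite pE E -addrA (addrC (- _)) -scalerBl -/g'.
have -> : \sum_(r < k) bcoord r (p q) *: @bpoly R k r.+1 =
    \sum_(r < k.-1) bcoord r (p q) *: @bpoly R k r.+1.
  rewrite -(big_mkord predT (fun r => bcoord r (p q) *: @bpoly R k r.+1)) {1}kE.
  by rewrite big_nat_recr//= -kE (@bpoly_big R k k2 k)// scaler0 addr0 big_mkord.
rewrite -(big_mkord predT (fun r => c r *: @bpoly R k r)) [X in index_iota 0 X]kE.
by rewrite big_nat_recl//= bpoly0 big_mkord addrC.
Qed.

(** The coefficient of the [i]-th B-spline is read in cell [i], the last cell of its support, except
    that the final [k.-1] coefficients are read in cell [m.-1]. *)
Definition base_cell (i : nat) := minn i m.-1.

Lemma base_cell_lt i : (base_cell i < m)%N.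
Proof. by rewrite /base_cell; lia. Qed.

Lemma bcoord_consistent q d r : (q + d < m)%N -> (r + d < k)%N ->
  bcoord (r + d) (p (q + d)) = bcoord r (p q).
Proof.
elim: d => [|d IH] h1 h2; first by rewrite !addn0.
by rewrite !addnS bcoord_shift ?IH//; lia.
Qed.

Definition spline_coef (i : nat) : R :=
  bcoord (k.-1 - (i - base_cell i)) (p (base_cell i)).

Lemma spline_coefE q s : (q < m)%N -> (s < k)%N ->
  spline_coef (q + s) = bcoord (k.-1 - s) (p q).
Proof.
move=> qm sk; rewrite /spline_coef.
have [d dE] : exists d, base_cell (q + s) = (q + d)%N.
  by exists (base_cell (q + s) - q)%N; rewrite /base_cell; lia.
have ds : (d <= s)%N by move: dE; rewrite /base_cell; lia.
have dm := base_cell_lt (q + s).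
rewrite dE in dm *.
rewrite (_ : (k.-1 - (q + s - (q + d)) = k.-1 - s + d)%N); last by lia.
by rewrite bcoord_consistent//; lia.
Qed.

(** On cell [q] only the B-splines with indices [q], ..., [q + k.-1] are active, and consistency of
    the coordinates makes their global coefficients agree with the local ones. *)
Lemma spline_representation q (u : R) : (q < m)%N -> 0 <= u <= 1 ->
  (p q).[u] = \sum_(i < m + k.-1) spline_coef i * bspline k (q%:R + u - i%:R + k.-1%:R).
Proof.
move=> qm u01; have /andP[u0 u1] := u01.
rewrite -(big_mkord predT (fun i => spline_coef i * bspline k (q%:R + u - i%:R + k.-1%:R))).
have kS : k%:R = k.-1%:R + 1 :> R by rewrite natr1 prednK//; lia.
rewrite (@big_nat_tail0 _ (q + k)); [|by lia|]; last first.
  move=> i /andP[qi _]; rewrite bspline_neg ?mulr0//.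
  have : (q + k)%:R <= i%:R :> R by rewrite ler_nat.
  by rewrite natrD kS; lra.
rewrite (@big_cat_nat _ _ _ q)//=; last by lia.
rewrite [X in X + _]big_nat_cond [X in X + _]big1 ?add0r; last first.
  move=> i; rewrite andbT => /andP[_ iq]; rewrite bspline_big ?mulr0//.
  have : i.+1%:R <= q%:R :> R by rewrite ler_nat.
  by rewrite -natr1 kS; lra.
rewrite big_nat_shift.
rewrite {1}(bcoordP (sp qm)) horner_sum.
rewrite -(big_mkord predT (fun r => (bcoord r (p q) *: @bpoly R k r).[u])) big_nat_rev /=.
rewrite big_nat [RHS]big_nat; apply: eq_bigr => s /andP[_ sk].
rewrite add0n hornerZ spline_coefE//.
rewrite (_ : (k - s.+1 = k.-1 - s)%N); last lia.
rewrite -(@bspline_local R k k2)//; congr (_ * bspline k _).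
by rewrite natrB ?natrD; [ring|lia].
Qed.

End spline_representation.

(** * Splines on a line: jumps at the knots and reproduction from point values *)

Lemma eq_limit_left (R : realType) (g h : R -> R) (a xi : R) : a < xi ->
  {for xi, continuous g} -> {for xi, continuous h} ->
  (forall x, a < x < xi -> g x = h x) -> g xi = h xi.
Proof.
move=> axi cg ch gh.
have Hg := cvg_at_left_filter cg; have Hh := cvg_at_left_filter ch.
apply: (@cvg_unique _ (@Rhausdorff R) (g x @[x --> xi^'-])%classic) => //.
apply: cvg_trans Hh; apply: near_eq_cvg.
near=> x; apply/esym; apply: gh.
apply/andP; split; near: x; [exact: nbhs_left_gt|exact: nbhs_left_lt].
Unshelve. all: by end_near. Qed.

Lemma eq_limit_right (R : realType) (g h : R -> R) (xi b : R) : xi < b ->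
  {for xi, continuous g} -> {for xi, continuous h} ->
  (forall x, xi < x < b -> g x = h x) -> g xi = h xi.
Proof.
move=> xib cg ch gh.
have Hg := cvg_at_right_filter cg; have Hh := cvg_at_right_filter ch.
apply: (@cvg_unique _ (@Rhausdorff R) (g x @[x --> xi^'+])%classic) => //.
apply: cvg_trans Hh; apply: near_eq_cvg.
near=> x; apply/esym; apply: gh.
apply/andP; split; near: x; [exact: nbhs_right_gt|exact: nbhs_right_lt].
Unshelve. all: by end_near. Qed.

Lemma derivative_chain_poly (R : realType) (f : nat -> R -> R) (K : nat) (a b : R) (P : {poly R}) :
  (forall j x, (j < K)%N -> a < x < b -> is_derive x 1 (f j) (f j.+1 x)) ->
  (forall x, a < x < b -> f 0 x = P.[x]) ->
  forall j x, (j <= K)%N -> a < x < b -> f j x = (P^`(j)).[x].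
Proof.
move=> df f0; elim=> [|j IH] x jK xab; first by rewrite f0.
have d1 := df j x jK xab.
have d2 : is_derive x 1 (f j) (P^`(j.+1)).[x].
  have dP := is_derive_poly P^`(j) x; rewrite derivnS; apply: near_eq_is_derive dP.
  have : x \in `]a, b[ by rewrite in_itv.
  move=> /near_in_itvoo; apply: filterS => y; rewrite in_itv /= => yab.
  by rewrite (IH y (ltnW jK) yab).
by rewrite -(@derive_val _ _ _ _ _ _ _ d1) (@derive_val _ _ _ _ _ _ _ d2).
Qed.

Lemma poly_ext (R : realType) (p q : {poly R}) : (forall x, p.[x] = q.[x]) -> p = q.
Proof.
move=> H; apply/eqP; rewrite -subr_eq0; apply/eqP.
have inj : injective (fun i : 'I_(size (p - q)) => (i : nat)%:R : R).
  by move=> i j /eqP; rewrite eqr_nat => /eqP/val_inj.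
by apply: (poly_eq0_nodes inj) => // i; rewrite hornerD hornerN H subrr.
Qed.

(** All derivatives of [Q - P] up to order [k - 2] vanish at [xi], by continuity from both sides, so
    only the top term of its Taylor expansion survives. The derivatives form an abstract chain
    [f j], to be filled with partial derivatives along a coordinate line. *)
Lemma smooth_jump (R : realType) (f : nat -> R -> R) (k : nat) (a xi b : R) (P Q : {poly R}) :
  (1 < k)%N -> a < xi < b -> (size P <= k)%N -> (size Q <= k)%N ->
  (forall j x, (j < k - 2)%N -> a < x < b -> is_derive x 1 (f j) (f j.+1 x)) ->
  (forall j, (j <= k - 2)%N -> {for xi, continuous (f j)}) ->
  (forall x, a < x < xi -> f 0 x = P.[x]) -> (forall x, xi < x < b -> f 0 x = Q.[x]) ->
  exists g, Q = P + g *: ('X - xi%:P) ^+ k.-1.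
Proof.
move=> k2 /andP[axi xib] sP sQ df cf fP fQ.
have cp (p : {poly R}) : {for xi, continuous (horner p)} by exact: continuous_horner.
have D0 j : (j <= k - 2)%N -> ((Q - P)^`(j)).[xi] = 0.
  move=> jk; rewrite derivnB hornerD hornerN; apply/eqP; rewrite subr_eq0; apply/eqP.
  have <- : f j xi = (Q^`(j)).[xi].
    apply: (eq_limit_right xib (cf j jk) (cp _)) => x /andP[h1 h2].
    apply: (derivative_chain_poly (a := xi) (b := b) (K := k - 2)) => //; last by rewrite h1.
    by move=> i y ik /andP[y1 y2]; apply: df => //; rewrite y2 (lt_trans axi).
  apply: (eq_limit_left axi (cf j jk) (cp _)) => x /andP[h1 h2].
  apply: (derivative_chain_poly (a := a) (b := xi) (K := k - 2)) => //; last by rewrite h1.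
  by move=> i y ik /andP[y1 y2]; apply: df => //; rewrite y1 (lt_trans _ xib).
have s : (size (Q - P)%R <= k)%N.
  by apply: (leq_trans (size_polyD _ _)); rewrite size_polyN geq_max sQ.
exists ((Q - P)^`N(k.-1)).[xi]; apply/eqP; rewrite addrC -subr_eq; apply/eqP/poly_ext => x.
have -> : x = xi + (x - xi) by rewrite addrC subrK.
rewrite (nderiv_taylor_wide _ s); last exact: mulrC.
rewrite hornerZ horner_exp hornerXsubC (addrC xi) addrK.
have kE : k = k.-1.+1 by lia.
rewrite [in LHS]kE big_ord_recr /= big1 ?add0r// => j _.
have jf : (j`!)%:R != 0 :> R by rewrite pnatr_eq0 -lt0n fact_gt0.
have jk : (j <= k - 2)%N by have := ltn_ord j; lia.
have := D0 j jk; rewrite nderivn_def hornerMn -mulr_natr => /eqP.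
by rewrite mulf_eq0 (negbTE jf) orbF => /eqP ->; rewrite mul0r.
Qed.

Section line_splines.
Context {R : realType} (k m : nat).
Hypothesis k2 : (1 < k)%N.
Hypothesis m0 : (0 < m)%N.

Definition grid_point (q : nat) : R := q%:R / m%:R.

(** Only the shape of the jumps is recorded, not differentiability; restrictions of multivariate
    splines and single polynomials of low degree both qualify. The end points 0 and 1 are left out
    because the functions of interest live on the open cube. *)
Definition line_spline (f : R -> R) : Prop := exists P : nat -> {poly R},
  [/\ forall q, (q < m)%N -> (size (P q) <= k)%N,
      forall q s, (q < m)%N -> grid_point q <= s <= grid_point q.+1 -> 0 < s < 1 -> f s = (P q).[s] &
      forall q, (q.+1 < m)%N -> exists g, P q.+1 = P q + g *: ('X - (grid_point q.+1)%:P) ^+ k.-1].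

Lemma line_spline_poly (P : {poly R}) (f : R -> R) : (size P <= k)%N ->
  (forall s, 0 < s < 1 -> f s = P.[s]) -> line_spline f.
Proof.
by move=> sP fP; exists (fun=> P); split => // [q s _ _ /fP//|q _]; exists 0; rewrite scale0r addr0.
Qed.

Let m0R : 0 < m%:R :> R. Proof. by rewrite ltr0n. Qed.

Lemma cell_coordinate (s : R) : 0 < s < 1 -> exists2 q, (q < m)%N &
  grid_point q <= s <= grid_point q.+1.
Proof.
move=> /andP[s0 s1]; have ms : 0 <= s * m%:R by rewrite mulr_ge0// ltW.
have /andP[h1 h2] := truncn_itv ms.
exists (Num.truncn (s * m%:R)).
  rewrite -(ltr_nat R); apply: le_lt_trans h1 _.
  by rewrite gtr_pMl.
by rewrite /grid_point ler_pdivrMr// ler_pdivlMr// h1 ltW.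
Qed.

Variables (xi : 'I_k -> R) (om : 'I_k -> 'I_k -> R).
Hypothesis xi01 : forall a, 0 < xi a < 1.
Hypothesis dual : forall p : {poly R}, (size p <= k)%N ->
    p = \sum_(r < k) (\sum_(a < k) om r a * p.[xi a]) *: @bpoly R k r.

Definition dual_weight (r : nat) (a : 'I_k) : R := if insub r is Some r' then om r' a else 0.

Lemma bcoord_weight r p : bcoord xi om r p = \sum_(a < k) dual_weight r a * p.[xi a].
Proof.
rewrite /bcoord /dual_weight; case: insub => // .
by rewrite big1// => a _; rewrite mul0r.
Qed.

(** The [k] evaluation points of a coefficient lie inside its base cell, so no node leaves ]0, 1[,
    even for B-splines that reach over the boundary. *)
Definition node (e : 'I_(m + k.-1) * 'I_k) : R := ((base_cell m e.1)%:R + xi e.2) / m%:R.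

Definition node_weight (e : 'I_(m + k.-1) * 'I_k) : R :=
  dual_weight (k.-1 - (e.1 - base_cell m e.1)) e.2.

Definition bspline_at (i : nat) (s : R) : R := bspline k (s * m%:R - i%:R + k.-1%:R).

Lemma node01 e : 0 < node e < 1.
Proof.
have /andP[x0 x1] := xi01 e.2; have b := base_cell_lt k2 m0 e.1.
rewrite /node divr_gt0 ?ltr_wpDl//= ltr_pdivrMr// mul1r.
apply: (@lt_le_trans _ _ ((base_cell m e.1)%:R + 1)); first by rewrite ltrD2l.
by rewrite natr1 ler_nat.
Qed.

Lemma line_reproduction (f : R -> R) : line_spline f -> forall s, 0 < s < 1 ->
  f s = \sum_e (node_weight e * bspline_at e.1 s) * f (node e).
Proof.
move=> [P [sP fP jP]] s s01.
pose p q : {poly R} := P q \Po (m%:R^-1 *: 'X + (grid_point q)%:P).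
have pE q u : (p q).[u] = (P q).[(q%:R + u) / m%:R].
  rewrite horner_comp hornerD hornerZ hornerX hornerC /grid_point; congr (P q).[_].
  by rewrite mulrDl addrC [u / _]mulrC.
have sl q : (size (m%:R^-1 *: 'X + (grid_point q)%:P : {poly R})%R <= 2)%N.
  apply: (leq_trans (size_polyD _ _)); rewrite geq_max (leq_trans (size_scale_leq _ _)) ?size_polyX//=.
  by rewrite (leq_trans (size_polyC_leq1 _)).
have sp q : (q < m)%N -> (size (p q) <= k)%N.
  move=> qm; have [P0|P0] := eqVneq (P q) 0; first by rewrite /p P0 comp_poly0 size_poly0.
  apply: (leq_trans (size_comp_poly_leq _ _)).
  rewrite -size_poly_gt0 in P0; have := sP q qm; have := sl q.
  by move: {+}(size _) => t; nia.
have jump q : (q.+1 < m)%N -> exists g : R, p q.+1 = (p q \Po ('X + 1%:P)) + g *: 'X ^+ k.-1.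
  move=> qm; have [g gE] := jP q qm; exists (g * m%:R^-1 ^+ k.-1); apply: poly_ext => u.
  rewrite pE gE !hornerD !hornerZ horner_exp hornerXsubC hornerXn horner_comp pE.
  rewrite hornerD hornerX hornerC -mulrA -exprMn; congr ((P q).[_] + _ * _ ^+ _).
    by rewrite -natr1; congr (_ / _); ring.
  by rewrite /grid_point mulrDl addrAC subrr add0r mulrC.
have [q qm /andP[q1 q2]] := cell_coordinate s01.
have u01 : 0 <= s * m%:R - q%:R <= 1.
  move: q1 q2; rewrite /grid_point ler_pdivrMr// ler_pdivlMr// -natr1 => *; apply/andP; split; lra.
have -> : f s = (p q).[s * m%:R - q%:R].
  by rewrite pE addrC subrK mulfK ?gt_eqF//; apply: fP => //; rewrite q1.
rewrite (spline_representation k2 dual m0 sp jump qm u01).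
rewrite -(pair_big predT predT (fun i a => (node_weight (i, a) * bspline_at i s) * f (node (i, a)))) /=.
apply: eq_bigr => i _; rewrite /spline_coef bcoord_weight mulr_suml; apply: eq_bigr => a _.
rewrite /node_weight /= -!mulrA; congr (_ * _); rewrite mulrC /bspline_at; congr (_ * _).
  by congr bspline; ring.
have bm := base_cell_lt k2 m0 i.
rewrite pE -(fP (base_cell m i)) ?node01//; last exact: (node01 (i, a)).
have /andP[x0 x1] := xi01 a.
by rewrite /grid_point !ler_pM2r ?invr_gt0// lerDl -natr1 lerD2l !ltW.
Qed.

End line_splines.

(** * Tensor products *)

Section tensor_expansion.
Context {R : realType} (E : finType) (beta : E -> R -> R) (nu : E -> R) (A : set R).
Hypothesis nuA : forall e, A (nu e).

Definition fcons n (e0 : E) (e : {ffun 'I_n -> E}) : {ffun 'I_n.+1 -> E} :=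
  [ffun j => oapp e e0 (unlift ord0 j)].

Lemma big_fcons n (V : nmodType) (H : {ffun 'I_n.+1 -> E} -> V) :
  \sum_e H e = \sum_e0 \sum_(e : {ffun 'I_n -> E}) H (fcons e0 e).
Proof.
rewrite pair_big /= (reindex (fun p : E * {ffun 'I_n -> E} => fcons p.1 p.2)) //.
exists (fun e : {ffun 'I_n.+1 -> E} => (e ord0, [ffun j => e (lift ord0 j)])) => [[e0 e] _|e _] /=.
  congr pair; first by rewrite ffunE unlift_none.
  by apply/ffunP => j; rewrite !ffunE liftK.
by apply/ffunP => j; rewrite !ffunE; case: unliftP => [i|] -> //=; rewrite ffunE.
Qed.

(** The one-dimensional expansion is applied to one coordinate after the other, by induction on the
    dimension with the first coordinate split off. *)
Lemma tensor_expansion n (F : 'rV[R]_n -> R) :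
  (forall (x : 'rV[R]_n) j, (forall i, A (x 0 i)) ->
     F x = \sum_e beta e (x 0 j) * F (upd x j (nu e))) ->
  forall x : 'rV[R]_n, (forall i, A (x 0 i)) ->
  F x = \sum_(e : {ffun 'I_n -> E}) (\prod_j beta (e j) (x 0 j)) * F (\row_j nu (e j)).
Proof.
elim: n F => [|n IH] F HF x Ax.
  rewrite (big_pred1 [ffun j : 'I_0 => let: Ordinal _ h := j in False_rect E (notF h)]); last first.
    by move=> e; apply/esym/eqP/ffunP => -[].
  by rewrite big_ord0 mul1r; congr F; apply/rowP => -[].
pose x0 : R := x 0 ord0; pose y : 'rV[R]_n := \row_j x 0 (lift ord0 j).
have xE : x = cons_rV (x0, y) by rewrite -(uncons_rVK x).
have cons0 (s : R) (z : 'rV[R]_n) : cons_rV (s : measurableTypeR R, z) 0 ord0 = s by rewrite mxE unlift_none.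
have consS (s : R) (z : 'rV[R]_n) j : cons_rV (s : measurableTypeR R, z) 0 (lift ord0 j) = z 0 j by rewrite mxE liftK.
have Acons (s : R) (z : 'rV[R]_n) : A s -> (forall i, A (z 0 i)) ->
    forall i, A (cons_rV (s : measurableTypeR R, z) 0 i).
  by move=> As Az i; case: (unliftP ord0 i) => [j|] ->; rewrite ?cons0 ?consS.
have Ay i : A (y 0 i) by rewrite mxE.
have updS (s : R) (z : 'rV[R]_n) j r :
    upd (cons_rV (s : measurableTypeR R, z)) (lift ord0 j) r = cons_rV (s : measurableTypeR R, upd z j r).
  apply/rowP => i; rewrite !mxE; case: (unliftP ord0 i) => [i'|] -> /=.
    by rewrite !mxE (inj_eq lift_inj).
  by [].
have upd0 (s : R) (z : 'rV[R]_n) r :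
    upd (cons_rV (s : measurableTypeR R, z)) ord0 r = cons_rV (r : measurableTypeR R, z).
  apply/rowP => i; rewrite !mxE; case: (unliftP ord0 i) => [i'|] -> /=.
    by [].
  by [].
rewrite [in LHS]xE (IH (fun z => F (cons_rV (x0 : measurableTypeR R, z)))); last first.
- by move=> i; rewrite mxE.
- move=> z j Az; rewrite (HF _ (lift ord0 j)); last by apply: Acons => //; exact: Ax.
  by apply: eq_bigr => e _; rewrite consS updS.
rewrite big_fcons exchange_big /=; apply: eq_bigr => e _.
rewrite (HF _ ord0); last by apply: Acons => [|i]; rewrite ?mxE//; exact: Ax.
rewrite mulr_sumr; apply: eq_bigr => e0 _.
rewrite cons0 upd0 big_ord_recl /= ffunE unlift_none /= mulrA [RHS]mulrAC.
rewrite [X in X * _ = _]mulrC -!mulrA; congr (_ * _); rewrite mulrC; congr (F _ * _).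
  apply/rowP => i; rewrite !mxE ffunE; case: (unliftP ord0 i) => [i'|] _ //=.
  by rewrite mxE.
by apply: eq_bigr => j _; rewrite ffunE liftK mxE.
Qed.

End tensor_expansion.

Lemma near_eq_continuous (R : realType) D (f g : 'rV[R]_D -> R) (x : 'rV[R]_D) :
  (\forall y \near x, f y = g y) -> {for x, continuous f} -> {for x, continuous g}.
Proof.
move=> fg cf; have gx : f x = g x := nbhs_singleton fg.
move=> B; rewrite -gx => nB; have h := cf B nB.
by apply: filterS2 fg h => y fgy; rewrite /preimage /= fgy.
Qed.

(** * Differentiability classes and tensor products of functions of one variable *)

Section Ck.
Context {R : realType} {D : nat}.
Implicit Types (U : set 'rV[R]_D) (f g : 'rV[R]_D -> R).

Lemma partials_lin U (a : R) f g k : open U -> Ck_on k U f -> Ck_on k U g ->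
  forall l, (size l <= k)%N -> forall x, U x ->
  partials l (fun x => a * f x + g x) x = a * partials l f x + partials l g x.
Proof.
move=> oU cf cg; elim=> [//|i l IH] /= lk x Ux.
rewrite /partial (near_eq_derive _ (g := fun x => a * partials l f x + partials l g x)).
  have df := (proj2 (cf l)) lk x i Ux; have dg := (proj2 (cg l)) lk x i Ux.
  have -> : (fun x => a * partials l f x + partials l g x) = (a \*: partials l f) + partials l g by [].
  by rewrite (deriveD (derivableZ df) dg) deriveZ.
have := open_nbhs_nbhs (conj oU Ux); apply: filterS => y Uy.
by apply: IH => //; exact: ltnW.
Qed.

Lemma Ck_on_lin U (a : R) f g k : open U -> Ck_on k U f -> Ck_on k U g ->
  Ck_on k U (fun x => a * f x + g x).
Proof.
move=> oU cf cg l; have pl := partials_lin a oU cf cg.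
split=> [lk x Ux|lk x i Ux].
  apply: (@near_eq_continuous _ _ (fun x => a * partials l f x + partials l g x)).
    by have := open_nbhs_nbhs (conj oU Ux); apply: filterS => y Uy; rewrite pl.
  apply: continuousD; last exact: (proj1 (cg l)).
  by apply: continuousM; [exact: cst_continuous|exact: (proj1 (cf l))].
apply: (@near_eq_derivable _ _ _ (fun x => a * partials l f x + partials l g x)).
  have := open_nbhs_nbhs (conj oU Ux); apply: filterS => y Uy.
  by rewrite pl// ltnW.
apply: derivableD; last exact: (proj2 (cg l)).
by apply: derivableZ; exact: (proj2 (cf l)).
Qed.

Lemma Ck_on_sub U V f k k' : U `<=` V -> (k <= k')%N -> Ck_on k' V f -> Ck_on k U f.
Proof.
move=> UV kk H l; have [h1 h2] := H l; split=> [lk x /UV Vx|lk x i /UV Vx].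
  by apply: h1 => //; exact: leq_trans kk.
by apply: h2 => //; exact: leq_trans kk.
Qed.

Variables (g : 'I_D -> nat -> R -> R) (K : nat).
Hypothesis dg : forall j i (s : R), (i < K)%N -> is_derive s 1 (g j i) (g j i.+1 s).
Hypothesis cg : forall j i, (i <= K)%N -> continuous (g j i).

(** [c j] counts the derivatives already taken in coordinate [j], and [g j i] is the [i]-th
    derivative of the [j]-th factor, so partial differentiation stays within the family. *)
Definition tensor (c : 'I_D -> nat) (x : 'rV[R]_D) : R := \prod_j g j (c j) (x 0 j).

Lemma is_derive_tensor (c : 'I_D -> nat) (x : 'rV[R]_D) (i : 'I_D) : (c i < K)%N ->
  is_derive x (delta_mx 0 i) (tensor c) (tensor (fun j => (j == i) + c j)%N x).
Proof.
move=> ci; rewrite -[x](upd_id x i); apply: is_derive_coordinate; rewrite upd_id.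
pose r := \prod_(j | j != i) g j (c j) (x 0 j).
have -> : (fun s => tensor c (upd x i s)) = r \*: g i (c i).
  apply/funext => s; rewrite /tensor (bigD1 i)//= upd_eq mulrC; congr (_ * _).
  by apply: eq_bigr => j ji; rewrite upd_neq.
have := is_deriveZ r (dg i (x 0 i) ci); move=> /is_derive_eq; apply.
rewrite /tensor (bigD1 i)//= eqxx add1n mulrC ?upd_eq; congr (_ * _).
by apply: eq_bigr => j ji; rewrite (negbTE ji) ?upd_neq.
Qed.

Lemma partials_tensor l : (size l <= K)%N ->
  partials l (tensor (fun=> 0%N)) = tensor (fun j => count_mem j l).
Proof.
elim: l => [//|i l IH] /= lK; rewrite IH ?(ltnW lK)//; apply/funext => x.
have ci : (count_mem i l < K)%N by apply: leq_ltn_trans lK; exact: count_size.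
rewrite /partial (@derive_val _ _ _ _ _ _ _ (@is_derive_tensor (fun j => count_mem j l) x i ci)) /tensor.
by apply: eq_bigr => j _; rewrite eq_sym.
Qed.

Lemma Ck_on_tensor : Ck_on K setT (tensor (fun=> 0%N)).
Proof.
move=> l; split=> [lK x _|lK x i _]; rewrite partials_tensor//; last first.
- exact: ltnW.
- have ci : (count_mem i l < K)%N by apply: leq_ltn_trans lK; exact: count_size.
  by case: (@is_derive_tensor (fun j => count_mem j l) x i ci).
have H (r : seq 'I_D) : {for x, continuous (fun x : 'rV[R]_D => \prod_(j <- r) g j (count_mem j l) (x 0 j))}.
  elim: r => [|j r IH].
    rewrite (_ : (fun _ => _) = cst 1); first exact: cst_continuous.
    by apply/funext => y; rewrite big_nil.
  rewrite (_ : (fun _ => _) = fun y : 'rV[R]_D => g j (count_mem j l) (y 0 j) * \prod_(j <- r) g j (count_mem j l) (y 0 j)).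
    apply: continuousM => //; apply: continuous_comp; first exact: coord_continuous.
    by apply: cg; apply: leq_trans lK; exact: count_size.
  by apply/funext => y; rewrite big_cons.
exact: H.
Qed.

End Ck.

Section truncated_powers.
Context {R : realType}.
Implicit Types x : R.

Lemma tpow_max e x : (0 < e)%N -> tpow e x = Num.max x 0 ^+ e.
Proof.
move=> e0; rewrite /tpow; case: (leP 0 x) => x0; first by [].
by rewrite expr0n (gtn_eqF e0).
Qed.

Lemma continuous_tpow e : (0 < e)%N -> continuous (@tpow R e).
Proof.
move=> e0; have -> : @tpow R e = (fun y => y ^+ e) \o (fun x => Num.max x 0).
  by apply/funext => x; rewrite tpow_max.
move=> x; apply: continuous_comp; last exact: exprn_continuous.
apply: (@continuous_max _ _ id (cst 0)); [exact: cvg_id|exact: cvg_cst].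
Qed.

Lemma is_derive_tpow e x : (1 < e)%N -> is_derive x 1 (@tpow R e) (e%:R * tpow e.-1 x).
Proof.
move=> e1; have eE : e = e.-1.+1 by lia.
case: (ltgtP 0 x) => x0.
- have d := is_derive_exprS e.-1 x; rewrite -eE in d.
  rewrite {2}/tpow ltW//; apply: near_eq_is_derive d.
  have := lt_nbhsr x0; apply: filterS => y y0; by rewrite /tpow ltW.
- rewrite {2}/tpow leNgt x0 /= mulr0.
  have dc := is_derive_cst (0 : R) x (1 : R); apply: near_eq_is_derive dc.
  have := lt_nbhsl x0; apply: filterS => y y0; by rewrite /tpow leNgt y0.
(* At the knot the difference quotient is [tpow e.-1] itself, which is continuous because
   [1 < e]. *)
- rewrite -x0; apply/is_derive1_caratheodory; exists (tpow e.-1); split.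
  + move=> z; rewrite subr0 /tpow lexx expr0n (_ : (e == 0)%N = false); last by lia.
    by rewrite subr0; case: ifP => _; [rewrite -exprSr -eE|rewrite mul0r].
  + apply: continuous_tpow; lia.
  + rewrite /tpow lexx expr0n (_ : (e.-1 == 0)%N = false) ?mulr0//; lia.
Qed.

Variable k : nat.
Hypothesis k2 : (1 < k)%N.

Definition bspline_der (i : nat) (x : R) : R :=
  \sum_(j < k.+1) bcoef k j * ((k.-1 ^_ i)%:R * tpow (k.-1 - i) (x - j%:R)).

Lemma bspline_der0 x : bspline_der 0 x = bspline k x.
Proof. by apply: eq_bigr => j _; rewrite ffactn0 mul1r subn0. Qed.

Lemma is_derive_bspline_der i x : (i < k - 2)%N ->
  is_derive x 1 (bspline_der i) (bspline_der i.+1 x).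
Proof.
move=> ik.
have -> : bspline_der i = \sum_(j < k.+1)
    ((bcoef k j * (k.-1 ^_ i)%:R) \*: (tpow (k.-1 - i) \o (fun y => y - j%:R))).
  by apply/funext => y; rewrite fct_sumE; apply: eq_bigr => j _; rewrite mulrA.
apply: is_derive_sum => j.
have e1 : (1 < k.-1 - i)%N by lia.
have d1 : is_derive x 1 (fun y : R => y - j%:R) 1.
  have := is_deriveB (is_derive_id x (1 : R)) (is_derive_cst (j%:R : R) x (1 : R)).
  by rewrite subr0.
have := is_deriveZ (bcoef k j * (k.-1 ^_ i)%:R) (@is_derive1_comp R (tpow (k.-1 - i)) (fun y => y - j%:R) x _ _ (is_derive_tpow (x - j%:R) e1) d1).
move=> /is_derive_eq; apply; rewrite mulr1 -[LHS]/(_ * _) ffactnSr natrM.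
by rewrite (_ : (k.-1 - i.+1 = (k.-1 - i).-1)%N); [ring|lia].
Qed.

Lemma continuous_bspline_der i : (i <= k - 2)%N -> continuous (bspline_der i).
Proof.
move=> ik x; rewrite /bspline_der.
have H (r : seq 'I_k.+1) : {for x, continuous (fun x : R => \sum_(j <- r) bcoef k j * ((k.-1 ^_ i)%:R * tpow (k.-1 - i) (x - j%:R)))}.
  elim: r => [|j r IH].
    rewrite (_ : (fun _ => _) = cst 0); first exact: cst_continuous.
    by apply/funext => y; rewrite big_nil.
  rewrite (_ : (fun _ => _) = fun x : R => bcoef k j * ((k.-1 ^_ i)%:R * tpow (k.-1 - i) (x - j%:R)) +
     \sum_(j <- r) bcoef k j * ((k.-1 ^_ i)%:R * tpow (k.-1 - i) (x - j%:R))); last first.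
    by apply/funext => y; rewrite big_cons.
  apply: continuousD => //; apply: continuousM; first exact: cst_continuous.
  apply: continuousM; first exact: cst_continuous.
  apply: continuous_comp; last by apply: continuous_tpow; lia.
  by apply: continuousB; [exact: cvg_id|exact: cst_continuous].
exact: H.
Qed.

(** The truncated powers grow although the B-spline vanishes outside [0, k]; clamping the argument
    keeps every term bounded and Lipschitz. *)
Lemma bspline_clip x : bspline k x = bspline k (Num.min (Num.max x 0) k%:R).
Proof.
have k0 : 0 <= k%:R :> R by [].
case: (leP 0 x) => x0.
  by case: (leP x k%:R) => // xk; rewrite !(bspline_big k2)// ltW.
by rewrite min_l// !(bspline_neg k2)// ltW.
Qed.

Lemma bspline_lipschitz : exists2 C : R, 0 <= C & forall x y,
  `|bspline k x| <= C /\ `|bspline k x - bspline k y| <= C * `|x - y|.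
Proof.
pose c := \sum_(j < k.+1) `|bcoef k j : R|.
have c0 : 0 <= c by exact: sumr_ge0.
pose C1 := c * k%:R ^+ k.-1; pose C2 := c * (k.-1%:R * k%:R ^+ k.-2).
have C10 : 0 <= C1 by rewrite mulr_ge0// exprn_ge0.
have C20 : 0 <= C2 by rewrite !mulr_ge0// exprn_ge0.
have cl (x : R) : 0 <= Num.min (Num.max x 0) k%:R <= k%:R.
  by rewrite ge_min lexx orbT andbT le_min ler0n andbT le_max lexx orbT.
have clj (x : R) (j : nat) : 0 <= x <= k%:R -> 0 <= Num.max (x - j%:R) 0 <= k%:R.
  move=> /andP[x0 xk]; rewrite le_max lexx orbT /= ge_max ler0n andbT.
  by have : 0 <= j%:R :> R by []; lra.
have e0 : (0 < k.-1)%N by lia.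
have kE : k.-1 = k.-2.+1 by rewrite prednK.
exists (C1 + C2) => [|x y]; first exact: addr_ge0.
split.
  rewrite bspline_clip; apply: (@le_trans _ _ C1); last by rewrite lerDl.
  rewrite /bspline /C1 mulr_suml; apply: le_trans (ler_norm_sum _ _ _) _.
  apply: ler_sum => j _; rewrite normrM ler_wpM2l// tpow_max//.
  have /andP[h1 h2] := clj _ j (cl x).
  by rewrite ger0_norm ?exprn_ge0// lerXn2r// ?nnegrE.
rewrite (bspline_clip x) (bspline_clip y).
apply: (@le_trans _ _ (C2 * `|Num.min (Num.max x 0) k%:R - Num.min (Num.max y 0) k%:R|)); last first.
  apply: ler_pM => //; first by rewrite lerDr.
  have h1 (a b d : R) : `|Num.min a d - Num.min b d| <= `|a - b|.
    rewrite /Num.min; case: ifP => h; case: ifP => h'; rewrite ?lexx//.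
    - by rewrite !ler0_norm; lra.
    - by rewrite !ger0_norm; lra.
    - by rewrite subrr normr0.
  have h2 (a b d : R) : `|Num.max a d - Num.max b d| <= `|a - b|.
    rewrite /Num.max; case: ifP => h; case: ifP => h'; rewrite ?lexx//.
    - by rewrite subrr normr0.
    - by rewrite !ler0_norm; lra.
    - by rewrite !ger0_norm; lra.
  exact: le_trans (h1 _ _ _) (h2 _ _ _).
move: (Num.min (Num.max x 0) _) (Num.min (Num.max y 0) _) (cl x) (cl y) => {}x {}y x01 y01.
rewrite /bspline -sumrB /C2 -mulrA mulr_suml; apply: le_trans (ler_norm_sum _ _ _) _.
apply: ler_sum => j _; rewrite -mulrBr normrM ler_wpM2l// !tpow_max//.
have /andP[h1 h2] := clj _ j x01; have /andP[h3 h4] := clj _ j y01.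
set u := Num.max _ _ in h1 h2 *; set v := Num.max _ _ in h3 h4 *.
have uv : `|u - v| <= `|x - y|.
  rewrite /u /v /Num.max; case: ifP => h; case: ifP => h'.
  - by rewrite subrr normr0.
  - by rewrite !ler0_norm; lra.
  - by rewrite !ger0_norm; lra.
  - by rewrite (_ : x - j%:R - (y - j%:R) = x - y)//; ring.
have := @MVT_bound R (fun s => s ^+ k.-1) (fun s => k.-1%:R * s ^+ k.-2) v u (k.-1%:R * k%:R ^+ k.-2).
move=> /(_ _ _)/le_trans; apply; last by rewrite ler_wpM2l// mulr_ge0// exprn_ge0.
  by move=> s _; rewrite kE; exact: is_derive_exprS.
move=> s; rewrite in_itv /= ge_min le_max => /andP[/orP s1 /orP s2].
have s0 : 0 <= s by case: s1 => ?; lra.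
have sk : s <= k%:R by case: s2 => ?; lra.
by rewrite normrM normr_nat ler_wpM2l// ger0_norm ?exprn_ge0// lerXn2r// ?nnegrE.
Qed.

End truncated_powers.

Section tensor_splines.
Context {R : realType} {D : nat} (k m : nat).
Hypothesis k2 : (1 < k)%N.
Hypothesis m0 : (0 < m)%N.
Implicit Types (x : 'rV[R]_D).

Let m0R : 0 < m%:R :> R. Proof. by rewrite ltr0n. Qed.

Definition spline_index := {ffun 'I_D -> 'I_(m + k.-1)}.

Definition bspline_chain (i d : nat) (s : R) : R :=
  m%:R ^+ d * bspline_der k d (s * m%:R - i%:R + k.-1%:R).

Definition tensor_bspline (i : spline_index) x : R := \prod_j bspline_at k m (i j) (x 0 j).

Lemma is_derive_bspline_chain i d (s : R) : (d < k - 2)%N ->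
  is_derive s 1 (bspline_chain i d) (bspline_chain i d.+1 s).
Proof.
move=> dk.
have d1 : is_derive s 1 (fun s : R => s * m%:R - i%:R + k.-1%:R) m%:R.
  have h := is_deriveZ (m%:R : R) (is_derive_id s (1 : R)).
  have h2 := is_deriveD h (is_derive_cst (- i%:R + k.-1%:R : R) s (1 : R)).
  rewrite addr0 in h2; move: h2; rewrite -[_ *: 1]/(_ * 1) mulr1.
  by rewrite (_ : _ + _ = fun s : R => s * m%:R - i%:R + k.-1%:R)//; apply/funext => y;
    rewrite addrA; congr (_ + _ + _); rewrite mulrC.
have h := is_deriveZ (m%:R ^+ d) (is_derive1_comp (is_derive_bspline_der k2 _ dk) d1).
by move: h => /is_derive_eq; apply; rewrite -[LHS]/(_ * _) /bspline_chain exprS; ring.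
Qed.

Lemma continuous_bspline_chain i d : (d <= k - 2)%N -> continuous (bspline_chain i d).
Proof.
move=> dk s.
suff : {for s, continuous (fun s : R => m%:R ^+ d * bspline_der k d (s * m%:R - i%:R + k.-1%:R))} by [].
apply: continuousM; first exact: cst_continuous.
apply: continuous_comp; last exact: continuous_bspline_der.
apply: continuousD; last exact: cst_continuous.
apply: continuousB; last exact: cst_continuous.
by apply: continuousM; [exact: cvg_id|exact: cst_continuous].
Qed.

Lemma Ck_on_tensor_bspline (i : spline_index) U : Ck_on (k - 2) U (tensor_bspline i).
Proof.
apply: (Ck_on_sub (V := setT) _ (leqnn _)) => //.
have -> : tensor_bspline i = tensor (fun j => bspline_chain (i j)) (fun=> 0%N).
  apply/funext => x; apply: eq_bigr => j _.
  by rewrite /bspline_chain bspline_der0 expr0 mul1r.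
by apply: Ck_on_tensor => j d; [exact: is_derive_bspline_chain|exact: continuous_bspline_chain].
Qed.

Lemma bspline_at_piece (i q : nat) : (q < m)%N -> exists2 P : {poly R}, (size P <= k)%N &
  forall s, grid_point m q <= s <= grid_point m q.+1 -> bspline_at k m i s = P.[s].
Proof.
move=> qm.
have u01 (s : R) : grid_point m q <= s <= grid_point m q.+1 -> 0 <= s * m%:R - q%:R <= 1.
  rewrite /grid_point ler_pdivrMr// ler_pdivlMr// -natr1 => /andP[? ?].
  by apply/andP; split; lra.
have [iq|qi] := leqP i (q + k.-1); last first.
  exists 0; first by rewrite size_poly0.
  move=> s /u01/andP[u0 u1]; rewrite horner0 /bspline_at (bspline_neg k2)//.
  have : (q + k.-1).+1%:R <= i%:R :> R by rewrite ler_nat.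
  by rewrite -natr1 natrD; lra.
exists (bpoly k (q + k.-1 - i) \Po (m%:R *: 'X - q%:R%:P)).
  have sl : (size (m%:R *: 'X - q%:R%:P : {poly R})%R <= 2)%N.
    apply: (leq_trans (size_polyD _ _)); rewrite size_polyN geq_max.
    by rewrite (leq_trans (size_scale_leq _ _)) ?size_polyX// (leq_trans (size_polyC_leq1 _)).
  apply: (leq_trans (size_comp_poly_leq _ _)).
  by have := size_bpoly (R := R) k2 (q + k.-1 - i); move: sl; move: {+}(size _) => t;
    move: {+}(size _) => t'; nia.
move=> s /u01 u; rewrite horner_comp hornerD hornerN hornerZ hornerX hornerC.
rewrite mulrC -(bspline_local k2 _ u) /bspline_at; congr (bspline k _).
by rewrite natrB// natrD; ring.
Qed.

Lemma tensor_poly_prod (P : 'I_D -> {poly R}) : (forall j, (size (P j) <= k)%N) ->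
  exists c : {ffun 'I_D -> 'I_k} -> R, forall x, \prod_j (P j).[x 0 j] = tensor_poly c x.
Proof.
move=> sP; exists (fun al : {ffun 'I_D -> 'I_k} => \prod_j (P j)`_(al j)) => x.
under eq_bigr do rewrite (horner_coef_wide _ (sP _)).
by rewrite bigA_distr_bigA /=; apply: eq_bigr => al _; rewrite big_split.
Qed.

Lemma cell_grid (i : cell_index D m) x : cell i x -> Omega x /\
  forall j, grid_point m (i j) <= x 0 j <= grid_point m (i j).+1.
Proof.
by move=> [Ox Hx]; split => // j; have := Hx j; rewrite subr0 addr0.
Qed.

Lemma spline_tensor_bspline (i : spline_index) : spline k m (tensor_bspline i).
Proof.
split; first exact: Ck_on_tensor_bspline.
move=> q.
have /choice[P HP] : forall j, exists P : {poly R}, (size P <= k)%N /\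
  forall s, grid_point m (q j) <= s <= grid_point m (q j).+1 -> bspline_at k m (i j) s = P.[s].
  by move=> j; have [P P1 P2] := bspline_at_piece (i j) (ltn_ord (q j)); exists P.
have [c Hc] := tensor_poly_prod (fun j => (HP j).1).
exists c => x; rewrite inE => /cell_grid[_ xq]; rewrite -Hc.
by apply: eq_bigr => j _; apply: (HP j).2.
Qed.

Lemma spline_lin (a : R) (u v : 'rV[R]_D -> R) : spline k m u -> spline k m v ->
  spline k m (fun x => a * u x + v x).
Proof.
move=> [cu pu] [cv pv]; split.
  apply: Ck_on_lin => //.
  have -> : @Omega R D = obox 0 (const_mx 1).
    by apply/seteqP; split => x H j; have := H j; rewrite !mxE.
  exact: open_obox.
move=> i; have [c Hc] := pu i; have [d Hd] := pv i.
exists (fun al => a * c al + d al) => x xi; rewrite Hc// Hd// /tensor_poly mulr_sumr -big_split /=.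
by apply: eq_bigr => al _; ring.
Qed.

Lemma spline_sum (c : spline_index -> R) :
  spline k m (fun x => \sum_i c i * tensor_bspline i x).
Proof.
have H (r : seq spline_index) : spline k m (fun x => \sum_(i <- r) c i * tensor_bspline i x).
  elim: r => [|i r IH].
    have i0 : spline_index by exact: [ffun=> Ordinal (ltn_addr k.-1 m0)].
    have := spline_lin (-1) (spline_tensor_bspline i0) (spline_tensor_bspline i0).
    by congr spline; apply/funext => x; rewrite big_nil mulN1r addNr.
  have := spline_lin (c i) (spline_tensor_bspline i) IH.
  by congr spline; apply/funext => x; rewrite big_cons.
exact: H.
Qed.

Lemma Omega_upd x j (s : R) : Omega x -> 0 < s < 1 -> Omega (upd x j s).
Proof. by move=> Ox s01 i; rewrite mxE; case: eqP. Qed.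

Lemma cell_exists x : Omega x -> exists i : cell_index D m, cell i x.
Proof.
move=> Ox; have /choice[q Hq] : forall j, exists q : 'I_m, grid_point m q <= x 0 j <= grid_point m q.+1.
  by move=> j; have [q qm H] := cell_coordinate m0 (Ox j); exists (Ordinal qm).
by exists [ffun j => q j]; split => // j; rewrite ffunE subr0 addr0; exact: Hq.
Qed.

Lemma line_of_tensor_poly k' (c : {ffun 'I_D -> 'I_k'} -> R) x j : exists2 P : {poly R},
  (size P <= k')%N & forall s, tensor_poly c (upd x j s) = P.[s].
Proof.
exists (\sum_al (c al * \prod_(l | l != j) x 0 l ^+ al l) *: 'X ^+ al j).
  apply: (leq_trans (size_sum _ _ _)); apply/bigmax_leqP => al _.
  by apply: (leq_trans (size_scale_leq _ _)); rewrite size_polyXn.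
move=> s; rewrite horner_sum; apply: eq_bigr => al _.
rewrite hornerZ hornerXn (bigD1 j)//= upd_eq -mulrA [X in _ * X]mulrC; congr (_ * (_ * _)).
by apply: eq_bigr => l lj; rewrite upd_neq.
Qed.

(** The line runs through the cells that share all other indices with one fixed cell containing [x].
    The repeated partial derivatives in direction [j] are the chain that [smooth_jump] asks for. *)
Lemma line_spline_of_spline F x j : spline k m F -> Omega x ->
  line_spline k m (fun s => F (upd x j s)).
Proof.
move=> [cF pF] Ox; have [i0 Hi0] := cell_exists Ox.
have [_ gi0] := cell_grid Hi0.
have /choice[P HP] : forall q : nat, exists P : {poly R}, (q < m)%N -> (size P <= k)%N /\
   forall s, grid_point m q <= s <= grid_point m q.+1 -> 0 < s < 1 -> F (upd x j s) = P.[s].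
  move=> q; case: (ltnP q m) => qm; last by exists 0.
  have [c Hc] := pF [ffun l => if l == j then Ordinal qm else i0 l].
  have [P sP HP] := line_of_tensor_poly c x j; exists P => _; split => // s sq s01.
  rewrite -HP; apply: Hc; rewrite inE; split; first exact: Omega_upd.
  by move=> l; rewrite ffunE mxE subr0 addr0; case: eqP => _ //; exact: gi0.
exists P; split => [q /HP[]//|q s /HP[_ H]|q qm]; first exact: H.
have qm' := ltnW qm; have [sP hP] := HP _ qm'; have [sQ hQ] := HP _ qm.
have gp (q1 q2 : nat) : (q1 < q2)%N -> grid_point m q1 < grid_point m q2 :> R.
  by move=> q12; rewrite ltr_pM2r ?invr_gt0// ltr_nat.
have g0 q' : 0 <= grid_point m q' :> R by rewrite divr_ge0.
have g1 q' : (q' <= m)%N -> grid_point m q' <= 1 :> R.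
  by move=> q'm; rewrite ler_pdivrMr// mul1r ler_nat.
have in01 (s : R) : grid_point m q < s < grid_point m q.+2 -> 0 < s < 1.
  move=> /andP[h1 h2]; rewrite (le_lt_trans (g0 q))//=; exact: lt_le_trans (g1 _ qm).
have mid1 := gp q q.+1 (ltnSn _); have mid2 := gp q.+1 q.+2 (ltnSn _).
have mid := introT andP (conj mid1 mid2).
apply: (smooth_jump (f := fun i s => partials (nseq i j) F (upd x j s)) k2 mid sP sQ).
- move=> i s ik /in01 s01.
  apply: (@derivable_line _ _ _ (partials (nseq i j) F)).
  by apply: (proj2 (cF _)); [rewrite size_nseq|exact: Omega_upd].
- move=> i ik; have Ou : Omega (upd x j (grid_point m q.+1)) by apply: Omega_upd => //; exact: in01.
  apply: continuous_comp; first exact: continuous_upd.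
  by apply: (proj1 (cF _)) => //; rewrite size_nseq.
- move=> s /andP[h1 h2]; apply: hP; first by rewrite !ltW.
  by apply: in01; rewrite h1 (lt_trans h2).
- move=> s /andP[h1 h2]; apply: hQ; first by rewrite !ltW.
  by apply: in01; rewrite h2 (lt_trans _ h1).
Qed.

End tensor_splines.

(** * Quasi-interpolation *)

Lemma card_near (R : realType) (N K : nat) (s : R) :
  (#|[pred i : 'I_N | (`|i%:R - s| <= K%:R)%R]| <= (2 * K).+1)%N.
Proof.
set P := [pred i : 'I_N | _].
pose t := Num.truncn (Num.max (s - K%:R) 0).
rewrite cardE -(size_map val) -(size_iota t (2 * K).+1).
apply: uniq_leq_size; first by rewrite map_inj_uniq ?enum_uniq//; exact: val_inj.
move=> _ /mapP[i iP ->]; rewrite mem_enum inE /= ler_norml in iP.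
have /andP[h1 h2] := iP.
have m0 : 0 <= Num.max (s - K%:R) 0 by rewrite le_max lexx orbT.
have /andP[t1 t2] := truncn_itv m0; rewrite -/t in t1 t2.
rewrite mem_iota -(ltr_nat R) -(ler_nat R); apply/andP; split.
  apply: (le_trans t1); rewrite ge_max ler0n andbT; lra.
have mK : s - K%:R <= Num.max (s - K%:R) 0 by rewrite le_max lexx.
have -> : (t + (2 * K).+1)%:R = t.+1%:R + K%:R + K%:R :> R by rewrite -!natrD; congr _%:R; lia.
rewrite -[X in X%:R < _]/(i : nat); lra.
Qed.

(** Locality in grid units: [s] is a point scaled by the grid, and the index may belong to a cell or
    to a B-spline, so that one counting lemma serves both. *)
Definition near_index (R : realType) (D : nat) (K : nat) (s : 'I_D -> R) (N : 'I_D -> nat) : bool :=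
  [forall j, `|(N j)%:R - s j| <= K%:R].

Lemma card_near_index (R : realType) (D N K : nat) (s : 'I_D -> R) :
  (#|[pred i : {ffun 'I_D -> 'I_N} | near_index K s (fun j => i j)]| <= (2 * K).+1 ^ D)%N.
Proof.
have -> : #|[pred i : {ffun 'I_D -> 'I_N} | near_index K s (fun j => i j)]| =
   #|(family (fun j => [pred i : 'I_N | (`|i%:R - s j| <= K%:R)%R]) : simpl_pred {ffun 'I_D -> 'I_N})|.
  by apply: eq_card => i; rewrite !inE.
rewrite card_family; have -> : ((2 * K).+1 ^ D = \prod_(j < D) (2 * K).+1)%N by rewrite prod_nat_const card_ord.
rewrite foldrE big_image /=; apply: leq_prod => j _; exact: card_near.
Qed.

Lemma sum_near_le (R : realType) (I : finType) (P : pred I) (K : nat) (F : I -> R) (B : R) :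
  (#|P| <= K)%N -> 0 <= B -> (forall i, P i -> F i <= B) -> \sum_(i | P i) F i <= K%:R * B.
Proof.
move=> PK B0 H; apply: (@le_trans _ _ (\sum_(i | P i) B)); first exact: ler_sum.
by rewrite sumr_const -[leLHS]mulr_natl ler_wpM2r// ler_nat.
Qed.

Lemma prod_lipschitz (R : realType) (I : Type) (r : seq I) (u v : I -> R) (C e : R) :
  1 <= C -> 0 <= e -> (forall i, `|u i| <= C) -> (forall i, `|v i| <= C) ->
  (forall i, `|u i - v i| <= e) ->
  `|\prod_(i <- r) u i - \prod_(i <- r) v i| <= (size r)%:R * C ^+ size r * e.
Proof.
move=> C1 e0 uC vC uv; have C0 : 0 <= C by exact: le_trans C1.
elim: r => [|i r IH]; first by rewrite !big_nil subrr normr0 !mul0r.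
rewrite !big_cons /= (_ : _ - _ = (u i - v i) * \prod_(i <- r) u i + v i * (\prod_(i <- r) u i - \prod_(i <- r) v i)); last by ring.
apply: le_trans (ler_normD _ _) _; rewrite !normrM -natr1 exprS.
have pC : `|\prod_(i <- r) u i| <= C ^+ size r.
  elim: {IH} r => [|l r IH]; first by rewrite big_nil normr1.
  by rewrite big_cons normrM exprS ler_pM.
have h1 : `|u i - v i| * `|\prod_(i <- r) u i| <= e * C ^+ size r by rewrite ler_pM.
have h2 : e * C ^+ size r <= C * (e * C ^+ size r) by rewrite ler_peMl// mulr_ge0// exprn_ge0.
have h3 : `|v i| * `|\prod_(i <- r) u i - \prod_(i <- r) v i| <= C * ((size r)%:R * C ^+ size r * e) by rewrite ler_pM.
by apply: (le_trans (lerD (le_trans h1 h2) h3)); rewrite le_eqVlt; apply/orP; left; apply/eqP; ring.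
Qed.

Section reproduction.
Context {R : realType} {D : nat} (k : nat).
Hypothesis k2 : (1 < k)%N.
Variables (xi : 'I_k -> R) (om : 'I_k -> 'I_k -> R).
Hypothesis xi01 : forall a, 0 < xi a < 1.
Hypothesis dual : forall p : {poly R}, (size p <= k)%N ->
    p = \sum_(r < k) (\sum_(a < k) om r a * p.[xi a]) *: @bpoly R k r.
Implicit Types (x y : 'rV[R]_D).

Definition mnode m (i : spline_index k m) (a : {ffun 'I_D -> 'I_k}) : 'rV[R]_D :=
  \row_j node xi (i j, a j).

Definition mcoef m (i : spline_index k m) (G : 'rV[R]_D -> R) : R :=
  \sum_(a : {ffun 'I_D -> 'I_k}) (\prod_j node_weight om (i j, a j)) * G (mnode i a).

Lemma mnode_in m (i : spline_index k m) a : (0 < m)%N -> Omega (mnode i a).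
Proof. by move=> m0 j; rewrite mxE; exact: (node01 k2). Qed.

(** The spline property is needed only along coordinate lines, so the formula applies alike to
    splines and to polynomials of coordinate degree below [k]. *)
Lemma tensor_reproduction m (G : 'rV[R]_D -> R) : (0 < m)%N ->
  (forall x j, Omega x -> line_spline k m (fun s => G (upd x j s))) ->
  forall x, Omega x -> G x = \sum_(i : spline_index k m) mcoef i G * tensor_bspline i x.
Proof.
move=> m0 HG x Ox.
have H x' j : (forall i, [set s : R | 0 < s < 1] (x' 0 i)) ->
    G x' = \sum_e (node_weight om e * bspline_at k m e.1 (x' 0 j)) * G (upd x' j (node (m := m) xi e)).
  move=> Ox'; have := line_reproduction k2 m0 xi01 dual (HG x' j Ox') (Ox' j).
  by rewrite upd_id.
rewrite (tensor_expansion (beta := fun e s => node_weight om e * bspline_at k m e.1 s) (nu := node (m := m) xi) (A := [set s : R | 0 < s < 1]) _ H) //; last first.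
  by move=> e; exact: (node01 k2).
pose h (p : spline_index k m * {ffun 'I_D -> 'I_k}) : {ffun 'I_D -> 'I_(m + k.-1) * 'I_k} :=
  [ffun j => (p.1 j, p.2 j)].
rewrite (reindex h) /=; last first.
  exists (fun e : {ffun 'I_D -> 'I_(m + k.-1) * 'I_k} => ([ffun j => (e j).1], [ffun j => (e j).2])).
    by move=> [i a] _; congr pair; apply/ffunP => j; rewrite !ffunE.
  by move=> e _; apply/ffunP => j; rewrite !ffunE; case: (e j).
rewrite -(pair_big predT predT (fun i a => (\prod_j (node_weight om (h (i, a) j) *
   bspline_at k m (h (i, a) j).1 (x 0 j))) * G (\row_j node xi (h (i, a) j)))) /=.
apply: eq_bigr => i _; rewrite /mcoef mulr_suml; apply: eq_bigr => a _.
rewrite big_split /= mulrAC; congr (_ * _ * _).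
- by apply: eq_bigr => j _; rewrite ffunE.
- by congr G; apply/rowP => j; rewrite !mxE ffunE.
- by apply: eq_bigr => j _; rewrite ffunE.
Qed.

(** Inside the base cell of [i], the B-spline [i'] is either a piece [bpoly r'] or zero, and the
    functional reads off the coordinate [r] of that piece. This is what makes B-spline coefficients
    recoverable from point values, hence stable. *)
Lemma node_dual m (i i' : 'I_(m + k.-1)) : (0 < m)%N ->
  \sum_(a < k) node_weight om (i, a) * bspline_at k m i' (node xi (i, a)) = (i == i')%:R.
Proof.
move=> m0; rewrite /node_weight /=; set b := base_cell m i; set r := (k.-1 - (i - b))%N.
have bm := base_cell_lt k2 m0 i; rewrite -/b in bm.
have m0R : m%:R != 0 :> R by rewrite pnatr_eq0 -lt0n.
have bi : (b <= i)%N by rewrite /b /base_cell; lia.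
have ib : (i <= b + k.-1)%N by have := ltn_ord i; rewrite /b /base_cell; lia.
have argE a : node (m := m) xi (i, a) * m%:R - i'%:R + k.-1%:R = xi a + b%:R + k.-1%:R - i'%:R.
  by rewrite /node /= -/b divfK//; ring.
have [bi'|bi'] := boolP ((b <= i') && (i' <= b + k.-1))%N.
  have /andP[h1 h2] := bi'; set r' := (b + k.-1 - i')%N.
  transitivity (bcoord xi om r (bpoly k r')).
    rewrite bcoord_weight; apply: eq_bigr => a _; congr (_ * _).
    have /andP[x0 x1] := xi01 a.
    rewrite /bspline_at argE -(bspline_local k2 r') ?ltW//; congr (bspline k _).
    by rewrite natrB// natrD; ring.
  have rk : (r < k)%N by rewrite /r; lia.
  have rk' : (r' < k)%N by rewrite /r'; lia.
  rewrite (bcoord_unique k2 dual (c := fun s => (s == r')%:R))//.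
    have -> : (r == r') = (i == i'); last by [].
    apply/eqP/eqP => [rr|ii']; last by rewrite /r /r' -ii'; lia.
    by apply/val_inj; move: rr; rewrite /r /r' /=; lia.
  rewrite (bigD1 (Ordinal rk')) //= eqxx scale1r big1 ?addr0// => s.
  by rewrite -val_eqE /= => /negbTE ->; rewrite scale0r.
have -> : (i == i') = false.
  by apply/negbTE; apply: contra bi' => /eqP <-; rewrite bi ib.
rewrite big1// => a _; have /andP[x0 x1] := xi01 a.
rewrite /bspline_at argE; move: bi'; rewrite negb_and -!ltnNge => /orP[h|h].
  rewrite (bspline_big k2) ?mulr0//.
  have : i'.+1%:R <= b%:R :> R by rewrite ler_nat.
  have -> : k%:R = k.-1%:R + 1 :> R by rewrite natr1 prednK//; lia.
  by rewrite -natr1; lra.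
rewrite (bspline_neg k2) ?mulr0//.
have : (b + k.-1).+1%:R <= i'%:R :> R by rewrite ler_nat.
by rewrite -natr1 natrD; lra.
Qed.

Lemma mcoef_bspline m (i i' : spline_index k m) : (0 < m)%N ->
  mcoef i (tensor_bspline i') = (i == i')%:R.
Proof.
move=> m0; rewrite /mcoef /tensor_bspline.
under eq_bigr do rewrite -big_split /=.
transitivity (\prod_j \sum_(a < k) node_weight om (i j, a) * bspline_at k m (i' j) (node xi (i j, a))).
  rewrite bigA_distr_bigA /=; apply: eq_bigr => a _; apply: eq_bigr => j _.
  by rewrite mxE.
under eq_bigr do rewrite node_dual//.
have [->|ii'] := eqVneq i i'; first by rewrite big1// => j _; rewrite eqxx.
have /existsP[j ij] : [exists j, i j != i' j].
  by rewrite -negb_forall; apply: contra ii' => /forallP H; apply/eqP/ffunP => j; apply/eqP.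
by rewrite (bigD1 j)//= (negbTE ij) mul0r.
Qed.

Lemma mcoef_sum m (c : spline_index k m -> R) i : (0 < m)%N ->
  mcoef i (fun x => \sum_i' c i' * tensor_bspline i' x) = c i.
Proof.
move=> m0; transitivity (\sum_i' c i' * mcoef i (tensor_bspline i')).
  rewrite /mcoef; under eq_bigr do rewrite mulr_sumr.
  rewrite exchange_big /=; apply: eq_bigr => i' _; rewrite mulr_sumr; apply: eq_bigr => a _.
  by rewrite mulrCA.
rewrite (bigD1 i)//= mcoef_bspline// eqxx mulr1 big1 ?addr0// => i' ii'.
by rewrite mcoef_bspline// eq_sym (negbTE ii') mulr0.
Qed.

Lemma mcoef_bound : exists2 C : R, 0 <= C & forall m (i : spline_index k m) G,
  `|mcoef i G| <= C * \sum_a `|G (mnode i a)|.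
Proof.
pose W := \sum_(r < k) \sum_(a < k) `|om r a|.
have W0 : 0 <= W by apply: sumr_ge0 => r _; exact: sumr_ge0.
have HW r a : `|dual_weight om r a| <= W.
  rewrite /dual_weight; case: insubP => [r' _ _|_]; last by rewrite normr0.
  rewrite /W (bigD1 r')//= (bigD1 a)//= -addrA lerDl addr_ge0//; first exact: sumr_ge0.
  by apply: sumr_ge0 => ? _; exact: sumr_ge0.
exists (W ^+ D) => [|m i G]; first exact: exprn_ge0.
rewrite /mcoef mulr_sumr; apply: le_trans (ler_norm_sum _ _ _) _.
apply: ler_sum => a _; rewrite normrM ler_wpM2r// normr_prod.
have -> : W ^+ D = \prod_(j < D) W by rewrite prodr_const card_ord.
by apply: ler_prod => j _; rewrite normr_ge0 /=; exact: HW.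
Qed.

Lemma tensor_bspline_bound : exists2 C : R, 0 <= C & forall m (i : spline_index k m) x y,
  `|tensor_bspline i x| <= C /\
  `|tensor_bspline i x - tensor_bspline i y| <= C * m%:R * `|x - y|.
Proof.
have [C0 C00 HC0] := bspline_lipschitz (R := R) k2.
pose C := C0 + 1; have C1 : 1 <= C by rewrite lerDr.
have CC : C0 <= C by rewrite lerDl.
have C0' : 0 <= C by exact: le_trans C1.
exists (C ^+ D + D%:R * C ^+ D * C) => [|m i x y]; first by rewrite addr_ge0 ?mulr_ge0 ?exprn_ge0.
have b s j : `|bspline_at k m (i j) s| <= C by apply: le_trans CC; exact: (HC0 _ 0).1.
split.
  apply: (@le_trans _ _ (C ^+ D)); last by rewrite lerDl ?mulr_ge0 ?exprn_ge0.
  rewrite /tensor_bspline normr_prod.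
  have -> : C ^+ D = \prod_(j < D) C by rewrite prodr_const card_ord.
  by apply: ler_prod => j _; rewrite normr_ge0 /=.
have l j : `|bspline_at k m (i j) (x 0 j) - bspline_at k m (i j) (y 0 j)| <= C * m%:R * `|x - y|.
  apply: le_trans (HC0 _ _).2 _; rewrite -mulrA; apply: ler_pM => //.
  rewrite (_ : _ - _ = m%:R * (x 0 j - y 0 j)); last by ring.
  rewrite normrM normr_nat ler_wpM2l//.
  by have := coord_le_norm (x - y) j; rewrite !mxE.
have e0 : 0 <= C * m%:R * `|x - y| by rewrite !mulr_ge0.
have := prod_lipschitz (index_enum 'I_D) C1 e0 (fun j => b (x 0 j) j) (fun j => b (y 0 j) j) l.
have -> : size (index_enum 'I_D) = D by rewrite /index_enum -enumT size_enum_ord.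
move=> /le_trans; apply; rewrite [leRHS](_ : _ = C ^+ D * (m%:R * `|x - y|) + D%:R * C ^+ D * (C * m%:R * `|x - y|)); last by ring.
by rewrite lerDr mulr_ge0 ?exprn_ge0// mulr_ge0.
Qed.

Lemma tensor_bspline_support m (i : spline_index k m) x :
  tensor_bspline i x != 0 -> near_index k (fun j => m%:R * x 0 j) (fun j => i j).
Proof.
move=> H; apply/forallP => j; apply: contraNT H => H.
rewrite /tensor_bspline (bigD1 j)//= /bspline_at.
have kE : k%:R = k.-1%:R + 1 :> R by rewrite natr1 prednK//; lia.
move: H; rewrite -ltNge ltr_normr => /orP[h|h].
  rewrite (bspline_neg k2) ?mul0r//; move: h; rewrite kE; lra.
rewrite (bspline_big k2) ?mul0r//; move: h; rewrite kE.
have : 0 <= k.-1%:R :> R by []; lra.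
Qed.

End reproduction.

(** * Decay of the inverse Gram matrix *)

Lemma sum_sqr_le (R : realType) (I : finType) (P : pred I) (t : I -> R) (K : nat) :
  (#|P| <= K)%N -> (\sum_(i | P i) t i) ^+ 2 <= K%:R * \sum_(i | P i) t i ^+ 2.
Proof.
move=> PK; set S := \sum_(i | P i) t i ^+ 2.
have S0 : 0 <= S by apply: sumr_ge0 => i _; exact: sqr_ge0.
apply: (@le_trans _ _ (#|P|%:R * S)); last by rewrite ler_wpM2r// ler_nat.
rewrite expr2 big_distrlr /=.
apply: (@le_trans _ _ (\sum_(i | P i) \sum_(j | P j) (t i ^+ 2 + t j ^+ 2) / 2)).
  apply: ler_sum => i _; apply: ler_sum => j _; have := sqr_ge0 (t i - t j).
  by rewrite sqrrB; lra.
under eq_bigr do rewrite -mulr_suml big_split /= sumr_const.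
rewrite -mulr_suml big_split /= sumrMnl -/S sumr_const -mulr2n -[_ *+ 2]mulr_natr.
by rewrite mulfK ?pnatr_eq0// mulr_natl.
Qed.

Section gram.
Context {R : realType} (I : finType) (G : I -> I -> R) (kappa K : R).
Hypothesis kappa0 : 0 < kappa.
Hypothesis coercive : forall c : I -> R,
  kappa * \sum_i c i ^+ 2 <= \sum_i \sum_j c i * G i j * c j.
Hypothesis symG : forall i j, G i j = G j i.

(** Coercivity makes the matrix injective and, being square, invertible. *)
Lemma gram_solve (F : I -> R) : exists c : I -> R, forall i, \sum_j G i j * c j = F i.
Proof.
pose M : 'M[R]_#|I| := \matrix_(i, j) G (enum_val i) (enum_val j).
have Mu : M \in unitmx.
  rewrite -row_free_unit -kermx_eq0; apply/eqP/row_matrixP => i; rewrite row0.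
  set v := row i _; have vM : v *m M = 0 by rewrite /v -row_mul mulmx_ker row0.
  pose c (x : I) := v 0 (enum_rank x).
  have := coercive c.
  have -> : \sum_x \sum_y c x * G x y * c y = 0.
    rewrite exchange_big /= big1// => y _; rewrite -mulr_suml.
    have := congr1 (fun w : 'rV_#|I| => w 0 (enum_rank y)) vM; rewrite !mxE => E.
    rewrite (_ : \sum_x _ = 0) ?mul0r// -[RHS]E (reindex (@enum_val I I)) /=.
      by apply: eq_bigr => j _; rewrite /c enum_valK [M _ _]mxE enum_rankK.
    by exists enum_rank => x _; [exact: enum_valK|exact: enum_rankK].
  have S0 : 0 <= \sum_x c x ^+ 2 by apply: sumr_ge0 => x _; exact: sqr_ge0.
  rewrite pmulr_rle0// => S0'.
  have /eqP : \sum_x c x ^+ 2 = 0 by apply/eqP; rewrite eq_le S0 S0'.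
  rewrite psumr_eq0; last by move=> x _; exact: sqr_ge0.
  move=> /allP H; apply/rowP => j; rewrite [RHS]mxE.
  have := H (enum_val j) (mem_index_enum _); rewrite sqrf_eq0 /c enum_valK => /eqP //.
pose Fv : 'cV[R]_#|I| := \col_i F (enum_val i).
exists (fun x => (invmx M *m Fv) (enum_rank x) 0) => x.
have := congr1 (fun w : 'cV_#|I| => w (enum_rank x) 0) (mulKVmx Mu Fv).
rewrite !mxE enum_rankK => <-; rewrite (reindex (@enum_val I I)) /=.
  by apply: eq_bigr => j _; rewrite [M _ _]mxE enum_rankK enum_valK.
by exists enum_rank => y _; [exact: enum_valK|exact: enum_rankK].
Qed.

Hypothesis rowG : forall i, \sum_j `|G i j| <= K.

(* For weights [theta] that vary slowly along the band of [G], conjugation by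
   [theta] is a small perturbation of [G], so it remains coercive. *)
Lemma gram_decay (eta : R) (theta : I -> R) (c F : I -> R) :
  (forall i, 0 < theta i) -> 0 <= eta -> eta * K <= kappa / 2 ->
  (forall i j, G i j != 0 -> `|theta i / theta j - 1| <= eta) ->
  (forall i, \sum_j G i j * c j = F i) ->
  \sum_i (theta i * c i) ^+ 2 <= (2 / kappa) ^+ 2 * \sum_i (theta i * F i) ^+ 2.
Proof.
move=> th0 eta0 etaK thG cF.
pose d i := theta i * c i; pose f i := theta i * F i.
pose S := \sum_i d i ^+ 2; pose Sf := \sum_i f i ^+ 2.
rewrite -/S -/Sf.
have E1 : \sum_i d i * f i = \sum_i \sum_j d i * G i j * d j +
    \sum_i \sum_j d i * G i j * d j * (theta i / theta j - 1).
  rewrite -big_split /=; apply: eq_bigr => i _; rewrite -big_split /= /f -cF !mulr_sumr.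
  apply: eq_bigr => j _; rewrite /d; have := lt0r_neq0 (th0 j) => tj; by field.
have E2 : `|\sum_i \sum_j d i * G i j * d j * (theta i / theta j - 1)| <= eta * (K * S).
  have H : \sum_i \sum_j `|G i j| * (d i ^+ 2 + d j ^+ 2) / 2 <= K * S.
    have -> : \sum_i \sum_j `|G i j| * (d i ^+ 2 + d j ^+ 2) / 2 =
        (\sum_i \sum_j `|G i j| * d i ^+ 2 + \sum_i \sum_j `|G i j| * d j ^+ 2) / 2.
      rewrite mulrDl !mulr_suml -big_split /=; apply: eq_bigr => i _.
      by rewrite !mulr_suml -big_split /=; apply: eq_bigr => j _; ring.
    rewrite [X in (_ + X)]exchange_big /=.
    have -> : \sum_j \sum_i `|G i j| * d j ^+ 2 = \sum_i \sum_j `|G i j| * d i ^+ 2.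
      by apply: eq_bigr => i _; apply: eq_bigr => j _; rewrite symG.
    rewrite -mulr2n -[_ *+ 2]mulr_natr mulfK ?pnatr_eq0// /S mulr_sumr.
    by apply: ler_sum => i _; rewrite -mulr_suml ler_wpM2r ?sqr_ge0.
  apply: le_trans (ler_wpM2l eta0 H); rewrite mulr_sumr.
  apply: le_trans (ler_norm_sum _ _ _) _; apply: ler_sum => i _.
  rewrite mulr_sumr; apply: le_trans (ler_norm_sum _ _ _) _; apply: ler_sum => j _.
  have [->|Gij] := eqVneq (G i j) 0; first by rewrite mulr0 !mul0r normr0 !mul0r mulr0.
  have := thG i j Gij; set w := _ - 1 => wE.
  rewrite (_ : d i * G i j * d j * w = w * (G i j * (d i * d j))); last by ring.
  rewrite normrM; apply: ler_pM => //; rewrite normrM -mulrA ler_wpM2l//.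
  have := sqr_ge0 (d i - d j); have := sqr_ge0 (d i + d j).
  by rewrite sqrrB sqrrD ler_norml => *; apply/andP; split; lra.
(* Young's inequality, weighted so that after the perturbation [kappa / 2 * S] a quarter of the
   coercivity is left. *)
have E3 : \sum_i d i * f i <= kappa / 4 * S + kappa^-1 * Sf.
  rewrite /S /Sf !mulr_sumr -big_split /=; apply: ler_sum => i _.
  have : 0 <= (kappa / 2 * d i - f i) ^+ 2 / kappa by rewrite divr_ge0 ?sqr_ge0// ltW.
  rewrite (_ : _ / kappa = kappa / 4 * d i ^+ 2 + kappa^-1 * f i ^+ 2 - d i * f i); first by rewrite subr_ge0.
  by field; rewrite gt_eqF.
have E4 := coercive d; rewrite -/S in E4.
have S0 : 0 <= S by apply: sumr_ge0 => i _; exact: sqr_ge0.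
have E5 : eta * (K * S) <= kappa / 2 * S by rewrite mulrA ler_wpM2r.
have E6 : kappa / 4 * S <= kappa^-1 * Sf.
  move: E2; rewrite ler_norml => /andP[E2 _]; move: E3; rewrite E1; lra.
have -> : (2 / kappa) ^+ 2 * Sf = (4 / kappa) * (kappa^-1 * Sf) by field; rewrite gt_eqF.
have -> : S = (4 / kappa) * (kappa / 4 * S) by field; rewrite gt_eqF.
by rewrite ler_wpM2l// divr_ge0// ltW.
Qed.

End gram.

Definition ndist (i j : nat) : nat := (i - j + (j - i))%N.

Section decay_weights.
Context {R : realType} {D N : nat}.
Implicit Types (i j : {ffun 'I_D -> 'I_N}) (la : R).

(** A product weight, so that sums over the index grid factor into geometric series. *)
Definition decay la i j : R := \prod_l la ^+ ndist (i l) (j l).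

Lemma geometric_le la (M : nat) : 0 <= la < 1 -> \sum_(0 <= i < M) la ^+ i <= (1 - la)^-1.
Proof.
move=> /andP[l0 l1]; have d0 : 0 < 1 - la by rewrite subr_gt0.
rewrite -[leRHS]mul1r ler_pdivlMr// mulr_suml.
have -> : \sum_(0 <= i < M) la ^+ i * (1 - la) = 1 - la ^+ M.
  elim: M => [|M IH]; first by rewrite big_nil expr0 subrr.
  by rewrite big_nat_recr//= IH exprSr; ring.
by rewrite gerBl exprn_ge0.
Qed.

Lemma decay1_sum la (t : nat) : 0 <= la < 1 ->
  \sum_(i < N) la ^+ ndist i t <= 2 / (1 - la).
Proof.
move=> la01; have /andP[l0 l1] := la01.
rewrite -(big_mkord predT (fun i : nat => la ^+ ndist i t)).
apply: (@le_trans _ _ (\sum_(0 <= i < t.+1 + N) la ^+ ndist i t)).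
  rewrite [leRHS](@big_cat_nat _ _ _ N)//=; last by rewrite leq_addl.
  by rewrite lerDl; apply: sumr_ge0 => i _; rewrite exprn_ge0.
rewrite (@big_cat_nat _ _ _ t.+1)//=; last by rewrite leq_addr.
rewrite mulrDl mul1r; apply: lerD.
  rewrite big_nat_rev /= big_nat; apply: le_trans (geometric_le t.+1 la01).
  rewrite [leRHS]big_nat; apply: ler_sum => i /andP[_ it].
  by rewrite (_ : ndist _ _ = i)//; rewrite /ndist; lia.
rewrite big_nat_shift; apply: le_trans (geometric_le N la01).
apply: ler_sum => i _; rewrite (_ : ndist _ _ = i.+1); last by rewrite /ndist; lia.
by rewrite exprS ler_piMl ?exprn_ge0// ltW.
Qed.

Lemma decay_sum la j : 0 <= la < 1 -> \sum_i decay la i j <= (2 / (1 - la)) ^+ D.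
Proof.
move=> la01; have /andP[l0 l1] := la01.
rewrite /decay -(bigA_distr_bigA (fun l (t : 'I_N) => la ^+ ndist t (j l))) /=.
have -> : (2 / (1 - la)) ^+ D = \prod_(l < D) (2 / (1 - la)) by rewrite prodr_const card_ord.
apply: ler_prod => l _; rewrite decay1_sum// andbT.
by apply: sumr_ge0 => i _; rewrite exprn_ge0.
Qed.

Lemma decay_sym la i j : decay la i j = decay la j i.
Proof. by apply: eq_bigr => l _; congr (_ ^+ _); rewrite /ndist addnC. Qed.

Lemma decay_gt0 la i j : 0 < la -> 0 < decay la i j.
Proof. by move=> l0; apply: prodr_gt0 => l _; rewrite exprn_gt0. Qed.

Lemma decay_refl la i : decay la i i = 1.
Proof. by rewrite /decay big1// => l _; rewrite /ndist subnn. Qed.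

End decay_weights.

Lemma decay_ratio (R : realType) (D M : nat) (eta : R) : 0 < eta ->
  exists2 la : R, 0 < la < 1 & forall N (i j t : {ffun 'I_D -> 'I_N}), (forall l, (ndist (i l) (j l) <= M)%N) ->
    `|decay la i t / decay la j t - 1| <= eta.
Proof.
(* By Bernoulli's inequality this choice gives [(1 - e) ^+ (M * D) >= (1 + eta)^-1]; the successor
   guards against a zero denominator. *)
move=> eta0; pose e := (eta / (1 + eta)) / (M * D).+1%:R.
have n0 : 0 < (M * D).+1%:R :> R by rewrite ltr0n.
have e0 : 0 < e by rewrite !divr_gt0// addr_gt0.
have q1 : eta / (1 + eta) < 1 by rewrite ltr_pdivrMr ?addr_gt0//; lra.
have q0 : 0 < eta / (1 + eta) by rewrite divr_gt0 ?addr_gt0.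
have e1 : e < 1 by rewrite /e ltr_pdivrMr// mul1r (lt_le_trans q1)// ler1n.
pose la := 1 - e; have l0 : 0 < la by rewrite subr_gt0.
have l1 : la < 1 by rewrite gtrBl.
have bern (q : nat) : 1 - q%:R * e <= la ^+ q.
  elim: q => [|q IH]; first by rewrite mul0r subr0.
  rewrite exprS; apply: le_trans (ler_wpM2l (ltW l0) IH); rewrite /la -natr1.
  have : 0 <= q%:R * (e * e) by rewrite mulr_ge0// mulr_ge0// ltW.
  by lra.
exists la; first by rewrite l0.
have step N (i j t : {ffun 'I_D -> 'I_N}) : (forall l, (ndist (i l) (j l) <= M)%N) ->
    (1 - eta / (1 + eta)) * decay la j t <= decay la i t.
  move=> ijM; have h : la ^+ (M * D) * decay la j t <= decay la i t.
    have -> : la ^+ (M * D) = \prod_(l < D) la ^+ M by rewrite prodr_const card_ord exprM.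
    rewrite /decay -big_split /=; apply: ler_prod => l _.
    rewrite -exprD exprn_ge0 ?(ltW l0)//= ler_wiXn2l ?(ltW l0) ?(ltW l1)//.
    by have := ijM l; rewrite /ndist; lia.
  apply: le_trans h; rewrite ler_wpM2r ?(ltW (decay_gt0 _ _ l0))//.
  apply: le_trans (bern _); rewrite lerD2l lerN2.
  rewrite /e mulrCA ler_piMr ?(ltW q0)// ler_pdivrMr// mul1r ler_nat; lia.
move=> N i j t ijM; have ji l : (ndist (j l) (i l) <= M)%N by rewrite /ndist addnC; exact: ijM.
have h1 := step N i j t ijM; have h2 := step N j i t ji.
have dj := decay_gt0 j t l0; have di := decay_gt0 i t l0.
have ee : 1 - eta / (1 + eta) = (1 + eta)^-1 by field; rewrite gt_eqF// addr_gt0.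
rewrite ee in h1 h2; have p0 : 0 < 1 + eta by rewrite addr_gt0.
rewrite ler_norml lerBrDr lerBlDr ler_pdivlMr// ler_pdivrMr//; apply/andP; split; last first.
  by move: h2; rewrite mulrC ler_pdivrMr// => h2; rewrite [X in X * _]addrC mulrC.
apply: le_trans h1; rewrite ler_wpM2r ?(ltW dj)//.
rewrite -ee addrC lerD2l lerN2 ler_pdivrMr//; nra.
Qed.

Lemma ndist_le (R : realType) (i j K : nat) : `|i%:R - j%:R| <= K%:R :> R -> (ndist i j <= K)%N.
Proof.
rewrite ler_norml lerBrDr lerBlDr => /andP[h1 h2].
have : (i <= K + j)%N by rewrite -(ler_nat R) natrD.
have : (j <= i + K)%N by rewrite -(ler_nat R) natrD; lra.
by rewrite /ndist; lia.
Qed.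

Lemma sum_sqr_le_sqr (R : realType) (I : finType) (t : I -> R) : (forall i, 0 <= t i) ->
  \sum_i t i ^+ 2 <= (\sum_i t i) ^+ 2.
Proof.
move=> t0; rewrite expr2 big_distrlr /=; apply: ler_sum => i _.
by rewrite (bigD1 i)//= -expr2 lerDl; apply: sumr_ge0 => j _; rewrite mulr_ge0.
Qed.

(** * Discrete least squares *)

Lemma dual_nodes (R : realType) (k : nat) : (1 < k)%N ->
  exists xi : 'I_k -> R, exists om : 'I_k -> 'I_k -> R,
    (forall a, 0 < xi a < 1) /\
    forall p : {poly R}, (size p <= k)%N ->
      p = \sum_(r < k) (\sum_(a < k) om r a * p.[xi a]) *: @bpoly R k r.
Proof.
move=> k2; pose xi (a : 'I_k) : R := a.+1%:R / k.+1%:R.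
have k0 : 0 < k.+1%:R :> R by rewrite ltr0n.
have xi_inj : injective xi.
  move=> a b /(mulIf (invr_neq0 (lt0r_neq0 k0))) /eqP; rewrite eqr_nat eqSS.
  by move=> /eqP/val_inj.
have [om Hom] := dual_basis k2 xi_inj.
exists xi, om; split => // a; rewrite /xi divr_gt0//= ltr_pdivrMr// mul1r ltr_nat ltnS.
exact: ltn_ord.
Qed.

Section least_squares.
Context {R : realType} {D : nat} (k : nat).
Hypothesis k2 : (1 < k)%N.
Variables (xi : 'I_k -> R) (om : 'I_k -> 'I_k -> R).
Hypothesis xi01 : forall a, 0 < xi a < 1.
Hypothesis dual : forall p : {poly R}, (size p <= k)%N ->
    p = \sum_(r < k) (\sum_(a < k) om r a * p.[xi a]) *: @bpoly R k r.
Implicit Types (x y : 'rV[R]_D).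

Definition comb m (c : spline_index k m -> R) (x : 'rV[R]_D) : R :=
  \sum_i c i * tensor_bspline i x.

Lemma mnode_near m (i : spline_index (D := D) k m) a : (0 < m)%N ->
  near_index k (fun j => m%:R * mnode xi i a 0 j) (fun j => i j).
Proof.
move=> m0; apply/forallP => j; rewrite mxE /node /= mulrC divfK ?pnatr_eq0 -?lt0n//.
have bi : (base_cell m (i j) <= i j)%N by rewrite /base_cell; lia.
have ib : (i j <= base_cell m (i j) + k.-1)%N by have := ltn_ord (i j); rewrite /base_cell; lia.
have kE : k%:R = k.-1%:R + 1 :> R by rewrite natr1 prednK//; lia.
rewrite -(ler_nat R) in bi; rewrite -(ler_nat R) natrD in ib.
move: bi ib.
have /andP[x0 x1] := xi01 (a j).
by rewrite ler_norml kE => *; apply/andP; split; lra.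
Qed.

Definition neighbours m (i i' : spline_index (D := D) k m) : bool :=
  near_index (3 * k) (fun j => (i j)%:R : R) (fun j => i' j).

Lemma neighbours_sym m (i i' : spline_index k m) : neighbours i i' = neighbours i' i.
Proof. by apply: eq_forallb => j; rewrite distrC. Qed.

Lemma card_neighbours m (i : spline_index k m) :
  (#|neighbours i| <= (2 * (3 * k)).+1 ^ D)%N.
Proof.
apply: leq_trans (@card_near_index R D (m + k.-1) (3 * k) (fun j => (i j)%:R)).
by apply/eq_leq/eq_card => i'; rewrite !inE.
Qed.

(** The coefficients are functionals of the values at the nodes. Moving every node to a data point
    within [delta / m] perturbs those values by [delta] times neighbouring coefficients, a term that
    is absorbed once [delta] is small; each data point replaces only boundedly many nodes. *)
Lemma gram_coercive : exists2 delta : R, 0 < delta <= 1 & exists2 kappa : R, 0 < kappa &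
  forall m (Pt : finType) (y : Pt -> 'rV[R]_D), (0 < m)%N ->
  (forall z, Omega z -> exists al, `|y al - z| <= delta / m%:R) ->
  forall c : spline_index k m -> R,
    kappa * \sum_i c i ^+ 2 <= \sum_al comb c (y al) ^+ 2.
Proof.
have kk1 : 1 + k%:R <= (2 * k)%:R :> R by rewrite nat1r ler_nat; lia.
have kk2 : k%:R + k%:R <= (3 * k)%:R :> R by rewrite -natrD ler_nat; lia.
have kk3 : k%:R + (2 * k)%:R <= (3 * k)%:R :> R by rewrite -natrD ler_nat; lia.
have NbD : ((2 * (2 * k)).+1 ^ D <= (2 * (3 * k)).+1 ^ D)%N.
  by case: (posnP D) => [->|D0]; rewrite ?expn0// leq_exp2r//; lia.
have [Cw Cw0 HCw] := @mcoef_bound R D k xi om.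
have [Cb Cb0 HCb] := tensor_bspline_bound (R := R) (D := D) k2.
pose Na := (k ^ D)%N; pose Nb := ((2 * (3 * k)).+1 ^ D)%N.
pose A1 := 2 * Cw ^+ 2 * Na%:R * (Na%:R * Nb%:R).
pose A2 := 2 * Cw ^+ 2 * Na%:R ^+ 2 * Cb ^+ 2 * Nb%:R * Nb%:R.
have A10 : 0 <= A1 by rewrite !mulr_ge0 ?sqr_ge0.
have A20 : 0 <= A2 by rewrite !mulr_ge0 ?sqr_ge0.
(* [A2] collects the constants of the perturbation term; the choice gives [delta * A2 <= 1 / 2],
   hence [delta ^+ 2 * A2 <= 1 / 2]. *)
pose delta := (1 + 2 * A2)^-1.
have d1 : 0 < 1 + 2 * A2 by rewrite ltr_pwDl// mulr_ge0.
have d0 : 0 < delta by rewrite invr_gt0.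
have dle1 : delta <= 1 by rewrite invf_le1// lerDl mulr_ge0.
have dA : delta ^+ 2 * A2 <= 1 / 2.
  have h : delta * A2 <= 1 / 2 by rewrite /delta mulrC ler_pdivrMr//; lra.
  by apply: le_trans h; rewrite expr2 -mulrA ler_piMl// mulr_ge0// ltW.
exists delta; first by apply/andP; split.
exists (2 * (A1 + 1))^-1; first by rewrite invr_gt0 mulr_gt0// ltr_wpDl.
move=> m Pt y m0 dense c.
have m0R : 0 < m%:R :> R by rewrite ltr0n.
set v := comb c.
have /choice[al Hal] : forall p : spline_index k m * {ffun 'I_D -> 'I_k},
    exists al, `|y al - mnode xi p.1 p.2| <= delta / m%:R.
  by move=> p; apply: dense; exact: mnode_in.
have near_al i a : near_index (2 * k) (fun j => m%:R * y (al (i, a)) 0 j) (fun j => i j).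
  apply/forallP => j; have /forallP/(_ j) h1 := mnode_near i a m0.
  have h2 : `|m%:R * (mnode xi i a 0 j - y (al (i, a)) 0 j)| <= 1.
    rewrite normrM normr_nat mulrC -ler_pdivlMr//.
    have := Hal (i, a); rewrite distrC => h; have := coord_le_norm (mnode xi i a - y (al (i, a))) j.
    rewrite !mxE => /le_trans; apply; apply: le_trans h _.
    by rewrite ler_pM2r ?invr_gt0.
  rewrite (_ : _ - _ = ((i j)%:R - m%:R * mnode xi i a 0 j) + m%:R * (mnode xi i a 0 j - y (al (i, a)) 0 j)); last by ring.
  by apply: le_trans (ler_normD _ _) _; apply: le_trans kk1; rewrite addrC lerD.
(* Only B-splines near [i] see the node or its substitute, and their Lipschitz constant [Cb * m]
   cancels the [m] in the distance [delta / m]. *)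
have vdiff i a : `|v (mnode xi i a)| <= `|v (y (al (i, a)))| +
    Cb * delta * \sum_(i' | neighbours i i') `|c i'|.
  rewrite -[v (mnode xi i a)](subrK (v (y (al (i, a))))) addrC.
  apply: le_trans (ler_normD _ _) _; rewrite lerD2l /v /comb -sumrB mulr_sumr.
  rewrite (bigID (neighbours i)) /= [X in _ + X]big1 ?addr0; last first.
    move=> i' ni'; rewrite -mulrBr; apply/eqP; rewrite mulf_eq0; apply/orP; right.
    rewrite subr_eq0; have -> : tensor_bspline i' (mnode xi i a) = 0.
      apply/eqP; apply: contraNT ni' => /(tensor_bspline_support k2)/forallP h1.
      apply/forallP => j; have /forallP/(_ j) h2 := mnode_near i a m0.
      rewrite (_ : _ - _ = ((i' j)%:R - m%:R * mnode xi i a 0 j) - ((i j)%:R - m%:R * mnode xi i a 0 j)); last by ring.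
      by apply: le_trans (ler_normB _ _) _; apply: le_trans (lerD (h1 j) h2) _.
    rewrite eq_sym; apply: contraNT ni' => /(tensor_bspline_support k2)/forallP h1.
    apply/forallP => j; have /forallP/(_ j) h2 := near_al i a.
    rewrite (_ : _ - _ = ((i' j)%:R - m%:R * y (al (i, a)) 0 j) - ((i j)%:R - m%:R * y (al (i, a)) 0 j)); last by ring.
    by apply: le_trans (ler_normB _ _) _; apply: le_trans (lerD (h1 j) h2) _.
  apply: le_trans (ler_norm_sum _ _ _) _; apply: ler_sum => i' _.
  rewrite -mulrBr normrM mulrC ler_wpM2r//.
  apply: le_trans (HCb m i' _ (y (al (i, a)))).2 _.
  rewrite -mulrA ler_wpM2l// -ler_pdivlMl// mulrC distrC; exact: Hal (i, a).
have cbound i : c i ^+ 2 <= 2 * Cw ^+ 2 * Na%:R * \sum_a v (y (al (i, a))) ^+ 2 +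
     delta ^+ 2 * (2 * Cw ^+ 2 * Na%:R ^+ 2 * Cb ^+ 2 * Nb%:R) * \sum_(i' | neighbours i i') c i' ^+ 2.
  have ca : #|{ffun 'I_D -> 'I_k}| = Na by rewrite card_ffun !card_ord.
  have h0 : `|c i| <= Cw * \sum_a (`|v (y (al (i, a)))| + Cb * delta * \sum_(i' | neighbours i i') `|c i'|).
    rewrite -(mcoef_sum k2 xi01 dual c i m0); apply: le_trans (HCw m i _) _.
    rewrite ler_wpM2l//; apply: ler_sum => a _; exact: vdiff.
  set P := \sum_a `|v (y (al (i, a)))|; set Q := \sum_(i' | neighbours i i') `|c i'|.
  have h1 : `|c i| <= Cw * P + Cw * (Na%:R * (Cb * delta * Q)).
    apply: le_trans h0 _; rewrite big_split /= sumr_const ca -[_ *+ _]mulr_natl.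
    by rewrite mulrDr.
  have h2 : c i ^+ 2 <= 2 * (Cw * P) ^+ 2 + 2 * (Cw * (Na%:R * (Cb * delta * Q))) ^+ 2.
    have P0 : 0 <= P by exact: sumr_ge0.
    have Q0 : 0 <= Q by exact: sumr_ge0.
    rewrite -[leLHS]real_normK ?num_real//.
    apply: (@le_trans _ _ ((Cw * P + Cw * (Na%:R * (Cb * delta * Q))) ^+ 2)).
      by rewrite lerXn2r// nnegrE addr_ge0// !mulr_ge0// ltW.
    set s := Cw * P; set t := Cw * (_ * _); have := sqr_ge0 (s - t); rewrite sqrrB sqrrD; lra.
  have h3 : P ^+ 2 <= Na%:R * \sum_a v (y (al (i, a))) ^+ 2.
    have := @sum_sqr_le R _ predT (fun a => `|v (y (al (i, a)))|) Na; rewrite ca => /(_ (leqnn _)).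
    by move=> /le_trans; apply; rewrite ler_wpM2l//; apply: ler_sum => a _; rewrite real_normK ?num_real.
  have h4 : Q ^+ 2 <= Nb%:R * \sum_(i' | neighbours i i') c i' ^+ 2.
    have := @sum_sqr_le R _ (neighbours i) (fun i' => `|c i'|) Nb (card_neighbours i).
    by move=> /le_trans; apply; rewrite ler_wpM2l//; apply: ler_sum => a _; rewrite real_normK ?num_real.
  apply: le_trans h2 _; apply: lerD.
    rewrite exprMn mulrA -[leRHS]mulrA ler_wpM2l// mulr_ge0 ?sqr_ge0//.
  rewrite (_ : 2 * _ ^+ 2 = delta ^+ 2 * (2 * Cw ^+ 2 * Na%:R ^+ 2 * Cb ^+ 2) * Q ^+ 2); last by ring.
  rewrite (_ : delta ^+ 2 * (_ * Nb%:R) * _ = delta ^+ 2 * (2 * Cw ^+ 2 * Na%:R ^+ 2 * Cb ^+ 2) * (Nb%:R * \sum_(i' | neighbours i i') c i' ^+ 2)); last by ring.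
  apply: ler_wpM2l => //; apply: mulr_ge0; first exact: sqr_ge0.
  by rewrite !mulr_ge0 ?sqr_ge0.
set S := \sum_i c i ^+ 2; set V := \sum_al v (y al) ^+ 2.
have S1 : \sum_i \sum_a v (y (al (i, a))) ^+ 2 <= Na%:R * Nb%:R * V.
  have -> : \sum_i \sum_a v (y (al (i, a))) ^+ 2 =
     \sum_b v (y b) ^+ 2 * \sum_i \sum_a (al (i, a) == b)%:R.
    under [RHS]eq_bigr do rewrite mulr_sumr; rewrite [RHS]exchange_big /=.
    apply: eq_bigr => i _; under [RHS]eq_bigr do rewrite mulr_sumr; rewrite [RHS]exchange_big /=.
    apply: eq_bigr => a _; rewrite (bigD1 (al (i, a)))//= eqxx mulr1 big1 ?addr0// => b.
    by rewrite eq_sym => /negbTE ->; rewrite mulr0.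
  rewrite mulrC mulr_suml; apply: ler_sum => b _; rewrite ler_wpM2l ?sqr_ge0//.
  rewrite (bigID (fun i : spline_index k m => near_index (2 * k) (fun j => m%:R * y b 0 j) (fun j => i j))) /=.
  rewrite [X in _ + X]big1 ?addr0; last first.
    move=> i ni; rewrite big1// => a _; case: eqP => // ab; move: ni; rewrite -ab near_al//.
  rewrite mulrC; apply: sum_near_le => //.
    apply: leq_trans NbD; apply: leq_trans (@card_near_index R D (m + k.-1) (2 * k) (fun j => m%:R * y b 0 j)).
    by apply/eq_leq/eq_card => i; rewrite !inE.
  move=> i _; apply: (@le_trans _ _ (\sum_(a : {ffun 'I_D -> 'I_k}) 1)).
    by apply: ler_sum => a _; case: eqP.
  by rewrite sumr_const card_ffun !card_ord.
have S2 : \sum_i \sum_(i' | neighbours i i') c i' ^+ 2 <= Nb%:R * S.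
  rewrite (exchange_big_dep predT)//= /S mulr_sumr; apply: ler_sum => i' _.
  apply: sum_near_le => //; last exact: sqr_ge0.
  apply: leq_trans (card_neighbours i').
  by apply/eq_leq/eq_card => i; rewrite unfold_in neighbours_sym.
have S0 : 0 <= S by apply: sumr_ge0 => i _; exact: sqr_ge0.
have V0 : 0 <= V by apply: sumr_ge0 => i _; exact: sqr_ge0.
have main : S <= A1 * V + delta ^+ 2 * A2 * S.
  apply: (@le_trans _ _ (\sum_i (2 * Cw ^+ 2 * Na%:R * \sum_a v (y (al (i, a))) ^+ 2 +
     delta ^+ 2 * (2 * Cw ^+ 2 * Na%:R ^+ 2 * Cb ^+ 2 * Nb%:R) * \sum_(i' | neighbours i i') c i' ^+ 2))).
    by apply: ler_sum => i _; exact: cbound.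
  rewrite big_split /= -!mulr_sumr /A1 /A2; apply: lerD.
    by rewrite -[leRHS]mulrA ler_wpM2l// !mulr_ge0 ?sqr_ge0.
  rewrite (_ : _ * S = delta ^+ 2 * (2 * Cw ^+ 2 * Na%:R ^+ 2 * Cb ^+ 2 * Nb%:R) * (Nb%:R * S)); last by ring.
  apply: ler_wpM2l => //; apply: mulr_ge0; first exact: sqr_ge0.
  by rewrite !mulr_ge0 ?sqr_ge0.
have dS : delta ^+ 2 * A2 * S <= 1 / 2 * S by rewrite ler_wpM2r.
rewrite mulrC ler_pdivrMr ?mulr_gt0 ?ltr_wpDl//.
have : 0 <= V * A1 by rewrite mulr_ge0.
by lra.
Qed.

Lemma line_spline_tensor m (F : 'rV[R]_D -> R) : (0 < m)%N -> spline k m F ->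
  forall x, Omega x -> F x = comb (fun i : spline_index k m => mcoef xi om i F) x.
Proof.
move=> m0 sF; apply: (tensor_reproduction k2 xi01 dual m0) => x j Ox.
exact: line_spline_of_spline.
Qed.

(** The normal equations without the particle weight, which is common to all terms and cancels. *)
Definition discrete_projection (m : nat) (Pt : finType) (y : Pt -> 'rV[R]_D) (g : Pt -> R) u : Prop :=
  spline k m u /\ forall v, spline k m v -> \sum_al u (y al) * v (y al) = \sum_al g al * v (y al).

(** The difference [c - c'] solves the Gram system whose right-hand side is the residual of
    [comb c'] at the data points, so it inherits the decay of the inverse. [Np] bounds the data
    points per B-spline and thereby the row sums; [delta] is fixed before it, so the density
    threshold is independent of how crowded the points are. *)
Lemma least_squares : exists2 delta : R, 0 < delta <= 1 & forall Np : nat,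
  exists2 C : R, 0 <= C & exists2 la : R, 0 < la < 1 &
  forall m (Pt : finType) (y : Pt -> 'rV[R]_D), (0 < m)%N ->
  (forall al, Omega (y al)) ->
  (forall z, Omega z -> exists al, `|y al - z| <= delta / m%:R) ->
  (forall i : spline_index k m,
     (#|[pred al | near_index k (fun j => (m%:R * y al 0 j)%R) (fun j => i j)]| <= Np)%N) ->
  forall g : Pt -> R, exists2 c : spline_index k m -> R,
    discrete_projection m y g (comb c) /\
    (forall w, discrete_projection m y g w -> {in @Omega R D, w =1 comb c}) &
    forall (c' : spline_index k m -> R) i, `|c i - c' i| <= C * \sum_j decay la j i *
       \sum_(al | near_index k (fun l => m%:R * y al 0 l) (fun l => j l)) `|g al - comb c' (y al)|.
Proof.
have [delta d01 [kappa kappa0 coer]] := gram_coercive.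
exists delta => // Np.
have [Cb Cb0 HCb] := tensor_bspline_bound (R := R) (D := D) k2.
pose Nb := ((2 * k).+1 ^ D)%N.
pose K := Np%:R * (Cb * (Nb%:R * Cb)).
have K0 : 0 <= K by rewrite !mulr_ge0.
pose eta := kappa / 2 / (K + 1).
have eta0 : 0 < eta by rewrite !divr_gt0// ltr_wpDl.
have etaK : eta * K <= kappa / 2.
  rewrite /eta -mulrA ler_piMr ?divr_ge0 ?(ltW kappa0)// mulrC ler_pdivrMr ?ltr_wpDl//.
  by rewrite mul1r lerDl.
have [la la01 Hla] := decay_ratio D (2 * k) eta0.
have /andP[la0 la1] := la01.
exists (2 / kappa * Cb) => [|]; first by rewrite mulr_ge0// divr_ge0// ltW.
exists la => // m Pt y m0 Oy dense cnt g.
pose B (i : spline_index k m) (al : Pt) := tensor_bspline i (y al).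
pose G (i j : spline_index k m) := \sum_al B i al * B j al.
have BCb (i : spline_index k m) (al : Pt) : `|B i al| <= Cb by exact: (HCb m i (y al) (y al)).1.
have Bsupp (i : spline_index k m) (al : Pt) : ~~ near_index k (fun j => m%:R * y al 0 j) (fun j => i j) -> B i al = 0.
  by move=> h; apply/eqP; apply: contraNT h => /(tensor_bspline_support k2).
have testE (u : Pt -> R) (w : spline_index k m -> R) :
    \sum_al u al * comb w (y al) = \sum_j w j * \sum_al u al * B j al.
  under eq_bigr do rewrite /comb mulr_sumr; rewrite exchange_big /=; apply: eq_bigr => j _.
  by rewrite mulr_sumr; apply: eq_bigr => al _; rewrite mulrCA.
have combG (c : spline_index k m -> R) (j : spline_index k m) : \sum_al comb c (y al) * B j al = \sum_i G j i * c i.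
  under eq_bigr do rewrite mulrC /comb mulr_sumr; rewrite exchange_big /=; apply: eq_bigr => i _.
  by rewrite /G mulr_suml; apply: eq_bigr => al _; rewrite mulrA mulrAC.
have quad (c : spline_index k m -> R) : \sum_al comb c (y al) ^+ 2 = \sum_i \sum_j c i * G i j * c j.
  under eq_bigr do rewrite expr2; rewrite testE; apply: eq_bigr => i _.
  by rewrite combG mulr_sumr; apply: eq_bigr => j _; rewrite mulrA.
have coerG (c : spline_index k m -> R) : kappa * \sum_i c i ^+ 2 <= \sum_i \sum_j c i * G i j * c j.
  by rewrite -quad; exact: coer.
have symG (i j : spline_index k m) : G i j = G j i by apply: eq_bigr => al _; rewrite mulrC.
have rowG (i : spline_index k m) : \sum_j `|G i j| <= K.
  apply: (@le_trans _ _ (\sum_j \sum_al `|B i al| * `|B j al|)).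
    by apply: ler_sum => j _; apply: le_trans (ler_norm_sum _ _ _) _; apply: ler_sum => al _; rewrite normrM.
  rewrite exchange_big /= (bigID [pred al | near_index k (fun j => m%:R * y al 0 j) (fun j => i j)]) /=.
  rewrite [X in _ + X]big1 ?addr0; last first.
    by move=> al /Bsupp h; rewrite big1// => j _; rewrite h normr0 mul0r.
  apply: sum_near_le; [exact: cnt|by rewrite !mulr_ge0|move=> al _].
  rewrite -mulr_sumr; apply: ler_pM => //; first exact: sumr_ge0.
  rewrite (bigID [pred j : spline_index k m | near_index k (fun l => m%:R * y al 0 l) (fun l => j l)]) /=.
  rewrite [X in _ + X]big1 ?addr0; last by move=> j /Bsupp ->; rewrite normr0.
  apply: sum_near_le => //.
  by apply: leq_trans (@card_near_index R D (m + k.-1) k (fun l => m%:R * y al 0 l)).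
have thG (t i j : spline_index k m) : G i j != 0 -> `|decay la i t / decay la j t - 1| <= eta.
  move=> Gij; apply: Hla => l.
  have [al] : exists al, B i al * B j al != 0.
    apply/existsP; apply: contraNT Gij => /existsPn H; rewrite /G big1// => al _.
    by have := H al; rewrite negbK => /eqP.
  rewrite mulf_eq0 negb_or => /andP[/(tensor_bspline_support k2)/forallP/(_ l) h1 /(tensor_bspline_support k2)/forallP/(_ l) h2].
  apply: (@ndist_le R); rewrite (_ : _ - _ = ((i l)%:R - m%:R * y al 0 l) - ((j l)%:R - m%:R * y al 0 l)); last by ring.
  by apply: le_trans (ler_normB _ _) _; rewrite mul2n -addnn natrD lerD.
have [c cE] := gram_solve kappa0 coerG (fun j => \sum_al g al * B j al).
have projc : discrete_projection m y g (comb c).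
  split; first exact: spline_sum.
  move=> v sv; have vE (al : Pt) : v (y al) = comb (fun i : spline_index k m => mcoef xi om i v) (y al).
    exact: line_spline_tensor.
  under eq_bigr do rewrite vE; under [RHS]eq_bigr do rewrite vE.
  by rewrite !testE; apply: eq_bigr => j _; rewrite combG cE.
exists c; first (split=> // w [sw Hw] x Ox).
  pose e x := (-1) * comb c x + w x.
  have se : spline k m e by apply: spline_lin => //; exact: projc.1.
  have eE (z : 'rV[R]_D) : Omega z -> e z = comb (fun i : spline_index k m => mcoef xi om i e) z by exact: line_spline_tensor.
  have e0 : \sum_al comb (fun i : spline_index k m => mcoef xi om i e) (y al) ^+ 2 = 0.
    have E : \sum_al e (y al) * e (y al) = 0.
      have h1 := Hw e se; have h2 := projc.2 e se.
      transitivity (\sum_al w (y al) * e (y al) - \sum_al comb c (y al) * e (y al)); last by rewrite h1 h2 subrr.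
      by rewrite -sumrB; apply: eq_bigr => al _; rewrite {1}/e; ring.
    by rewrite -[RHS]E; apply: eq_bigr => al _; rewrite -eE ?expr2.
  have := coer m Pt y m0 dense (fun i => mcoef xi om i e); rewrite e0.
  have S0 : 0 <= \sum_(i : spline_index k m) mcoef xi om i e ^+ 2 by apply: sumr_ge0 => i _; exact: sqr_ge0.
  rewrite pmulr_rle0// => S0'.
  have /eqP : \sum_(i : spline_index k m) mcoef xi om i e ^+ 2 = 0 by apply/eqP; rewrite eq_le S0 S0'.
  rewrite psumr_eq0; last by move=> i _; exact: sqr_ge0.
  move=> /allP H; rewrite inE in Ox; have := eE x Ox; rewrite /comb big1 => [|i _].
    by rewrite /e => /eqP; rewrite mulN1r addrC subr_eq0 => /eqP.
  by have := H i (mem_index_enum _); rewrite sqrf_eq0 => /eqP ->; rewrite mul0r.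
move=> c' i.
pose F j := \sum_al (g al - comb c' (y al)) * B j al.
have dE (j : spline_index k m) : \sum_i G j i * (c i - c' i) = F j.
  under eq_bigr do rewrite mulrBr; rewrite sumrB cE -combG -sumrB.
  by apply: eq_bigr => al _; rewrite mulrBl.
have dec0 j := decay_gt0 j i la0.
(* With the weights centred at [i], the single term [c i - c' i] carries weight 1. *)
have := gram_decay kappa0 coerG symG rowG dec0 (ltW eta0) etaK (thG i) dE.
move=> h; have h1 : `|c i - c' i| ^+ 2 <= (2 / kappa * \sum_j decay la j i * `|F j|) ^+ 2.
  rewrite exprMn; apply: (@le_trans _ _ (\sum_j (decay la j i * (c j - c' j)) ^+ 2)).
    rewrite (bigD1 i)//= decay_refl mul1r real_normK ?num_real// lerDl.
    by apply: sumr_ge0 => j _; exact: sqr_ge0.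
  apply: le_trans h _; rewrite ler_wpM2l ?sqr_ge0//.
  apply: le_trans (sum_sqr_le_sqr _); last by move=> j; rewrite mulr_ge0// ltW.
  by apply: ler_sum => j _; rewrite !exprMn real_normK ?num_real.
have S0 : 0 <= 2 / kappa * \sum_j decay la j i * `|F j|.
  by rewrite mulr_ge0 ?divr_ge0 ?(ltW kappa0)//; apply: sumr_ge0 => j _; rewrite mulr_ge0// ltW.
rewrite ler_pXn2r ?nnegrE// in h1; apply: le_trans h1 _.
rewrite -[leRHS]mulrA; apply: ler_wpM2l; first by rewrite divr_ge0// ltW.
rewrite mulr_sumr; apply: ler_sum => j _.
rewrite mulrCA ler_wpM2l ?(ltW (dec0 j))// /F.
rewrite (bigID [pred al | near_index k (fun l => m%:R * y al 0 l) (fun l => j l)]) /=.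
rewrite [X in _ + X]big1 ?addr0; last by move=> al /Bsupp ->; rewrite mulr0.
apply: le_trans (ler_norm_sum _ _ _) _; rewrite mulr_sumr; apply: ler_sum => al _.
by rewrite normrM mulrC ler_wpM2r.
Qed.

End least_squares.

(** * Measurability and measure of cells *)

Section measurable_boxes.
Context {R : realType} {D : nat}.
Local Notation mu := (lebesgue_rV R D).
Implicit Types (x y z : 'rV[R]_D) (V : set 'rV[R]_D).

Lemma measurable_coords (P : 'I_D -> set (measurableTypeR R)) :
  (forall j, measurable (P j)) -> measurable [set x : 'rV[R]_D | forall j, P j (x 0 j)].
Proof.
move=> mP; rewrite (_ : [set x | _] = \big[setI/setT]_j
    ((fun x : 'rV[R]_D => x 0 j : measurableTypeR R) @^-1` P j)).
  apply: bigsetI_measurable => j _; rewrite -[X in measurable X]setTI.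
  exact: measurable_coor.
rewrite -bigcap_seq; apply/seteqP; split => x Bx i => [_|]; first exact: Bx.
by apply: Bx; rewrite /= mem_index_enum.
Qed.

Lemma measurable_Omega : measurable (@Omega R D).
Proof.
rewrite (_ : @Omega R D = [set x | forall j, `]0, 1[%classic (x 0 j)]).
  by apply: (@measurable_coords (fun=> `]0, 1[%classic)) => j; exact: measurable_itv.
by apply/seteqP; split => x Ox j; have := Ox j; rewrite /= in_itv.
Qed.

Lemma open_Omega : open (@Omega R D).
Proof.
rewrite (_ : @Omega R D = obox 0 (const_mx 1)); first exact: open_obox.
by apply/seteqP; split => x Ox j; have := Ox j; rewrite !mxE.
Qed.

Lemma cubeE z (r : R) : 0 <= r -> [set x : 'rV[R]_D | `|x - z| <= r] =
  [set x | forall j, x 0 j \in `[(z - const_mx r) 0 j, (z + const_mx r) 0 j]].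
Proof.
move=> r0; apply/seteqP; split => x /=.
  move=> h j; have := le_trans (coord_le_norm (x - z) j) h.
  by rewrite !mxE in_itv /= ler_distl.
move=> h; apply/norm_leP => // j; have := h j.
by rewrite !mxE in_itv /= ler_distl.
Qed.

Lemma measurable_cube z (r : R) : 0 <= r -> measurable [set x : 'rV[R]_D | `|x - z| <= r].
Proof.
move=> r0; rewrite cubeE//; apply: (@measurable_coords (fun j => `[(z - const_mx r) 0 j, (z + const_mx r) 0 j]%classic)).
by move=> j; exact: measurable_itv.
Qed.

Lemma measure_cube z (r : R) : 0 <= r -> mu [set x | `|x - z| <= r] = ((2 * r) ^+ D)%:E.
Proof.
move=> r0; rewrite cubeE// lebesgue_rV_box => [|j]; last first.
  by rewrite !mxE lerD2l ge0_cp.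
congr EFin; rewrite (_ : (2 * r) ^+ D = \prod_(j < D) (2 * r)).
  by apply: eq_bigr => j _; rewrite !mxE; ring.
by rewrite prodr_const card_ord.
Qed.

Lemma measure_Omega_le : (mu (@Omega R D) <= 1)%E.
Proof.
have -> : 1%E = mu [set x | `|x - const_mx (2^-1)| <= 2^-1].
  by rewrite measure_cube ?invr_ge0// mulfV// expr1n.
apply: le_measure; rewrite ?inE; [exact: measurable_Omega|exact: measurable_cube|].
move=> x Ox /=; apply/norm_leP => // j; have := Ox j; rewrite !mxE ler_distl => /andP[h1 h2].
by apply/andP; split; lra.
Qed.

(* Half-open, so that the cubes of a grid are disjoint. *)
Definition grid_cube m (q : cell_index D m) : set 'rV[R]_D :=
  [set x | forall j, (q j)%:R <= m%:R * x 0 j < (q j).+1%:R].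

Lemma grid_cube_measurable m (q : cell_index D m) : measurable (grid_cube q).
Proof.
apply: (@measurable_coords (fun j => [set s : R | (q j)%:R <= m%:R * s < (q j).+1%:R])) => j.
rewrite (_ : [set s | _] = setT `&` (fun s : R => m%:R * s) @^-1` `[(q j)%:R, (q j).+1%:R[%classic).
  have h : measurable_fun [set: measurableTypeR R] (fun s : R => m%:R * s) by exact: measurable_funM.
  by apply: h => //; exact: measurable_itv.
by rewrite setTI; apply/seteqP; split => s /=; rewrite in_itv.
Qed.

Lemma grid_cube_exists m x : (0 < m)%N -> Omega x -> exists q : cell_index D m, grid_cube q x.
Proof.
move=> m0 Ox; have m0R : 0 < m%:R :> R by rewrite ltr0n.
have h j : 0 <= m%:R * x 0 j by have /andP[/ltW x0 _] := Ox j; rewrite mulr_ge0.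
have tm j : (Num.truncn (m%:R * x 0 j)%R < m)%N.
  have /andP[x0 x1] := Ox j; rewrite -(ltr_nat R); have /andP[t1 _] := truncn_itv (h j); apply: le_lt_trans t1 _.
  by rewrite -[ltRHS]mulr1 ltr_pM2l.
exists [ffun j => Ordinal (tm j)] => j; rewrite !ffunE /=; exact: truncn_itv.
Qed.

Lemma grid_cube_unique m (q q' : cell_index D m) x : grid_cube q x -> grid_cube q' x -> q = q'.
Proof.
move=> qx q'x; apply/ffunP => j; apply/val_inj.
have /andP[h1 h2] := qx j; have /andP[h3 h4] := q'x j.
have := le_lt_trans h1 h4; have := le_lt_trans h3 h2; rewrite !ltr_nat !ltnS => h5 h6.
by apply/eqP; rewrite eqn_leq h5 h6.
Qed.

Lemma grid_cube_dist m (q : cell_index D m) x y : (0 < m)%N ->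
  grid_cube q x -> grid_cube q y -> `|x - y| <= m%:R^-1.
Proof.
move=> m0 qx qy; have m0R : 0 < m%:R :> R by rewrite ltr0n.
apply/norm_leP => [|j]; first by rewrite invr_ge0.
have := qx j; have := qy j; rewrite !mxE -!natr1 => /andP[h1 h2] /andP[h3 h4].
rewrite -[leRHS]mulr1 ler_pdivlMl// -[m%:R in leLHS]ger0_norm// -normrM ler_norml.
by rewrite mulrBr; apply/andP; split; lra.
Qed.

Lemma grid_cube_measure m (q : cell_index D m) : (0 < m)%N ->
  (((2 * m%:R)^-1 ^+ D)%:E <= mu (grid_cube q))%E.
Proof.
move=> m0; have m0R : 0 < m%:R :> R by rewrite ltr0n.
pose z : 'rV[R]_D := \row_j ((q j)%:R / m%:R + (4 * m%:R)^-1).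
have r0 : 0 <= (4 * m%:R)^-1 :> R by rewrite invr_ge0 mulr_ge0.
have -> : (2 * m%:R)^-1 = 2 * (4 * m%:R)^-1 :> R by field; rewrite gt_eqF.
rewrite -(measure_cube z)//; apply: le_measure; rewrite ?inE; [exact: measurable_cube|exact: grid_cube_measurable|].
rewrite cubeE// => x /= h j; have := h j; rewrite !mxE in_itv /= => /andP[h1 h2].
apply/andP; split.
  by rewrite mulrC -ler_pdivrMr//; move: h1; rewrite addrK.
rewrite -natr1 mulrC -ltr_pdivlMr// mulrDl mul1r; apply: le_lt_trans h2 _.
rewrite -addrA ltrD2l; have -> : (4 * m%:R)^-1 = m%:R^-1 / 4 :> R by field; rewrite gt_eqF.
by have : 0 < m%:R^-1 :> R; [rewrite invr_gt0|lra].
Qed.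

Definition inner_cubes m V : set 'rV[R]_D :=
  \bigcup_(q in [set q : cell_index D m | grid_cube q `<=` V]) grid_cube q.

Lemma inner_cubes_sub m V : inner_cubes m V `<=` V.
Proof. by move=> x [q qV]; exact: qV. Qed.

Lemma measurable_inner_cubes m V : measurable (inner_cubes m V).
Proof. by apply: fin_bigcup_measurable => [|q _]; [exact: finite_finset|exact: grid_cube_measurable]. Qed.

Lemma inner_cubes_fill V x : open V -> V `<=` @Omega R D -> V x ->
  exists N, forall m, (N <= m)%N -> inner_cubes m V x.
Proof.
move=> oV VO Vx; have /nbhs_ballP[e /= e0 eV] : nbhs x V by exact: open_nbhs_nbhs.
exists (Num.truncn e^-1).+1 => m Nm.
have m0 : (0 < m)%N by exact: leq_trans Nm.
have [q qx] := grid_cube_exists m0 (VO _ Vx).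
exists q => // y qy; apply: eV; rewrite -ball_normE /=.
apply: le_lt_trans (grid_cube_dist m0 qx qy) _.
rewrite invf_plt ?posrE ?ltr0n//; apply: lt_le_trans (truncnS_gt _) _.
by rewrite ler_nat.
Qed.

(** The grids of edge 1/m are not nested in [m], so the unions of inner cubes need not increase.
    Keeping only the points that all grids from [k.+1] on cover makes the sets increase to [V]. *)
Definition eventual_cubes V k : set 'rV[R]_D := \bigcap_m inner_cubes (k + m).+1 V.

Lemma measurable_eventual_cubes V k : measurable (eventual_cubes V k).
Proof. by apply: bigcapT_measurable => m; exact: measurable_inner_cubes. Qed.

Lemma bigcup_eventual_cubes V : open V -> V `<=` @Omega R D ->
  \bigcup_k eventual_cubes V k = V.
Proof.
move=> oV VO; apply/seteqP; split => [x [k _ /(_ 0%N I)]|x Vx]; first exact: inner_cubes_sub.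
have [N HN] := inner_cubes_fill oV VO Vx.
by exists N => // m _; apply: HN; rewrite -addnS leq_addr.
Qed.

Lemma eventual_cubes_nondecreasing V : {homo eventual_cubes V : n m / (n <= m)%N >-> (n <= m)%O}.
Proof.
move=> k l kl; apply/subsetPset => x H m _.
by have := H (l - k + m)%N I; rewrite addnA subnKC.
Qed.

(** The sigma-algebra is generated by the coordinates; open sets are reached by countable operations
    on grid cubes. *)
Lemma open_measurable_rV V : open V -> V `<=` @Omega R D -> measurable V.
Proof.
move=> oV VO; rewrite -(bigcup_eventual_cubes oV VO).
by apply: bigcup_measurable => k _; exact: measurable_eventual_cubes.
Qed.

Lemma open_OmegaI V : open V -> measurable (@Omega R D `&` V).
Proof.
move=> oV; apply: open_measurable_rV => [|x []//].
by apply: openI => //; exact: open_Omega.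
Qed.

Lemma continuous_measurable_Omega (f : 'rV[R]_D -> R) :
  (forall x, Omega x -> {for x, continuous f}) -> measurable_fun (@Omega R D) f.
Proof.
move=> cf; apply: (measurability _ (RGenInftyO.measurableE R)) => _ [_ [s ->] <-].
have -> : @Omega R D `&` f @^-1` `]-oo, s[ = @Omega R D `&` (f @^-1` `]-oo, s[)°.
  apply/seteqP; split => x [Ox fx]; split => //; last exact: interior_subset.
  apply: (cf x Ox); apply: open_nbhs_nbhs; split => //; exact: interval_open.
by apply: open_OmegaI; exact: open_interior.
Qed.

Lemma continuous_measurable_rV (f : 'rV[R]_D -> 'rV[R]_D) :
  (forall x, Omega x -> {for x, continuous f}) -> measurable_fun (@Omega R D) f.
Proof.
move=> cf.
have H : g_sigma_preimage (fun (i : 'I_D) (x : 'rV[R]_D) => x 0 i : measurableTypeR R) `<=`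
   image_set_system (@Omega R D) f measurable.
  apply: smallest_sub.
    by apply: sigma_algebra_image; split => [|A mA|A mA];
      [exact: measurable0|apply: measurableD => //; exact: measurable_Omega|exact: bigcupT_measurable].
  rewrite -bigcup_seq => A [i _] [B mB <-]; rewrite /image_set_system /= setTI.
  have h : measurable_fun (@Omega R D) (fun x => f x 0 i).
    apply: continuous_measurable_Omega => x Ox; apply: (continuous_comp (f := f) (g := fun y : 'rV[R]_D => y 0 i)); first exact: cf.
    exact: coord_continuous.
  exact: (h measurable_Omega B mB).
by move=> _ A mA; exact: H.
Qed.

End measurable_boxes.

(** * Pullback of Lebesgue measure by a flow map *)

Section regularity.
Context {R : realType} {D : nat}.
Local Notation mu := (lebesgue_rV R D).
Local Notation Om := (@Omega R D).
Implicit Types (A U F : set 'rV[R]_D).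

(* Stated symmetrically in [A] and its complement. *)
Definition regular A := forall e : R, 0 < e -> exists U F,
  [/\ open U, open F, A `<=` U, ~` A `<=` F & (mu (Om `&` (U `&` F)) < e%:E)%E].

(** Complements exchange the two open sets. For a countable union, the sets are taken with errors
    that sum to [e / 2]. *)
Lemma regular_sigma_algebra : sigma_algebra setT regular.
Proof.
split=> [e e0|A rA e e0|A rA e e0].
- exists set0, setT; split => //; [exact: openT|].
  by rewrite set0I setI0 measure0.
- have [U [F [oU oF AU AF muUF]]] := rA e e0.
  by exists F, U; rewrite setTD setCK [F `&` _]setIC; split.
have e2 i : 0 < e / 2 / (2 ^ i.+1)%:R by rewrite !divr_gt0// ltr0n expn_gt0.
have /choice[UF HUF] : forall i, exists UF : set 'rV[R]_D * set 'rV[R]_D,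
    [/\ open UF.1, open UF.2, A i `<=` UF.1, ~` A i `<=` UF.2 &
      (mu (Om `&` (UF.1 `&` UF.2)) < (e / 2 / (2 ^ i.+1)%:R)%:E)%E].
  by move=> i; have [U [F H]] := rA i _ (e2 i); exists (U, F).
pose U := \bigcup_i (UF i).1.
(* The intersection of all the open sets around the complements need not be open; finitely many of
   them suffice, by continuity from above of the finite measure on [Om]. *)
pose F N := \bigcap_(i in `I_N) (UF i).2.
have oU : open U by apply: bigcup_open => i _; have [] := HUF i.
have oF N : open (F N).
  rewrite /F; elim: N => [|N IH]; first by rewrite II0 bigcap_set0; exact: openT.
  rewrite IIS bigcap_setU bigcap_set1; apply: openI => //; have [] := HUF N => //.
pose G N := Om `&` (U `&` F N).
have mG N : measurable (G N) by apply: open_OmegaI; apply: openI.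
have G0 : (mu (G 0%N) < +oo)%E.
  apply: le_lt_trans (_ : (1 < +oo)%E); last exact: ltry.
  apply: le_trans measure_Omega_le; apply: le_measure; rewrite ?inE//; first exact: measurable_Omega.
  by move=> x [].
have Gd : {homo G : n m / (n <= m)%N >-> (m <= n)%O}.
  move=> k l kl; apply/subsetPset => x [Ox [Ux Fx]]; split => //; split => // i ik.
  by apply: Fx; exact: leq_trans kl.
have mGi : measurable (\bigcap_n G n) by exact: bigcapT_measurable.
have muG : (mu (\bigcap_n G n) <= (e / 2)%:E)%E.
  apply: le_trans (epsilon_trick0 predT _); last by rewrite divr_ge0// ltW.
  have sub := @measure_sigma_subadditive _ _ _ mu (\bigcap_n G n) (fun i => Om `&` ((UF i).1 `&` (UF i).2)).
  apply: le_trans (sub _ mGi _) _.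
  - by move=> i; apply: open_OmegaI; have [? ? _ _ _] := HUF i; exact: openI.
  - move=> x H; have [Ox [[i _ Ux] _]] := H 0%N I; exists i => //; split => //; split => //.
    by have [_ [_ Fx]] := H i.+1 I; apply: Fx => /=.
  by apply: lee_nneseries => i *; rewrite ?measure_ge0// ltW//; have [] := HUF i.
have muGe : (mu (\bigcap_n G n) < e%:E)%E.
  by apply: le_lt_trans muG _; rewrite lte_fin; lra.
have cv := @nonincreasing_cvg_mu _ _ _ mu G G0 mG mGi Gd.
have [N _ HN] : \forall N \near \oo, (mu (G N) < e%:E)%E.
  apply: (cv [set z | (z < e%:E)%E]).
  apply: open_nbhs_nbhs; split => //.
  exact: open_ereal_lt_ereal.
exists U, (F N); split => //; last by have := HN N (leqnn N).
- by move=> x [i _ Aix]; exists i => //; have [_ _ H _ _] := HUF i; exact: H.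
- by move=> x nA i _; have [_ _ _ H _] := HUF i; apply: H => Aix; apply: nA; exists i.
Qed.

Lemma measurable_regular A : measurable A -> regular A.
Proof.
apply: smallest_sub; first exact: regular_sigma_algebra.
rewrite -bigcup_seq => B [i _] [Y mY <-].
rewrite RGenInftyO.measurableE in mY.
have H : <<s @RGenInftyO.G R >> `<=`
   image_set_system setT (fun x : 'rV[R]_D => x 0 i) regular.
  apply: smallest_sub; first exact: sigma_algebra_image regular_sigma_algebra.
  move=> _ [c ->] e e0; rewrite setTI.
  pose U : set 'rV[R]_D := [set x | x 0 i < c]; pose F k : set 'rV[R]_D := [set x | c - k.+1%:R^-1 < x 0 i].
  have cc : continuous (fun x : 'rV[R]_D => x 0 i) by move=> x; exact: coord_continuous.
  have oU : open U by apply: (open_comp (D := [set s : R | s < c])) => [x _|]; [exact: cc|exact: open_lt].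
  have oF k : open (F k).
    by apply: (open_comp (D := [set s : R | c - k.+1%:R^-1 < s])) => [x _|]; [exact: cc|exact: open_gt].
  pose G k := Om `&` (U `&` F k).
  have mG k : measurable (G k) by apply: open_OmegaI; apply: openI.
  have G0 : (mu (G 0%N) < +oo)%E.
    apply: le_lt_trans (_ : (1 < +oo)%E); last exact: ltry.
    apply: le_trans measure_Omega_le; apply: le_measure; rewrite ?inE//; first exact: measurable_Omega.
    by move=> x [].
  have Gd : {homo G : n m / (n <= m)%N >-> (m <= n)%O}.
    move=> k l kl; apply/subsetPset => x [Ox [Ux Fx]]; split => //; split => //.
    by apply: le_lt_trans Fx; rewrite lerD2l lerN2 lef_pV2 ?posrE// ler_nat.
  have GI : \bigcap_n G n = set0.
    rewrite -subset0 => x H; have [_ [Ux _]] := H 0%N I.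
    have d0 : 0 < c - x 0 i by rewrite subr_gt0.
    have [_ [_]] := H (Num.truncn (c - x 0 i)^-1) I.
    rewrite /F /= ltrBlDr -ltrBlDl; apply/negP; rewrite -leNgt.
    by rewrite invf_ple ?posrE// ltW// truncnS_gt.
  have cv := @nonincreasing_cvg_mu _ _ _ mu G G0 mG (bigcapT_measurable mG) Gd.
  rewrite GI measure0 in cv.
  have [N _ HN] : \forall N \near \oo, (mu (G N) < e%:E)%E.
    apply: (cv [set z | (z < e%:E)%E]).
    by apply: open_nbhs_nbhs; split; [exact: open_ereal_lt_ereal|rewrite /= lte_fin].
  exists U, (F N); split => //; last by have := HN N (leqnn N).
  move=> x /=; rewrite in_itv /= => /negP; rewrite -leNgt => h; apply: lt_le_trans h.
  by rewrite ltrBlDr ltrDl invr_gt0.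
by have := H _ mY; rewrite /image_set_system /= setTI.
Qed.

Lemma outer_open A (e : R) : measurable A -> 0 < e -> exists U,
  [/\ open U, A `<=` U & (mu (Om `&` U) <= mu (Om `&` A) + e%:E)%E].
Proof.
move=> mA e0; have [U [F [oU oF AU AF muUF]]] := measurable_regular mA e0.
exists U; split => //.
have mOA : measurable (Om `&` A) by apply: measurableI => //; exact: measurable_Omega.
have mUF : measurable (Om `&` (U `&` F)) by apply: open_OmegaI; exact: openI.
apply: (@le_trans _ _ (mu ((Om `&` A) `|` (Om `&` (U `&` F))))).
  apply: le_measure; rewrite ?inE; [exact: open_OmegaI|exact: measurableU|].
  move=> x [Ox Ux]; have [Ax|nAx] := pselect (A x); first by left.
  by right; split => //; split => //; exact: AF.
apply: le_trans (measureU2 _ mOA mUF) _; rewrite leeD2l// ltW//.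
Qed.

End regularity.

Section pullback.
Context {R : realType} {D : nat}.
Local Notation mu := (lebesgue_rV R D).
Local Notation Om := (@Omega R D).
Variables (f : 'rV[R]_D -> 'rV[R]_D) (L : R).
Hypothesis L1 : 1 <= L.
Hypothesis mf : measurable_fun Om f.
Hypothesis fO : forall x, Om x -> Om (f x).
Hypothesis lip : forall x y, Om x -> Om y -> `|x - y| <= L * `|f x - f y|.
Implicit Types (A V : set 'rV[R]_D).

Let nu A := mu (Om `&` f @^-1` A).

Let mnu A : measurable A -> measurable (Om `&` f @^-1` A).
Proof. by move=> mA; exact: (mf measurable_Omega mA). Qed.

Let L0 : 0 <= L. Proof. exact: le_trans L1. Qed.

Let C0 : (0 <= ((4 * L) ^+ D)%:E)%E.
Proof. by rewrite lee_fin exprn_ge0// mulr_ge0. Qed.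

(** The preimage of a cube of edge 1/m has diameter at most [L / m], so a cube of edge [2 L / m]
    contains it; comparison with a cube of edge [1 / (2 m)] inside the given one yields the factor
    [4 L] per dimension. *)
Lemma pullback_grid_cube m (q : cell_index D m) : (0 < m)%N ->
  (nu (grid_cube q) <= ((4 * L) ^+ D)%:E * mu (grid_cube q))%E.
Proof.
move=> m0; have m0R : 0 < m%:R :> R by rewrite ltr0n.
rewrite /nu; have [[z [Oz qz]]|/nonemptyPn ->] := pselect ((Om `&` f @^-1` grid_cube q) !=set0); last first.
  by rewrite measure0 mule_ge0.
have r0 : 0 <= L * m%:R^-1 by rewrite mulr_ge0 ?invr_ge0.
apply: (@le_trans _ _ (mu [set x | `|x - z| <= L * m%:R^-1])).
  apply: le_measure; rewrite ?inE; [exact: mnu (grid_cube_measurable q)|exact: measurable_cube|].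
  move=> x [Ox qx] /=; apply: le_trans (lip Ox Oz) _.
  by rewrite ler_wpM2l//; exact: (grid_cube_dist m0).
rewrite measure_cube//; apply: le_trans (lee_wpmul2l C0 (grid_cube_measure q m0)).
rewrite -EFinM lee_fin -exprMn le_eqVlt; apply/orP; left; apply/eqP; congr (_ ^+ D).
by field; rewrite gt_eqF.
Qed.

Lemma pullback_inner_cubes m V : (0 < m)%N ->
  (nu (inner_cubes m V) <= ((4 * L) ^+ D)%:E * mu (inner_cubes m V))%E.
Proof.
move=> m0; rewrite /nu /inner_cubes preimage_bigcup setI_bigcupr.
set S := [set q : cell_index D m | _].
have fS : finite_set S by exact: finite_finset.
have t1 : trivIset S (@grid_cube R D m).
  by move=> q q' _ _ [x [qx q'x]]; exact: grid_cube_unique qx q'x.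
have t2 : trivIset S (fun q => Om `&` f @^-1` grid_cube q).
  by move=> q q' _ _ [x [[_ qx] [_ q'x]]]; exact: grid_cube_unique qx q'x.
have m1 q : S q -> measurable (@grid_cube R D m q) by move=> _; exact: grid_cube_measurable.
have m2 q : S q -> measurable (Om `&` f @^-1` grid_cube q) by move=> _; exact: mnu (grid_cube_measurable q).
rewrite (measure_fin_bigcup mu fS t1 m1) (measure_fin_bigcup mu fS t2 m2).
rewrite ge0_mule_fsumr; last by move=> q; exact: measure_ge0.
by apply: lee_fsum => [|q _]; [exact: finite_finset|exact: pullback_grid_cube].
Qed.

Lemma pullback_open V : open V -> V `<=` Om ->
  (nu V <= ((4 * L) ^+ D)%:E * mu V)%E.
Proof.
move=> oV VO; have mW k := measurable_eventual_cubes V k.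
have mV := open_measurable_rV oV VO.
have E : Om `&` f @^-1` V = \bigcup_k (Om `&` f @^-1` eventual_cubes V k).
  by rewrite -setI_bigcupr -preimage_bigcup bigcup_eventual_cubes.
have cv : mu (Om `&` f @^-1` eventual_cubes V k) @[k --> \oo] --> nu V.
  rewrite /nu E; apply: nondecreasing_cvg_mu => [k|| k l kl].
  - exact: mnu.
  - by rewrite -E; exact: mnu.
  apply/subsetPset => x [Ox Wx]; split => //.
  by have /subsetPset := eventual_cubes_nondecreasing V kl; exact.
apply: (cvge_to_le cv); apply: nearW => k.
apply: (@le_trans _ _ (nu (inner_cubes k.+1 V))).
  apply: le_measure; rewrite ?inE; [exact: mnu|exact: mnu (measurable_inner_cubes _ _)|].
  by move=> x [Ox /(_ 0%N I)]; rewrite addn0.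
apply: le_trans (pullback_inner_cubes _ _) _ => //.
apply: lee_wpmul2l => //; apply: le_measure; rewrite ?inE//; first exact: measurable_inner_cubes.
exact: inner_cubes_sub.
Qed.

(** The bound passes from grid cubes to open sets by exhaustion, and from open sets to measurable
    ones by outer regularity. *)
Lemma pullback_measure A : measurable A ->
  (mu (Om `&` f @^-1` A) <= ((4 * L) ^+ D)%:E * mu (Om `&` A))%E.
Proof.
move=> mA; have C1 : 0 < (4 * L) ^+ D by rewrite exprn_gt0// mulr_gt0// (lt_le_trans _ L1).
apply/lee_addgt0Pr => e e0.
have [|U [oU AU muU]] := @outer_open _ _ _ (e / (4 * L) ^+ D) mA; first by rewrite divr_gt0.
apply: (@le_trans _ _ (nu (Om `&` U))).
  apply: le_measure; rewrite ?inE; [exact: mnu|exact: mnu (open_OmegaI oU)|].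
  by move=> x [Ox Ax]; split => //; split; [exact: fO|exact: AU].
apply: le_trans (pullback_open _ _) _; [by apply: openI => //; exact: open_Omega|by move=> x []|].
apply: le_trans (lee_wpmul2l C0 muU) _.
rewrite ge0_muleDr//; last by rewrite lee_fin divr_ge0// ltW.
by rewrite leeD2l// -EFinM lee_fin mulrCA mulfV ?gt_eqF// mulr1.
Qed.

End pullback.

(** * Discrete and integral norms *)

(** The tangent inequality of the convex function x^r at [a]. Summed or integrated with [a] an
    average, it is Jensen's inequality, which is how it is used below. *)
Lemma powR_tangent (R : realType) (r x a : R) : 1 <= r -> 0 <= x -> 0 <= a ->
  r * (x * a `^ (r - 1)) <= x `^ r + (r - 1) * a `^ r.
Proof.
move=> r1 x0 a0; have r0 : 0 < r by exact: lt_le_trans r1.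
have [->|r1'] := eqVneq r 1.
  by rewrite subrr powRr0 mul0r addr0 powRr1// mul1r mulr1.
have s0 : 0 < r - 1 by rewrite subr_gt0 lt_neqAle eq_sym r1'.
have q0 : 0 < r / (r - 1) by rewrite divr_gt0.
have pq : r^-1 + (r / (r - 1))^-1 = 1 by field; rewrite !gt_eqF.
have := conjugate_powR x0 (powR_ge0 a (r - 1)) r0 q0 pq.
rewrite -powRrM (_ : (r - 1) * (r / (r - 1)) = r); last by field; rewrite gt_eqF.
rewrite -(ler_pM2l r0) => /le_trans; apply; rewrite le_eqVlt; apply/orP; left; apply/eqP.
by field; rewrite !gt_eqF.
Qed.

Lemma powRD_le (R : realType) (r a b : R) : 1 <= r -> 0 <= a -> 0 <= b ->
  (a + b) `^ r <= 2 `^ r * (a `^ r + b `^ r).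
Proof.
move=> r1 a0 b0; have r0 : 0 <= r by exact: le_trans r1.
wlog ab : a b a0 b0 / a <= b.
  move=> H; have [ab|/ltW ba] := leP a b; first exact: H.
  by rewrite addrC [_ `^ r + _]addrC; exact: H.
apply: (@le_trans _ _ ((2 * b) `^ r)).
  by apply: ge0_ler_powR => //; rewrite ?nnegrE ?addr_ge0 ?mulr_ge0//; lra.
by rewrite powRM// ler_wpM2l ?powR_ge0// lerDr powR_ge0.
Qed.

Section discrete_norm.
Context {R : realType}.
Implicit Types (I J : finType) (p : \bar R) (V E : R).

(* [E] bounds the [l^p] norm of [A] with the weight [V] on each index. *)
Definition lpb I V p (A : I -> R) E : Prop :=
  match p with r%:E => V * \sum_i A i `^ r <= E `^ r | _ => forall i, A i <= E end.

Lemma lpb_le I V p (A B : I -> R) E F : (1 <= p)%E -> 0 <= V -> 0 <= E -> E <= F ->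
  (forall i, 0 <= B i <= A i) -> lpb V p A E -> lpb V p B F.
Proof.
case: p => [r||] //=; rewrite ?lee_fin => r1 V0 E0 EF BA H; last first.
  by move=> i; have /andP[_ /le_trans] := BA i; apply; exact: le_trans (H i) EF.
have r0 : 0 <= r by exact: le_trans r1.
apply: (@le_trans _ _ (E `^ r)); last by apply: ge0_ler_powR; rewrite ?nnegrE// (le_trans E0).
apply: le_trans H; apply: ler_wpM2l => //; apply: ler_sum => i _.
have /andP[B0 Bi] := BA i.
by apply: ge0_ler_powR; rewrite ?nnegrE// (le_trans B0).
Qed.

Lemma lpb_scale I V p (A : I -> R) c E : (1 <= p)%E -> 0 <= c -> 0 <= E ->
  (forall i, 0 <= A i) -> lpb V p A E -> lpb V p (fun i => c * A i) (c * E).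
Proof.
case: p => [r||] //=; rewrite ?lee_fin => r1 c0 E0 A0 H; last by move=> i; rewrite ler_wpM2l.
under eq_bigr do rewrite powRM//.
by rewrite powRM// -mulr_sumr mulrCA ler_wpM2l ?powR_ge0.
Qed.

(** The constant 4 in place of Minkowski's 1: one factor 2 comes from [powRD_le], the other from
    bounding E^r + F^r by (2 (E + F))^r. *)
Lemma lpb_add I V p (A B : I -> R) E F : (1 <= p)%E -> 0 <= V -> 0 <= E -> 0 <= F ->
  (forall i, 0 <= A i) -> (forall i, 0 <= B i) ->
  lpb V p A E -> lpb V p B F -> lpb V p (fun i => A i + B i) (4 * (E + F)).
Proof.
case: p => [r||] //=; rewrite ?lee_fin => r1 V0 E0 F0 A0 B0 HA HB; last first.
  move=> i; apply: le_trans (lerD (HA i) (HB i)) _.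
  by rewrite ler_peMl ?addr_ge0// ler1n.
have r0 : 0 <= r by exact: le_trans r1.
apply: (@le_trans _ _ (2 `^ r * (E `^ r + F `^ r))).
  apply: (@le_trans _ _ (2 `^ r * (V * \sum_i A i `^ r + V * \sum_i B i `^ r))).
    rewrite -mulrDr -big_split /= mulrCA ler_wpM2l// mulr_sumr.
    by apply: ler_sum => i _; exact: powRD_le.
  by rewrite ler_wpM2l ?powR_ge0// lerD.
have -> : 4 * (E + F) = 2 * (2 * (E + F)) by ring.
rewrite powRM ?mulr_ge0 ?addr_ge0// ler_wpM2l ?powR_ge0//.
rewrite powRM ?addr_ge0//; apply: (@le_trans _ _ (2 * (E + F) `^ r)).
  rewrite mulr_natl mulr2n; apply: lerD; apply: ge0_ler_powR => //; rewrite ?nnegrE ?addr_ge0//.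
    by rewrite lerDl.
  by rewrite lerDr.
rewrite ler_wpM2r ?powR_ge0//; rewrite -[leLHS](powRr1 (a := 2))//.
by apply: ler_powR => //; rewrite ler1n.
Qed.

Lemma lpb_sum I V p (K : Type) (s : seq K) (A : K -> I -> R) E : (1 <= p)%E -> 0 <= V -> 0 <= E ->
  (forall k i, 0 <= A k i) -> (forall k, lpb V p (A k) E) ->
  lpb V p (fun i => \sum_(k <- s) A k i) (8 ^+ size s * E).
Proof.
move=> p1 V0 E0 A0 HA; elim: s => [|k s IH].
  rewrite mul1r; under eq_fun do rewrite big_nil; move: p1.
  case: p {HA} => [r||] //=; rewrite lee_fin => r1.
  have r0 : r != 0 by rewrite gt_eqF// (lt_le_trans _ r1).
  by rewrite big1 ?mulr0 ?powR_ge0// => i _; rewrite powR0.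
under eq_fun do rewrite big_cons.
have e0 : 0 <= 8 ^+ size s * E by rewrite mulr_ge0// exprn_ge0.
have S0 i : 0 <= \sum_(k <- s) A k i by apply: sumr_ge0.
apply: (lpb_le p1 V0 _ _ _ (lpb_add p1 V0 E0 e0 (A0 k) S0 (HA k) IH)).
- by rewrite mulr_ge0// addr_ge0.
- rewrite [leRHS]/= exprS -mulrA (_ : 8 * _ = 4 * (8 ^+ size s * E + 8 ^+ size s * E)); last by ring.
  by rewrite ler_wpM2l// lerD2r ler_peMl// exprn_ege1// ler1n.
- by move=> i; rewrite lexx andbT addr_ge0.
Qed.

(** Schur's test: Jensen's inequality with a row of the kernel as the measure, then exchange of the
    sums and the column bound. *)
Lemma lpb_schur I J V p (K : I -> J -> R) (A : J -> R) (S E : R) : (1 <= p)%E ->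
  0 <= V -> 0 < S -> 0 <= E -> (forall i j, 0 <= K i j) -> (forall j, 0 <= A j) ->
  (forall i, \sum_j K i j <= S) -> (forall j, \sum_i K i j <= S) ->
  lpb V p A E -> lpb V p (fun i => \sum_j K i j * A j) (S * E).
Proof.
case: p => [r||] //=; rewrite ?lee_fin => r1 V0 S0 E0 K0 A0 row col H; last first.
  move=> i; apply: (@le_trans _ _ (\sum_j K i j * E)); first by apply: ler_sum => j _; rewrite ler_wpM2l.
  by rewrite -mulr_suml ler_wpM2r.
have r0 : 0 < r by exact: lt_le_trans r1.
pose a i := (\sum_j K i j * A j) / S.
have a0 i : 0 <= a i by rewrite divr_ge0 ?(ltW S0)//; apply: sumr_ge0 => j _; rewrite mulr_ge0.
have step i : S * a i `^ r <= \sum_j K i j * A j `^ r.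
  have h : r * (S * a i * a i `^ (r - 1)) <= \sum_j K i j * A j `^ r + S * ((r - 1) * a i `^ r).
    have -> : S * a i = \sum_j K i j * A j by rewrite /a mulrCA mulfV ?gt_eqF// mulr1.
    rewrite mulr_suml mulr_sumr.
    apply: (@le_trans _ _ (\sum_j K i j * (A j `^ r + (r - 1) * a i `^ r))).
      apply: ler_sum => j _; rewrite (_ : r * _ = K i j * (r * (A j * a i `^ (r - 1)))); last by ring.
      by rewrite ler_wpM2l//; exact: powR_tangent.
    under eq_bigr do rewrite mulrDr; rewrite big_split /= lerD2l -mulr_suml ler_wpM2r//.
    by rewrite mulr_ge0 ?subr_ge0// powR_ge0.
  by move: h; rewrite -mulrA mulr_powRB1//; lra.
have E1 i : (\sum_j K i j * A j) `^ r = S `^ r * a i `^ r.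
  by rewrite -powRM ?(ltW S0)// /a mulrCA mulfV ?gt_eqF// mulr1.
under eq_bigr do rewrite E1.
rewrite powRM ?(ltW S0)// -mulr_sumr mulrCA ler_wpM2l ?powR_ge0//.
apply: le_trans H; rewrite ler_wpM2l//.
rewrite -(ler_pM2l S0) !mulr_sumr; apply: (@le_trans _ _ (\sum_i \sum_j K i j * A j `^ r)).
  by apply: ler_sum => i _; exact: step.
by rewrite exchange_big /=; apply: ler_sum => j _; rewrite -mulr_suml ler_wpM2r ?powR_ge0.
Qed.

End discrete_norm.

Section integral_norm.
Context d (T : measurableType d) (R : realType) (mu : {measure set T -> \bar R}).
Implicit Types (A B : set T) (p : \bar R) (f g : T -> R).

(** Norm bounds at the level of r-th powers, so that integrals can be split over cells and summed
    without roots. *)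
Definition lpE A p f (E : R) : Prop :=
  match p with
  | r%:E => (\int[mu]_(x in A) (`|f x| `^ r)%:E <= (E `^ r)%:E)%E
  | _ => \forall x \ae mu, A x -> `|f x| <= E
  end.

Lemma measurable_powR_norm A f (r : R) : measurable_fun A f ->
  measurable_fun A (fun x => (`|f x| `^ r)%:E).
Proof.
move=> mf; apply/measurable_EFinP.
apply: (measurableT_comp (f := fun t : R => t `^ r)); first exact: measurable_powR.
exact: measurableT_comp.
Qed.

Lemma lpEP A p f (E : R) : (1 <= p)%E -> 0 <= E ->
  ('N[mu]_p[(EFin \o f) \_ A] <= E%:E)%E <-> lpE A p f E.
Proof.
case: p => [r||] //=; rewrite ?lee_fin => r1 E0.
  have r0 : 0 < r by exact: lt_le_trans r1.
  have -> : (\int[mu]_(x in A) (`|f x| `^ r)%:E = 'N[mu]_r%:E[(EFin \o f) \_ A] `^ r)%E.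
    rewrite powR_Lnorm ?gt_eqF// integral_mkcond; apply: eq_integral => x _.
    rewrite !patchE; case: ifP => _ //=.
    by rewrite normr0 powR0 ?gt_eqF.
  rewrite -poweR_EFin; have := Lnorm_ge0 mu r%:E ((EFin \o f) \_ A).
  move: ('N[mu]_r%:E[(EFin \o f) \_ A])%E => [N||] // N0.
    rewrite !poweR_EFin !lee_fin; split => h; first by apply: ge0_ler_powR; rewrite ?nnegrE ?(ltW r0).
    have rr : r * r^-1 = 1 by rewrite mulfV// gt_eqF.
    rewrite -[N](powRr1 (a := N))// -[E](powRr1 (a := E))// -rr !powRrM.
    by apply: ge0_ler_powR; rewrite ?nnegrE ?invr_ge0 ?(ltW r0) ?powR_ge0.
  by rewrite poweRyr ?gt_eqF// poweR_EFin; split; rewrite leye_eq.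
(* The L^oo norm is 0 by convention when the whole space is null; in that case every property holds
   almost everywhere. *)
rewrite unlock /=; case: ifPn => [mu0|mu0].
  split => [/ess_supP|] H; last first.
    apply/ess_supP; apply: filterS H => x /=; rewrite patchE; case: ifPn => [|_ _] /=; rewrite ?normr0 ?lee_fin//.
    by rewrite inE => Ax; apply.
  by apply: filterS H => x /=; rewrite patchE => + Ax; rewrite mem_set//= lee_fin.
rewrite lee_fin E0; split => // _; exists setT; split => //.
by apply/eqP; rewrite eq_le measure_ge0 andbT leNgt.
Qed.

Lemma lpE_le A B p f g (E F : R) : (1 <= p)%E -> measurable A -> measurable B ->
  measurable_fun A f -> measurable_fun B g -> B `<=` A -> 0 <= E -> E <= F ->
  (forall x, B x -> `|g x| <= `|f x|) -> lpE A p f E -> lpE B p g F.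
Proof.
case: p => [r||] //=; rewrite ?lee_fin => r1 mA mB mf mg BA E0 EF gf H.
  have r0 : 0 < r by exact: lt_le_trans r1.
  apply: (@le_trans _ _ (\int[mu]_(x in A) (`|f x| `^ r)%:E)%E); last first.
    apply: le_trans H _; rewrite lee_fin; apply: ge0_ler_powR; rewrite ?nnegrE ?(ltW r0)//.
    exact: le_trans EF.
  apply: (@le_trans _ _ (\int[mu]_(x in B) (`|f x| `^ r)%:E)%E); last first.
    by apply: ge0_subset_integral => //; exact: measurable_powR_norm.
  apply: ge0_le_integral => //; [exact: measurable_powR_norm|
    by apply: measurable_powR_norm; exact: measurable_funS BA mf|].
  by move=> x Bx; rewrite lee_fin; apply: ge0_ler_powR; rewrite ?nnegrE ?(ltW r0)//; exact: gf.
apply: filterS H => x H Bx; apply: le_trans (gf x Bx) _.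
exact: le_trans (H (BA _ Bx)) EF.
Qed.

Lemma lpE_add A p f g (E F : R) : (1 <= p)%E -> measurable A ->
  measurable_fun A f -> measurable_fun A g -> 0 <= E -> 0 <= F ->
  lpE A p f E -> lpE A p g F -> lpE A p (fun x => f x + g x) (4 * (E + F)).
Proof.
case: p => [r||] //=; rewrite ?lee_fin => r1 mA mf mg E0 F0 H1 H2; last first.
  apply: filterS2 H1 H2 => x H1 H2 Ax; apply: le_trans (ler_normD _ _) _.
  apply: le_trans (lerD (H1 Ax) (H2 Ax)) _.
  by rewrite ler_peMl ?addr_ge0// ler1n.
have r0 : 0 <= r by exact: le_trans r1.
have mfg : measurable_fun A (fun x => f x + g x) by exact: measurable_funD.
apply: (@le_trans _ _ (\int[mu]_(x in A) ((2 `^ r)%:E * ((`|f x| `^ r)%:E + (`|g x| `^ r)%:E)))%E).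
  apply: ge0_le_integral => //; first exact: measurable_powR_norm.
    by apply: emeasurable_funM => //; apply: emeasurable_funD; exact: measurable_powR_norm.
  move=> x Ax; rewrite -EFinD -EFinM lee_fin.
  apply: le_trans (powRD_le r1 (normr_ge0 _) (normr_ge0 _)).
  by apply: ge0_ler_powR => //; rewrite ?nnegrE ?addr_ge0//; exact: ler_normD.
rewrite ge0_integralZl//; last 2 first.
- by apply: emeasurable_funD; exact: measurable_powR_norm.
- by move=> x Ax; rewrite -EFinD lee_fin addr_ge0 ?powR_ge0.
have mpf := measurable_powR_norm r mf; have mpg := measurable_powR_norm r mg.
rewrite ge0_integralD//.
apply: le_trans (lee_wpmul2l _ (leeD H1 H2)) _ => //.
rewrite -EFinD -EFinM lee_fin.
have -> : 4 * (E + F) = 2 * (2 * (E + F)) by ring.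
rewrite powRM ?mulr_ge0 ?addr_ge0// ler_wpM2l ?powR_ge0//.
rewrite powRM ?addr_ge0//; apply: (@le_trans _ _ (2 * (E + F) `^ r)).
  rewrite mulr_natl mulr2n; apply: lerD; apply: ge0_ler_powR => //; rewrite ?nnegrE ?addr_ge0//.
    by rewrite lerDl.
  by rewrite lerDr.
rewrite ler_wpM2r ?powR_ge0//; rewrite -[leLHS](powRr1 (a := 2))//.
by apply: ler_powR => //; rewrite ler1n.
Qed.

Lemma lpE_integrable A p f (E : R) : (1 <= p)%E -> measurable A -> (mu A < +oo)%E ->
  measurable_fun A f -> lpE A p f E -> (\int[mu]_(x in A) `|f x|%:E < +oo)%E.
Proof.
move=> p1 mA Aoo mf; case: p p1 => [r||] //=; rewrite ?lee_fin => r1 H.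
  apply: (@le_lt_trans _ _ (\int[mu]_(x in A) ((`|f x| `^ r)%:E + 1))%E).
    apply: ge0_le_integral => //.
    - by apply/measurable_EFinP; exact: measurableT_comp.
    - by apply: emeasurable_funD => //; exact: measurable_powR_norm.
    move=> x Ax; rewrite -EFinD lee_fin; have [h|h] := leP `|f x| 1.
      by apply: le_trans h _; rewrite lerDr powR_ge0.
    apply: (@le_trans _ _ (`|f x| `^ r)); last by rewrite lerDl.
    rewrite -[leLHS](powRr1 (normr_ge0 _)); apply: ler_powR => //; exact: ltW.
  have mpf := measurable_powR_norm r mf.
  rewrite ge0_integralD// integral_cst// mul1e lte_add_pinfty//; exact: le_lt_trans H (ltry _).
apply: (@le_lt_trans _ _ (\int[mu]_(x in A) `|E|%:E)%E).
  apply: ae_ge0_le_integral => //; first by apply/measurable_EFinP; exact: measurableT_comp.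
  apply: filterS H => x H Ax; rewrite lee_fin; exact: le_trans (H Ax) (ler_norm _).
rewrite integral_cst//; exact: lte_mul_pinfty.
Qed.

(** Normalised by a fixed upper bound [V] of the measure, so that all cells share the weight [V] of
    [lpb]. *)
Definition mean (V : R) A f : R := fine (\int[mu]_(x in A) `|f x|%:E)%E / V.

Lemma mean_ge0 V A f : 0 < V -> 0 <= mean V A f.
Proof.
move=> V0; rewrite divr_ge0 ?(ltW V0)//; apply: fine_ge0.
exact: integral_ge0.
Qed.

(** Jensen's inequality on a set of measure at most [V], by integrating the tangent inequality at
    the mean. *)
Lemma mean_powR (V : R) A f (r : R) : 1 <= r -> 0 < V -> measurable A -> (mu A <= V%:E)%E ->
  measurable_fun A f -> (\int[mu]_(x in A) `|f x|%:E < +oo)%E ->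
  ((V * mean V A f `^ r)%:E <= \int[mu]_(x in A) (`|f x| `^ r)%:E)%E.
Proof.
move=> r1 V0 mA AV mf foo; have r0 : 0 < r by exact: lt_le_trans r1.
set a := mean V A f; have a0 : 0 <= a by exact: mean_ge0.
have mnf : measurable_fun A (fun x => `|f x|%:E) by apply/measurable_EFinP; exact: measurableT_comp.
have mpf := measurable_powR_norm r mf.
have I0 : (0 <= \int[mu]_(x in A) `|f x|%:E)%E by exact: integral_ge0.
have IE : (\int[mu]_(x in A) `|f x|%:E = (V * a)%:E)%E.
  by rewrite /a /mean mulrCA mulfV ?gt_eqF// mulr1 fineK// ge0_fin_numE.
have h : ((r * (V * a * a `^ (r - 1)))%:E <=
    \int[mu]_(x in A) (`|f x| `^ r)%:E + (V * ((r - 1) * a `^ r))%:E)%E.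
  have c0 : 0 <= r * a `^ (r - 1) by rewrite mulr_ge0 ?powR_ge0// ltW.
  have d0 : 0 <= (r - 1) * a `^ r by rewrite mulr_ge0 ?powR_ge0// subr_ge0.
  apply: (@le_trans _ _ (\int[mu]_(x in A) ((`|f x| `^ r)%:E + ((r - 1) * a `^ r)%:E))%E).
    rewrite (_ : (r * (V * a * a `^ (r - 1)))%:E = ((r * a `^ (r - 1))%:E * \int[mu]_(x in A) `|f x|%:E)%E); last first.
      by rewrite IE -EFinM; congr EFin; ring.
    rewrite -ge0_integralZl//; apply: ge0_le_integral => //.
    - by move=> x Ax; rewrite mule_ge0// lee_fin.
    - exact: emeasurable_funM.
    - exact: emeasurable_funD.
    move=> x Ax; rewrite -EFinM -EFinD lee_fin; apply: le_trans (powR_tangent r1 (normr_ge0 _) a0).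
    by rewrite le_eqVlt; apply/orP; left; apply/eqP; ring.
  rewrite ge0_integralD//.
  rewrite leeD2l// integral_cst// [leRHS]EFinM muleC; exact: lee_wpmul2r.
have d0 : 0 <= V * ((r - 1) * a `^ r) by rewrite !mulr_ge0 ?powR_ge0 ?subr_ge0// ltW.
move: h; rewrite -leeBlDr// -EFinB; apply: le_trans; rewrite lee_fin.
by rewrite -[V * a * _]mulrA mulr_powRB1//; lra.
Qed.

Lemma lpb_mean (I : finType) (V : R) A (B : I -> set T) p f (E : R) : (1 <= p)%E -> 0 < V ->
  0 <= E -> measurable A -> (forall i, measurable (B i)) -> (forall i, B i `<=` A) ->
  (forall i, (mu (B i) <= V%:E)%E) -> trivIset setT B -> measurable_fun A f ->
  lpE A p f E -> lpb V p (fun i => mean V (B i) f) E.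
Proof.
move=> p1 V0 E0 mA mB BA BV tB mf H.
have mfB i : measurable_fun (B i) f by exact: measurable_funS (BA i) mf.
have foo i : (\int[mu]_(x in B i) `|f x|%:E < +oo)%E.
  apply: (lpE_integrable p1 (mB i) _ (mfB i)); first exact: le_lt_trans (BV i) (ltry _).
  exact: (lpE_le p1 mA (mB i) mf (mfB i) (BA i) E0 (lexx E) (fun x _ => lexx _) H).
case: p p1 H => [r||] //=; rewrite ?lee_fin => r1 H.
  have r0 : 0 < r by exact: lt_le_trans r1.
  rewrite -lee_fin mulr_sumr -sumEFin.
  apply: (@le_trans _ _ (\sum_i \int[mu]_(x in B i) (`|f x| `^ r)%:E)%E).
    by apply: lee_sum => i _; exact: mean_powR.
  apply: le_trans H; set D := \big[setU/set0]_(i <- index_enum I) B i.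
  have DA : D `<=` A by rewrite /D; elim/big_ind: _ => // X Y XA YA x [/XA|/YA].
  have mD : measurable D by exact: bigsetU_measurable.
  rewrite -ge0_integral_bigsetU//; first last.
  - by apply: measurable_powR_norm; exact: measurable_funS DA mf.
  - by move=> i j _ _; exact: tB.
  - exact: index_enum_uniq.
  by apply: ge0_subset_integral => //; exact: measurable_powR_norm.
move=> i; rewrite ler_pdivrMr// -lee_fin fineK; last by rewrite ge0_fin_numE// integral_ge0.
apply: (@le_trans _ _ (\int[mu]_(x in B i) E%:E)%E).
  apply: ae_ge0_le_integral => //; first by apply/measurable_EFinP; exact: measurableT_comp.
  by apply: filterS H => x H Bx; rewrite lee_fin H//; exact: BA Bx.
by rewrite integral_cst// EFinM lee_wpmul2l.
Qed.


Lemma sum_integral (I : finType) A (B : I -> set T) (F : T -> \bar R) :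
  measurable A -> (forall i, measurable (B i)) -> (forall i, B i `<=` A) ->
  measurable_fun A F -> (forall x, A x -> (0 <= F x)%E) ->
  (\sum_i \int[mu]_(x in B i) F x = \int[mu]_(x in A) \sum_i (F \_ (B i)) x)%E.
Proof.
move=> mA mB BA mF F0; rewrite ge0_integral_sum//.
- by apply: eq_bigr => i _; rewrite -integral_mkcondr setIidr//; exact: BA.
- move=> i; rewrite -measurable_restrict//.
  by rewrite setIidr; [exact: measurable_funS (BA i) mF|exact: BA].
- by move=> i x Ax; rewrite patchE; case: ifP => _ //; exact: F0.
Qed.

Lemma lpE_cover (I : finType) A (B : I -> set T) p f (e : I -> R) (E : R) :
  (1 <= p)%E -> measurable A -> (forall i, measurable (B i)) ->
  (forall i, B i `<=` A) -> (forall x, A x -> exists i, B i x) -> measurable_fun A f ->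
  (forall i, lpE (B i) p f (e i)) -> lpb 1 p e E -> lpE A p f E.
Proof.
move=> p1 mA mB BA AB mf; case: p p1 => [r||] //=; rewrite ?lee_fin => r1 Hf He.
  have mpf := measurable_powR_norm r mf.
  apply: (@le_trans _ _ (\sum_i \int[mu]_(x in B i) (`|f x| `^ r)%:E)%E); last first.
    apply: (@le_trans _ _ (\sum_i (e i `^ r)%:E)%E); first exact: lee_sum.
    by rewrite sumEFin lee_fin; move: He; rewrite mul1r.
  rewrite (sum_integral mA mB BA mpf)//; apply: ge0_le_integral => //.
    apply: emeasurable_sum => i; rewrite -measurable_restrict//.
    by rewrite setIidr; [exact: measurable_funS (BA i) mpf|exact: BA].
  move=> x Ax; have [i Bi] := AB x Ax.
  rewrite (bigD1 i)//= patchE mem_set// leeDl// sume_ge0// => j _.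
  by rewrite patchE; case: ifP => // _; rewrite lee_fin powR_ge0.
have H : \forall x \ae mu, forall i, B i x -> `|f x| <= e i by exact: filter_forall.
by apply: filterS H => x H Ax; have [i Bi] := AB x Ax; exact: le_trans (H i Bi) (He i).
Qed.

Lemma lpE_cover_sup (I : finType) (V : R) A (B : I -> set T) p f (e : I -> R) (E : R) :
  (1 <= p)%E -> 0 <= V -> (forall i, 0 <= e i) -> measurable A -> (forall i, measurable (B i)) ->
  (forall i, (mu (B i) <= V%:E)%E) ->
  (forall i, B i `<=` A) -> (forall x, A x -> exists i, B i x) -> measurable_fun A f ->
  (forall i x, B i x -> `|f x| <= e i) -> lpb V p e E -> lpE A p f E.
Proof.
move=> p1 V0 e0 mA mB BV BA AB mf Hf He.
case: p p1 He => [r||] //=; rewrite ?lee_fin => r1 He; last first.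
  by apply: aeW => x Ax; have [i Bi] := AB x Ax; exact: le_trans (Hf i x Bi) (He i).
have r0 : 0 < r by exact: lt_le_trans r1.
apply: (@lpE_cover I A B r%:E f (fun i => V `^ r^-1 * e i)) => //=.
  move=> i; have mfB := measurable_funS mA (BA i) mf.
  apply: (@le_trans _ _ (\int[mu]_(x in B i) (e i `^ r)%:E)%E).
    apply: ge0_le_integral => //; first exact: measurable_powR_norm.
    by move=> x Bx; rewrite lee_fin; apply: ge0_ler_powR; rewrite ?nnegrE ?(ltW r0)//; exact: Hf.
  rewrite integral_cst// powRM ?powR_ge0// -powRrM mulVf ?gt_eqF// powRr1//.
  by rewrite [leRHS]EFinM muleC; apply: lee_wpmul2r => //; rewrite lee_fin powR_ge0.
rewrite mul1r; apply: le_trans He; rewrite mulr_sumr; apply: ler_sum => i _.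
by rewrite powRM ?powR_ge0// -powRrM mulVf ?gt_eqF// powRr1.
Qed.

(** For finite [p] the local norms themselves are the witnesses: each point is counted at most [K]
    times, and K^(1/r) <= K. *)
Lemma lpE_overlap (I : finType) A (B : I -> set T) (K : nat) p f (E : R) :
  (1 <= p)%E -> 0 <= E -> measurable A -> (forall i, measurable (B i)) ->
  (forall i, B i `<=` A) -> measurable_fun A f -> (0 < K)%N ->
  (forall x, A x -> (#|[pred i | x \in B i]| <= K)%N) ->
  lpE A p f E -> exists2 e : I -> R, (forall i, 0 <= e i /\ lpE (B i) p f (e i)) & lpb 1 p e (K%:R * E).
Proof.
move=> p1 E0 mA mB BA mf K0 BK H.
have K1 : 1 <= K%:R :> R by rewrite ler1n.
case: p p1 H => [r||] //=; rewrite ?lee_fin => r1 H; last first.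
  exists (fun=> E) => [i|i]; last by rewrite ler_peMl.
  by split => //; apply: filterS H => x H Bx; exact: H (BA _ _ Bx).
have r0 : 0 < r by exact: lt_le_trans r1.
have mpf := measurable_powR_norm r mf.
have le1 i : (\int[mu]_(x in B i) (`|f x| `^ r)%:E <= (E `^ r)%:E)%E.
  by apply: le_trans H; apply: ge0_subset_integral => //; exact: BA.
have ge0 i : (0 <= \int[mu]_(x in B i) (`|f x| `^ r)%:E)%E.
  by apply: integral_ge0 => x _; rewrite lee_fin powR_ge0.
pose e i := fine (\int[mu]_(x in B i) (`|f x| `^ r)%:E)%E `^ r^-1.
have eE i : (\int[mu]_(x in B i) (`|f x| `^ r)%:E = (e i `^ r)%:E)%E.
  rewrite /e -powRrM mulVf ?gt_eqF// powRr1 ?fine_ge0// fineK// ge0_fin_numE//.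
  exact: le_lt_trans (le1 i) (ltry _).
exists e => [i|]; first by rewrite powR_ge0 eE.
rewrite mul1r -lee_fin -sumEFin.
under eq_bigr do rewrite -eE.
rewrite (sum_integral mA mB BA mpf)//.
apply: (@le_trans _ _ (\int[mu]_(x in A) (K%:R%:E * (`|f x| `^ r)%:E))%E).
  apply: ge0_le_integral => //.
  - by move=> x Ax; apply: sume_ge0 => i _; rewrite patchE; case: ifP => // _; rewrite lee_fin powR_ge0.
  - apply: emeasurable_sum => i; rewrite -measurable_restrict//.
    by rewrite setIidr; [exact: measurable_funS (BA i) mpf|exact: BA].
  - exact: emeasurable_funM.
  move=> x Ax; rewrite (bigID (fun i => x \in B i)) /= [X in (_ + X)%E]big1; last first.
    by move=> i; rewrite patchE => /negbTE ->.
  rewrite adde0 (eq_bigr (fun=> (`|f x| `^ r)%:E)); last by move=> i; rewrite patchE => ->.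
  rewrite sumEFin -EFinM lee_fin sumr_const -[leLHS]mulr_natl ler_wpM2r ?powR_ge0// ler_nat.
  exact: BK.
rewrite ge0_integralZl//.
apply: (@le_trans _ _ (K%:R%:E * (E `^ r)%:E)%E); first exact: lee_wpmul2l.
rewrite -EFinM lee_fin powRM// ler_wpM2r ?powR_ge0//.
by rewrite -[leLHS](powRr1 (a := K%:R))//; exact: ler_powR.
Qed.

End integral_norm.

Section pullback_norm.
Context {R : realType} {D : nat}.
Local Notation mu := (lebesgue_rV R D).
Local Notation Om := (@Omega R D).
Variables (phi : 'rV[R]_D -> 'rV[R]_D) (L : R).
Hypothesis L1 : 1 <= L.
Hypothesis mphi : measurable_fun Om phi.
Hypothesis phiO : forall x, Om x -> Om (phi x).
Hypothesis lip : forall x y, Om x -> Om y -> `|x - y| <= L * `|phi x - phi y|.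

Lemma measurable_pullback (f : 'rV[R]_D -> R) : measurable_fun Om f -> measurable_fun Om (f \o phi).
Proof.
move=> mf; apply: (measurable_comp measurable_Omega _ mf mphi).
by move=> _ [x Ox <-]; exact: phiO.
Qed.

(** For finite [p]: the pushforward of Lebesgue measure by [phi] is dominated on [Om] by a multiple
    of Lebesgue measure, and integrals are monotone in the measure. For infinite [p]: preimages of
    null sets are null. *)
Lemma pullback_lpE p f (E : R) : (1 <= p)%E -> 0 <= E -> measurable_fun Om f ->
  lpE mu Om p f E -> lpE mu Om p (f \o phi) ((4 * L) ^+ D * E).
Proof.
have mO : measurable Om by exact: measurable_Omega.
have C1 : 1 <= (4 * L) ^+ D by rewrite exprn_ege1//; have := L1; lra.
have C0 : 0 <= (4 * L) ^+ D by exact: le_trans C1.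
move=> p1 E0 mf; have mff := measurable_pullback mf.
case: p p1 => [r||] //=; rewrite ?lee_fin => r1 H; last first.
  have mA : measurable (Om `&` [set x | E < `|f x|]).
    have h : measurable_fun Om (fun x => `|f x|) by exact: measurableT_comp.
    have := h mO `]E, +oo[%classic (measurable_itv _).
    by congr measurable; apply/seteqP; split => x /=; rewrite in_itv /= andbT.
  have muA : mu (Om `&` [set x | E < `|f x|]) = 0.
    apply/eqP; rewrite eq_le measure_ge0 andbT.
    have [N [mN N0 HN]] := H; rewrite -N0; apply: le_measure; rewrite ?inE//.
    apply: subset_trans HN => x [Ox Ef] /= /(_ Ox); apply/negP; rewrite -ltNge; exact: Ef.
  exists (Om `&` phi @^-1` (Om `&` [set x | E < `|f x|])); split.
  - exact: mphi.
  - apply/eqP; rewrite eq_le measure_ge0 andbT.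
    apply: le_trans (pullback_measure L1 mphi phiO lip mA) _.
    by rewrite setIA setIid muA mule0.
  move=> x /= nP; have [Ox|nOx] := pselect (Om x); last by exfalso; apply: nP.
  split => //; split; first exact: phiO.
  rewrite /= ltNge; apply/negP => h; apply: nP => _; apply: le_trans h _.
  by rewrite ler_peMl.
have r0 : 0 < r by exact: lt_le_trans r1.
(* Points outside [Om] are sent to 0, which is then not a point of [Om], so preimages of subsets of
   [Om] stay in [Om]. *)
pose phi' := phi \_ Om.
have mphi' : measurable_fun setT phi' by apply/(measurable_restrictT phi mO).
have phiE (S : set 'rV[R]_D) : phi' @^-1` (Om `&` S) = Om `&` phi @^-1` S.
  apply/seteqP; split => x; rewrite /preimage /= /phi' patchE; case: ifPn => [xO|xO].
  - by rewrite inE in xO => -[].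
  - move=> [Op _]; exfalso; move: xO; rewrite notin_setE; apply => j.
    by have := Op j; rewrite !mxE ltxx.
  - by move=> [Ox Sx]; split => //; exact: phiO.
  - by move=> [Ox Sx]; rewrite mem_set in xO.
pose m0 := (pushforward mu phi' : {measure set 'rV[R]_D -> \bar R}).
pose m1 := m0 mphi'.
have mOc : measurable (~` Om) by exact: measurableC.
pose Cn : {nonneg R} := NngNum C0.
(* The restricted term makes the comparison true on all measurable sets; it gives no mass to [Om]
   and drops out of the integrals there. *)
pose m2 := measure_add (mscale Cn mu) (mrestr m1 mOc).
have m12 S : measurable S -> (m1 S <= m2 S)%E.
  move=> mS; rewrite /m2 measure_addE.
  have mOS : measurable (Om `&` S) by exact: measurableI.
  have mSO : measurable (S `&` ~` Om) by exact: measurableI.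
  have -> : m1 S = (m1 (Om `&` S) + m1 (S `&` ~` Om))%E.
    rewrite -measureU//; first by rewrite [Om `&` _]setIC -setIUr setUv setIT.
    by rewrite -subset0 => x [[Ox _] [_ nO]].
  apply: leeD => //; rewrite /m1 /= /pushforward phiE /mscale /=.
  apply: le_trans (pullback_measure L1 mphi phiO lip mS) _.
  apply: lee_wpmul2l; first by rewrite lee_fin.
  by apply: le_measure; rewrite ?inE.
have mpf := measurable_powR_norm r mf.
pose F := ((fun x => (`|f x| `^ r)%:E) \_ Om).
have mF : measurable_fun setT F by apply/(measurable_restrictT _ mO).
have F0 x : (0 <= F x)%E by rewrite /F patchE; case: ifP => // _; rewrite lee_fin powR_ge0.
have h := ge0_le_measure_integral m12 mO F0 mF.
have FE (m : {measure set 'rV[R]_D -> \bar R}) : (\int[m]_(x in Om) F x = \int[m]_(x in Om) (`|f x| `^ r)%:E)%E.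
  by apply: eq_integral => x Ox; rewrite /F patchE Ox.
rewrite !FE in h.
have e1 : (\int[m1]_(x in Om) (`|f x| `^ r)%:E = \int[mu]_(x in Om) (`|f (phi x)| `^ r)%:E)%E.
  have p0 : {in Om, forall y, (0 <= (`|f y| `^ r)%:E)%E} by move=> y _; rewrite lee_fin powR_ge0.
  rewrite [LHS](ge0_integral_pushforward mphi' mu mO mpf p0).
  have -> : phi' @^-1` Om = Om by have := phiE setT; rewrite preimage_setT !setIT.
  by apply: eq_integral => x Ox; rewrite /= /phi' patchE Ox.
rewrite -e1; apply: le_trans h _.
have p0 x : Om x -> (0 <= (`|f x| `^ r)%:E)%E by move=> _; rewrite lee_fin powR_ge0.
rewrite (ge0_integral_measure_add _ _ mO p0 mpf).
have n0 : mrestr m1 mOc Om = 0 by rewrite /mrestr setICr measure0.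
rewrite [X in (_ + X)%E](null_set_integral mO mpf n0) adde0.
rewrite (ge0_integral_mscale _ mO _ mpf p0).
apply: le_trans (lee_wpmul2l _ H) _; first by rewrite lee_fin.
rewrite -EFinM lee_fin powRM// ler_wpM2r ?powR_ge0//= -[leLHS](powRr1 C0).
exact: ler_powR.
Qed.

End pullback_norm.

(** * Bump functions *)

Section smooth_functions.
Context {R : realType}.
Implicit Types (f g : R -> R).

Fixpoint ck (k : nat) f : Prop :=
  if k is k'.+1 then (forall t : R, derivable f t 1) /\ ck k' (derive1 f) else True.

Lemma ckW k f : ck k.+1 f -> ck k f.
Proof. by elim: k f => [//|k IH] f [df cf]; split => //; exact: IH. Qed.

Lemma ckD k f g : ck k f -> ck k g -> ck k (fun t => f t + g t).
Proof.
elim: k f g => [//|k IH] f g [df cf] [dg cg]; split => [t|].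
  exact: derivableD.
rewrite (_ : derive1 _ = fun t => derive1 f t + derive1 g t); first exact: IH.
by apply/funext => t; rewrite !derive1E deriveD.
Qed.

Lemma ckM k f g : ck k f -> ck k g -> ck k (fun t => f t * g t).
Proof.
elim: k f g => [//|k IH] f g cf cg; have [df cf'] := cf; have [dg cg'] := cg.
split => [t|]; first exact: derivableM.
rewrite (_ : derive1 _ = fun t => f t * derive1 g t + g t * derive1 f t).
  by apply: ckD; apply: IH => //; exact: ckW.
by apply/funext => t; rewrite !derive1E deriveM.
Qed.

Lemma ck_cst k (c : R) : ck k (fun=> c).
Proof.
elim: k c => [//|k IH] c; split => [t|]; first exact: derivable_cst.
by rewrite (_ : derive1 _ = fun=> 0) //; apply/funext => t; rewrite derive1_cst.
Qed.

Lemma is_derive_affine f (a b t d : R) : is_derive (a * t + b) 1 f d ->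
  is_derive t 1 (fun s => f (a * s + b)) (a * d).
Proof.
move=> H; have h : is_derive t 1 (fun s : R => a * s + b) a.
  apply: (is_derive_eq (is_deriveD (is_deriveZ (f := id) a (is_derive_id t (1 : R))) (is_derive_cst b t (1 : R)))).
  by rewrite addr0 /GRing.scale /= mulr1.
have := is_derive1_comp (g := fun s : R => a * s + b) H h.
by rewrite mulrC.
Qed.

Lemma ck_affine k f (a b : R) : ck k f -> ck k (fun t => f (a * t + b)).
Proof.
elim: k f => [//|k IH] f [df cf].
have H (t : R) : is_derive t 1 (fun s => f (a * s + b)) (a * derive1 f (a * t + b)).
  by apply: is_derive_affine; rewrite derive1E; exact/derivableP.
split => [t|]; first by have [] := H t.
rewrite (_ : derive1 _ = fun t => a * derive1 f (a * t + b)).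
  by apply: ckM; [exact: ck_cst|exact: IH].
by apply/funext => t; rewrite derive1E; have [_ ->] := H t.
Qed.

Lemma ck_derive1n f : (forall k, ck k f) -> forall i (t : R), is_derive t 1 (derive1n i f) (derive1n i.+1 f t).
Proof.
move=> cf i t; have H j : forall k, ck k (derive1n j f).
  by elim: j => [//|j IH] k; have [_ h] := IH k.+1; rewrite derive1nS.
rewrite derive1nS derive1E; have [h _] := H i 1%N; exact/derivableP.
Qed.

(* [flat p] is [p(1/t) exp(-1/t)] for [t > 0], and a class of functions of this
   form is closed under differentiation. *)
Definition flat (p : {poly R}) (t : R) : R :=
  if 0 < t then p.[t^-1] * expR (- t^-1) else 0.

Lemma flat_bound p : exists2 C : R, 0 <= C & forall t, 0 < t <= 1 -> `|flat p t| <= C * t ^+ 2.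
Proof.
(* Two powers more than the polynomial uses: once the exponential beats the [N]-th power, they leave
   the factor [t ^+ 2] that makes the derivative at 0 vanish. *)
pose S := \sum_(i < size p) `|p`_i|; pose N := (size p).+2.
have S0 : 0 <= S by exact: sumr_ge0.
have N0 : 0 < N%:R :> R by rewrite ltr0n.
exists (S * N%:R ^+ N) => [|t /andP[t0 t1]]; first by rewrite mulr_ge0// exprn_ge0.
rewrite /flat t0; set y := t^-1; have y1 : 1 <= y by rewrite invf_ge1.
have y0 : 0 < y by exact: lt_le_trans y1.
have py : `|p.[y]| <= S * y ^+ size p.
  rewrite horner_coef mulr_suml; apply: le_trans (ler_norm_sum _ _ _) _.
  apply: ler_sum => i _; rewrite normrM ler_wpM2l// ger0_norm ?exprn_ge0 ?(ltW y0)//.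
  by apply: ler_weXn2l => //; exact: ltnW (ltn_ord i).
have ey : (y / N%:R) ^+ N <= expR y.
  have -> : expR y = expR (y / N%:R) ^+ N.
    by rewrite -expRM_natl -mulr_natl mulrCA mulfV ?gt_eqF// mulr1.
  rewrite lerXn2r// ?nnegrE ?expR_ge0 ?divr_ge0 ?(ltW y0)//.
  by apply: le_trans (expR_ge1Dx _); rewrite lerDr.
have -> : t ^+ 2 = (y ^+ 2)^-1 by rewrite /y exprVn invrK.
rewrite normrM (ger0_norm (expR_ge0 _)) expRN.
rewrite ler_pdivrMr ?expR_gt0// mulrAC ler_pdivlMr ?exprn_gt0//.
apply: (@le_trans _ _ (S * y ^+ size p * y ^+ 2)); first by rewrite ler_wpM2r// exprn_ge0// ltW.
rewrite -mulrA -exprD addn2 -/N -mulrA ler_wpM2l//.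
by move: ey; rewrite expr_div_n ler_pdivrMr ?exprn_gt0// mulrC.
Qed.

Lemma gt_near (x a : R) : a < x -> \forall y \near x, a < y.
Proof. by move=> h; apply: open_nbhs_nbhs; split => //; exact: open_gt. Qed.

Lemma is_derive_quadratic f (C : R) : 0 <= C -> (forall t, `|t| <= 1 -> `|f t| <= C * t ^+ 2) ->
  is_derive (0 : R) 1 f 0.
Proof.
move=> C0 H; have f0 : f 0 = 0.
  by apply/eqP; rewrite -normr_le0; have := H 0; rewrite normr0 expr0n mulr0; exact.
have c : h^-1 *: (f (h *: (1 : R) + 0) - f 0) @[h --> 0^'] --> (0 : R).
  apply/cvgrPdist_le => e e0; near=> h.
  have h0 : h != 0 by near: h; exact: nbhs_dnbhs_neq.
  have h1 : `|h| <= 1 by near: h; apply: dnbhs0_le.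
  have h2 : `|h| <= e / (C + 1) by near: h; apply: dnbhs0_le; rewrite divr_gt0// ltr_wpDl.
  rewrite f0 sub0r normrN subr0 addr0 /GRing.scale /= mulr1 normrM normfV.
  rewrite ler_pdivrMl ?normr_gt0//; apply: le_trans (H h h1) _.
  rewrite -real_normK ?num_real// expr2 mulrCA ler_wpM2l//.
  apply: (@le_trans _ _ ((C + 1) * `|h|)); first by rewrite ler_wpM2r// lerDl.
  by rewrite mulrC -ler_pdivlMr// ltr_wpDl.
split; first by apply/cvg_ex; exists 0.
by apply/cvg_lim.
Unshelve. all: by end_near.
Qed.

Lemma is_derive_flat p (t : R) : is_derive t 1 (flat p) (flat ('X^2 * (p - p^`())) t).
Proof.
have [t0|t0|->] := ltgtP t 0.
- rewrite {2}/flat ltNge (ltW t0) /=.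
  apply: near_eq_is_derive (is_derive_cst (0 : R) t 1) => //.
  near=> s; rewrite /flat ltNge (_ : s <= 0)//; apply: ltW; near: s; exact: lt_nbhsl.
- have h : is_derive t 1 (fun s : R => p.[s^-1] * expR (- s^-1)) (flat ('X^2 * (p - p^`())) t).
    have tn : t != 0 by rewrite gt_eqF.
    have di : is_derive t 1 (fun s : R => s^-1) (- t ^- 2).
      apply: (is_derive_eq (is_deriveV (f := id) tn (is_derive_id t (1 : R)))).
      by rewrite /GRing.scale /= mulr1.
    have dp : is_derive t 1 (fun s : R => p.[s^-1]) (p^`().[t^-1] * - t ^- 2).
      exact: (is_derive1_comp (is_derive_poly p t^-1) di).
    have de : is_derive t 1 (fun s : R => expR (- s^-1)) (expR (- t^-1) * t ^- 2).
      have dn : is_derive t 1 (fun s : R => - s^-1) (t ^- 2).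
        by apply: (is_derive_eq (is_deriveN di)); rewrite opprK.
      exact: (is_derive1_comp (g := fun s : R => - s^-1) (is_derive_expR (- t^-1)) dn).
    apply: (is_derive_eq (is_deriveM dp de)).
    rewrite /flat t0 hornerM hornerXn hornerD hornerN -!exprVn /GRing.scale /=; ring.
  apply: near_eq_is_derive h => //.
  near=> s; rewrite /flat (_ : 0 < s)//; near: s; exact: gt_near.
- rewrite {2}/flat ltxx; have [C C0 H] := flat_bound p.
  apply: (is_derive_quadratic C0) => s; rewrite ler_norml => /andP[_ s1].
  have [s0|s0] := ltP 0 s; first by apply: H; rewrite s0.
  by rewrite /flat ltNge s0 /= normr0 mulr_ge0// sqr_ge0.
Unshelve. all: by end_near.
Qed.

Lemma ck_flat k p : ck k (flat p).
Proof.
elim: k p => [//|k IH] p; split => [t|]; first by have [] := is_derive_flat p t.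
rewrite (_ : derive1 _ = flat ('X^2 * (p - p^`()))); first exact: IH.
by apply/funext => t; rewrite derive1E; have [_ ->] := is_derive_flat p t.
Qed.

(** Supported in [1/4, 3/4], so that its scaled copy in a cell has compact support in the interior,
    also for cells at the boundary of [Omega]. *)
Definition bump (t : R) : R := flat 1 (1 * t + - 4^-1) * flat 1 (- 1 * t + 3 / 4).

Lemma ck_bump k : ck k bump.
Proof. by apply: ckM; apply: ck_affine; exact: ck_flat. Qed.

Lemma bump_out t : t <= 4^-1 \/ 3 / 4 <= t -> bump t = 0.
Proof.
rewrite /bump /flat => -[h|h].
  by rewrite ifN ?mul0r// -leNgt; lra.
by rewrite [X in _ * X]ifN ?mulr0// -leNgt; lra.
Qed.

Lemma bump_ge0 t : 0 <= bump t.
Proof.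
by rewrite mulr_ge0// /flat; case: ifP => // _; rewrite hornerC mul1r expR_ge0.
Qed.

Lemma bump_mid t : 3 / 8 <= t <= 5 / 8 -> expR (- 16) <= bump t.
Proof.
move=> /andP[t0 t1]; rewrite /bump /flat ifT; last lra.
rewrite ifT; last lra.
rewrite !hornerC !mul1r -expRD ler_expR.
have h1 : (t + - 4^-1)^-1 <= 8 by rewrite invf_ple ?posrE; lra.
have h2 : (- 1 * t + 3 / 4)^-1 <= 8 by rewrite invf_ple ?posrE; lra.
lra.
Qed.

Definition dbump (i : nat) : R -> R := derive1n i bump.

Lemma is_derive_dbump i (t : R) : is_derive t 1 (dbump i) (dbump i.+1 t).
Proof. by apply: ck_derive1n => k; exact: ck_bump. Qed.

Lemma continuous_dbump i : continuous (dbump i).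
Proof.
move=> t; apply: differentiable_continuous; apply/derivable1_diffP.
by have [] := is_derive_dbump i t.
Qed.

Lemma dbump_out i t : t < 4^-1 \/ 3 / 4 < t -> dbump i t = 0.
Proof.
elim: i t => [|i IH] t h.
  by apply: bump_out; case: h => /ltW; [left|right].
have [_ <-] := is_derive_dbump i t.
rewrite -[RHS](derive_cst (0 : R) t (1 : R)); apply: near_eq_derive => //.
by case: h => h; near=> s; apply: IH; [left|right]; near: s; [exact: lt_nbhsl|exact: gt_near].
Unshelve. all: by end_near.
Qed.

Lemma dbump_bound i : exists2 C : R, 0 <= C & forall t, `|dbump i t| <= C.
Proof.
have cn : {within `[0, 1], continuous (fun t => `|dbump i t|)}.
  apply: continuous_subspaceT => t.
  by apply: cvg_norm; exact: continuous_dbump.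
have [c _ Hc] := EVT_max ler01 cn.
exists `|dbump i c| => // t.
have [t0|t0] := ltP t 0; first by rewrite dbump_out ?normr0//; left; lra.
have [t1|t1] := ltP 1 t; first by rewrite dbump_out ?normr0//; right; lra.
by apply: Hc; rewrite in_itv /= t0.
Qed.

End smooth_functions.

(** * Moments: pairing of monomials with derivatives of the bump *)

Section bump_moments.
Context {R : realType}.
Local Notation leb := (@lebesgue_measure R).

Definition moment_fun (m q : nat) (a b : nat) (x : R) : R :=
  (m%:R * x - q%:R) ^+ a * dbump b (m%:R * x - q%:R).

Lemma moment_fun_out m q a b (x : R) : m%:R * x < q%:R \/ q.+1%:R < m%:R * x ->
  moment_fun m q a b x = 0.
Proof.
rewrite -natr1 => h; rewrite /moment_fun dbump_out ?mulr0//.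
by case: h => h; [left|right]; lra.
Qed.

Lemma continuous_moment_fun m q a b : continuous (moment_fun m q a b).
Proof.
move=> x; have ca : {for x, continuous (fun y : R => m%:R * y - q%:R)}.
  by apply: cvgB; [apply: cvgM; [exact: cvg_cst|exact: cvg_id]|exact: cvg_cst].
rewrite /moment_fun; apply: cvgM.
  by apply: (continuous_comp (g := fun t : R => t ^+ a) ca); exact: exprn_continuous.
by apply: (continuous_comp (g := dbump b) ca); exact: continuous_dbump.
Qed.

Lemma moment_fun_bound a b : exists2 C : R, 0 <= C & forall m q x, `|moment_fun m q a b x| <= C.
Proof.
have [C C0 H] := dbump_bound (R := R) b.
exists C => // m q x; set t := m%:R * x - q%:R.
rewrite /moment_fun -/t.
have [t0|t0] := ltP t 0; first by rewrite dbump_out ?mulr0 ?normr0//; left; lra.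
have [t1|t1] := ltP 1 t; first by rewrite dbump_out ?mulr0 ?normr0//; right; lra.
rewrite normrM normrX -[leRHS]mul1r ler_pM// ger0_norm//.
exact: exprn_ile1.
Qed.

Definition moment (m q a b : nat) : R := \int[leb]_x moment_fun m q a b x.

Definition unit_cell (m q : nat) : set (measurableTypeR R) := `[q%:R / m%:R, q.+1%:R / m%:R]%classic.

Lemma moment_cell m q a b : (0 < m)%N ->
  (\int[leb]_x (moment_fun m q a b x)%:E = \int[leb]_(x in unit_cell m q) (moment_fun m q a b x)%:E)%E.
Proof.
move=> m0; have m0R : 0 < m%:R :> R by rewrite ltr0n.
rewrite [RHS]integral_mkcond; apply: eq_integral => x _; rewrite patchE.
case: ifPn => // /negP; rewrite inE /unit_cell /= in_itv /= => h.
rewrite moment_fun_out//; apply: contrapT => /not_orP[/negP h1 /negP h2]; apply: h.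
by rewrite ler_pdivrMr// ler_pdivlMr// ![x * _]mulrC; rewrite -!leNgt in h1 h2; apply/andP.
Qed.

Lemma integrable_moment_cell m q a b : (0 < m)%N ->
  leb.-integrable (unit_cell m q) (EFin \o moment_fun m q a b).
Proof.
move=> m0; apply: continuous_compact_integrable; first exact: segment_compact.
by apply: continuous_subspaceT; exact: continuous_moment_fun.
Qed.

Lemma integrable_moment m q a b : (0 < m)%N ->
  leb.-integrable setT (EFin \o moment_fun m q a b).
Proof.
move=> m0; have := integrable_moment_cell q a b m0.
have m0R : 0 < m%:R :> R by rewrite ltr0n.
move=> /integrableP[_ h]; apply/integrableP; split.
  apply/measurable_EFinP; apply: continuous_measurable_fun.
  exact: continuous_moment_fun.
apply: le_lt_trans h; rewrite [leRHS]integral_mkcond.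
rewrite le_eqVlt; apply/orP; left; apply/eqP; apply: eq_integral => x _.
rewrite patchE; case: ifPn => // /negP; rewrite inE /unit_cell /= in_itv /= => h.
rewrite moment_fun_out ?normr0//; apply: contrapT => /not_orP[/negP h1 /negP h2]; apply: h.
by rewrite ler_pdivrMr// ler_pdivlMr// ![x * _]mulrC; rewrite -!leNgt in h1 h2; apply/andP.
Qed.

Lemma measure_unit_cell m q : (0 < m)%N -> (leb (unit_cell m q) = m%:R^-1%:E)%E.
Proof.
move=> m0; have m0R : 0 < m%:R :> R by rewrite ltr0n.
rewrite lebesgue_measure_itv /= lte_fin ltr_pM2r ?invr_gt0// ltr_nat ltnSn.
by rewrite -EFinB -mulrBl -natr1 addrAC subrr add0r mul1r.
Qed.

Lemma moment_bound a b : exists2 C : R, 0 <= C & forall m q, (0 < m)%N ->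
  `|moment m q a b| <= C / m%:R.
Proof.
have [C C0 H] := moment_fun_bound a b; exists C => // m q m0.
have mc : measurable (unit_cell m q) by exact: measurable_itv.
have -> : moment m q a b = \int[leb]_(x in unit_cell m q) moment_fun m q a b x.
  by rewrite /moment /Rintegral moment_cell.
have h := le_normr_Rintegral mc (integrable_moment_cell q a b m0); apply: (le_trans h).
have ci : leb.-integrable (unit_cell m q) (EFin \o (fun=> C)).
  by apply: continuous_compact_integrable; [exact: segment_compact|
    apply: continuous_subspaceT => x; exact: cst_continuous].
apply: (@le_trans _ _ (\int[leb]_(x in unit_cell m q) C)).
  apply: le_Rintegral => //; first exact/integrable_norm/integrable_moment_cell.
by rewrite Rintegral_cst// [X in fine X](measure_unit_cell q m0).
Qed.

Lemma is_derive_moment_fun m q a b (x : R) : is_derive x 1 (moment_fun m q a b)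
  (m%:R * (a%:R * moment_fun m q a.-1 b x + moment_fun m q a b.+1 x)).
Proof.
have dd := is_derive_affine (b := - q%:R) (is_derive_dbump b (m%:R * x - q%:R)).
have dp : is_derive x (1 : R) (fun y : R => (m%:R * y - q%:R) ^+ a) (m%:R * (a%:R * (m%:R * x - q%:R) ^+ a.-1)).
  apply: (is_derive_affine (f := fun t : R => t ^+ a) (b := - q%:R)).
  case: a => [|a]; first by rewrite mul0r; exact: is_derive_cst.
  exact: is_derive_exprS.
apply: (is_derive_eq (is_deriveM dp dd)).
by rewrite /moment_fun /GRing.scale /=; ring.
Qed.

Lemma moment_by_parts m q a b : (0 < m)%N ->
  moment m q a b.+1 = - (a%:R * moment m q a.-1 b).
Proof.
move=> m0; have m0R : 0 < m%:R :> R by rewrite ltr0n.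
pose l : R := q%:R / m%:R; pose r : R := q.+1%:R / m%:R.
have lr : l < r by rewrite ltr_pM2r ?invr_gt0// ltr_nat.
pose F := moment_fun m q a b.
pose f x := m%:R * (a%:R * moment_fun m q a.-1 b x + moment_fun m q a b.+1 x).
have cf : {within `[l, r], continuous f}.
  apply: continuous_subspaceT => x; rewrite /f; apply: cvgM; first exact: cvg_cst.
  apply: cvgD; last exact: continuous_moment_fun.
  by apply: cvgM; [exact: cvg_cst|exact: continuous_moment_fun].
have dF : derivable_oo_LRcontinuous F l r.
  split => [x _||]; first by have [] := is_derive_moment_fun m q a b x.
    by apply: cvg_at_right_filter; exact: continuous_moment_fun.
  by apply: cvg_at_left_filter; exact: continuous_moment_fun.
have Ff : {in `]l, r[, F^`()%classic =1 f}.
  by move=> x _; rewrite derive1E; have [_ ->] := is_derive_moment_fun m q a b x.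
have := continuous_FTC2 lr cf dF Ff.
have F0 x : m%:R * x = q%:R \/ m%:R * x = q.+1%:R -> F x = 0.
  rewrite /F /moment_fun -natr1 => h; rewrite dbump_out ?mulr0//.
  by case: h => ->; [left|right]; lra.
rewrite (F0 l) ?(F0 r) ?subrr; last 2 first.
- by right; rewrite /r mulrC divfK// gt_eqF.
- by left; rewrite /l mulrC divfK// gt_eqF.
move=> E; have : \int[leb]_(x in unit_cell m q) f x = 0 by rewrite /Rintegral E subee.
have i1 := integrable_moment_cell q a.-1 b m0; have i2 := integrable_moment_cell q a b.+1 m0.
have mc : measurable (unit_cell m q) by exact: measurable_itv.
have i3 : leb.-integrable (unit_cell m q) (EFin \o (fun x => a%:R * moment_fun m q a.-1 b x)).
  exact: (integrableZl mc a%:R i1).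
have i4 : leb.-integrable (unit_cell m q) (EFin \o (fun x => a%:R * moment_fun m q a.-1 b x + moment_fun m q a b.+1 x)).
  exact: (integrableD mc i3 i2).
rewrite /f RintegralZl// RintegralD// RintegralZl// => /eqP; rewrite mulf_eq0 (gt_eqF m0R) /= => /eqP.
rewrite /moment /Rintegral !moment_cell// -/(Rintegral _ _ _) => h.
by apply/eqP; rewrite -addr_eq0 addrC; apply/eqP.
Qed.

(** Each integration by parts takes one derivative of the monomial, and nothing is left after more
    than [a] of them. Together with [moment_diag] this makes the matrix of moments triangular with
    nonzero diagonal. *)
Lemma moment_lt m q a b : (0 < m)%N -> (a < b)%N -> moment m q a b = 0.
Proof.
move=> m0; elim: b a => [//|b IH] [|a] ab; rewrite moment_by_parts// ?mul0r ?oppr0//.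
by rewrite IH// mulr0 oppr0.
Qed.

Lemma moment_diag m q b : (0 < m)%N -> moment m q b b = (-1) ^+ b * b`!%:R * moment m q 0 0.
Proof.
move=> m0; elim: b => [|b IH]; first by rewrite !mul1r.
by rewrite moment_by_parts//= IH factS natrM exprS; ring.
Qed.

Lemma moment0_ge : exists2 c : R, 0 < c & forall m q, (0 < m)%N -> c / m%:R <= moment m q 0 0.
Proof.
(* The bump is at least [expR (- 16)] on [3/8, 5/8], an interval of length 1/4. *)
exists (expR (- 16) / 4) => [|m q m0]; first by rewrite divr_gt0 ?expR_gt0.
have m0R : 0 < m%:R :> R by rewrite ltr0n.
pose l : R := (q%:R + 3 / 8) / m%:R; pose r : R := (q%:R + 5 / 8) / m%:R.
have mI : measurable (`[l, r]%classic : set (measurableTypeR R)) by exact: measurable_itv.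
have lr : l < r by rewrite ltr_pM2r ?invr_gt0//; lra.
have f0 x : 0 <= moment_fun m q 0 0 x by rewrite /moment_fun expr0 mul1r; exact: bump_ge0.
have mf : measurable_fun setT (fun x => (moment_fun m q 0 0 x)%:E).
  apply/measurable_EFinP; apply: continuous_measurable_fun; exact: continuous_moment_fun.
rewrite -lee_fin fineK; last first.
  exact: (integrable_fin_num measurableT (integrable_moment q 0 0 m0)).
apply: (@le_trans _ _ (\int[leb]_(x in `[l, r]%classic) (expR (- 16))%:E)%E).
  have ml : leb `[l, r]%classic = (r - l)%:E by rewrite lebesgue_measure_itv /= lte_fin lr EFinB.
  rewrite integral_cst// [X in (_ * X)%E]ml -EFinM lee_fin.
  by rewrite /l /r; rewrite le_eqVlt; apply/orP; left; apply/eqP; field; rewrite gt_eqF.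
apply: (@le_trans _ _ (\int[leb]_(x in `[l, r]%classic) (moment_fun m q 0 0 x)%:E)%E).
  apply: ge0_le_integral => //; first exact: measurable_funTS.
  move=> x /=; rewrite in_itv /= lee_fin /moment_fun expr0 mul1r => /andP[h1 h2].
  apply: bump_mid; move: h1 h2; rewrite /l /r ler_pdivrMr// ler_pdivlMr// mulrC => h1 h2.
  by apply/andP; split; lra.
by apply: ge0_subset_integral => // x _; rewrite lee_fin.
Qed.

End bump_moments.

Section tensor_integral.
Context {R : realType}.
Local Notation leb := (@lebesgue_measure R).

Lemma measurable_prod_rV D (f : 'I_D -> R -> R) :
  (forall j, measurable_fun setT (f j)) ->
  measurable_fun setT (fun x : 'rV[R]_D => \prod_j f j (x 0 j)).
Proof.
move=> mf; apply: measurable_prod => j _.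
exact: (measurableT_comp (mf j) (measurable_coor j)).
Qed.

(** Induction on the dimension by Fubini's theorem, as the measure is the pushforward of a product
    measure under [cons_rV]. *)
Lemma integral_tensor D (f : 'I_D -> R -> R) :
  (forall j, leb.-integrable setT (EFin \o f j)) ->
  (lebesgue_rV R D).-integrable setT (EFin \o (fun x : 'rV[R]_D => \prod_j f j (x 0 j))) /\
  (\int[lebesgue_rV R D]_x (\prod_j f j (x 0 j))%:E = (\prod_j \int[leb]_s f j s)%:E)%E.
Proof.
elim: D f => [|D IH] f intf.
  under eq_fun do rewrite big_ord0; under eq_integral do rewrite big_ord0; rewrite big_ord0.
  rewrite integral_cst// mul1e /= diracT; split => //.
  apply/integrableP; split; first exact: measurable_cst.
  by rewrite /comp /= normr1 integral_cst// mul1e /= diracT ltry.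
have mf j : measurable_fun setT (f j) by have /integrableP[/measurable_EFinP] := intf j.
pose F (x : 'rV[R]_D.+1) := \prod_j f j (x 0 j).
pose G (y : 'rV[R]_D) := \prod_j f (lift ord0 j) (y 0 j).
have [intG EG] := IH (fun j => f (lift ord0 j)) (fun j => intf (lift ord0 j)).
rewrite -/G in EG; have {}intG : (lebesgue_rV R D).-integrable setT (EFin \o G) by [].
have mF : measurable_fun setT F by exact: measurable_prod_rV.
have mG : measurable_fun setT G by exact: (measurable_prod_rV (f := fun j => f (lift ord0 j)) (fun j => mf _)).
have FE z : F (cons_rV z) = f ord0 z.1 * G z.2.
  rewrite /F big_ord_recl mxE unlift_none; congr (_ * _).
  by apply: eq_bigr => j _; rewrite mxE liftK.
pose nu := (leb \x lebesgue_rV R D)%E.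
have mFc : measurable_fun setT (EFin \o (F \o @cons_rV R D)).
  apply/measurable_EFinP; apply: (measurableT_comp (f := F) (g := @cons_rV R D)) => //; exact: measurable_cons_rV.
have intFc : nu.-integrable setT (EFin \o (F \o @cons_rV R D)).
  apply/integrable12ltyP => //=.
  have /integrableP[_ h0] := intf ord0; have /integrableP[_ hG] := intG.
  have mG1 : measurable_fun setT (fun y => `|G y|%:E) by apply/measurable_EFinP; exact: measurableT_comp.
  have E1 x : (\int[lebesgue_rV R D]_y `|(F (cons_rV (x, y)))%:E| = `|(f ord0 x)%:E| * \int[lebesgue_rV R D]_y `|(G y)%:E|)%E.
    rewrite -ge0_integralZl//; apply: eq_integral => y _.
    by rewrite FE /= normrM EFinM.
  under eq_integral do rewrite E1.
  have mf0 : measurable_fun setT (fun y => `|f ord0 y|%:E) by apply/measurable_EFinP; exact: measurableT_comp.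
  rewrite ge0_integralZr//; last exact: integral_ge0.
  by rewrite lte_mul_pinfty// ?integral_ge0// ge0_fin_numE// integral_ge0.
have mEF : measurable_fun setT (EFin \o F) by exact/measurable_EFinP.
pose m0 := (pushforward nu (@cons_rV R D) : {measure set 'rV[R]_D.+1 -> \bar R}).
pose m1 := m0 (@measurable_cons_rV R D).
have mE (h : 'rV[R]_D.+1 -> \bar R) : (\int[lebesgue_rV R D.+1]_x h x = \int[m1]_x h x)%E.
  exact: eq_measure_integral.
have intF1 := integrable_pushforward (@measurable_cons_rV R D) mEF intFc measurableT.
split.
  apply/integrableP; split; first exact/measurable_EFinP.
  by rewrite mE; have /integrableP[] := intF1.
rewrite mE [LHS](integral_pushforward (@measurable_cons_rV R D) mEF intFc measurableT).
rewrite preimage_setT; transitivity (\int[nu]_z (F (cons_rV z))%:E)%E => //.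
rewrite -(integral12_prod_meas1 intFc) /fubini_F /=.
have G_fin : (\int[lebesgue_rV R D]_y (G y)%:E)%E \is a fin_num by exact: integrable_fin_num.
have E2 (x : R) : (\int[lebesgue_rV R D]_y (F (cons_rV (x, y)))%:E = (f ord0 x)%:E * \int[lebesgue_rV R D]_y (G y)%:E)%E.
  by rewrite -integralZl//; apply: eq_integral => y _; rewrite FE EFinM.
under eq_integral do rewrite E2 EG.
rewrite (integralZr _ (intf ord0))// [in RHS]big_ord_recl EFinM; congr (_ * _)%E.
by rewrite /Rintegral fineK//; exact: integrable_fin_num (intf ord0).
Qed.

End tensor_integral.

Section bump_tensors.
Context {R : realType} {D : nat}.
Local Notation mu := (lebesgue_rV R D).
Implicit Types (x : 'rV[R]_D) (b e : 'I_D -> nat).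

(** Contains the supports of all bumps of the cell. These sets are compact in [Omega] and pairwise
    disjoint, and their volume is a fixed fraction of the cell's. *)
Definition middle m (q : cell_index D m) : set 'rV[R]_D :=
  [set x | forall j, (q j)%:R + 4^-1 <= m%:R * x 0 j <= (q j)%:R + 3 / 4].

Definition bump_tensor m (q : cell_index D m) b x : R :=
  \prod_j dbump (b j) (m%:R * x 0 j - (q j)%:R).

Section fixed_cell.
Variables (m : nat) (q : cell_index D m).
Hypothesis m0 : (0 < m)%N.
Let m0R : 0 < m%:R :> R. Proof. by rewrite ltr0n. Qed.

Lemma middle_cbox : middle q = cbox (\row_j (((q j)%:R + 4^-1) / m%:R)) (\row_j (((q j)%:R + 3 / 4) / m%:R)).
Proof.
apply/seteqP; split => x H j; have := H j; rewrite !mxE.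
  by rewrite ler_pdivrMr// ler_pdivlMr// ![x 0 j * _]mulrC.
by rewrite ler_pdivrMr// ler_pdivlMr// ![x 0 j * _]mulrC.
Qed.

Lemma middle_grid_cube : middle q `<=` grid_cube q.
Proof. by move=> x H j; have := H j; rewrite -[(q j).+1%:R]natr1 => /andP[h1 h2]; apply/andP; split; lra. Qed.

Lemma middle_Omega : middle q `<=` @Omega R D.
Proof.
move=> x H j; have /andP[h1 h2] := H j.
have qm : (q j)%:R + 1 <= m%:R :> R by rewrite natr1 ler_nat.
have q0 : 0 <= (q j)%:R :> R by [].
apply/andP; split; first by rewrite -(ltr_pM2l m0R) mulr0; lra.
by rewrite -(ltr_pM2l m0R) mulr1; lra.
Qed.

Lemma grid_cube_cell : grid_cube q `&` @Omega R D `<=` cell q.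
Proof.
move=> x [H Ox]; split => // j; have /andP[h1 h2] := H j; rewrite subr0 addr0.
by rewrite ler_pdivrMr// ler_pdivlMr// ![x 0 j * _]mulrC h1 ltW.
Qed.

Lemma middle_cell : middle q `<=` cell q.
Proof. by move=> x H; apply: grid_cube_cell; split; [exact: middle_grid_cube|exact: middle_Omega]. Qed.

Lemma closed_middle : closed (middle q).
Proof. by rewrite middle_cbox; exact: closed_cbox. Qed.

Lemma compact_middle : compact (middle q).
Proof.
apply: bounded_closed_compact; last exact: closed_middle.
exists 1; split => // M M1 x H; apply: le_trans (ltW M1).
apply/norm_leP => // j; have /andP[h1 h2] := middle_Omega H j.
by rewrite ler_norml; apply/andP; split; lra.
Qed.

Lemma measurable_cbox (l r : 'rV[R]_D) : measurable (cbox l r).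
Proof.
have := @measurable_coords R D (fun j => `[l 0 j, r 0 j]%classic) (fun j => measurable_itv _).
by congr measurable; apply/seteqP; split => x H j; have := H j; rewrite /= in_itv.
Qed.

Lemma measurable_middle : measurable (middle q).
Proof. by rewrite middle_cbox; exact: measurable_cbox. Qed.

Lemma measure_cell_le (A : set 'rV[R]_D) : measurable A -> A `<=` cell q ->
  (mu A <= ((m%:R^-1) ^+ D)%:E)%E.
Proof.
move=> mA Aq; pose z : 'rV[R]_D := \row_j (((q j)%:R + 2^-1) / m%:R).
have r0 : 0 <= (2 * m%:R)^-1 :> R by rewrite invr_ge0 mulr_ge0.
have -> : m%:R^-1 = 2 * (2 * m%:R)^-1 :> R by field; rewrite gt_eqF.
rewrite -(measure_cube z)//; apply: le_measure; rewrite ?inE//; first exact: measurable_cube.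
move=> x /Aq[_ H] /=; apply/norm_leP => // j; have := H j.
rewrite !mxE -[(q j).+1%:R]natr1 ler_distl invfM => /andP[h1 h2]; apply/andP; split; lra.
Qed.

Lemma bump_tensor_out b x : ~ middle q x -> bump_tensor q b x = 0.
Proof.
move=> /existsNP[j /negP]; rewrite negb_and -!ltNge => h; rewrite /bump_tensor (bigD1 j)//= dbump_out ?mul0r//.
by case/orP: h => h; [left|right]; lra.
Qed.

Lemma bump_tensor_chain b : bump_tensor q b =
  tensor (fun j i (t : R) => m%:R ^+ i * dbump (b j + i) (m%:R * t - (q j)%:R)) (fun=> 0%N).
Proof. by apply/funext => x; apply: eq_bigr => j _; rewrite expr0 mul1r addn0. Qed.

Lemma bump_chain_derive (c i q' : nat) (t : R) :
  is_derive t 1 (fun t : R => m%:R ^+ i * dbump (c + i) (m%:R * t - q'%:R))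
    (m%:R ^+ i.+1 * dbump (c + i.+1) (m%:R * t - q'%:R)).
Proof.
have dd := is_derive_affine (b := - q'%:R) (is_derive_dbump (c + i) (m%:R * t - q'%:R)).
apply: (is_derive_eq (is_deriveZ (m%:R ^+ i) dd)).
by rewrite addnS exprSr -mulrA.
Qed.

Lemma bump_chain_continuous (c i q' : nat) :
  continuous (fun t : R => m%:R ^+ i * dbump (c + i) (m%:R * t - q'%:R)).
Proof.
move=> t; apply: differentiable_continuous; apply/derivable1_diffP.
by have [] := bump_chain_derive c i q' t.
Qed.

Lemma bump_tensor_test b : test_function (@Omega R D) (bump_tensor q b).
Proof.
have sub : closure [set x | bump_tensor q b x != 0] `<=` middle q.
  rewrite [X in _ `<=` X](closure_id _).1; last exact: closed_middle.
  apply: closureS => x /= h; apply: contrapT => nx; move: h.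
  by rewrite bump_tensor_out// eqxx.
split.
- move=> K; rewrite bump_tensor_chain; apply: Ck_on_tensor => [j i s _|j i _].
    exact: bump_chain_derive.
  exact: bump_chain_continuous.
- by apply: subclosed_compact compact_middle sub; exact: closed_closure.
- have -> : (@Omega R D)° = @Omega R D by apply/interior_id; exact: open_Omega.
  by apply: subset_trans sub _; exact: middle_Omega.
Qed.

Lemma multi_partial_bump k (al : multi_index k) b : (\sum_i (al i : nat) = k)%N ->
  multi_partial al (bump_tensor q b) = m%:R ^+ k \*: bump_tensor q (fun j => b j + al j)%N.
Proof.
move=> alk; rewrite /multi_partial bump_tensor_chain.
set l := flatten _.
pose g (j : 'I_D) (i : nat) (t : R) := m%:R ^+ i * dbump (b j + i) (m%:R * t - (q j)%:R).
have dg j i (t : R) : (i < size l)%N -> is_derive t 1 (g j i) (g j i.+1 t) by move=> _; exact: bump_chain_derive.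
rewrite (partials_tensor (K := size l) dg (leqnn _)).
apply/funext => x; rewrite /tensor /bump_tensor /g big_split /=.
have cE j : count_mem j l = al j.
  rewrite count_flatten -map_comp sumnE big_map big_enum /= (bigD1 j)//= count_nseq /= eqxx mul1n.
  by rewrite big1 ?addn0// => i ij; rewrite count_nseq /= (negbTE ij).
under eq_bigr do rewrite cE; under [X in _ * X]eq_bigr do rewrite cE.
by rewrite prodrXr alk.
Qed.

Lemma bump_tensor_measurable b : measurable_fun setT (bump_tensor q b).
Proof.
apply: (measurable_prod_rV (f := fun j t => dbump (b j) (m%:R * t - (q j)%:R))) => j.
apply: continuous_measurable_fun => t.
have := @bump_chain_continuous (b j) 0 (q j) t.
by rewrite /continuous_at; under eq_fun do rewrite addn0 expr0 mul1r; rewrite addn0 expr0 mul1r.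
Qed.

Lemma integral_bump_monomial b e : 
  mu.-integrable setT (EFin \o (fun x => (\prod_j (m%:R * x 0 j - (q j)%:R) ^+ e j) * bump_tensor q b x)) /\
  \int[mu]_x ((\prod_j (m%:R * x 0 j - (q j)%:R) ^+ e j) * bump_tensor q b x) = \prod_j moment m (q j) (e j) (b j).
Proof.
have [] := @integral_tensor R D (fun j => moment_fun m (q j) (e j) (b j)) (fun j => integrable_moment (q j) (e j) (b j) m0).
have -> : (fun x => \prod_j (m%:R * x 0 j - (q j)%:R) ^+ e j * bump_tensor q b x) =
    (fun x => \prod_j moment_fun m (q j) (e j) (b j) (x 0 j)).
  by apply/funext => x; rewrite /bump_tensor -big_split.
by move=> h1 h2; split => //; rewrite /Rintegral h2.
Qed.

End fixed_cell.

Lemma bump_tensor_bound (K : nat) : exists2 C : R, 0 <= C & forall m (q : cell_index D m) b x,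
  (forall j, (b j <= K)%N) -> `|bump_tensor q b x| <= C.
Proof.
have /choice[c Hc] : forall i, exists c : R, 0 <= c /\ forall t, `|dbump i t| <= c.
  by move=> i; have [c c0 H] := dbump_bound (R := R) i; exists c.
pose C := \sum_(i < K.+1) c i.
have C0 : 0 <= C by apply: sumr_ge0 => i _; have [] := Hc i.
have HC i t : (i <= K)%N -> `|dbump i t| <= C.
  move=> iK; apply: le_trans ((Hc i).2 t) _; rewrite /C (bigD1 (Ordinal (iK : (i < K.+1)%N)))//= lerDl.
  by apply: sumr_ge0 => l _; have [] := Hc l.
exists (C ^+ D) => [|m q b x bK]; first exact: exprn_ge0.
rewrite normr_prod (_ : C ^+ D = \prod_(j < D) C); last by rewrite prodr_const card_ord.
by apply: ler_prod => j _; rewrite normr_ge0 /=; exact: HC.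
Qed.

End bump_tensors.

(** * Local coefficients of a spline *)

Section cell_polynomials.
Context {R : realType} {D : nat}.
Local Notation mu := (lebesgue_rV R D).

Definition cell_poly k m (q : cell_index D m) (c : {ffun 'I_D -> 'I_k} -> R) (x : 'rV[R]_D) : R :=
  \sum_al c al * \prod_j (m%:R * x 0 j - (q j)%:R) ^+ al j.

Definition total_degree k (al : {ffun 'I_D -> 'I_k}) : nat := \sum_j al j.

Lemma cell_poly_pairing k m (q : cell_index D m) (c : {ffun 'I_D -> 'I_k} -> R) (b : 'I_D -> nat) :
  (0 < m)%N ->
  mu.-integrable setT (EFin \o (fun x => cell_poly q c x * bump_tensor q b x)) /\
  \int[mu]_x (cell_poly q c x * bump_tensor q b x) =
  \sum_al c al * \prod_j moment m (q j) (al j) (b j).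
Proof.
move=> m0; rewrite /cell_poly.
have E : (fun x : 'rV[R]_D => (\sum_al c al * \prod_j (m%:R * x 0 j - (q j)%:R) ^+ al j) * bump_tensor q b x) =
   (fun x => \sum_(al <- index_enum _) c al * ((\prod_j (m%:R * x 0 j - (q j)%:R) ^+ al j) * bump_tensor q b x)).
  by apply/funext => x; rewrite mulr_suml; apply: eq_bigr => al _; rewrite mulrA.
rewrite E; elim: (index_enum _) => [|al r [IH1 IH2]].
  under [X in EFin \o X]eq_fun do rewrite big_nil.
  split; last by rewrite big_nil /Rintegral; under eq_integral do rewrite big_nil; rewrite integral0.
  exact: (integrable0 mu setT).
pose e (j : 'I_D) : nat := fun_of_fin al j.
have H12 := @integral_bump_monomial R D m q m0 b e; have h1 := H12.1; have h2 := H12.2.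
have h3 : mu.-integrable setT (EFin \o (fun x : 'rV[R]_D => c al * ((\prod_j (m%:R * x 0 j - (q j)%:R) ^+ al j) * bump_tensor q b x))).
  exact: (integrableZl measurableT (c al) h1).
under [X in EFin \o X]eq_fun do rewrite big_cons; split; first exact: (integrableD measurableT h3 IH1).
rewrite big_cons -IH2 -h2 -RintegralZl// -RintegralD//.
by apply: eq_Rintegral => x _; rewrite big_cons.
Qed.

(** Testing with the bump derivative of order [b] annihilates every monomial whose exponent is below
    [b] in some coordinate. What remains is the coefficient of [b] and coefficients of strictly
    larger degree, so the bounds follow by descending induction on the degree; monotonicity of [w]
    carries the weights along. *)
Lemma cell_coef_bound k : exists2 C : R, 0 <= C &
  forall m (q : cell_index D m) (c w : {ffun 'I_D -> 'I_k} -> R) (eps : R), (0 < m)%N -> 0 <= eps ->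
  (forall b, 0 <= w b) -> (forall b b' : {ffun 'I_D -> 'I_k}, (forall j, b j <= b' j)%N -> w b <= w b') ->
  (forall b, (0 < total_degree b)%N ->
     w b * (m%:R ^+ D * `|\int[mu]_x (cell_poly q c x * bump_tensor q (fun j => b j) x)|) <= eps) ->
  forall b, (0 < total_degree b)%N -> w b * `|c b| <= C * eps.
Proof.
have [c0 c00 Hc0] := moment0_ge (R := R).
have /choice[Cm HCm] : forall p : 'I_k * 'I_k, exists C : R, 0 <= C /\ forall m q, (0 < m)%N -> `|moment m q p.1 p.2| <= C / m%:R.
  by move=> p; have [C C0 H] := moment_bound (R := R) p.1 p.2; exists C.
pose M := \sum_p Cm p.
have M0 : 0 <= M by apply: sumr_ge0 => p _; have [] := HCm p.
have HM m q (a b : 'I_k) : (0 < m)%N -> `|moment m q a b| <= M / m%:R :> R.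
  move=> m0; apply: le_trans ((HCm (a, b)).2 m q m0) _; rewrite ler_wpM2r ?invr_ge0//.
  by rewrite /M (bigD1 (a, b))//= lerDl; apply: sumr_ge0 => p _; have [] := HCm p.
pose B := #|{ffun 'I_D -> 'I_k}|%:R : R.
(* [N] bounds how far the total degree lies below [D * k]; the constant grows with every step of the
   descent. *)
suff H : forall N, exists2 C : R, 0 <= C &
  forall m (q : cell_index D m) (c w : {ffun 'I_D -> 'I_k} -> R) (eps : R), (0 < m)%N -> 0 <= eps ->
  (forall b, 0 <= w b) -> (forall b b' : {ffun 'I_D -> 'I_k}, (forall j, b j <= b' j)%N -> w b <= w b') ->
  (forall b, (0 < total_degree b)%N ->
     w b * (m%:R ^+ D * `|\int[mu]_x (cell_poly q c x * bump_tensor q (fun j => b j) x)|) <= eps) ->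
  forall b, (0 < total_degree b)%N -> (D * k <= total_degree b + N)%N -> w b * `|c b| <= C * eps.
  have [C C0 HC] := H (D * k)%N; exists C => // m q c w eps m0 e0 w0 wm Hw b b0.
  by apply: (HC m q c w eps) => //; rewrite leq_addl.
elim=> [|N [A A0 IH]].
  exists 0 => // m q c w eps _ _ _ _ _ b b0; rewrite addn0 => bk.
  have : (total_degree b + D <= D * k)%N.
    rewrite -[X in (_ + X)%N](card_ord D) -sum1_card /total_degree -big_split /=.
    rewrite (_ : (D * k)%N = \sum_(j < D) k)%N; last by rewrite sum_nat_const card_ord.
    by apply: leq_sum => j _; rewrite addn1.
  have [D0|D0] := posnP D; last by move: bk D0; lia.
  move: b0; rewrite /total_degree big1// => j _; by have /leq_trans/(_ (eq_leq D0)) := ltn_ord j.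
exists ((c0 ^+ D)^-1 * (1 + M ^+ D * (B * A))).
  by rewrite mulr_ge0 ?invr_ge0 ?exprn_ge0 ?(ltW c00)// addr_ge0// !mulr_ge0// exprn_ge0.
move=> m q c w eps m0 e0 w0 wm Hw b b0 bN.
have m0R : 0 < m%:R :> R by rewrite ltr0n.
have := Hw b b0; have [_ ->] := cell_poly_pairing q c (fun j => b j) m0.
rewrite (bigD1 b)//=; set P := \prod_j _; set S := \sum_(_ | _) _ => HwS.
have HP : (c0 / m%:R) ^+ D <= `|P|.
  rewrite /P normr_prod (_ : (c0 / m%:R) ^+ D = \prod_(j < D) (c0 / m%:R)); last by rewrite prodr_const card_ord.
  apply: ler_prod => j _; rewrite divr_ge0 ?(ltW c00)//= moment_diag// !normrM normrX normrN normr1 expr1n mul1r normr_nat.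
  have h := Hc0 m (q j) m0; apply: (le_trans h); apply: le_trans (ler_norm _) _.
  by rewrite ler_peMl// ler1n fact_gt0.
have HS : w b * `|S| <= B * (A * eps * (M / m%:R) ^+ D).
  rewrite /S; apply: (@le_trans _ _ (\sum_(al | al != b) A * eps * (M / m%:R) ^+ D)); last first.
    rewrite sumr_const -[leLHS]mulr_natl ler_wpM2r ?mulr_ge0 ?exprn_ge0 ?divr_ge0//.
    by rewrite /B ler_nat max_card.
  apply: le_trans (ler_wpM2l (w0 b) (ler_norm_sum _ _ _)) _; rewrite mulr_sumr.
  apply: ler_sum => al alb.
  have A1 : 0 <= A * eps * (M / m%:R) ^+ D by rewrite !mulr_ge0 ?exprn_ge0 ?divr_ge0.
  have [/existsP[j alj]|/existsPn/= bal] := boolP [exists j, (al j < b j)%N].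
    by rewrite (bigD1 j)//= moment_lt// mul0r mulr0 normr0 mulr0.
  have {}bal j : (b j <= al j)%N by rewrite leqNgt bal.
  have dal : (total_degree b < total_degree al)%N.
    have [j bj] : exists j, (b j < al j)%N.
      apply/existsP; apply: contraNT alb => /existsPn H; apply/eqP/ffunP => j; apply/val_inj/eqP.
      by rewrite eqn_leq bal andbT leqNgt; exact: H.
    rewrite /total_degree (bigD1 j)//= [ltnRHS](bigD1 j)//= -addSn leq_add//.
    by apply: leq_sum => i _; exact: bal.
  rewrite normrM mulrA; apply: ler_pM; rewrite ?mulr_ge0//.
    apply: (@le_trans _ _ (w al * `|c al|)); first by rewrite ler_wpM2r// wm.
    apply: (IH m q c w eps) => //; first exact: ltn_trans dal.
    by apply: leq_trans bN _; rewrite addnS -addSn leq_add2r.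
  rewrite normr_prod (_ : (M / m%:R) ^+ D = \prod_(j < D) (M / m%:R)); last by rewrite prodr_const card_ord.
  by apply: ler_prod => j _; rewrite normr_ge0 /=; exact: HM.
have h1 : w b * `|c b| * `|P| <= w b * `|c b * P + S| + w b * `|S|.
  rewrite -mulrA -normrM -mulrDr ler_wpM2l//.
  have -> : c b * P = (c b * P + S) - S by rewrite addrK.
  by rewrite [in leRHS]addrK; apply: ler_normB.
have h2 : w b * `|c b| * (c0 / m%:R) ^+ D <= w b * `|c b * P + S| + B * (A * eps * (M / m%:R) ^+ D).
  apply: le_trans (le_trans h1 _); first by rewrite ler_wpM2l// mulr_ge0.
  by rewrite lerD2l.
have mD : 0 < m%:R ^+ D :> R by rewrite exprn_gt0.
rewrite -mulrA ler_pdivlMl ?exprn_gt0//.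
rewrite -(ler_pM2l mD) in h2; rewrite !expr_div_n in h2.
have -> : c0 ^+ D * (w b * `|c b|) = m%:R ^+ D * (w b * `|c b| * (c0 ^+ D / m%:R ^+ D)).
  by field; rewrite gt_eqF.
apply: le_trans h2 _; rewrite mulrDr.
have -> : m%:R ^+ D * (B * (A * eps * (M ^+ D / m%:R ^+ D))) = M ^+ D * (B * A) * eps.
  by field; rewrite gt_eqF.
by rewrite mulrDl mul1r lerD2r mulrCA.
Qed.

End cell_polynomials.

(** * Pairing with a function of mean zero *)

Section oscillation.
Context d (T : measurableType d) (R : realType).
Variable mu : {sigma_finite_measure set T -> \bar R}.
Implicit Types (A : set T) (f g : T -> R).

Lemma Rintegral_mul_bound A f g (C : R) : measurable A -> mu.-integrable A (EFin \o f) ->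
  measurable_fun A g -> 0 <= C -> (forall x, A x -> `|g x| <= C) ->
  mu.-integrable A (EFin \o (fun x => f x * g x)) /\
  `|\int[mu]_(x in A) (f x * g x)| <= C * fine (\int[mu]_(x in A) `|f x|%:E).
Proof.
move=> mA intf mg C0 gC; have /integrableP[mEf foo] := intf.
have mf : measurable_fun A f by exact/measurable_EFinP.
have mfg : measurable_fun A (fun x => f x * g x) by exact: measurable_funM.
have le : (\int[mu]_(x in A) `|(f x * g x)%:E| <= C%:E * \int[mu]_(x in A) `|f x|%:E)%E.
  rewrite -ge0_integralZl//; last by apply/measurable_EFinP; exact: measurableT_comp.
  apply: ge0_le_integral => //.
  - by apply/measurable_EFinP; exact: measurableT_comp.
  - by apply: emeasurable_funM => //; apply/measurable_EFinP; exact: measurableT_comp.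
  by move=> x Ax; rewrite -EFinM lee_fin normrM mulrC ler_wpM2r//; exact: gC.
have f0 : (\int[mu]_(x in A) `|f x|%:E)%E \is a fin_num by rewrite ge0_fin_numE// integral_ge0.
have intfg : mu.-integrable A (EFin \o (fun x => f x * g x)).
  apply/integrableP; split; first exact/measurable_EFinP.
  by apply: le_lt_trans le _; rewrite -(fineK f0) -EFinM ltry.
split => //; apply: (le_trans (le_normr_Rintegral mA intfg)).
rewrite -lee_fin fineK; last first.
  rewrite ge0_fin_numE ?integral_ge0//; apply: le_lt_trans le _.
  by rewrite -(fineK f0) -EFinM ltry.
by rewrite EFinM fineK.
Qed.

(** As [g] has mean zero, [f] may be replaced by its deviation from its mean over [A], and that
    deviation at [x] is at most the average over [y] of [|f x - f y|]. *)
Lemma osc_bound A f g (C V : R) : measurable A -> (mu A = V%:E)%E -> 0 < V ->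
  mu.-integrable A (EFin \o f) -> measurable_fun A g -> 0 <= C ->
  (forall x, A x -> `|g x| <= C) -> \int[mu]_(x in A) g x = 0 ->
  (\int[mu \x mu]_(z in A `*` A) `|f z.1 - f z.2|%:E < +oo)%E ->
  `|\int[mu]_(x in A) (f x * g x)| <=
    C * (fine (\int[mu \x mu]_(z in A `*` A) `|f z.1 - f z.2|%:E)%E / V).
Proof.
move=> mA AV V0 intf mg C0 gC g0 I2oo.
have /integrableP[mEf foo] := intf.
have mf : measurable_fun A f by exact/measurable_EFinP.
have AV' : (mu : {measure set T -> \bar R}) A = V%:E := AV.
have cstint (r : R) : mu.-integrable A (EFin \o cst r).
  apply/integrableP; split; first by apply/measurable_EFinP; exact: measurable_cst.
  by rewrite /comp /= integral_cst// AV' -EFinM ltry.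
pose c := (\int[mu]_(x in A) f x) / V.
have mAA : measurable (A `*` A) by exact: measurableX.
pose h (z : T * T) : \bar R := (`|f z.1 - f z.2|%:E)%E.
have mh : measurable_fun (A `*` A) h.
  have mf1 : measurable_fun (A `*` A) (f \o fst).
    apply: (measurable_comp mA _ mf); last exact: measurable_funTS.
    by move=> _ [z [Az _] <-].
  have mf2 : measurable_fun (A `*` A) (f \o snd).
    apply: (measurable_comp mA _ mf); last exact: measurable_funTS.
    by move=> _ [z [_ Az] <-].
  by apply/measurable_EFinP; apply: measurableT_comp => //; exact: measurable_funB.
have mH : measurable_fun setT (h \_ (A `*` A)) by apply/(measurable_restrictT _ mAA).
have H0 z : (0 <= (h \_ (A `*` A)) z)%E by rewrite patchE; case: ifP => // _; rewrite /h lee_fin.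
have I2E : (\int[mu \x mu]_(z in A `*` A) h z = \int[mu]_(x in A) \int[mu]_(y in A) h (x, y))%E.
  rewrite integral_mkcond (fubini_tonelli1 _ mH H0) [RHS]integral_mkcond.
  apply: eq_integral => x _; rewrite /fubini_F [RHS]patchE; case: ifPn => xA.
    rewrite [RHS]integral_mkcond; apply: eq_integral => y _; rewrite !patchE in_setX xA /=.
    by case: ifP.
  by apply: integral0_eq => y _; rewrite patchE in_setX (negbTE xA).
have mHF : measurable_fun A (fun x => \int[mu]_(y in A) h (x, y))%E.
  have := measurable_funTS (D := A) (measurable_fun_fubini_tonelli_F _ mH H0).
  move=> /(_ mu); apply: eq_measurable_fun => x xA; rewrite /fubini_F [RHS]integral_mkcond.
  by apply: eq_integral => y _; rewrite !patchE in_setX xA.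
have intfc : mu.-integrable A (EFin \o (fun x => f x - c)).
  have := integrableB mA intf (cstint c).
  by apply: eq_integrable => // x _.
have -> : \int[mu]_(x in A) (f x * g x) = \int[mu]_(x in A) ((f x - c) * g x).
  have [i1 _] := Rintegral_mul_bound mA intfc mg C0 gC.
  have [i2 _] := Rintegral_mul_bound mA (cstint c) mg C0 gC.
  have e : \int[mu]_(x in A) (cst c x * g x) = 0.
    have i3 : mu.-integrable A (EFin \o g).
      have [i _] := Rintegral_mul_bound mA (cstint 1) mg C0 gC.
      by apply: eq_integrable i => // x _ /=; rewrite mul1r.
    by rewrite RintegralZl// g0 mulr0.
  rewrite -[LHS]subr0 -e -RintegralB//; last first.
    by have [] := Rintegral_mul_bound mA intf mg C0 gC.
  by apply: eq_Rintegral => x _; rewrite mulrBl.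
have [_ le1] := Rintegral_mul_bound mA intfc mg C0 gC.
apply: le_trans le1 _; rewrite ler_wpM2l// ler_pdivlMr//.
have fc_fin : (\int[mu]_(x in A) `|f x - c|%:E)%E \is a fin_num.
  by have /integrableP[_] := intfc; rewrite ge0_fin_numE// integral_ge0.
rewrite -lee_fin EFinM !fineK//; last by rewrite ge0_fin_numE// integral_ge0.
rewrite -[in leRHS]/(h _) I2E muleC -ge0_integralZl//; last first.
- by rewrite lee_fin ltW.
- by apply/measurable_EFinP; apply: measurableT_comp => //; exact: measurable_funB.
apply: ge0_le_integral => //.
- by move=> x _; rewrite mule_ge0// lee_fin ltW.
- apply: emeasurable_funM => //.
  by apply/measurable_EFinP; apply: measurableT_comp => //; exact: measurable_funB.
move=> x Ax; have intx : mu.-integrable A (EFin \o (fun y => f x - f y)).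
  have := integrableB mA (cstint (f x)) intf.
  by apply: eq_integrable => // y _.
have -> : (V%:E * `|f x - c|%:E = `|\int[mu]_(y in A) (f x - f y)|%:E)%E.
  have -> : \int[mu]_(y in A) (f x - f y) = \int[mu]_(y in A) (f x) - \int[mu]_(y in A) f y.
    exact: (RintegralB mA (cstint (f x)) intf).
  rewrite (Rintegral_cst mu mA) AV' /= -EFinM; congr EFin.
  rewrite -[X in X * `|_|](gtr0_norm V0) -normrM mulrBr [V * f x]mulrC /c; congr (`| _ - _|).
  by rewrite mulrC divfK// gt_eqF.
have := le_normr_Rintegral mA intx; rewrite -lee_fin => /le_trans; apply.
rewrite fineK//; have /integrableP[_] := intx; rewrite ge0_fin_numE// integral_ge0//.
Qed.

End oscillation.

Section local_coefficients.
Context {R : realType} {D : nat}.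
Local Notation mu := (lebesgue_rV R D).
Local Notation Om := (@Omega R D).
Implicit Types (u v g : 'rV[R]_D -> R).

Lemma sub_multi_index (b : 'I_D -> nat) k : (k <= \sum_j b j)%N ->
  exists2 al : multi_index (D := D) k, al \in multi_indices (D := D) k & forall j, (al j <= b j)%N.
Proof.
move=> kb; have [a ak ab] : exists2 a : 'I_D -> nat, (\sum_j a j = k)%N & forall j, (a j <= b j)%N.
  elim: k kb => [|k IH] kb; first by exists (fun=> 0%N) => //; rewrite big1.
  have [a ak ab] := IH (ltnW kb).
  have [j aj] : exists j, (a j < b j)%N.
    apply/existsP; apply: contraTT kb => /existsPn H; rewrite -leqNgt -ak.
    by apply: leq_sum => j _; rewrite leqNgt; exact: H.
  exists (fun i => (i == j) + a i)%N => [|i]; last by case: eqP => [->|_]; [exact: aj|exact: ab].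
  rewrite big_split /= ak (bigD1 j)//= eqxx big1 ?addn0 ?add1n// => i ij.
  by rewrite (negbTE ij).
have ak' j : (a j < k.+1)%N by rewrite ltnS -ak (bigD1 j)//= leq_addr.
exists [ffun j => Ordinal (ak' j)] => [|j]; last by rewrite ffunE; exact: ab.
rewrite mem_enum inE; apply/eqP; rewrite -[RHS]ak.
by apply: eq_bigr => j _; rewrite ffunE.
Qed.

Lemma measure_middle m (q : cell_index D m) : (0 < m)%N ->
  mu (middle q) = (((2 * m%:R)^-1) ^+ D)%:E.
Proof.
move=> m0; have m0R : 0 < m%:R :> R by rewrite ltr0n.
rewrite middle_cbox//.
have -> : cbox (\row_j (((q j)%:R + 4^-1) / m%:R)) (\row_j (((q j)%:R + 3 / 4) / m%:R)) =
    [set x : 'rV[R]_D | forall j, x 0 j \in `[(\row_j (((q j)%:R + 4^-1) / m%:R)) 0 j, (\row_j (((q j)%:R + 3 / 4) / m%:R)) 0 j]].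
  by apply/seteqP; split => x H j; have := H j; rewrite in_itv.
rewrite lebesgue_rV_box => [|j]; last by rewrite !mxE ler_pM2r ?invr_gt0//; lra.
congr EFin; rewrite (_ : _ ^+ D = \prod_(j < D) (2 * m%:R)^-1); last by rewrite prodr_const card_ord.
by apply: eq_bigr => j _; rewrite !mxE; field; rewrite gt_eqF.
Qed.

Lemma integral_bump_middle m (q : cell_index D m) f b (A : set 'rV[R]_D) : (0 < m)%N -> middle q `<=` A ->
  \int[mu]_(x in A) (f x * bump_tensor q b x) = \int[mu]_(x in middle q) (f x * bump_tensor q b x).
Proof.
move=> m0 qA; rewrite /Rintegral integral_mkcond [in RHS]integral_mkcond; congr fine.
apply: eq_integral => x _; rewrite !patchE; case: ifPn => xA.
  by case: ifPn => // /negP; rewrite inE => /bump_tensor_out ->; rewrite mulr0.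
by rewrite ifN//; apply: contraNN xA; rewrite !inE; exact: qA.
Qed.

Definition cell_volume m : R := m%:R^-1 ^+ D.

(* [v] and [vf] are representatives chosen separately for the Lebesgue norms and
   for the fractional seminorm. *)
Definition local_error (s : R) m (q : cell_index D m) u g
    (v : forall j, multi_index (D := D) j -> 'rV[R]_D -> R)
    (vf : multi_index (D := D) (int_part s) -> 'rV[R]_D -> R) : R :=
  mean mu (cell_volume m) (middle q) (g \- u)
  + m%:R^-1 `^ s * \sum_(j < (int_part s).+1) \sum_(al <- multi_indices (D := D) j)
      mean mu (cell_volume m) (middle q) (v j al)
  + (if frac_part s == 0 then 0 else
     m%:R^-1 ^+ int_part s * \sum_(al <- multi_indices (D := D) (int_part s))
       mean (mu \x mu)%E (cell_volume m ^+ 2) (middle q `*` middle q)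
         (fun z => vf al z.1 - vf al z.2)).

(** [g] is tested with a bump derivative of order [b]. The part [g - u] is estimated directly. For
    [u], as many derivatives [al <= b] as [s] allows are moved onto it, each gaining a factor 1/m,
    and the others stay on the bump. Together with the weight this gives m^-n <= m^-s if all of them
    move, and m^-(int_part s) otherwise. *)
Lemma local_coefs (n : nat) (s : R) : 0 <= s <= n%:R -> exists2 C : R, 0 <= C &
  forall m (q : cell_index D m) (c : {ffun 'I_D -> 'I_n.+1} -> R) u g
    (v : forall j, multi_index (D := D) j -> 'rV[R]_D -> R)
    (vf : multi_index (D := D) (int_part s) -> 'rV[R]_D -> R), (0 < m)%N ->
  {in cell q, g =1 cell_poly q c} ->
  mu.-integrable Om (EFin \o u) -> mu.-integrable Om (EFin \o (g \- u)) ->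
  (forall j al, (j <= int_part s)%N -> al \in multi_indices (D := D) j ->
     weak_derivative Om al u (v j al)) ->
  (frac_part s != 0 -> forall al : multi_index (D := D) (int_part s), al \in multi_indices (D := D) (int_part s) ->
     weak_derivative Om al u (vf al) /\
     (\int[mu \x mu]_(z in middle q `*` middle q) `|vf al z.1 - vf al z.2|%:E < +oo)%E) ->
  forall b, (0 < total_degree b)%N ->
    m%:R^-1 ^+ (n - total_degree b) * `|c b| <= C * local_error q u g v vf.
Proof.
move=> /andP[s0 sn]; have [C C0 HC] := @cell_coef_bound R D n.+1.
have [Cb Cb0 HCb] := @bump_tensor_bound R D n.
exists (C * (Cb * (1 + 2 ^+ D))) => [|m q c u g v vf m0 gE intu intgu wd oscoo].
  by rewrite !mulr_ge0// addr_ge0// exprn_ge0.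
have m0R : 0 < m%:R :> R by rewrite ltr0n.
have V0 : 0 < cell_volume m by rewrite exprn_gt0// invr_gt0.
have VE : (cell_volume m)^-1 = m%:R ^+ D by rewrite /cell_volume exprVn invrK.
have mi1 : m%:R^-1 <= 1 :> R by rewrite invf_le1// ler1n.
have mi0 : 0 <= m%:R^-1 :> R by rewrite invr_ge0.
have mi0' : 0 < m%:R^-1 :> R by rewrite invr_gt0.
have mM := @measurable_middle R D m q m0; have mO := @measurable_Omega R D.
have MO := middle_Omega (R := R) (q := q) m0.
set T1 := mean mu (cell_volume m) (middle q) (g \- u).
have T1_0 : 0 <= T1 by exact: mean_ge0.
pose S2 := \sum_(j < (int_part s).+1) \sum_(al <- multi_indices (D := D) j)
      mean mu (cell_volume m) (middle q) (v j al).
pose T2 := m%:R^-1 `^ s * S2.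
have S2_0 : 0 <= S2 by apply: sumr_ge0 => j _; apply: sumr_ge0 => al _; exact: mean_ge0.
have T2_0 : 0 <= T2 by rewrite mulr_ge0// powR_ge0.
pose o2 al := mean (mu \x mu)%E (cell_volume m ^+ 2) (middle q `*` middle q)
         (fun z => vf al z.1 - vf al z.2).
have o2_0 al : 0 <= o2 al by apply: mean_ge0; rewrite exprn_gt0.
pose T3 := if frac_part s == 0 then 0 else m%:R^-1 ^+ int_part s *
   \sum_(al <- multi_indices (D := D) (int_part s)) o2 al.
have T3_0 : 0 <= T3.
  by rewrite /T3; case: ifP => // _; rewrite mulr_ge0 ?exprn_ge0//; apply: sumr_ge0.
have errE : local_error q u g v vf = T1 + T2 + T3 by [].
have err0 : 0 <= local_error q u g v vf by rewrite errE !addr_ge0.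
have Sn : (int_part s <= n)%N.
  by rewrite -(ler_nat R); apply: le_trans sn; have /andP[] := truncn_itv s0.
have intM f : mu.-integrable Om (EFin \o f) -> mu.-integrable (middle q) (EFin \o f).
  by move=> h; apply: integrableS h.
rewrite -mulrA; move=> b; move: b.
apply: (HC m q c (fun b => m%:R^-1 ^+ (n - total_degree b))) => //.
- by rewrite !mulr_ge0// addr_ge0// exprn_ge0.
- move=> b b' bb'; apply: ler_wiXn2l => //; apply: leq_sub2l.
  by apply: leq_sum => j _; exact: bb'.
move=> b b0; set psi := bump_tensor q _.
have bn j : (b j <= n)%N by rewrite -ltnS; exact: ltn_ord.
have w1 : m%:R^-1 ^+ (n - total_degree b) <= 1 :> R by exact: exprn_ile1.
have w0 : 0 <= m%:R^-1 ^+ (n - total_degree b) :> R by exact: exprn_ge0.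
have mpsi e : measurable_fun (@middle R D m q) (bump_tensor q e).
  by apply: measurable_funTS; exact: bump_tensor_measurable.
have bpsi e : (forall j, (e j <= n)%N) -> forall x, middle q x -> `|bump_tensor q e x| <= Cb.
  by move=> en x _; exact: HCb.
have split : \int[mu]_x (cell_poly q c x * psi x) =
    \int[mu]_(x in middle q) ((g \- u) x * psi x) + \int[mu]_(x in middle q) (u x * psi x).
  rewrite (integral_bump_middle _ _ m0)//.
  have [i1 _] := Rintegral_mul_bound mM (intM _ intgu) (mpsi _) Cb0 (bpsi _ bn).
  have [i2 _] := Rintegral_mul_bound mM (intM _ intu) (mpsi _) Cb0 (bpsi _ bn).
  rewrite -RintegralD//; apply: eq_Rintegral => x xM; rewrite -mulrDl subrK; congr (_ * _).
  by rewrite gE//; move: xM; rewrite !inE; exact: middle_cell.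
have part1 : m%:R^-1 ^+ (n - total_degree b) * (m%:R ^+ D * `|\int[mu]_(x in middle q) ((g \- u) x * psi x)|) <= Cb * T1.
  have [_ h] := Rintegral_mul_bound mM (intM _ intgu) (mpsi _) Cb0 (bpsi _ bn).
  apply: (@le_trans _ _ (1 * (m%:R ^+ D * (Cb * fine (\int[mu]_(x in middle q) `|(g \- u) x|%:E)%E)))).
    by apply: ler_pM; rewrite ?mulr_ge0 ?exprn_ge0// ler_wpM2l ?exprn_ge0//.
  by rewrite mul1r mulrCA ler_wpM2l// /T1 /mean VE mulrC.
have core k (al : multi_index (D := D) k) (vk : 'rV[R]_D -> R) (phi := bump_tensor q (fun j => b j - al j)%N) :
    weak_derivative Om al u vk -> al \in multi_indices (D := D) k -> (forall j, (al j <= b j)%N) ->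
    [/\ mu.-integrable (middle q) (EFin \o vk),
      `|\int[mu]_(x in middle q) (u x * psi x)| = m%:R^-1 ^+ k * `|\int[mu]_(x in middle q) (vk x * phi x)| &
      m%:R ^+ D * `|\int[mu]_(x in middle q) (vk x * phi x)| <= Cb * mean mu (cell_volume m) (middle q) (vk)].
  move=> [lu [mv lv] wdE] alk alb.
  have sumal : (\sum_i (al i : nat) = k)%N by move: alk; rewrite mem_enum inE => /eqP.
  have en j : (b j - al j <= n)%N by exact: leq_trans (leq_subr _ _) (bn j).
  have intv : mu.-integrable (middle q) (EFin \o vk).
    apply/integrableP; split; first by apply/measurable_EFinP; exact: measurable_funS MO mv.
    apply: (lv (middle q)) => //; last exact: compact_middle.
    have -> : Om° = Om by apply/interior_id; exact: open_Omega.
    exact: MO.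
  split => //.
    have := wdE _ (bump_tensor_test q m0 (fun j => b j - al j)%N).
    rewrite (multi_partial_bump q _ sumal).
    have -> : (fun j => b j - al j + al j)%N = (fun j => b j : nat) by apply/funext => j; rewrite subnK.
    rewrite (integral_bump_middle vk _ m0 MO) -/phi.
    have -> : \int[mu]_(x in Om) (u x * (m%:R ^+ k \*: psi) x) = m%:R ^+ k * \int[mu]_(x in middle q) (u x * psi x).
      have [i2 _] := Rintegral_mul_bound mM (intM _ intu) (mpsi _) Cb0 (bpsi _ bn).
      transitivity (\int[mu]_(x in Om) (m%:R ^+ k * u x * psi x)).
        by apply: eq_Rintegral => x _; rewrite -[RHS]mulrA -[RHS]mulrCA.
      rewrite (integral_bump_middle (fun x => m%:R ^+ k * u x) _ m0 MO) -RintegralZl//.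
      by apply: eq_Rintegral => x _; rewrite mulrA.
    move=> /(congr1 Num.norm); rewrite !normrM !normrX normrN normr1 expr1n mul1r normr_nat => <-.
    by rewrite mulrA -exprMn mulVf ?gt_eqF// expr1n mul1r.
  have [_ h] := Rintegral_mul_bound mM intv (mpsi _) Cb0 (bpsi _ en).
  by rewrite /mean VE mulrA [leRHS]mulrC ler_wpM2l// exprn_ge0.
have one2 : 1 <= 2 ^+ D :> R by rewrite exprn_ege1// ler1n.
suff part2 : m%:R^-1 ^+ (n - total_degree b) * (m%:R ^+ D * `|\int[mu]_(x in middle q) (u x * psi x)|) <= Cb * 2 ^+ D * (T2 + T3).
  rewrite split errE; apply: (@le_trans _ _ (Cb * T1 + Cb * 2 ^+ D * (T2 + T3))).
    apply: le_trans (lerD part1 part2); rewrite -!mulrDr ler_wpM2l// ler_wpM2l ?exprn_ge0//.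
    exact: ler_normD.
  have h1 : 0 <= Cb * 2 ^+ D * T1 by apply: mulr_ge0 => //; apply: mulr_ge0 => //; exact: exprn_ge0.
  have h2 : 0 <= Cb * (T2 + T3) by apply: mulr_ge0 => //; exact: addr_ge0.
  by move: h1 h2; set X := 2 ^+ D; lra.
have [bS|bS] := leqP (total_degree b) (int_part s).
  have [al alk alb] := sub_multi_index (b := fun j => b j) (leqnn (total_degree b)).
  have [_ -> meanv] := core _ al _ (wd _ al bS alk) alk alb; move: meanv.
  set J := `|\int[mu]_(x in middle q) _| => meanv.
  have bn' : (total_degree b <= n)%N by exact: leq_trans Sn.
  have -> : m%:R^-1 ^+ (n - total_degree b) * (m%:R ^+ D * (m%:R^-1 ^+ total_degree b * J)) = m%:R^-1 ^+ n * (m%:R ^+ D * J).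
    by rewrite -[in RHS](subnK bn') exprD; ring.
  have msn : m%:R^-1 ^+ n <= m%:R^-1 `^ s by rewrite -powR_mulrn//; apply: ger_powR => //; rewrite mi0' mi1.
  have meanS : mean mu (cell_volume m) (middle q) (v (total_degree b) al) <= S2.
    rewrite /S2 (bigD1 (Ordinal (bS : total_degree b < (int_part s).+1)%N))//= (big_rem al)//= -addrA lerDl addr_ge0//.
      by apply: sumr_ge0 => ? _; exact: mean_ge0.
    by apply: sumr_ge0 => ? _; apply: sumr_ge0 => ? _; exact: mean_ge0.
  apply: (@le_trans _ _ (m%:R^-1 `^ s * (Cb * S2))).
    apply: ler_pM; [exact: exprn_ge0|by apply: mulr_ge0; [exact: exprn_ge0|exact: normr_ge0]|exact: msn|].
    exact: le_trans meanv (ler_wpM2l Cb0 meanS).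
  rewrite mulrCA -/T2 -mulrA ler_wpM2l//.
  apply: (@le_trans _ _ (1 * (T2 + T3))); first by rewrite mul1r lerDl.
  by rewrite ler_wpM2r// addr_ge0.
have [al alk alb] := sub_multi_index (b := fun j => b j) (ltnW bS).
have [f0|f0] := eqVneq (frac_part s) 0.
have [intv -> meanv] := core _ al _ (wd _ al (leqnn _) alk) alk alb; move: meanv.
set phi := bump_tensor q _; set J := `|\int[mu]_(x in middle q) _| => meanv.
have J0 : 0 <= m%:R ^+ D * (m%:R^-1 ^+ int_part s * J).
  by apply: mulr_ge0; [exact: exprn_ge0|apply: mulr_ge0; [exact: exprn_ge0|exact: normr_ge0]].
apply: (@le_trans _ _ (m%:R^-1 ^+ int_part s * (m%:R ^+ D * J))).
  by rewrite [leRHS]mulrCA -[leRHS]mul1r ler_wpM2r.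
  have -> : m%:R^-1 ^+ int_part s = m%:R^-1 `^ s :> R.
    rewrite -powR_mulrn//; congr (_ `^ _); move/eqP: f0; rewrite subr_eq0 => /eqP {2}->//.
  have meanS : mean mu (cell_volume m) (middle q) (v (int_part s) al) <= S2.
    rewrite /S2 (bigD1 ord_max)//= (big_rem al)//= -addrA lerDl addr_ge0//.
      by apply: sumr_ge0 => ? _; exact: mean_ge0.
    by apply: sumr_ge0 => ? _; apply: sumr_ge0 => ? _; exact: mean_ge0.
  apply: (@le_trans _ _ (m%:R^-1 `^ s * (Cb * S2))).
    by rewrite ler_wpM2l ?powR_ge0//; apply: le_trans meanv _; rewrite ler_wpM2l.
  rewrite mulrCA -/T2 -mulrA ler_wpM2l//.
  apply: (@le_trans _ _ (1 * (T2 + T3))); first by rewrite mul1r lerDl.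
  by rewrite ler_wpM2r// addr_ge0.
have [wdf oscf] := oscoo f0 al alk.
have [intv -> meanv] := core _ al _ wdf alk alb; move: meanv.
set phi := bump_tensor q _; set J := `|\int[mu]_(x in middle q) _| => meanv.
have J0 : 0 <= m%:R ^+ D * (m%:R^-1 ^+ int_part s * J).
  by apply: mulr_ge0; [exact: exprn_ge0|apply: mulr_ge0; [exact: exprn_ge0|exact: normr_ge0]].
apply: (@le_trans _ _ (m%:R^-1 ^+ int_part s * (m%:R ^+ D * J))).
  by rewrite [leRHS]mulrCA -[leRHS]mul1r ler_wpM2r.
(* At least one derivative stays on the bump, so it has mean zero; here the oscillation, and with it
   the fractional part of [s], comes in. *)
have phi0 : \int[mu]_(x in middle q) phi x = 0.
  have [j bj] : exists j, (0 < b j - al j)%N.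
    apply/existsP; apply: contraTT bS => /existsPn H; rewrite -leqNgt.
    move: alk; rewrite mem_enum inE => /eqP <-; apply: leq_sum => j _.
    by rewrite -subn_eq0 -leqn0 leqNgt; exact: H.
  have := (@integral_bump_monomial R D m q m0 (fun j => b j - al j)%N (fun=> 0%N)).2.
  rewrite [RHS](bigD1 j)//= moment_lt// mul0r.
  rewrite (integral_bump_middle (fun x : 'rV[R]_D => \prod_j (m%:R * x 0 j - (q j)%:R) ^+ 0) _ m0)// => <-.
  by apply: eq_Rintegral => x _; rewrite big1// mul1r.
have V'0 : 0 < (2 * m%:R)^-1 ^+ D :> R by rewrite exprn_gt0// invr_gt0 mulr_gt0.
have en j : (b j - al j <= n)%N by exact: leq_trans (leq_subr _ _) (bn j).
have := osc_bound mM (measure_middle q m0) V'0 intv (mpsi _) Cb0 (bpsi _ en) phi0 oscf.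
rewrite -/J => hJ.
have le1 : m%:R ^+ D * J <= Cb * 2 ^+ D * o2 al.
  rewrite /o2 /mean; set I2 := fine _ in hJ *.
  have -> : Cb * 2 ^+ D * (I2 / cell_volume m ^+ 2) = m%:R ^+ D * (Cb * (I2 / (2 * m%:R)^-1 ^+ D)).
    rewrite /cell_volume !exprVn !invrK exprMn; ring.
  by rewrite ler_wpM2l ?exprn_ge0//.
have leT3 : m%:R^-1 ^+ int_part s * o2 al <= T3.
  rewrite /T3 (negbTE f0) ler_wpM2l ?exprn_ge0// (big_rem al)//= lerDl.
  by apply: sumr_ge0.
apply: (@le_trans _ _ (Cb * 2 ^+ D * (m%:R^-1 ^+ int_part s * o2 al))).
  by rewrite [leRHS]mulrCA ler_wpM2l ?exprn_ge0//.
apply: ler_wpM2l; first by apply: mulr_ge0 => //; exact: exprn_ge0.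
apply: le_trans leT3 _.
by rewrite lerDr.
Qed.

End local_coefficients.

(** * Jumps of splines across faces *)

Section recentering.
Context {R : realType} {D : nat} (k : nat).
Implicit Types (c : {ffun 'I_D -> 'I_k} -> R) (x y : 'rV[R]_D).

(** Coefficients after an affine substitution, by the binomial theorem in each coordinate:
    [la = m%:R^-1] passes to the variable of a cell, [la = 1] moves the origin to a point of the
    cell. *)
Definition recenter (la : R) y c (be : {ffun 'I_D -> 'I_k}) : R :=
  \sum_al c al * \prod_j ('C(al j, be j)%:R * la ^+ be j * y 0 j ^+ (al j - be j)).

Lemma recenterE (la : R) y c x :
  \sum_al c al * \prod_j (la * x 0 j + y 0 j) ^+ al j =
  \sum_be recenter la y c be * \prod_j x 0 j ^+ be j.
Proof.
have H (a : 'I_k) (s t : R) : (la * s + t) ^+ a = \sum_(i < k) ('C(a, i)%:R * la ^+ i * t ^+ (a - i)) * s ^+ i.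
  rewrite addrC exprDn.
  pose F (i : nat) := ('C(a, i)%:R * la ^+ i * t ^+ (a - i)) * s ^+ i.
  transitivity (\sum_(0 <= i < a.+1) F i).
    rewrite big_mkord; apply: eq_bigr => i _; rewrite /F exprMn -mulr_natl; ring.
  have ak : (a.+1 <= k)%N by exact: ltn_ord.
  transitivity (\sum_(0 <= i < k) F i); last by rewrite big_mkord.
  rewrite [RHS](@big_cat_nat _ _ _ a.+1)//= [X in _ = _ + X]big_nat [X in _ = _ + X]big1 ?addr0// => i /andP[ai _].
  by rewrite /F bin_small// !mul0r.
transitivity (\sum_al \sum_(be : {ffun 'I_D -> 'I_k}) c al * \prod_j (('C(al j, be j)%:R * la ^+ be j * y 0 j ^+ (al j - be j)) * x 0 j ^+ be j)).
  apply: eq_bigr => al _; rewrite -mulr_sumr; congr (_ * _).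
  rewrite -(bigA_distr_bigA (fun j (b : 'I_k) => ('C(al j, b)%:R * la ^+ b * y 0 j ^+ (al j - b)) * x 0 j ^+ b)) /=.
  by apply: eq_bigr => j _; exact: H.
rewrite exchange_big /=; apply: eq_bigr => be _; rewrite /recenter mulr_suml.
by apply: eq_bigr => al _; rewrite big_split /= mulrA.
Qed.

Lemma recenter_bound : exists2 C : R, 0 <= C & forall c y (w : {ffun 'I_D -> 'I_k} -> R) (B : R) be,
  (forall j, 0 <= y 0 j <= 1) -> 0 <= w be -> 0 <= B ->
  (forall al : {ffun 'I_D -> 'I_k}, (forall j, be j <= al j)%N -> w be * `|c al| <= B) ->
  w be * `|recenter 1 y c be| <= C * B.
Proof.
exists (#|{ffun 'I_D -> 'I_k}|%:R * (2 ^+ k) ^+ D) => [|c y w B be y01 w0 B0 H].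
  by rewrite mulr_ge0// !exprn_ge0.
rewrite /recenter; apply: le_trans (ler_wpM2l w0 (ler_norm_sum _ _ _)) _; rewrite mulr_sumr.
apply: (@le_trans _ _ (\sum_(al : {ffun 'I_D -> 'I_k}) (2 ^+ k) ^+ D * B)); last first.
  by rewrite sumr_const -[leLHS]mulr_natl mulrA.
apply: ler_sum => al _; have P0 : 0 <= (2 ^+ k) ^+ D * B :> R by rewrite mulr_ge0// !exprn_ge0.
have [/existsP[j alj]|/existsPn bal] := boolP [exists j, (al j < be j)%N].
  by rewrite (bigD1 j)//= bin_small// !mul0r mulr0 normr0 mulr0.
rewrite normrM mulrA mulrC; apply: ler_pM; rewrite ?mulr_ge0//; last first.
  by apply: H => j; rewrite leqNgt bal.
rewrite normr_prod (_ : (2 ^+ k) ^+ D = \prod_(j < D) 2 ^+ k); last by rewrite prodr_const card_ord.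
apply: ler_prod => j _; rewrite normr_ge0 /= expr1n mulr1 normrM -[leRHS]mulr1 ler_pM//.
  rewrite normr_nat -natrX ler_nat.
  have alk : (al j <= k)%N by exact/ltnW/ltn_ord.
  have b2 : ('C(al j, be j) <= 2 ^ al j)%N.
    have [ba|ab] := leqP (be j) (al j); last by rewrite bin_small.
    rewrite -[X in (X ^ _)%N]/(1 + 1)%N expnDn (bigD1 (inord (be j) : 'I_(al j).+1))//=.
    by rewrite inordK// !exp1n !muln1 leq_addr.
  by apply: leq_trans b2 _; rewrite leq_exp2l.
have /andP[y0 y1] := y01 j; rewrite normrX ger0_norm//; exact: exprn_ile1.
Qed.

End recentering.

Section polynomial_functions.
Context {R : realType}.
Implicit Types f g : R -> R.

Definition polynomial_fun f := exists P : {poly R}, forall s, f s = P.[s].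

Lemma polynomial_fun_cst (c : R) : polynomial_fun (fun=> c).
Proof. by exists c%:P => s; rewrite hornerC. Qed.

Lemma polynomial_funB f g : polynomial_fun f -> polynomial_fun g -> polynomial_fun (fun s => f s - g s).
Proof. by move=> [P HP] [Q HQ]; exists (P - Q) => s; rewrite hornerD hornerN HP HQ. Qed.

Lemma polynomial_funM f g : polynomial_fun f -> polynomial_fun g -> polynomial_fun (fun s => f s * g s).
Proof. by move=> [P HP] [Q HQ]; exists (P * Q) => s; rewrite hornerM HP HQ. Qed.

Lemma polynomial_fun_sum (I : Type) (r : seq I) (p : pred I) (F : I -> R -> R) :
  (forall i, p i -> polynomial_fun (F i)) -> polynomial_fun (fun s => \sum_(i <- r | p i) F i s).
Proof.
move=> H; elim: r => [|i r [P HP]]; first by exists 0 => s; rewrite big_nil horner0.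
have [pi|pi] := boolP (p i); last by exists P => s; rewrite big_cons (negbTE pi) HP.
by have [Q HQ] := H i pi; exists (Q + P) => s; rewrite big_cons pi hornerD HP HQ.
Qed.

Lemma polynomial_fun_prod (I : Type) (r : seq I) (p : pred I) (F : I -> R -> R) :
  (forall i, p i -> polynomial_fun (F i)) -> polynomial_fun (fun s => \prod_(i <- r | p i) F i s).
Proof.
move=> H; elim: r => [|i r [P HP]]; first by exists 1 => s; rewrite big_nil hornerC.
have [pi|pi] := boolP (p i); last by exists P => s; rewrite big_cons (negbTE pi) HP.
by have [Q HQ] := H i pi; exists (Q * P) => s; rewrite big_cons pi hornerM HP HQ.
Qed.

Lemma polynomial_fun_coor D (x : 'rV[R]_D) (o l : 'I_D) (la b : R) (k : nat) :
  polynomial_fun (fun s => (la * upd x o s 0 l - b) ^+ k).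
Proof.
have [->|lo] := eqVneq l o.
  by exists ((la *: 'X - b%:P) ^+ k) => s; rewrite upd_eq horner_exp hornerD hornerN hornerZ hornerX hornerC.
by exists ((la * x 0 l - b) ^+ k)%:P => s; rewrite upd_neq// hornerC.
Qed.

Lemma poly_eq0_itv (P : {poly R}) (a b : R) : a < b -> (forall s, a < s < b -> P.[s] = 0) -> P = 0.
Proof.
move=> ab H; apply/eqP; apply: contraT => P0.
pose pt (i : nat) : R := a + (b - a) * i.+1%:R^-1 / 2.
have ba : 0 < b - a by rewrite subr_gt0.
have := @max_poly_roots _ P [seq pt i | i <- iota 0 (size P)] P0.
rewrite size_map size_iota ltnn => -> //.
  apply/allP => _ /mapP[i _ ->]; apply/rootP/H; rewrite /pt ltrDl !mulr_gt0 ?invr_gt0//=.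
  have : i.+1%:R^-1 <= 1 :> R by rewrite invf_le1 ?ltr0n// ler1n.
  by move=> i1; rewrite -ltrBrDl -mulrA gtr_pMr// (le_lt_trans (y := 1 / 2))// ?ler_pM2r// ltr_pdivrMr// mul1r ltr1n.
rewrite map_inj_in_uniq ?iota_uniq// => i j _ _ /addrI E.
have /mulIf/(_ _ _ E) : 2^-1 != 0 :> R by rewrite invr_eq0 pnatr_eq0.
move=> /(mulfI (lt0r_neq0 ba))/invr_inj/eqP.
by rewrite eqr_nat eqSS => /eqP.
Qed.

End polynomial_functions.

Section patches.
Context {R : realType} {D : nat} (n : nat).
Hypothesis n0 : (0 < n)%N.
Local Notation coefs := ({ffun 'I_D -> 'I_n.+1} -> R).
Implicit Types (x : 'rV[R]_D).

Lemma cell_poly_of_spline m g : (0 < m)%N -> spline n.+1 m g ->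
  exists c : cell_index D m -> coefs, forall q, {in cell q, g =1 cell_poly q (c q)}.
Proof.
move=> m0 [_ sg]; have m0R : m%:R != 0 :> R by rewrite pnatr_eq0 -lt0n.
suff /choice[c Hc] : forall q : cell_index D m, exists c : coefs, {in cell q, g =1 cell_poly q c} by exists c.
move=> q; have [c Hc] := sg q.
exists (recenter m%:R^-1 (\row_j ((q j)%:R / m%:R)) c) => x qx; rewrite Hc//.
pose t : 'rV[R]_D := \row_j (m%:R * x 0 j - (q j)%:R).
have := recenterE m%:R^-1 (\row_j ((q j)%:R / m%:R)) c t.
rewrite /cell_poly; under [in X in _ = X -> _]eq_bigr do under eq_bigr do rewrite mxE.
move=> <-; apply: eq_bigr => al _; congr (_ * _); apply: eq_bigr => j _.
by rewrite !mxE mulrBr mulKf// mulrC subrK.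
Qed.

Lemma coef_affineX (b c : R) (a l : nat) : (a <= l)%N ->
  ((b *: 'X + c%:P) ^+ a)`_l = (a == l)%:R * b ^+ l.
Proof.
elim: a l => [|a IH] l al; first by rewrite coef1; case: l al => [|l]//= _; rewrite ?expr0 ?mul1r ?mul0r.
case: l al => // l al; rewrite exprS mulrDl coefD -scalerAl coefZ coefXM coefCM /= (IH l)// (IH l.+1); last exact: ltnW.
rewrite (ltn_eqF (al : (a < l.+1)%N)) mul0r mulr0 addr0 eqSS exprS; ring.
Qed.

(** The coefficient of the [n]-th power of coordinate [j] in the difference of two cell polynomials,
    as a function of the other coordinates: the only jump that smoothness of order n - 1 permits. *)
Definition top_jump m (q : cell_index D m) (c c' : coefs) (j : 'I_D) x : R :=
  \sum_(al : {ffun 'I_D -> 'I_n.+1} | al j == n :> nat) (c' al - c al) * \prod_(l | l != j) (m%:R * x 0 l - (q l)%:R) ^+ al l.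

(* The identity of [smooth_jump] on the common face extends to all points
   because both sides are polynomial along every coordinate line. *)
Lemma cell_jump m g (q q' : cell_index D m) (c c' : coefs) j : (0 < m)%N -> spline n.+1 m g ->
  {in cell q, g =1 cell_poly q c} -> {in cell q', g =1 cell_poly q' c'} ->
  q' j = (q j).+1 :> nat -> (forall l, l != j -> q' l = q l) ->
  forall x, cell_poly q' c' x - cell_poly q c x = top_jump q c c' j x * (m%:R * x 0 j - (q' j)%:R) ^+ n.
Proof.
move=> m0 [cg _] gq gq' qj ql.
have m0R : 0 < m%:R :> R by rewrite ltr0n.
pose line (p : cell_index D m) (d : coefs) x : {poly R} :=
  \sum_(al : {ffun 'I_D -> 'I_n.+1}) (d al * \prod_(l | l != j) (m%:R * x 0 l - (q l)%:R) ^+ al l) *: (m%:R *: 'X + (- (p j)%:R)%:P) ^+ al j.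
have lineE (p : cell_index D m) (d : coefs) (x : 'rV[R]_D) (s : R) : (forall l, l != j -> p l = q l) -> cell_poly p d (upd x j s) = (line p d x).[s].
  move=> pq; rewrite horner_sum; apply: eq_bigr => al _.
  rewrite hornerZ horner_exp hornerD hornerZ hornerX hornerC (bigD1 j)//= upd_eq -mulrA [X in _ * X]mulrC; congr (_ * (_ * _)).
  by apply: eq_bigr => l lj; rewrite upd_neq// pq.
have size_line (p : cell_index D m) (d : coefs) (x : 'rV[R]_D) : (size (line p d x) <= n.+1)%N.
  apply: (leq_trans (size_sum _ _ _)); apply/bigmax_leqP => al _.
  apply: (leq_trans (size_scale_leq _ _)).
  have h : (size (m%:R *: 'X + (- (p j)%:R)%:P : {poly R})%R <= 2)%N.
    apply: (leq_trans (size_polyD _ _)); rewrite geq_max (leq_trans (size_scale_leq _ _)) ?size_polyX//.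
    by apply: (leq_trans (size_polyC_leq1 _)).
  apply: leq_trans (size_poly_exp_leq _ _) _; rewrite ltnS.
  by apply: leq_trans (ltn_ord (al j) : (al j <= n)%N); rewrite -[leqRHS]mul1n leq_mul// -subn1 leq_subLR.
have top (p : cell_index D m) (d : coefs) (x : 'rV[R]_D) : (line p d x)`_n = m%:R ^+ n *
    \sum_(al : {ffun 'I_D -> 'I_n.+1} | al j == n :> nat) d al * \prod_(l | l != j) (m%:R * x 0 l - (q l)%:R) ^+ al l.
  rewrite coef_sum mulr_sumr [RHS]big_mkcond /=; apply: eq_bigr => al _.
  rewrite coefZ coef_affineX; last by rewrite -ltnS; exact: ltn_ord.
  by case: eqP => _; rewrite ?mul0r ?mulr0// mul1r mulrC.
pose gp i : R := i%:R / m%:R.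
pose face (x : 'rV[R]_D) := forall l, l != j -> gp (q l) < x 0 l < gp (q l).+1.
have on_face (x : 'rV[R]_D) : face x -> cell_poly q' c' x - cell_poly q c x = top_jump q c c' j x * (m%:R * x 0 j - (q' j)%:R) ^+ n.
  move=> fx.
  have gp_lt (i1 i2 : nat) : (i1 < i2)%N -> gp i1 < gp i2 by move=> h; rewrite ltr_pM2r ?invr_gt0// ltr_nat.
  have gp0 i : 0 <= gp i by rewrite divr_ge0.
  have gp1 i : (i <= m)%N -> gp i <= 1 by move=> h; rewrite ler_pdivrMr// mul1r ler_nat.
  have q'm : ((q j).+2 <= m)%N by rewrite -qj; exact: ltn_ord.
  have inO (s : R) : gp (q j) < s < gp (q j).+2 -> Omega (upd x j s).
    move=> /andP[s1 s2] l; have [->|lj] := eqVneq l j.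
      by rewrite upd_eq (le_lt_trans (gp0 _) s1) (lt_le_trans s2)// gp1.
    rewrite upd_neq//; have /andP[h1 h2] := fx l lj.
    by rewrite (le_lt_trans (gp0 _) h1) (lt_le_trans h2)// gp1.
  have inq (s : R) : gp (q j) < s < gp (q j).+1 -> upd x j s \in cell q.
    move=> /andP[s1 s2]; rewrite inE; split.
      by apply: inO; rewrite s1 (lt_trans s2)// gp_lt.
    move=> l; rewrite subr0 addr0; have [->|lj] := eqVneq l j; first by rewrite upd_eq !ltW.
    by rewrite upd_neq//; have /andP[h1 h2] := fx l lj; rewrite !ltW.
  have inq' (s : R) : gp (q j).+1 < s < gp (q j).+2 -> upd x j s \in cell q'.
    move=> /andP[s1 s2]; rewrite inE; split.
      by apply: inO; rewrite s2 (lt_trans _ s1)// gp_lt.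
    move=> l; rewrite subr0 addr0; have [->|lj] := eqVneq l j; first by rewrite upd_eq qj !ltW.
    by rewrite upd_neq// ql//; have /andP[h1 h2] := fx l lj; rewrite !ltW.
  have mid : gp (q j) < gp (q j).+1 < gp (q j).+2 by rewrite !gp_lt.
  have [] := smooth_jump (f := fun i s => partials (nseq i j) g (upd x j s)) (k := n.+1)
      (n0 : (1 < n.+1)%N) mid (size_line q c x) (size_line q' c' x).
  - move=> i s ik sI; apply: (@derivable_line _ _ _ (partials (nseq i j) g)).
    by apply: (proj2 (cg _)); [rewrite size_nseq|exact: inO].
  - move=> i ik; apply: continuous_comp; first exact: continuous_upd.
    by apply: (proj1 (cg _)); [rewrite size_nseq|exact: inO].
  - by move=> s sI; rewrite /= gq ?inq// lineE.
  - by move=> s sI; rewrite /= gq' ?inq'// lineE.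
  move=> ga E.
  have gaE : ga = m%:R ^+ n * top_jump q c c' j x.
    have /(congr1 (fun p : {poly R} => p`_n)) := E; rewrite coefD coefZ /=.
    have -> : ('X - (gp (q j).+1)%:P) ^+ n = (1 *: 'X + (- gp (q j).+1)%:P) ^+ n :> {poly R}.
      by rewrite scale1r polyCN.
    rewrite coef_affineX// eqxx expr1n !mulr1 !top => /eqP; rewrite addrC -subr_eq => /eqP <-.
    rewrite -mulrBr -sumrB; congr (_ * _); apply: eq_bigr => al _; by rewrite mulrBl.
  rewrite -{1 2}[x](upd_id x j) !lineE// E hornerD hornerZ horner_exp hornerXsubC addrC addKr gaE.
  rewrite mulrAC [RHS]mulrC; congr (_ * _); rewrite -exprMn mulrBr qj; congr ((_ - _) ^+ _).
  by rewrite /gp mulrC divfK// gt_eqF.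
move=> x; apply/eqP; rewrite -subr_eq0; apply/eqP.
pose F (x : 'rV[R]_D) := cell_poly q' c' x - cell_poly q c x - top_jump q c c' j x * (m%:R * x 0 j - (q' j)%:R) ^+ n.
(* The identity is extended one coordinate at a time: only the coordinates from [i] on are still
   confined to the face. *)
suff H : forall i, (i <= D)%N -> forall x : 'rV[R]_D, (forall l : 'I_D, (i <= l)%N -> l != j -> gp (q l) < x 0 l < gp (q l).+1) -> F x = 0.
  by apply: (H D (leqnn D)) => l; rewrite leqNgt ltn_ord.
elim=> [|i IH] iD y yq; first by apply/eqP; rewrite subr_eq0; apply/eqP/on_face => l; exact: yq.
pose o := Ordinal iD.
have [oj|oj] := eqVneq o j.
  by apply: IH => [|l il lj]; [exact: ltnW|apply: yq => //; rewrite ltn_neqAle il andbT; apply: contraNneq lj => il'; rewrite -oj; apply/eqP/val_inj].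
have [P HP] : polynomial_fun (fun s => F (upd y o s)).
  rewrite /F; do !apply: polynomial_funB; rewrite /cell_poly /top_jump; [| |apply: polynomial_funM].
  - apply: polynomial_fun_sum => al _; apply: polynomial_funM; first exact: polynomial_fun_cst.
    by apply: polynomial_fun_prod => l _; exact: polynomial_fun_coor.
  - apply: polynomial_fun_sum => al _; apply: polynomial_funM; first exact: polynomial_fun_cst.
    by apply: polynomial_fun_prod => l _; exact: polynomial_fun_coor.
  - apply: polynomial_fun_sum => al _; apply: polynomial_funM; first exact: polynomial_fun_cst.
    by apply: polynomial_fun_prod => l _; exact: polynomial_fun_coor.
  - exact: polynomial_fun_coor.
rewrite -[y](upd_id y o) HP (@poly_eq0_itv R P (gp (q o)) (gp (q o).+1)) ?horner0//.
  by rewrite /gp ltr_pM2r ?invr_gt0// ltr_nat.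
move=> s /andP[s1 s2]; rewrite -HP; apply: IH => [|l il lj]; first exact: ltnW.
have [->|lo] := eqVneq l o; first by rewrite upd_eq s1 s2.
rewrite upd_neq//; apply: yq => //; rewrite ltn_neqAle il andbT.
by apply: contraNneq lo => il'; apply/eqP/val_inj; rewrite /= il'.
Qed.

(** Every monomial of the top jump has exponent [n] in one coordinate, hence total degree at least
    [n], so only coefficients bounded by [B] enter. *)
Lemma jump_bound (Rr : R) : 1 <= Rr -> exists2 C : R, 0 <= C &
  forall m g (q q' : cell_index D m) (c c' : coefs) j (B : R), (0 < m)%N -> spline n.+1 m g ->
  {in cell q, g =1 cell_poly q c} -> {in cell q', g =1 cell_poly q' c'} ->
  q' j = (q j).+1 :> nat -> (forall l, l != j -> q' l = q l) -> 0 <= B ->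
  (forall b : {ffun 'I_D -> 'I_n.+1}, (n <= total_degree b)%N -> `|c b| <= B /\ `|c' b| <= B) ->
  forall x, (forall l, `|m%:R * x 0 l - (q l)%:R| <= Rr) -> `|m%:R * x 0 j - (q' j)%:R| <= Rr ->
  `|cell_poly q' c' x - cell_poly q c x| <= C * B.
Proof.
move=> R1; have R0 : 0 <= Rr by rewrite (le_trans ler01).
exists (#|{ffun 'I_D -> 'I_n.+1}|%:R * (2 * (Rr ^+ n) ^+ D) * Rr ^+ n) => [|m g q q' c c' j B m0 sg gq gq' qj ql B0 cB x xq xj].
  by rewrite !mulr_ge0// !exprn_ge0.
rewrite (cell_jump m0 sg gq gq' qj ql) normrM normrX mulrAC; apply: ler_pM => //; last first.
  by rewrite lerXn2r// nnegrE.
apply: le_trans (ler_norm_sum _ _ _) _.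
have P0 : 0 <= 2 * (Rr ^+ n) ^+ D * B by rewrite !mulr_ge0// !exprn_ge0.
apply: (@le_trans _ _ (\sum_(al : {ffun 'I_D -> 'I_n.+1}) 2 * (Rr ^+ n) ^+ D * B)); last first.
  by rewrite sumr_const -[leLHS]mulr_natl !mulrA.
rewrite big_mkcond; apply: ler_sum => al _; case: eqP => // aln.
have [h1 h2] : `|c al| <= B /\ `|c' al| <= B.
  by apply: cB; rewrite /total_degree (bigD1 j)//= aln leq_addr.
rewrite normrM mulrAC; apply: ler_pM => //.
  by rewrite mulr2n mulrDl !mul1r (le_trans (ler_normB _ _))// lerD.
rewrite normr_prod (_ : (Rr ^+ n) ^+ D = \prod_(l < D) Rr ^+ n); last by rewrite prodr_const card_ord.
rewrite big_mkcond; apply: ler_prod => l _; rewrite normrX; case: eqP => _ /=; first by rewrite ler01 exprn_ege1.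
rewrite exprn_ge0//= (@le_trans _ _ (Rr ^+ al l))//; first by rewrite lerXn2r// nnegrE.
by apply: ler_weXn2l => //; rewrite -ltnS.
Qed.

(** The passage from [q] to [q0] follows a chain of face neighbours inside the neighbourhood, at the
    cost of one jump per crossing. *)
Lemma patch_bound (K : nat) : exists2 C : R, 0 <= C &
  forall m g (c : cell_index D m -> coefs) (q0 : cell_index D m) (B : R), (0 < m)%N -> spline n.+1 m g -> 0 <= B ->
  (forall q, {in cell q, g =1 cell_poly q (c q)}) ->
  (forall q : cell_index D m, (forall l, ndist (q l) (q0 l) <= K)%N ->
     forall b : {ffun 'I_D -> 'I_n.+1}, (n <= total_degree b)%N -> `|c q b| <= B) ->
  forall q : cell_index D m, (forall l, ndist (q l) (q0 l) <= K)%N ->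
  forall x : 'rV[R]_D, (forall l, `|m%:R * x 0 l - (q0 l)%:R| <= K.+1%:R) ->
  `|cell_poly q (c q) x - cell_poly q0 (c q0) x| <= C * B.
Proof.
have [C C0 HC] := jump_bound (ler1n R (2 * K).+1).
exists ((D * K)%:R * C) => [|m g c q0 B m0 sg B0 gc cB]; first by rewrite mulr_ge0.
suff H : forall (N : nat) (q : cell_index D m), (forall l, ndist (q l) (q0 l) <= K)%N ->
    (\sum_l ndist (q l) (q0 l) <= N)%N -> forall x : 'rV[R]_D, (forall l, `|m%:R * x 0 l - (q0 l)%:R| <= K.+1%:R) ->
    `|cell_poly q (c q) x - cell_poly q0 (c q0) x| <= N%:R * C * B.
  move=> q qK; apply: H => //; apply: (@leq_trans (\sum_(l < D) K)); first by apply: leq_sum => l _; exact: qK.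
  by rewrite sum_nat_const card_ord.
have close (q : cell_index D m) (x : 'rV[R]_D) l : (ndist (q l) (q0 l) <= K)%N -> `|m%:R * x 0 l - (q0 l)%:R| <= K.+1%:R ->
    `|m%:R * x 0 l - (q l)%:R| <= (2 * K).+1%:R.
  move=> qK xq; rewrite -(subrK (q0 l)%:R (m%:R * x 0 l)) -addrA (le_trans (ler_normD _ _))//.
  have -> : (2 * K).+1%:R = K.+1%:R + K%:R :> R by rewrite -natrD mul2n -addnn addSn.
  rewrite lerD//; move: qK; rewrite /ndist => qK; case: (leqP (q l) (q0 l)) => h.
    by rewrite ger0_norm ?subr_ge0 ?ler_nat// -natrB// ler_nat (leq_trans (leq_addl _ _) qK).
  by rewrite distrC ger0_norm ?subr_ge0 ?ler_nat ?(ltnW h)// -natrB ?(ltnW h)// ler_nat (leq_trans (leq_addr _ _) qK).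
elim=> [|N IH] q qK qN x xq.
  suff -> : q = q0 by rewrite subrr normr0 !mul0r.
  apply/ffunP => l; apply/val_inj => /=; move: qN; rewrite leqn0 sum_nat_eq0 => /forallP/(_ l).
  by rewrite /ndist addn_eq0 !subn_eq0 /= -eqn_leq => /eqP.
have [/existsP[j qj]|/existsPn qq] := boolP [exists j, q j != q0 j]; last first.
  suff -> : q = q0 by rewrite subrr normr0 !mulr_ge0.
  by apply/ffunP => l; apply/eqP; move: (qq l); rewrite negbK.
pose v : nat := if (q j < q0 j)%N then (q j).+1 else (q j).-1.
have vm : (v < m)%N.
  have h1 := ltn_ord (q0 j); have h2 := ltn_ord (q j).
  by rewrite /v; case: ifP => h; [exact: (leq_ltn_trans h h1)|exact: (leq_ltn_trans (leq_pred _) h2)].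
have nv : (ndist v (q0 j)).+1 = ndist (q j) (q0 j).
  move: qj; rewrite /v /ndist -val_eqE /=; case: ltnP => h; rewrite ?neq_ltn; lia.
pose q1 : cell_index D m := [ffun l => if l == j then Ordinal vm else q l].
have q1j : q1 j = v :> nat by rewrite ffunE eqxx.
have q1l l : l != j -> q1 l = q l by move=> lj; rewrite ffunE (negbTE lj).
have q1K l : (ndist (q1 l) (q0 l) <= K)%N.
  have [->|lj] := eqVneq l j; last by rewrite q1l.
  by rewrite q1j (leq_trans _ (qK j))// -nv.
have -> : cell_poly q (c q) x - cell_poly q0 (c q0) x = (cell_poly q (c q) x - cell_poly q1 (c q1) x) +
    (cell_poly q1 (c q1) x - cell_poly q0 (c q0) x) by ring.
rewrite (le_trans (ler_normD _ _))// -natr1 !mulrDl mul1r addrC lerD//.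
  apply: IH => //; rewrite -ltnS (leq_trans _ qN)// [ltnLHS](bigD1 j)// [leqRHS](bigD1 j)//= q1j -nv addSn ltnS.
  by rewrite leq_add2l; apply: leq_sum => l lj; rewrite q1l.
have [h|h] := ltnP (q j) (q0 j).
  rewrite distrC; apply: (HC m g q q1 _ _ j) => //; first by rewrite q1j /v h.
  - by move=> b bn; split; apply: cB.
  - by move=> l; apply: close.
  - by apply: close.
apply: (HC m g q1 q _ _ j) => //.
- by rewrite q1j /v ltnNge h /=; move: qj h; rewrite -val_eqE /=; case: (nat_of_ord (q j)) => [|u]//; case: (nat_of_ord (q0 j)).
- by move=> l lj; rewrite q1l.
- by move=> b bn; split; apply: cB.
- by move=> l; apply: close.
- by apply: close.
Qed.

End patches.

(** * Local polynomials and their transport *)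

(** Total degree below [n] implies coordinate degree below [n], and a single polynomial is a spline
    on every grid. *)
Lemma word_poly_line (R : realType) (D n m : nat) (M : R) (f : 'rV[R]_D -> R) (z : 'rV[R]_D) (b : R) (x : 'rV[R]_D) j :
  (0 < n)%N -> word_poly 1 n M f -> line_spline n m (fun s => b + f (upd x j s - z)).
Proof.
move=> n0 [s sn [_ fE]].
have [P sP HP] : exists2 P : {poly R}, (size P <= n)%N & forall r, word_eval s (upd x j r - z) = P.[r].
  exists (\sum_(v <- s) (v.1 * mon (upd (x - z) j 1) v.2) *: ('X - (z 0 j)%:P) ^+ count_mem j v.2).
    rewrite big_seq; apply: (leq_trans (size_sum _ _ _)); apply/bigmax_leqP_seq => v vs _.
    apply: (leq_trans (size_scale_leq _ _)); rewrite size_exp_XsubC.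
    by have /allP/(_ v vs)/andP[_] := sn; apply: leq_ltn_trans; exact: count_size.
  move=> r; rewrite horner_sum; apply: eq_bigr => v _.
  rewrite hornerZ horner_exp hornerXsubC -mulrA; congr (_ * _).
  have -> : upd x j r - z = upd (x - z) j (r - z 0 j).
    by apply/rowP => l; rewrite !mxE; case: eqP => [->|].
  by rewrite mon_upd mulrC.
apply: (@line_spline_poly _ _ _ (b%:P + P)).
  rewrite (leq_trans (size_polyD _ _))// geq_max sP andbT.
  by rewrite (leq_trans (size_polyC_leq1 _)).
by move=> r _; rewrite fE HP hornerD hornerC.
Qed.

Section monomial_words.
Context {R : realType} {D k : nat}.
Implicit Types (be : {ffun 'I_D -> 'I_k}).

Definition word_of be : seq 'I_D := flatten [seq nseq (be j) j | j <- enum 'I_D].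

Lemma size_word_of be : size (word_of be) = total_degree be.
Proof.
rewrite size_flatten sumnE /shape -map_comp big_map big_enum /total_degree /=.
by apply: eq_bigr => j _; rewrite size_nseq.
Qed.

Lemma mon_word_of be (y : 'rV[R]_D) : mon y (word_of be) = \prod_j y 0 j ^+ be j.
Proof.
rewrite /mon big_flatten big_map big_enum; apply: eq_bigr => j _.
by rewrite big_nseq iter_mulr_1.
Qed.

Lemma word_poly_multi n (r : {ffun 'I_D -> 'I_k} -> R) :
  word_poly 1 n (\sum_(be | (0 < total_degree be < n)%N) `|r be|)
    (fun y => \sum_(be | (0 < total_degree be < n)%N) r be * \prod_j y 0 j ^+ be j).
Proof.
exists [seq (r be, word_of be) | be <- enum [pred be : {ffun 'I_D -> 'I_k} | (0 < total_degree be < n)%N]].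
  apply/allP => _ /mapP[be + ->] /=; rewrite mem_enum inE /= size_word_of //.
split; first by rewrite big_map big_enum.
move=> y; rewrite /word_eval big_map big_enum /=; apply: eq_bigr => be _.
by rewrite mon_word_of.
Qed.

End monomial_words.

Lemma ndist_natr (R : realType) (i j : nat) : (ndist i j)%:R = `|i%:R - j%:R| :> R.
Proof.
rewrite /ndist; case: (leqP i j) => h.
  by rewrite (eqP h) add0n natrB// distrC ger0_norm// subr_ge0 ler_nat.
by rewrite (eqP (ltnW h)) addn0 natrB ?(ltnW h)// ger0_norm// subr_ge0 ler_nat ltnW.
Qed.

Section local_polynomials.
Context {R : realType} {D : nat} (T : R) (a : 'rV[R]_D -> R -> 'rV[R]_D) (Phi : R -> R -> 'rV[R]_D -> 'rV[R]_D).
Hypothesis T0 : 0 < T.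
Hypothesis adm : admissible_velocity T a.
Hypothesis flowP : flow T a Phi.
Variable n : nat.
Hypothesis n0 : (0 < n)%N.
Local Notation coefs := ({ffun 'I_D -> 'I_n.+1} -> R).
Implicit Types (x : 'rV[R]_D).

(** The weight brings derivatives of all orders up to [n] to the common scale m^-n. For degrees
    above [n] truncated subtraction makes the weight 1. *)
Definition scaled_coefs m (c : cell_index D m -> coefs) (eps : cell_index D m -> R) : Prop :=
  forall q b, (0 < total_degree b)%N -> m%:R^-1 ^+ (n - total_degree b) * `|c q b| <= eps q.

Definition near_sum m (K : nat) x (eps : cell_index D m -> R) : R :=
  \sum_(q : cell_index D m | near_index K (fun j => m%:R * x 0 j) (fun j => q j)) eps q.

(** About [x0] the polynomial splits into a constant, the terms of degree 1 to n - 1, and the rest,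
    which counts as error. The factor [m%:R ^+ n] in the bound for [M] comes from passing to the
    unscaled variable. *)
Lemma cell_poly_recentered (K : nat) : exists2 C : R, 0 <= C &
  forall m (q : cell_index D m) (c : coefs) (B : R) x0, (0 < m)%N -> cell q x0 -> 0 <= B ->
  (forall b, (0 < total_degree b)%N -> m%:R^-1 ^+ (n - total_degree b) * `|c b| <= B) ->
  exists b0 M f, [/\ word_poly 1 n M f, M <= C * B * m%:R ^+ n &
    forall x, `|x - x0| <= K%:R / m%:R -> `|cell_poly q c x - (b0 + f (x - x0))| <= C * B].
Proof.
have [C2 C20 HC2] := recenter_bound (R := R) (D := D) n.+1.
pose Nb : R := #|{ffun 'I_D -> 'I_n.+1}|%:R.
have R1 : 1 <= K.+1%:R :> R by rewrite ler1n.
have R0 : 0 <= K.+1%:R :> R by [].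
exists (Nb * C2 * (K.+1%:R ^+ n) ^+ D) => [|m q c B x0 m0 qx0 B0 cB].
  by rewrite !mulr_ge0// !exprn_ge0.
have m0R : 0 < m%:R :> R by rewrite ltr0n.
have m1 : m%:R^-1 <= 1 :> R by rewrite invf_le1// ler1n.
pose y : 'rV[R]_D := \row_j (m%:R * x0 0 j - (q j)%:R).
have y01 j : 0 <= y 0 j <= 1.
  have [_ /(_ j)/andP[h1 h2]] := qx0; move: h1 h2; rewrite subr0 addr0 mxE.
  by rewrite ler_pdivrMr// ler_pdivlMr// -natr1 [_ * m%:R]mulrC subr_ge0 lerBlDl => -> ->.
pose r := recenter 1 y c.
have rB be : (0 < total_degree be)%N -> m%:R^-1 ^+ (n - total_degree be) * `|r be| <= C2 * B.
  move=> b0; apply: (HC2 c y (fun be => m%:R^-1 ^+ (n - total_degree be))) => // al al_be.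
  have dd : (total_degree be <= total_degree al)%N by apply: leq_sum => j _; exact: al_be.
  apply: le_trans (cB al (leq_trans b0 dd)); apply: ler_wpM2r => //.
  by apply: ler_wiXn2l; rewrite ?invr_ge0// leq_sub2l.
have E x : cell_poly q c x = \sum_be r be * \prod_j (m%:R * (x - x0) 0 j) ^+ be j.
  have := recenterE 1 y c (m%:R *: (x - x0)).
  rewrite -/r; under [in X in _ = X -> _]eq_bigr do under eq_bigr do rewrite mxE.
  move=> <-; apply: eq_bigr => al _; congr (_ * _); apply: eq_bigr => j _.
  by rewrite !mxE mul1r; congr (_ ^+ _); ring.
pose low (be : {ffun 'I_D -> 'I_n.+1}) := (0 < total_degree be < n)%N.
pose r' be := r be * m%:R ^+ total_degree be.
have K1 : 1 <= (K.+1%:R ^+ n) ^+ D :> R by rewrite !exprn_ege1.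
exists (\sum_(be | total_degree be == 0%N) r be), (\sum_(be | low be) `|r' be|), (fun y => \sum_(be | low be) r' be * \prod_j y 0 j ^+ be j).
split; first exact: word_poly_multi.
  apply: (@le_trans _ _ (\sum_(be : {ffun 'I_D -> 'I_n.+1}) C2 * B * m%:R ^+ n)); last first.
    rewrite sumr_const -[leLHS]mulr_natl !mulrA; apply: ler_wpM2r; first by rewrite exprn_ge0.
    apply: ler_wpM2r => //; rewrite ler_peMr// mulr_ge0//.
  rewrite big_mkcond; apply: ler_sum => be _; have P0 : 0 <= C2 * B * m%:R ^+ n by rewrite !mulr_ge0// exprn_ge0.
  case: ifP => // /andP[b0 bn]; rewrite /r' normrM normrX normr_nat.
  have -> : m%:R ^+ total_degree be = m%:R^-1 ^+ (n - total_degree be) * m%:R ^+ n :> R.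
    by rewrite -[in m%:R ^+ n](subnK (ltnW bn)) exprD mulrA -exprMn mulVf ?gt_eqF// expr1n mul1r.
  by rewrite mulrA; apply: ler_wpM2r; rewrite ?exprn_ge0// mulrC; exact: rB.
move=> x xx0.
have -> : cell_poly q c x - (\sum_(be | total_degree be == 0%N) r be + \sum_(be | low be) r' be * \prod_j (x - x0) 0 j ^+ be j) =
    \sum_(be : {ffun 'I_D -> 'I_n.+1} | (n <= total_degree be)%N) r be * \prod_j (m%:R * (x - x0) 0 j) ^+ be j.
  rewrite E (bigID (fun be => total_degree be == 0%N))/= [X in _ + X - _](bigID low)/=.
  have -> : \sum_(be : {ffun 'I_D -> 'I_n.+1} | total_degree be == 0%N) r be * \prod_j (m%:R * (x - x0) 0 j) ^+ be j =
            \sum_(be : {ffun 'I_D -> 'I_n.+1} | total_degree be == 0%N) r be.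
    apply: eq_bigr => be; rewrite /total_degree sum_nat_eq0 => /forallP b0.
    by rewrite big1 ?mulr1// => j _; rewrite (eqP (b0 j)).
  have -> : \sum_(be : {ffun 'I_D -> 'I_n.+1} | (total_degree be != 0%N) && low be) r be * \prod_j (m%:R * (x - x0) 0 j) ^+ be j =
            \sum_(be | low be) r' be * \prod_j (x - x0) 0 j ^+ be j.
    apply: eq_big => be; first by rewrite /low lt0n andbA andbb.
    move=> _; rewrite /r' -mulrA; congr (_ * _); under eq_bigr do rewrite exprMn; rewrite big_split /=; congr (_ * _).
    by rewrite prodrXr.
  set A := \sum_(i | _) r i; set A' := \sum_(i | low i) _.
  set S := \sum_(i | _ && ~~ _) _; have -> : forall u v w : R, u + (v + w) - (u + v) = w by move=> *; ring.
  apply: eq_bigl => be; rewrite /low -lt0n; case: (total_degree be) => [|d] /=; last by rewrite -leqNgt.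
  by rewrite leqn0 (gtn_eqF n0).
apply: le_trans (ler_norm_sum _ _ _) _.
apply: (@le_trans _ _ (\sum_(be : {ffun 'I_D -> 'I_n.+1}) C2 * B * (K.+1%:R ^+ n) ^+ D)); last first.
  by rewrite sumr_const -[leLHS]mulr_natl !mulrA [leRHS]mulrAC.
rewrite big_mkcond; apply: ler_sum => be _.
have P0 : 0 <= C2 * B * (K.+1%:R ^+ n) ^+ D by rewrite !mulr_ge0// !exprn_ge0.
case: ifP => // bn; rewrite normrM; apply: ler_pM => //.
  have := rB be (leq_trans n0 bn); rewrite (_ : n - total_degree be = 0)%N ?expr0 ?mul1r//.
  by apply/eqP; rewrite subn_eq0.
rewrite normr_prod (_ : (K.+1%:R ^+ n) ^+ D = \prod_(l < D) K.+1%:R ^+ n); last by rewrite prodr_const card_ord.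
apply: ler_prod => l _; rewrite normr_ge0 normrX /=.
apply: (@le_trans _ _ (K.+1%:R ^+ be l)); last by apply: ler_weXn2l => //; rewrite -ltnS.
rewrite lerXn2r ?nnegrE// normrM normr_nat -ler_pdivlMl// mulrC (le_trans (le_trans (coord_le_norm _ _) xx0))//.
by rewrite ler_pM2r ?invr_gt0// ler_nat.
Qed.

(** The trajectory [Z] of [z] is the reference. Near [Z 0] the spline is one polynomial by
    [patch_bound]; its terms of degree 1 to n - 1 are transported from time 0 to [t], while the
    constant needs no transport. *)
Lemma local_polynomial (K : nat) : exists2 C : R, 0 <= C & exists K' : nat,
  forall m g (c : cell_index D m -> coefs) (eps : cell_index D m -> R) t z, (0 < m)%N -> spline n.+1 m g ->
  (forall q, {in cell q, g =1 cell_poly q (c q)}) -> (forall q, 0 <= eps q) -> scaled_coefs c eps ->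
  0 <= t <= T -> Omega z ->
  exists2 p : 'rV[R]_D -> R, (forall x j, line_spline n m (fun s => p (upd x j s))) &
    forall x, Omega x -> `|x - z| <= K%:R / m%:R ->
      `|g (Phi t 0 x) - p x| <= C * near_sum K' (Phi t 0 z) eps.
Proof.
have [L L1 HL] := trajectory_gronwall T0 adm.
have L0 : 0 < L by rewrite (lt_le_trans ltr01).
(* The backward flow stretches a neighbourhood of [K] cell widths around [z] to at most [L * K] cell
   widths around [Z 0]. *)
pose J := (Num.truncn (L * K%:R)).+1.
have LKJ : L * K%:R <= J%:R by rewrite ltW// truncnS_gt.
have [C1 C10 HC1] := cell_poly_recentered J.
have [C2 C20 HC2] := patch_bound (R := R) (D := D) n0 J.+1.
have J1 : 1 <= J%:R :> R by rewrite ler1n.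
have [C3 C30 HC3] := transport adm T0 n0 J1.
exists (C2 + C1 + C3 * C1 * J%:R ^+ n); first by rewrite !addr_ge0 ?mulr_ge0 ?exprn_ge0.
exists J.+2 => m g c eps t z m0 sg gc e0 ce tT Oz.
have m0R : 0 < m%:R :> R by rewrite ltr0n.
have T00 : (0 : R) <= 0 <= T by rewrite lexx ltW.
have [Ztz trZ] := flowP tT Oz; pose Z r := Phi t r z.
have OZ0 : Omega (Z 0) by have := trajectory_in trZ T00.
have [q0 q0Z] := cell_exists m0 OZ0.
set B := near_sum _ _ _.
have eB (q : cell_index D m) : near_index J.+2 (fun j => m%:R * Z 0 0 j) (fun j => q j) -> eps q <= B.
  by move=> nq; rewrite /B /near_sum (bigD1 q)//= lerDl sumr_ge0.
have B0 : 0 <= B by rewrite /B /near_sum sumr_ge0.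
have inZ (q : cell_index D m) x j : cell q x -> 0 <= m%:R * x 0 j - (q j)%:R <= 1.
  move=> [_ /(_ j)/andP[h1 h2]]; move: h1 h2; rewrite subr0 addr0.
  by rewrite ler_pdivrMr// ler_pdivlMr// -natr1 [_ * m%:R]mulrC subr_ge0 lerBlDl => -> ->.
have near (q : cell_index D m) : (forall l, (ndist (q l) (q0 l) <= J.+1)%N) -> near_index J.+2 (fun j => m%:R * Z 0 0 j) (fun j => q j).
  move=> qq; apply/forallP => j; have := inZ q0 _ j q0Z; have := qq j.
  rewrite -(ler_nat R) ndist_natr -!natr1 => h /andP[u1 u2].
  rewrite (le_trans (ler_distD (q0 j)%:R _ _))// lerD// distrC ger0_norm//.
have [b0 [M [f [wf MB fE]]]] := HC1 m q0 (c q0) B (Z 0) m0 q0Z B0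
  (fun b b0 => le_trans (ce q0 b b0) (eB q0 (near q0 (fun l => ltac:(by rewrite /ndist subnn))))).
(* With this radius the factor [m%:R ^+ n] in the coefficients cancels against [rho ^+ n] in the
   transport error. *)
pose rho := J%:R / m%:R : R.
have rhoB : 0 < rho <= J%:R.
  by rewrite /rho divr_gt0 ?ltr0n//= ler_pdivrMr// ler_peMr// ler1n.
have [f1 wf1 Hf1] := HC3 Z t M rho f trZ tT rhoB wf.
exists (fun x => b0 + f1 (x - z)) => [x j|x Ox xz]; first exact: (word_poly_line _ _ _ _ _ n0 wf1).
have [Xtx trX] := flowP tT Ox; pose X r := Phi t r x.
have XZ r : 0 <= r <= T -> `|X r - Z r| <= rho.
  move=> rT; apply: le_trans (HL X Z t r trX trZ tT rT) _.
  rewrite /X /Z Xtx Ztz (le_trans (ler_wpM2l (ltW L0) xz))// mulrA ler_wpM2r// invr_ge0//.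
have OX0 : Omega (X 0) by have := trajectory_in trX T00.
have [q qX] := cell_exists m0 OX0.
have XZ0 l : `|m%:R * X 0 0 l - m%:R * Z 0 0 l| <= J%:R.
  rewrite -mulrBr normrM normr_nat -ler_pdivlMl// mulrC (le_trans _ (XZ 0 T00))//.
  by have := coord_le_norm (X 0 - Z 0) l; rewrite !mxE.
have qq0 l : (ndist (q l) (q0 l) <= J.+1)%N.
  rewrite -(ler_nat R) ndist_natr -natr1; have := inZ _ _ l qX; have := inZ _ _ l q0Z; have := XZ0 l.
  by clear; rewrite !ler_norml => /andP[? ?] /andP[? ?] /andP[? ?]; apply/andP; split; lra.
have H1 : `|cell_poly q (c q) (X 0) - cell_poly q0 (c q0) (X 0)| <= C2 * B.
  apply: (HC2 m g c q0 B) => // [q1 q1q0 b bn|l].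
    have := ce q1 b (leq_trans n0 bn); rewrite (_ : n - total_degree b = 0)%N ?expr0 ?mul1r; last by apply/eqP; rewrite subn_eq0.
    by move=> /le_trans; apply; apply: eB; exact: near.
  have := inZ _ _ l q0Z; have := XZ0 l; rewrite -!natr1 !ler_norml.
  by clear; move=> /andP[? ?] /andP[? ?]; apply/andP; split; lra.
have H2 := fE (X 0) (XZ 0 T00).
have H3 : `|f1 (x - z) - f (X 0 - Z 0)| <= C3 * C1 * J%:R ^+ n * B.
  have := Hf1 X trX XZ; rewrite /X /Z Xtx Ztz => /le_trans; apply.
  have -> : C3 * C1 * J%:R ^+ n * B = C3 * (C1 * B * m%:R ^+ n) * rho ^+ n.
    by rewrite /rho exprMn exprVn; field; rewrite expf_neq0// gt_eqF.
  apply: ler_wpM2r; first by rewrite exprn_ge0// ltW//; case/andP: rhoB.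
  exact: ler_wpM2l.
have gE : g (Phi t 0 x) = cell_poly q (c q) (X 0) by rewrite (gc q)// inE.
rewrite gE (_ : _ - _ = (cell_poly q (c q) (X 0) - cell_poly q0 (c q0) (X 0)) +
  (cell_poly q0 (c q0) (X 0) - (b0 + f (X 0 - Z 0))) + (f (X 0 - Z 0) - f1 (x - z))); last by ring.
rewrite [leRHS]mulrDl [X in _ <= X + _]mulrDl (le_trans (ler_normD _ _))// lerD//; last by rewrite distrC.
by rewrite (le_trans (ler_normD _ _))// lerD.
Qed.

End local_polynomials.

(** * Error of the particle method *)

Lemma card_close (R : realType) (D N K : nat) (P : pred {ffun 'I_D -> 'I_N}) :
  (forall i j, P i -> P j -> forall l, `|(i l)%:R - (j l)%:R| <= K%:R :> R) ->
  (#|P| <= (2 * K).+1 ^ D)%N.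
Proof.
move=> H; have [i0 Pi0|P0] := pickP P; last by rewrite eq_card0.
apply: leq_trans (card_near_index N K (fun l => (i0 l)%:R : R)); apply: subset_leq_card.
by apply/fintype.subsetP => i Pi; rewrite inE; apply/forallP => l; exact: H.
Qed.

Lemma card_close_cell (R : realType) (D N K : nat) (r : R) (P : pred {ffun 'I_D -> 'I_N})
    (s : {ffun 'I_D -> 'I_N} -> 'rV[R]_D) : (0 < N)%N -> 2 + N%:R * r <= K%:R ->
  (forall i, P i -> cell i (s i)) -> (forall i j, P i -> P j -> `|s i - s j| <= r) ->
  (#|P| <= (2 * K).+1 ^ D)%N.
Proof.
move=> N0 rK Ps H; apply: (card_close (R := R)) => i j Pi Pj l.
have N0R : 0 < N%:R :> R by rewrite ltr0n.
have [_ /(_ l)/andP[h1 h2]] := Ps i Pi; have [_ /(_ l)/andP[h3 h4]] := Ps j Pj.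
move: h1 h2 h3 h4; rewrite !subr0 !addr0 !ler_pdivrMr// !ler_pdivlMr// -!natr1 => h1 h2 h3 h4.
have : `|(s i - s j) 0 l| <= r by exact: le_trans (coord_le_norm _ _) (H i j Pi Pj).
rewrite !mxE -(ler_pM2l N0R) => h5.
have : `|s i 0 l * N%:R - s j 0 l * N%:R| <= N%:R * r by rewrite -mulrBl normrM normr_nat mulrC.
move: rK h1 h2 h3 h4; clear => rK h1 h2 h3 h4; rewrite !ler_norml => /andP[h5 h6].
by apply/andP; split; lra.
Qed.

(** Schur's test for a kernel with entries 0 and 1. *)
Lemma lpb_near (R : realType) (I J : finType) (V : R) p (P : I -> J -> bool) (A : J -> R) (N : nat) (E : R) :
  (1 <= p)%E -> 0 <= V -> 0 <= E -> (0 < N)%N -> (forall j, 0 <= A j) ->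
  (forall i, (#|[pred j | P i j]| <= N)%N) -> (forall j, (#|[pred i | P i j]| <= N)%N) ->
  lpb V p A E -> lpb V p (fun i => \sum_(j | P i j) A j) (N%:R * E).
Proof.
move=> p1 V0 E0 N0 A0 rP cP HA.
have -> : (fun i => \sum_(j | P i j) A j) = (fun i => \sum_j (P i j)%:R * A j).
  apply/funext => i; rewrite big_mkcond; apply: eq_bigr => j _; by case: (P i j); rewrite ?mul1r ?mul0r.
apply: lpb_schur => //; first by rewrite ltr0n.
- move=> i; rewrite -natr_sum ler_nat; apply: leq_trans (rP i); rewrite -sum1_card [leqRHS]big_mkcond.
  by apply: leq_sum => j _; rewrite inE; case: (P i j).
- move=> j; rewrite -natr_sum ler_nat; apply: leq_trans (cP j); rewrite -sum1_card [leqRHS]big_mkcond.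
  by apply: leq_sum => i _; rewrite inE; case: (P i j).
Qed.

Lemma common_bound (s : seq nat) : exists K, all (fun k => k <= K)%N s.
Proof.
elim: s => [|k s [K HK]]; first by exists 0%N.
by exists (maxn k K); rewrite /= leq_maxl; apply: sub_all HK => i h; rewrite (leq_trans h)// leq_maxr.
Qed.

Lemma near_index_coord (R : realType) (D K m : nat) (x : 'rV[R]_D) (N : 'I_D -> nat) l :
  near_index K (fun j => m%:R * x 0 j) N -> `|(N l)%:R - m%:R * x 0 l| <= K%:R.
Proof. by move=> /forallP/(_ l). Qed.

Section particle_error.
Context {R : realType} {D : nat} (T : R) (a : 'rV[R]_D -> R -> 'rV[R]_D) (Phi : R -> R -> 'rV[R]_D -> 'rV[R]_D).
Hypothesis T0 : 0 < T.
Hypothesis adm : admissible_velocity T a.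
Hypothesis flowP : flow T a Phi.
Variable n : nat.
Hypothesis n2 : (1 < n)%N.
Variables (xi : 'I_n -> R) (om : 'I_n -> 'I_n -> R).
Hypothesis xi01 : forall b, 0 < xi b < 1.
Hypothesis dual : forall p : {poly R}, (size p <= n)%N ->
    p = \sum_(r < n) (\sum_(b < n) om r b * p.[xi b]) *: @bpoly R n r.
Local Notation coefs := ({ffun 'I_D -> 'I_n.+1} -> R).
Implicit Types (x z : 'rV[R]_D).

(** As the local polynomial [p] is reproduced, the error is [w - p] at [z] plus the
    quasi-interpolant of [p - w]. Only nodes within [2 * n] cell widths of [z] matter: the node and
    [z] are both within [n] of the index of an active B-spline. *)
Lemma quasi_interpolation_error : exists2 C : R, 0 <= C & exists K' : nat,
  forall m g (c : cell_index D m -> coefs) (eps : cell_index D m -> R) t, (0 < m)%N -> spline n.+1 m g ->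
  (forall q, {in cell q, g =1 cell_poly q (c q)}) -> (forall q, 0 <= eps q) -> scaled_coefs c eps ->
  0 <= t <= T -> forall z, Omega z ->
  `|g (Phi t 0 z) - comb (fun i : spline_index n m => mcoef xi om i (fun x => g (Phi t 0 x))) z|
    <= C * near_sum K' (Phi t 0 z) eps.
Proof.
have [C1 C10 [K' HC1]] := local_polynomial T0 adm flowP (ltnW n2) (2 * n).
have [C2 C20 HC2] := @mcoef_bound R D n xi om.
have [C3 C30 HC3] := tensor_bspline_bound (R := R) (D := D) n2.
pose Na := #|{ffun 'I_D -> 'I_n}|%:R : R.
exists (C1 + ((2 * n).+1 ^ D)%:R * (C2 * (Na * C1) * C3)).
  by rewrite addr_ge0// !mulr_ge0.
exists K' => m g c eps t m0 sg gc e0 ce tT z Oz.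
have [p lp Hp] := HC1 m g c eps t z m0 sg gc e0 ce tT Oz.
set B := near_sum _ _ _ in Hp *; set w := fun x => _.
have B0 : 0 <= B by rewrite /B /near_sum sumr_ge0.
have m0R : 0 < m%:R :> R by rewrite ltr0n.
have pE : p z = comb (fun i : spline_index n m => mcoef xi om i p) z.
  by apply: (tensor_reproduction n2 xi01 dual m0) => // x j _; exact: lp.
have -> : g (Phi t 0 z) - comb (fun i : spline_index n m => mcoef xi om i w) z =
    (w z - p z) + \sum_(i : spline_index n m) (mcoef xi om i (fun x => p x - w x)) * tensor_bspline i z.
  rewrite (_ : \sum_i _ = p z - comb (fun i : spline_index n m => mcoef xi om i w) z); first by rewrite /w; ring.
  rewrite pE /comb -sumrB; apply: eq_bigr => i _; rewrite -mulrBl; congr (_ * _).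
  by rewrite /mcoef -sumrB; apply: eq_bigr => b _; rewrite mulrBr.
rewrite mulrDl (le_trans (ler_normD _ _))// lerD//.
  by apply: Hp => //; rewrite subrr normr0 divr_ge0.
apply: le_trans (ler_norm_sum _ _ _) _.
rewrite (bigID (fun i : spline_index n m => near_index n (fun j => m%:R * z 0 j) (fun j => i j)))/= [X in _ + X]big1 ?addr0; last first.
  move=> i /negP ni; have [->|tz] := eqVneq (tensor_bspline i z) 0; first by rewrite mulr0 normr0.
  by case: ni; exact: (tensor_bspline_support n2).
rewrite -mulrA; apply: sum_near_le; first exact: card_near_index; first by rewrite !mulr_ge0.
move=> i nz; rewrite normrM -mulrA -mulrA mulrA [leRHS](_ : _ = (C2 * (Na * (C1 * B))) * C3); last by ring.
apply: ler_pM => //; last by have [] := HC3 m i z z.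
apply: le_trans (HC2 m i _) _; apply: ler_wpM2l => //.
apply: (@le_trans _ _ (\sum_(b : {ffun 'I_D -> 'I_n}) C1 * B)); last by rewrite sumr_const -mulr_natl.
apply: ler_sum => b _; rewrite distrC; apply: Hp; first exact: mnode_in.
apply: norm_leP => [|l]; first by rewrite divr_ge0.
rewrite !mxE ler_pdivlMr// -[X in _ * X](normr_nat R) -normrM mulrBl.
have hn : near_index n (fun j => m%:R * mnode xi i b 0 j) (fun j => i j) by apply: mnode_near.
have := near_index_coord l nz; have := near_index_coord l hn; rewrite !mxE.
rewrite mul2n -addnn natrD; set u := node _ _; set v := z 0 l; set Ni := (i l)%:R.
move=> h1 h2; rewrite (_ : u * m%:R - v * m%:R = (Ni - m%:R * v) - (Ni - m%:R * u)); last by ring.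
by rewrite (le_trans (ler_normB _ _))// lerD.
Qed.

(** Uniqueness of trajectories, from Gronwall's inequality with equal data at time [t]. It
    identifies the particle values with values of the transported spline at the current
    positions. *)
Lemma flow_back t x X : 0 <= t <= T -> trajectory T a X -> X t = x -> Phi t 0 x = X 0.
Proof.
move=> tT trX Xt; have [L _ HL] := trajectory_gronwall T0 adm.
have T00 : (0 : R) <= 0 <= T by rewrite lexx ltW.
have [Ph1 Ph2] := flowP tT (ltac:(by rewrite -Xt; exact: trajectory_in trX tT) : Omega x).
apply/eqP; rewrite -subr_eq0 -normr_le0; apply: le_trans (HL _ _ t 0 Ph2 trX tT T00) _.
by rewrite Ph1 Xt subrr normr0 mulr0.
Qed.

(** The error on a cell is [eps] sent through a chain of kernels: from cells at time 0 to particles,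
    to B-splines, through the inverse Gram matrix, back to cells; the quasi-interpolation error
    contributes one more kernel. All have bounded row and column sums, so Schur's test gives a
    constant independent of [p]. *)
Lemma particle_error : exists2 d0 : R, 0 < d0 < 1 & forall d : R, 0 < d <= d0 ->
  exists2 C : R, 0 < C & forall m M g (c : cell_index D m -> coefs) (eps : cell_index D m -> R)
    (x : cell_index D M -> R -> 'rV[R]_D) t, (0 < m)%N -> (0 < M)%N -> M%:R^-1 = d * m%:R^-1 ->
  spline n.+1 m g -> (forall q, {in cell q, g =1 cell_poly q (c q)}) -> (forall q, 0 <= eps q) ->
  scaled_coefs c eps -> particles T a x -> 0 <= t <= T ->
  exists u_hs, [/\ regularization n m (fun i => x i t) (fun i => g (x i 0)) u_hs,
    forall w, regularization n m (fun i => x i t) (fun i => g (x i 0)) w -> {in @Omega R D, w =1 u_hs} &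
    exists e : cell_index D m -> R, [/\ forall q, 0 <= e q,
      forall q z, cell q z -> `|u_hs z - g (Phi t 0 z)| <= e q &
      forall (V : R) p E, (1 <= p)%E -> 0 <= V -> 0 <= E -> lpb V p eps E -> lpb V p e (C * E)]].
Proof.
have [L L1 HL] := trajectory_gronwall T0 adm.
have L0 : 0 < L by rewrite (lt_le_trans ltr01).
have [delta /andP[de0 de1] HLS] := least_squares (D := D) n2 xi01 dual.
have [Ca Ca0 [K' HCa]] := quasi_interpolation_error.
have [Cb Cb0 HCb] := tensor_bspline_bound (R := R) (D := D) n2.
(* At time 0 every point has a particle within [h]; the flow stretches this to [L * h], which must
   not exceed [delta / m]. The factor 2 ensures [d0 < 1]. *)
exists (delta / (2 * L)).
  rewrite divr_gt0 ?mulr_gt0//= ltr_pdivrMr ?mulr_gt0// mul1r (le_lt_trans de1)//.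
  by rewrite (lt_le_trans (ltr1n R 2 : 1 < 2)) // ler_peMr.
move=> d /andP[d0 dd].
have T00 : (0 : R) <= 0 <= T by rewrite lexx ltW.
(* Counts particles near a point: one cell width of the spline grid is [d^-1] widths of the particle
   grid, which is how the constant comes to depend on [d]. *)
pose K1 := (Num.truncn (2 + d^-1 * (L * (2 * n + 2 * K')%:R))).+1.
have K1P : 2 + d^-1 * (L * (2 * n + 2 * K')%:R) <= K1%:R by rewrite ltW// truncnS_gt.
pose K2 := (Num.truncn (2 + L * (2 * K')%:R)).+1.
have K2P : 2 + L * (2 * K')%:R <= K2%:R by rewrite ltW// truncnS_gt.
have [Kb /= /andP[b1 /andP[b2 /andP[b3 /andP[b4 /andP[b5 _]]]]]] :=
  common_bound [:: K1; K2; 2 * n.+1; 2 * K'; 2 * K' + (Num.truncn (2 * K'%:R + L)).+1]%N.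
pose Np := ((2 * Kb).+1 ^ D)%N.
have Np0 : (0 < Np)%N by rewrite expn_gt0.
have NpR : 0 < Np%:R :> R by rewrite ltr0n.
have toNp k : (k <= Kb)%N -> ((2 * k).+1 ^ D <= Np)%N.
  by move=> h; rewrite /Np; elim: (D) => // D' IH; rewrite !expnS leq_mul// ltnS leq_mul2l h orbT.
have [Cc Cc0 [la /andP[la0 la1] HCc]] := HLS Np.
have la01 : 0 <= la < 1 by rewrite ltW.
have S0 : 0 < (2 / (1 - la)) ^+ D by rewrite exprn_gt0// divr_gt0// subr_gt0.
(* The product of the kernel bounds along the chain [v1] to [v4]. *)
pose Cv := Np%:R * ((2 / (1 - la)) ^+ D * (Np%:R * (Np%:R * 1))).
have Cv0 : 0 < Cv by rewrite !mulr_gt0.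
exists (4 * (Cb * (Cc * Ca) * Cv + Ca * Np%:R) + 1).
  by rewrite ltr_wpDl// mulr_ge0// addr_ge0// ?mulr_ge0// ltW.
move=> m M g c eps x t m0 M0 dM sg gc e0 ce px tT.
have m0R : 0 < m%:R :> R by rewrite ltr0n.
have M0R : 0 < M%:R :> R by rewrite ltr0n.
have MR : M%:R = d^-1 * m%:R :> R by rewrite -[M%:R]invrK dM invfM invrK.
pose y i := x i t.
have Oy al : Omega (y al) by have [tx _] := px al; exact: trajectory_in tx tT.
have Ox0 al : Omega (x al 0) by have [tx _] := px al; exact: trajectory_in tx T00.
have back al : Phi t 0 (y al) = x al 0 by have [tx _] := px al; exact: flow_back.
have lip0 al be : `|x al 0 - x be 0| <= L * `|y al - y be|.
  by have [t1 _] := px al; have [t2 _] := px be; exact: HL.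
pose w z := g (Phi t 0 z).
pose c' (i : spline_index n m) := mcoef xi om i w.
have wc' z : Omega z -> `|w z - comb c' z| <= Ca * near_sum K' (Phi t 0 z) eps.
  exact: HCa.
have near2 (k : nat) (z z' : 'rV[R]_D) (N : 'I_D -> nat) :
    near_index k (fun j => m%:R * z 0 j) N -> near_index k (fun j => m%:R * z' 0 j) N -> `|z - z'| <= (2 * k)%:R / m%:R.
  move=> h1 h2; apply: norm_leP => [|l]; first by rewrite divr_ge0.
  rewrite ler_pdivlMr// -[X in _ * X](normr_nat R) -normrM !mxE mul2n -addnn natrD.
  rewrite (_ : _ * _ = ((N l)%:R - m%:R * z' 0 l) - ((N l)%:R - m%:R * z 0 l)); last by ring.
  by rewrite (le_trans (ler_normB _ _))// lerD//; exact: near_index_coord.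
have near3 (k : nat) (N : nat) (z : 'rV[R]_D) (u v : {ffun 'I_D -> 'I_N}) :
    near_index k (fun j => m%:R * z 0 j) (fun j => u j) -> near_index k (fun j => m%:R * z 0 j) (fun j => v j) ->
    forall l, `|(u l)%:R - (v l)%:R| <= (2 * k)%:R :> R.
  move=> h1 h2 l; rewrite (le_trans (ler_distD (m%:R * z 0 l) _ _))// mul2n -addnn natrD lerD//.
    exact: (near_index_coord l h1).
  by rewrite distrC; exact: (near_index_coord l h2).
have partK (P : pred (cell_index D M)) (k : nat) : (k <= 2 * n + 2 * K')%N ->
    (forall al be, P al -> P be -> `|x al 0 - x be 0| <= L * (k%:R / m%:R)) -> (#|P| <= Np)%N.
  move=> kk H; apply: leq_trans (toNp K1 b1).
  apply: (card_close_cell M0 _ _ H); last by move=> al _; have [_] := px al.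
  apply: le_trans K1P; rewrite lerD2l MR -!mulrA ler_pM2l ?invr_gt0// mulrCA ler_pM2l//.
  by rewrite mulrCA mulfV ?gt_eqF// mulr1 ler_nat.
have dense z : Omega z -> exists al, `|y al - z| <= delta / m%:R.
  move=> Oz; have [zt trz] := flowP tT Oz; pose Z r := Phi t r z.
  have [al zal] := cell_exists M0 (trajectory_in trz T00 : Omega (Phi t 0 z)).
  exists al; have [tx xal] := px al.
  apply: (@le_trans _ _ (L * M%:R^-1)); last first.
    rewrite dM mulrA ler_pM2r ?invr_gt0// mulrC -ler_pdivlMr// (le_trans dd)//.
    by rewrite ler_pM2l// lef_pV2 ?posrE ?mulr_gt0// ler_peMl ?ler1n// ltW.
  have := HL _ _ 0 t tx trz T00 tT; rewrite zt => /le_trans; apply; rewrite ler_pM2l//.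
  apply: norm_leP => [|l]; first by rewrite invr_ge0.
  have [_ /(_ l)/andP[h1 h2]] := zal; have [_ /(_ l)/andP[h3 h4]] := xal.
  move: h1 h2 h3 h4; rewrite !subr0 !addr0 -natr1 mulrDl mul1r !mxE; clear => h1 h2 h3 h4.
  by rewrite ler_norml; apply/andP; split; lra.
have count (i : spline_index n m) :
    (#|[pred al | near_index n (fun j => (m%:R * y al 0 j)%R) (fun j => i j)]| <= Np)%N.
  apply: (partK _ (2 * n)%N); first by rewrite leq_addr.
  by move=> al be h1 h2; rewrite (le_trans (lip0 _ _))// ler_pM2l//; exact: near2 h1 h2.
have [cs [[su Hu] uniq] Hc] := HCc m _ y m0 Oy dense count (fun al => g (x al 0)).
have regP u : regularization n m y (fun i => g (x i 0)) u <-> discrete_projection n m y (fun al => g (x al 0)) u.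
  have WW : M%:R^-1 ^+ D != 0 :> R by rewrite expf_neq0// invr_eq0 gt_eqF.
  rewrite /regularization /discrete_projection /A_h /particle_functional; split=> -[su' H]; split=> // v sv.
    apply: (mulfI WW); rewrite !mulr_sumr; under eq_bigr do rewrite mulrA; rewrite H//.
    by apply: eq_bigr => i _; rewrite mulrA.
  under eq_bigr do rewrite -mulrA; rewrite -mulr_sumr H// mulr_sumr; by apply: eq_bigr => i _; rewrite mulrA.
exists (comb cs); split; [by apply/regP|by move=> v /regP; exact: uniq|].
pose v1 al := \sum_(q : cell_index D m | near_index K' (fun j => m%:R * x al 0 0 j) (fun j => q j)) eps q.
pose v2 (j : spline_index n m) := \sum_(al | near_index n (fun l => m%:R * y al 0 l) (fun l => j l)) v1 al.
pose v3 (i : spline_index n m) := \sum_j decay la i j * v2 j.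
pose v4 (q : cell_index D m) := \sum_(i : spline_index n m | near_index n.+1 (fun l => (q l)%:R : R) (fun l => i l)) v3 i.
(* Relates [q] to the cells near its image under the backward flow. The Lipschitz bound of the flow
   limits the [q'] for each [q], that of its inverse the [q] for each [q']. *)
pose P5 (q q' : cell_index D m) := `[< exists2 z, cell q z & near_index K' (fun j => m%:R * Phi t 0 z 0 j) (fun j => q' j) >].
pose v5 (q : cell_index D m) := \sum_(q' | P5 q q') eps q'.
have v10 al : 0 <= v1 al by exact: sumr_ge0.
have v20 j : 0 <= v2 j by exact: sumr_ge0.
have d0' (i j : spline_index (D := D) n m) : 0 <= decay la i j by apply: ltW; exact: decay_gt0.
have v30 i : 0 <= v3 i by apply: sumr_ge0 => j _; exact: mulr_ge0.
have v40 q : 0 <= v4 q by exact: sumr_ge0.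
have v50 q : 0 <= v5 q by exact: sumr_ge0.
exists (fun q => Cb * (Cc * Ca) * v4 q + Ca * v5 q); split.
- by move=> q; rewrite addr_ge0// !mulr_ge0.
- move=> q z qz; have [Oz qz'] := qz.
  rewrite (_ : _ - _ = (comb cs z - comb c' z) + (comb c' z - w z)); last by rewrite /w; ring.
  rewrite (le_trans (ler_normD _ _))// lerD//; last first.
    rewrite distrC (le_trans (wc' z Oz))//; apply: ler_wpM2l => //; rewrite /near_sum /v5.
    rewrite [leLHS]big_mkcond [leRHS]big_mkcond; apply: ler_sum => q' _.
    case: ifP => [h|_]; last by case: ifP.
    by rewrite ifT//; apply/asboolP; exists z.
  rewrite /comb -sumrB (le_trans (ler_norm_sum _ _ _))// /v4 mulr_sumr [leRHS]big_mkcond /=.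
  apply: ler_sum => i _; rewrite -mulrBl.
  have [->|tz] := eqVneq (tensor_bspline i z) 0.
    by rewrite mulr0 normr0; case: ifP => // _; rewrite !mulr_ge0.
  rewrite ifT; last first.
    apply/forallP => l; have := near_index_coord l (tensor_bspline_support n2 tz).
    have /andP[h1 h2] := qz' l; move: h1 h2.
    rewrite subr0 addr0 ler_pdivrMr// ler_pdivlMr// -natr1 => h1 h2.
    by rewrite !ler_norml -natr1 => /andP[h3 h4]; apply/andP; split; lra.
  rewrite normrM mulrC -mulrA; apply: ler_pM => //; first by have [] := HCb m i z z.
  apply: le_trans (Hc c' i) _; rewrite -mulrA ler_wpM2l// /v3 mulr_sumr; apply: ler_sum => j _.
  rewrite decay_sym mulrCA ler_wpM2l// /v2 mulr_sumr; apply: ler_sum => al _.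
  by have := wc' (y al) (Oy al); rewrite /w back.
move=> V p E p1 V0 E0 He.
have h1 : lpb V p v1 (Np%:R * E).
  apply: (lpb_near p1 V0 E0 Np0 e0 _ _ He) => [al|q].
    apply: leq_trans (toNp (2 * K')%N b4).
    by apply: (card_close (R := R)) => i j; exact: near3.
  apply: (partK _ (2 * K')%N); first by rewrite leq_addl.
  move=> al be n1 n2'; apply: (le_trans (near2 _ _ _ _ n1 n2')).
  by rewrite ler_peMl// divr_ge0.
have h2 : lpb V p v2 (Np%:R * (Np%:R * E)).
  apply: (lpb_near p1 V0 _ Np0 v10 _ _ h1) => [|j|al]; first by rewrite mulr_ge0.
    exact: count.
  apply: leq_trans (toNp (2 * n)%N (leq_trans (leq_mul (leqnn 2) (leqnSn n)) b3)).
  by apply: (card_close (R := R)) => i j; exact: near3.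
have h3 : lpb V p v3 ((2 / (1 - la)) ^+ D * (Np%:R * (Np%:R * E))).
  rewrite /v3; refine (lpb_schur p1 V0 S0 _ d0' v20 _ _ h2) => [|i|j]; first by rewrite !mulr_ge0.
    by under eq_bigr do rewrite decay_sym; exact: decay_sum.
  exact: decay_sum.
have h4 : lpb V p v4 (Cv * E).
  rewrite /Cv mulr1 -!mulrA; apply: (lpb_near p1 V0 _ Np0 v30 _ _ h3) => [|q|i].
  - by rewrite !mulr_ge0 // ltW.
  - apply: leq_trans (toNp (2 * n.+1)%N b3).
    apply: (card_close (R := R)) => i j /forallP i1 /forallP j1 l.
    by rewrite (le_trans (ler_distD (q l)%:R _ _))// mul2n -addnn natrD lerD// distrC.
  - apply: leq_trans (toNp (2 * n.+1)%N b3).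
    apply: (card_close (R := R)) => q q' /forallP i1 /forallP j1 l.
    by rewrite (le_trans (ler_distD (i l)%:R _ _))// mul2n -addnn natrD lerD// distrC.
have h5 : lpb V p v5 (Np%:R * E).
  apply: (lpb_near p1 V0 E0 Np0 e0 _ _ He) => [q|q'].
    apply: leq_trans (toNp (2 * K' + (Num.truncn (2 * K'%:R + L)).+1)%N b5).
    apply: (card_close (R := R)) => i j /asboolP[z [Oz qz] nz] /asboolP[z' [Oz' qz'] nz'] l.
    have [zt trz] := flowP tT Oz; have [zt' trz'] := flowP tT Oz'.
    have zz' : `|z - z'| <= m%:R^-1.
      apply: norm_leP => [|k]; first by rewrite invr_ge0.
      have /andP[u1 u2] := qz k; have /andP[u3 u4] := qz' k.
      move: u1 u2 u3 u4; rewrite !subr0 !addr0 -natr1 mulrDl mul1r !mxE => u1 u2 u3 u4.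
      by rewrite ler_norml; apply/andP; split; lra.
    have := HL _ _ t 0 trz trz' tT T00; rewrite zt zt' => h.
    have : `|m%:R * Phi t 0 z 0 l - m%:R * Phi t 0 z' 0 l| <= L.
      rewrite -mulrBr normrM normr_nat -ler_pdivlMl// mulrC.
      have := coord_le_norm (Phi t 0 z - Phi t 0 z') l; rewrite !mxE => /le_trans; apply.
      by rewrite (le_trans h)// ler_pM2l.
    have := near_index_coord l nz; have := near_index_coord l nz'.
    have := ltW (truncnS_gt (2 * K'%:R + L)); have : 0 <= K'%:R :> R by [].
    rewrite natrD; set tr := (Num.truncn _).+1%:R; set iz := (i l)%:R; set jz := (j l)%:R.
    set az := m%:R * _; set bz := m%:R * _; rewrite natrM; set kk := K'%:R.
    move: tr iz jz az bz kk; clear => tr iz jz az bz kk; rewrite !ler_norml => h0 h1 /andP[? ?] /andP[? ?] /andP[? ?].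
    by apply/andP; split; lra.
  have /choice[s Hs] : forall q : cell_index D m, exists z, P5 q q' -> cell q z /\ near_index K' (fun j => m%:R * Phi t 0 z 0 j) (fun j => q' j).
    by move=> q; have [/asboolP[z h1' h2']|h] := boolP (P5 q q'); [exists z|exists 0].
  apply: leq_trans (toNp K2 b2).
  apply: (card_close_cell (r := L * ((2 * K')%:R / m%:R)) (s := s) m0).
  - by rewrite mulrCA [_ * (_ / _)]mulrCA mulfV ?gt_eqF// mulr1.
  - by move=> q /Hs[].
  move=> q r /Hs[[Oz qz] nz] /Hs[[Oz' rz] nz'].
  have [zt trz] := flowP tT Oz; have [zt' trz'] := flowP tT Oz'.
  have := HL _ _ 0 t trz trz' T00 tT; rewrite zt zt' => /le_trans; apply; rewrite ler_pM2l//.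
  exact: near2 nz nz'.
have CC : 0 <= Cb * (Cc * Ca) by rewrite !mulr_ge0.
have Cv0' := ltW Cv0; clearbody Cv.
have E1 : 0 <= Cb * (Cc * Ca) * (Cv * E) + Ca * (Np%:R * E) by apply: addr_ge0; apply: mulr_ge0 => //; apply: mulr_ge0.
apply: (@lpb_le _ _ _ _ (fun q => Cb * (Cc * Ca) * v4 q + Ca * v5 q) _ (4 * (Cb * (Cc * Ca) * (Cv * E) + Ca * (Np%:R * E)))) => //.
- exact: mulr_ge0.
- rewrite [leRHS](_ : _ = 4 * (Cb * (Cc * Ca) * (Cv * E) + Ca * (Np%:R * E)) + E); last by ring.
  by rewrite lerDl.
- by move=> q; rewrite lexx andbT addr_ge0// mulr_ge0.
apply: lpb_add => //; rewrite ?mulr_ge0//.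
- by move=> q; rewrite mulr_ge0.
- by move=> q; rewrite mulr_ge0.
- by apply: lpb_scale => //; rewrite mulr_ge0.
- by apply: lpb_scale => //; rewrite mulr_ge0.
Qed.

End particle_error.

(** * Sobolev norms on cells *)

Section finite_lp_norm.
Context {R : realType}.
Implicit Types (p x : \bar R) (s : seq (\bar R)).

Lemma lp_norm_ge p s x : (1 <= p)%E -> (forall y, y \in s -> 0 <= y)%E -> x \in s -> (x <= lp_norm p s)%E.
Proof.
case: p => [r||] //=.
  rewrite lee_fin => r1 s0 xs; have r0 : 0 < r by exact: lt_le_trans r1.
  have x0 := s0 x xs.
  rewrite -[leLHS]poweRe1// -[X in (x `^ X)%E](mulfV (lt0r_neq0 r0)) poweRrM.
  have h : (x `^ r <= \sum_(y <- s) y `^ r)%E.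
    by rewrite (big_rem x xs)/= leeDl// sume_ge0// => y _; exact: poweR_ge0.
  apply: gt0_ler_poweR => //; rewrite ?invr_ge0 ?(ltW r0)// in_itv /= leey andbT ?poweR_ge0//.
  by apply: sume_ge0 => y _; exact: poweR_ge0.
move=> _ _; elim: s => // y s IH; rewrite inE big_cons le_max => /predU1P[->|/IH ->]; by rewrite ?lexx ?orbT.
Qed.

Lemma lp_norm_le p s (E : R) : (1 <= p)%E -> 0 <= E -> (forall y, y \in s -> (0 <= y <= E%:E)%E) ->
  (lp_norm p s <= ((size s).+1%:R * E)%:E)%E.
Proof.
move=> + E0; have N1 : 1 <= (size s).+1%:R :> R by rewrite ler1n.
case: p => [r||] //=.
  rewrite lee_fin => r1 sE; have r0 : 0 < r by exact: lt_le_trans r1.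
  have h : (\sum_(y <- s) y `^ r <= (((size s).+1%:R * E) `^ r)%:E)%E.
    apply: (@le_trans _ _ (\sum_(y <- s) (E `^ r)%:E)%E).
      rewrite big_seq [leRHS]big_seq; apply: lee_sum => y /sE/andP[y0 yE].
      by rewrite -poweR_EFin; apply: gt0_ler_poweR; rewrite ?(ltW r0)// in_itv /= leey andbT ?lee_fin.
    have -> : (\sum_(y <- s) (E `^ r)%:E = ((size s)%:R * E `^ r)%:E)%E.
      by rewrite sumEFin big_const_seq count_predT iter_addr addr0 mulr_natl.
    rewrite lee_fin powRM//; apply: ler_wpM2r; first exact: powR_ge0.
    apply: (@le_trans _ _ (size s).+1%:R); first by rewrite ler_nat.
    by rewrite -[leLHS]powRr1//; apply: ler_powR.
  have N0 : 0 <= (size s).+1%:R * E by rewrite mulr_ge0.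
  rewrite [leRHS](_ : _ = ((((size s).+1%:R * E) `^ r)%:E `^ r^-1)%E); last first.
    by rewrite poweR_EFin -powRrM mulfV ?gt_eqF// powRr1.
  apply: gt0_ler_poweR => //; rewrite ?invr_ge0 ?(ltW r0)// in_itv /= leey andbT ?lee_fin ?powR_ge0//.
  by apply: sume_ge0 => y _; exact: poweR_ge0.
move=> _ sE; apply: (@le_trans _ _ E%:E); last by rewrite lee_fin ler_peMl.
elim: s sE {N1} => [|y s IH] sE; first by rewrite big_nil lee_fin.
rewrite big_cons ge_max; have /andP[_ ->] := sE y (mem_head _ _).
by apply: IH => z zs; apply: sE; rewrite inE zs orbT.
Qed.

End finite_lp_norm.

Section sobolev_families.
Context {R : realType} {D : nat}.
Local Notation mu := (lebesgue_rV R D).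
Implicit Types (A B : set 'rV[R]_D) (u v : 'rV[R]_D -> R) (p : \bar R).

Definition derivative_norm A (s : R) p v : \bar R :=
  if frac_part s == 0 then Lp_norm A p v else slobodeckij A (frac_part s) p v.

Lemma derivative_norm_ge0 A s p v : (0 <= derivative_norm A s p v)%E.
Proof. by rewrite /derivative_norm; case: ifP => _; exact: Lnorm_ge0. Qed.

Lemma derivative_inf_ge0 A s p u (al : multi_index (D := D) (int_part s)) :
  (0 <= ereal_inf [set derivative_norm A s p v | v in weak_derivative A al u])%E.
Proof. by apply: le_ereal_inf_tmp => _ [v _ <-]; exact: derivative_norm_ge0. Qed.

Lemma sobolev_seminorm_ge0 A s p u : (0 <= sobolev_seminorm A s p u)%E.
Proof.
rewrite /sobolev_seminorm; case: p => [r||]; rewrite ?poweR_ge0//=; elim/big_rec: _ => // x y _ y0.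
  by rewrite le_max y0 orbT.
by rewrite le_max y0 orbT.
Qed.

(** The infimum over representatives need not be attained, hence the strict inequality in the
    hypothesis. *)
Lemma seminorm_derivative A s p u (E : R) : (1 <= p)%E -> (sobolev_seminorm A s p u < E%:E)%E ->
  forall al : multi_index (D := D) (int_part s), al \in multi_indices (int_part s) ->
  exists2 v, weak_derivative A al u v & (derivative_norm A s p v <= E%:E)%E.
Proof.
move=> p1 semi al als.
have : (ereal_inf [set derivative_norm A s p v | v in weak_derivative A al u] < E%:E)%E.
  apply: le_lt_trans semi; apply: lp_norm_ge => //; last by apply/mapP; exists al.
  by move=> _ /mapP[be _ ->]; exact: derivative_inf_ge0.
by move=> /ereal_inf_lt[_ [v wv <-] vE]; exists v => //; exact: ltW.
Qed.

Lemma int_part_nat k : int_part (k%:R : R) = k.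
Proof. by rewrite /int_part natrK. Qed.

Lemma frac_part_nat k : frac_part (k%:R : R) = 0.
Proof. by rewrite /frac_part int_part_nat subrr. Qed.

Lemma sobolev_norm_derivative A s p u (E : R) : (1 <= p)%E -> (sobolev_norm A s p u < E%:E)%E ->
  (forall k (al : multi_index (D := D) k), (k <= int_part s)%N -> al \in multi_indices k ->
     exists2 v, weak_derivative A al u v & (Lp_norm A p v <= E%:E)%E) /\
  (forall al : multi_index (D := D) (int_part s), al \in multi_indices (int_part s) ->
     exists2 v, weak_derivative A al u v & (derivative_norm A s p v <= E%:E)%E).
Proof.
move=> p1 sE.
have semi t : t \in [seq sobolev_seminorm A k%:R p u | k <- iota 0 (int_part s).+1] ++
    (if frac_part s == 0 then [::] else [:: sobolev_seminorm A s p u]) -> (t < E%:E)%E.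
  move=> tl; apply: le_lt_trans sE; apply: lp_norm_ge => // y; rewrite mem_cat => /orP[/mapP[k _ ->]|].
    exact: sobolev_seminorm_ge0.
  by case: ifP => //= _; rewrite inE => /eqP ->; exact: sobolev_seminorm_ge0.
have H k (al : multi_index (D := D) k) : (k <= int_part s)%N -> al \in multi_indices k ->
    exists2 v, weak_derivative A al u v & (Lp_norm A p v <= E%:E)%E.
  move=> ks; have : (sobolev_seminorm A k%:R p u < E%:E)%E.
    by apply: semi; rewrite mem_cat; apply/orP; left; apply/mapP; exists k => //; rewrite mem_iota.
  move=> /(seminorm_derivative p1); rewrite /derivative_norm frac_part_nat eqxx.
  by move: al; rewrite int_part_nat => al; exact.
split => // al als; have [f0|f0] := eqVneq (frac_part s) 0.
  by have [v wv vE] := H _ al (leqnn _) als; exists v => //; rewrite /derivative_norm f0 eqxx.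
by apply: seminorm_derivative => //; apply: semi; rewrite (negbTE f0) mem_cat mem_seq1 eqxx orbT.
Qed.

Lemma sobolev_seminorm_le A s p u (e : multi_index (D := D) (int_part s) -> R) : (1 <= p)%E ->
  (forall al, 0 <= e al) ->
  (forall al, al \in multi_indices (int_part s) -> exists2 v, weak_derivative A al u v &
     (derivative_norm A s p v <= (e al)%:E)%E) ->
  (sobolev_seminorm A s p u <=
    ((size (multi_indices (D := D) (int_part s))).+1%:R * \sum_(al <- multi_indices (int_part s)) e al)%:E)%E.
Proof.
move=> p1 e0 H; rewrite /sobolev_seminorm; set l := map _ _.
have -> : size (multi_indices (D := D) (int_part s)) = size l by rewrite size_map.
apply: lp_norm_le => //; first by apply: sumr_ge0.
move=> _ /mapP[al als ->]; rewrite derivative_inf_ge0 /=.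
have [v wv vE] := H al als; apply: (@le_trans _ _ (e al)%:E).
  by apply: le_trans vE; apply: ereal_inf_lbound; exists v.
by rewrite lee_fin (big_rem al)//= lerDl sumr_ge0.
Qed.

Lemma partials_out (phi : 'rV[R]_D -> R) l x : ~ closure [set x | phi x != 0] x -> partials l phi x = 0.
Proof.
set S := closure _; have oS : open (~` S) by apply: closed_openC; exact: closed_closure.
elim: l x => [|i l IH] x Sx /=.
  by apply/eqP; apply: contra_notT Sx => fx; exact: subset_closure.
rewrite /partial (near_eq_derive (g := cst 0)) ?derive_cst//.
by apply: filterS (open_nbhs_nbhs (conj oS Sx)) => y Sy; exact: IH.
Qed.

(** A test function on [B] is also one on [A], and the integrands vanish off its support. *)
Lemma weak_derivative_sub A B k (al : multi_index (D := D) k) u v : measurable A -> measurable B -> B `<=` A ->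
  weak_derivative A al u v -> weak_derivative B al u v.
Proof.
move=> mA mB BA [[mu' lu] [mv lv] H].
have L1 (f : 'rV[R]_D -> R) : measurable_fun A f -> (forall K, K `<=` A° -> compact K -> (\int[mu]_(x in K) `|f x|%:E < +oo)%E) -> locally_L1 B f.
  move=> mf lf; split; first exact: measurable_funS mf.
  by move=> K KB cK; apply: lf => //; apply: subset_trans KB _; exact: interiorS.
split; [exact: L1|exact: L1|move=> phi [sphi cphi Bphi]].
have supp (f h : 'rV[R]_D -> R) : (forall x, ~ closure [set x | phi x != 0] x -> h x = 0) ->
    \int[mu]_(x in B) (f x * h x) = \int[mu]_(x in A) (f x * h x).
  move=> h0; rewrite /Rintegral integral_mkcond [in RHS]integral_mkcond; congr fine.
  apply: eq_integral => x _; rewrite !patchE; case: ifPn => xB.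
    by rewrite ifT//; move: xB; rewrite !inE; exact: BA.
  case: ifPn => // _; rewrite h0 ?mulr0// => cx; move/negP: xB; apply.
  by rewrite inE; apply: interior_subset; exact: Bphi.
have tA : test_function A phi by split => //; apply: subset_trans Bphi _; exact: interiorS.
rewrite !supp; first exact: H.
  by move=> x cx; apply/eqP; apply: contra_notT cx => fx; exact: subset_closure.
by move=> x cx; exact: partials_out.
Qed.

End sobolev_families.

Section sobolev_on_cells.
Context {R : realType} {D : nat}.
Local Notation mu := (lebesgue_rV R D).
Local Notation Om := (@Omega R D).
Implicit Types (u v : 'rV[R]_D -> R) (p : \bar R).

Lemma enlarged_cell_Omega L m (i : cell_index D m) : @enlarged_cell R D L m i `<=` Om.
Proof. by move=> x []. Qed.

Lemma measurable_enlarged_cell L m (i : cell_index D m) : measurable (@enlarged_cell R D L m i).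
Proof.
have -> : @enlarged_cell R D L m i = [set x : 'rV[R]_D | forall j, (`]0, 1[%classic : set (measurableTypeR R)) (x 0 j)] `&`
    [set x : 'rV[R]_D | forall j, (`[((i j)%:R - L%:R) / m%:R, ((i j).+1%:R + L%:R) / m%:R]%classic : set (measurableTypeR R)) (x 0 j)].
  by apply/seteqP; split => x [h1 h2]; split=> j; have := h1 j; have := h2 j; rewrite /= ?in_itv.
apply: measurableI.
  by apply: (@measurable_coords R D (fun=> `]0, 1[%classic)) => j; exact: measurable_itv.
apply: (@measurable_coords R D (fun j => `[((i j)%:R - L%:R) / m%:R, ((i j).+1%:R + L%:R) / m%:R]%classic)) => j.
exact: measurable_itv.
Qed.

Lemma enlarged_cell_overlap L m x : (0 < m)%N ->
  (#|[pred i : cell_index D m | x \in @enlarged_cell R D L m i]| <= (2 * L.+1).+1 ^ D)%N.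
Proof.
move=> m0; have m0R : 0 < m%:R :> R by rewrite ltr0n.
apply: leq_trans (card_near_index m L.+1 (fun j => m%:R * x 0 j)).
apply: subset_leq_card; apply/fintype.subsetP => i; rewrite !inE => -[_ H]; apply/forallP => j.
have /andP[] := H j; rewrite ler_pdivrMr// ler_pdivlMr// -!natr1 => h1 h2.
by rewrite ler_norml; apply/andP; split; lra.
Qed.

Definition quotient (th : R) p v (z : 'rV[R]_D * 'rV[R]_D) : R :=
  `|v z.1 - v z.2| / eucl_norm (z.1 - z.2) `^ (th + D%:R * fine p^-1).

Lemma measurable_fst_snd v : measurable_fun Om v ->
  measurable_fun (Om `*` Om) (fun z => v z.1 - v z.2).
Proof.
move=> mv; have mO := @measurable_Omega R D; have mOO := measurableX mO mO.
apply: measurable_funB.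
  apply: (measurable_comp mO _ mv); first by move=> _ [z [z1 _] <-].
  by apply: measurable_funTS; exact: measurable_fst.
apply: (measurable_comp mO _ mv); first by move=> _ [z [_ z2] <-].
by apply: measurable_funTS; exact: measurable_snd.
Qed.

Lemma measurable_quotient th p v : measurable_fun Om v -> measurable_fun (Om `*` Om) (quotient th p v).
Proof.
move=> mv; set e := th + D%:R * fine p^-1.
have -> : quotient th p v = (fun z => `|v z.1 - v z.2| * ((\sum_i (z.1 0 i - z.2 0 i) ^+ 2) `^ 2^-1) `^ (- e)).
  apply/funext => z; rewrite /quotient powRN powR12_sqrt; last by apply: sumr_ge0 => i _; exact: sqr_ge0.
  by rewrite /eucl_norm; under eq_bigr do rewrite !mxE.
apply: measurable_funM; first by apply: measurableT_comp => //; exact: measurable_fst_snd.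
apply: measurable_funTS; apply: (measurableT_comp (measurable_powR _)).
apply: (measurableT_comp (measurable_powR _)).
apply: measurable_sum => i; apply: measurable_funX; apply: measurable_funB.
  exact: (measurableT_comp (measurable_coor i) measurable_fst).
exact: (measurableT_comp (measurable_coor i) measurable_snd).
Qed.

Lemma derivative_normP (A : set 'rV[R]_D) s p v (E : R) : (1 <= p)%E -> 0 <= E ->
  (derivative_norm A s p v <= E%:E)%E <->
  if frac_part s == 0 then lpE mu A p v E
  else lpE (mu \x mu)%E (A `*` A) p (quotient (frac_part s) p v) E.
Proof.
move=> p1 E0; rewrite /derivative_norm; case: ifP => _; first exact: lpEP.
exact: (lpEP (mu \x mu)%E (A `*` A) (quotient (frac_part s) p v) p1 E0).
Qed.

(** One global representative is restricted to all enlarged cells. These overlap boundedly, and so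
    do their Cartesian squares, over which the Slobodeckij seminorm integrates. *)
Lemma seminorm_cells (L : nat) (s : R) : exists2 C : R, 0 <= C &
  forall m p u (E : R), (0 < m)%N -> (1 <= p)%E -> 0 <= E ->
  (forall al : multi_index (D := D) (int_part s), al \in multi_indices (int_part s) ->
     exists2 v, weak_derivative Om al u v & (derivative_norm Om s p v <= E%:E)%E) ->
  exists2 e : cell_index D m -> R, (forall i, 0 <= e i /\
     (sobolev_seminorm (enlarged_cell L i) s p u <= (e i)%:E)%E) & lpb 1 p e (C * E).
Proof.
pose mi := multi_indices (D := D) (int_part s).
pose K := ((2 * L.+1).+1 ^ D)%N; have K0 : (0 < K)%N by rewrite expn_gt0.
exists ((size mi).+1%:R * (8 ^+ size mi * K%:R)) => [|m p u E m0 p1 E0 H].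
  by rewrite !mulr_ge0// exprn_ge0.
have mO := @measurable_Omega R D; have mOO := measurableX mO mO.
have cells (al : multi_index (D := D) (int_part s)) : exists e : cell_index D m -> R,
    [/\ forall i, 0 <= e i, lpb 1 p e (K%:R * E) & al \in mi -> forall i, exists2 v,
      weak_derivative (enlarged_cell L i) al u v & (derivative_norm (enlarged_cell L i) s p v <= (e i)%:E)%E].
  have [als|_] := boolP (al \in mi); last first.
    exists (fun=> 0); split => //; clear H; case: p p1 => [r||] //=; last by move=> _ _; rewrite mulr_ge0.
    rewrite lee_fin => r1; rewrite mul1r big1 ?powR_ge0// => i _.
    by rewrite powR0// gt_eqF// (lt_le_trans _ r1).
  have [v wv vE] := H al als; have [_ [mv _] _] := wv.
  have wd (i : cell_index D m) : weak_derivative (enlarged_cell L i) al u v.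
    by apply: weak_derivative_sub wv => //; [exact: measurable_enlarged_cell|exact: enlarged_cell_Omega].
  suff [e He Hb] : exists2 e : cell_index D m -> R, (forall i, 0 <= e i /\
       (derivative_norm (enlarged_cell L i) s p v <= (e i)%:E)%E) & lpb 1 p e (K%:R * E).
    exists e; split => // [i|_ i]; first by have [] := He i.
    by exists v => //; have [] := He i.
  move: vE => /(derivative_normP Om s v p1 E0); have [f0|f0] := eqVneq (frac_part s) 0 => vE.
    have [e He Hb] := lpE_overlap p1 E0 mO (fun i => measurable_enlarged_cell L i)
      (fun i => @enlarged_cell_Omega L m i) mv K0 (fun x _ => enlarged_cell_overlap L x m0) vE.
    exists e => // i; have [e0 ei] := He i; split => //.
    by apply/(derivative_normP _ _ _ p1 e0); rewrite f0 eqxx.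
  have BO (i : cell_index D m) : @enlarged_cell R D L m i `*` @enlarged_cell R D L m i `<=` Om `*` Om.
    by move=> z [/(@enlarged_cell_Omega L m i) z1 /(@enlarged_cell_Omega L m i) z2].
  have mB (i : cell_index D m) : measurable (@enlarged_cell R D L m i `*` @enlarged_cell R D L m i).
    by apply: measurableX; exact: measurable_enlarged_cell.
  have ov (z : 'rV[R]_D * 'rV[R]_D) : (Om `*` Om) z ->
      (#|[pred i : cell_index D m | z \in @enlarged_cell R D L m i `*` @enlarged_cell R D L m i]| <= K)%N.
    move=> _; apply: leq_trans (enlarged_cell_overlap L z.1 m0).
    by apply: subset_leq_card; apply/fintype.subsetP => i; rewrite !inE => -[].
  have [e He Hb] := lpE_overlap p1 E0 mOO mB BO (measurable_quotient _ _ mv) K0 ov vE.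
  exists e => // i; have [e0 ei] := He i; split => //.
  by apply/(derivative_normP _ _ _ p1 e0); rewrite (negbTE f0).
have [e He] := choice cells.
have e0 al i : 0 <= e al i by have [] := He al.
exists (fun i => (size mi).+1%:R * \sum_(al <- mi) e al i) => [i|].
  split; first by rewrite mulr_ge0// sumr_ge0.
  by apply: sobolev_seminorm_le => // al als; have [_ _ /(_ als i)] := He al.
rewrite -!mulrA; apply: lpb_scale => //.
- by rewrite !mulr_ge0// exprn_ge0.
- by move=> i; rewrite sumr_ge0.
apply: lpb_sum => //; first by rewrite mulr_ge0.
by move=> al; have [] := He al.
Qed.

(** The local approximation property, summed over the cells by means of [seminorm_cells]. *)
Lemma approximation_error (n : nat) (P : nat -> ('rV[R]_D -> R) -> 'rV[R]_D -> R) (s : R) :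
  quasi_interpolator n.+1 P -> 0 <= s <= n.+1%:R -> exists2 C : R, 0 <= C &
  forall m p u (E : R), (0 < m)%N -> (1 <= p)%E -> 0 <= E -> in_Lp Om 1 u ->
  (forall al : multi_index (D := D) (int_part s), al \in multi_indices (int_part s) ->
     exists2 v, weak_derivative Om al u v & (derivative_norm Om s p v <= E%:E)%E) ->
  measurable_fun Om (u \- P m u) /\ lpE mu Om p (u \- P m u) (C * (m%:R^-1 `^ s * E)).
Proof.
move=> [Plin [L [_ Papp]]] sn; have [C1 C10 HC1] := Papp s sn; have [C2 C20 HC2] := seminorm_cells L s.
exists (C1 * C2) => [|m p u E m0 p1 E0 u1 H]; first by rewrite mulr_ge0// ltW.
have [/(_ u u1)[sP _] _] := Plin m m0.
have mO := @measurable_Omega R D.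
have mP : measurable_fun Om (P m u).
  by apply: continuous_measurable_Omega => x Ox; exact: (proj1 (sP [::]) _ x Ox).
have mD : measurable_fun Om (u \- P m u) by apply: measurable_funB => //; have [] := u1.
split => //; have [e He Hb] := HC2 m p u E m0 p1 E0 H.
have c0 : 0 <= C1 * m%:R^-1 `^ s by rewrite mulr_ge0 ?powR_ge0// ltW.
apply: (@lpE_cover _ _ _ mu (cell_index D m) Om (@cell R D m) p _ (fun i => C1 * m%:R^-1 `^ s * e i)) => //.
- by move=> i; exact: measurable_enlarged_cell.
- by move=> i; exact: enlarged_cell_Omega.
- by move=> x Ox; exact: cell_exists.
- move=> i; have [e0 ei] := He i; apply/(lpEP mu _ _ p1); first exact: mulr_ge0.
  apply: le_trans (HC1 m i p u m0 p1 u1) _.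
  by rewrite [leRHS]EFinM; apply: lee_wpmul2l => //; rewrite lee_fin.
rewrite (_ : C1 * C2 * _ = C1 * m%:R^-1 `^ s * (C2 * E)); last by ring.
by apply: lpb_scale => //; [exact: mulr_ge0|move=> i; have [] := He i].
Qed.

End sobolev_on_cells.

Section coefficient_errors.
Context {R : realType} {D : nat}.
Local Notation mu := (lebesgue_rV R D).
Local Notation Om := (@Omega R D).
Implicit Types (u v g : 'rV[R]_D -> R) (p : \bar R).

Lemma eucl_norm_le (x : 'rV[R]_D) : eucl_norm x <= D%:R * `|x|.
Proof.
have D0 : 0 <= D%:R * `|x| :> R by rewrite mulr_ge0.
rewrite /eucl_norm -(ger0_norm D0) -sqrtr_sqr ler_wsqrtr// exprMn.
apply: (@le_trans _ _ (\sum_(i < D) `|x| ^+ 2)).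
  apply: ler_sum => i _; rewrite -real_normK ?num_real// lerXn2r ?nnegrE//; exact: coord_le_norm.
rewrite sumr_const card_ord -[leLHS]mulr_natl; apply: ler_wpM2r; first exact: sqr_ge0.
by rewrite -natrX ler_nat; case: (D) => // d; rewrite leq_pmulr.
Qed.

Lemma eucl_norm_eq0 (x : 'rV[R]_D) : eucl_norm x = 0 -> x = 0.
Proof.
move=> /eqP; rewrite sqrtr_eq0 => x0; apply/rowP => i; rewrite mxE; apply/eqP; rewrite -sqrf_eq0 eq_le sqr_ge0 andbT.
by apply: le_trans x0; rewrite (bigD1 i)//= lerDl; apply: sumr_ge0 => j _; exact: sqr_ge0.
Qed.

Lemma quotient_ge0 th p v z : 0 <= quotient th p v z.
Proof. by rewrite /quotient divr_ge0 ?powR_ge0. Qed.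

Lemma lpb_mono (I : finType) (V : R) p (A : I -> R) (E F : R) : (1 <= p)%E -> 0 <= V -> 0 <= E -> E <= F ->
  (forall i, 0 <= A i) -> lpb V p A E -> lpb V p A F.
Proof. by move=> p1 V0 E0 EF A0; apply: lpb_le => // i; rewrite lexx andbT. Qed.

(** Double integrals carry the weight [cell_volume m ^+ 2]; one of the two factors m^-D becomes
    m^(-D/p) on each term. *)
Lemma lpb_sqr_volume m p (A : cell_index D m -> R) (E : R) : (0 < m)%N -> (1 <= p)%E ->
  (forall q, 0 <= A q) -> lpb (cell_volume (R := R) (D := D) m ^+ 2) p A E ->
  lpb (cell_volume (R := R) (D := D) m) p (fun q => m%:R^-1 `^ (D%:R * fine p^-1) * A q) E.
Proof.
move=> m0 p1 A0; case: p p1 => [r||] //=; last first.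
  by move=> _ H q; rewrite ?invey /= mulr0 powRr0 mul1r.
rewrite lee_fin => r1; have r0 : 0 < r by exact: lt_le_trans r1.
rewrite inver gt_eqF//= => H; apply: le_trans H; rewrite expr2 -mulrA; apply: ler_wpM2l.
  by rewrite exprn_ge0// invr_ge0.
rewrite mulr_sumr.
apply: ler_sum => q _; rewrite powRM ?powR_ge0// -powRrM -mulrA mulVf ?gt_eqF// mulr1.
by rewrite powR_mulrn// invr_ge0.
Qed.

(** Two points of one cell are at distance at most [D / m], so the difference is at most (D/m)^(th +
    D/p) times the quotient. The part D/p of the exponent pays for the second volume factor in
    [lpb_sqr_volume], and th completes m^-(int_part s) to m^-s. *)
Lemma osc_mean (s : R) p : 0 <= s -> (1 <= p)%E -> exists2 C : R, 0 <= C &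
  forall m v (E : R), (0 < m)%N -> 0 <= E -> measurable_fun Om v -> 
  lpE (mu \x mu)%E (Om `*` Om) p (quotient (frac_part s) p v) E ->
  (forall q : cell_index D m, (\int[(mu \x mu)%E]_(z in middle q `*` middle q) `|v z.1 - v z.2|%:E < +oo)%E) /\
  lpb (cell_volume (R := R) (D := D) m) p (fun q : cell_index D m => m%:R^-1 ^+ int_part s *
     mean (mu \x mu)%E (cell_volume (R := R) (D := D) m ^+ 2) (middle q `*` middle q) (fun z => v z.1 - v z.2))
    (C * (m%:R^-1 `^ s * E)).
Proof.
move=> s0 p1; set th := frac_part s.
have th0 : 0 <= th by rewrite /th subr_ge0; have /andP[] := truncn_itv s0.
have fp0 : 0 <= fine p^-1 :> R.
  by case: p p1 => [r||] //=; rewrite ?invey// ?lee_fin => r1; rewrite inver gt_eqF ?(lt_le_trans ltr01 r1)//= invr_ge0 (le_trans ler01).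
pose e := th + D%:R * fine p^-1; have e0 : 0 <= e by rewrite addr_ge0// mulr_ge0.
exists (D%:R `^ e) => [|m v E m0 E0 mv HE]; first exact: powR_ge0.
have m0R : 0 < m%:R :> R by rewrite ltr0n.
have mi0 : 0 <= m%:R^-1 :> R by rewrite invr_ge0.
have mO := @measurable_Omega R D; have mOO := measurableX mO mO.
have mM (q : cell_index D m) := measurable_middle (R := R) q m0.
pose B (q : cell_index D m) := (@middle R D m q `*` @middle R D m q).
have mB q : measurable (B q) by exact: measurableX.
have BO q : B q `<=` Om `*` Om.
  by move=> z [z1 z2]; split; exact: (middle_Omega m0).
pose V : R := cell_volume (R := R) (D := D) m.
have V0 : 0 < V by rewrite exprn_gt0// invr_gt0.
have muB q : ((mu \x mu)%E (B q) <= (V ^+ 2)%:E)%E.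
  have h : (mu (middle q) <= V%:E)%E.
    by apply: (measure_cell_le (q := q) m0 (mM q)); exact: middle_cell.
  by rewrite /B product_measure1E// expr2 EFinM; apply: lee_pmul.
have muOO : ((mu \x mu)%E (Om `*` Om) < +oo)%E.
  rewrite product_measure1E//; apply: (@le_lt_trans _ _ (1 * 1)%E); last by rewrite mule1 ltry.
  by apply: lee_pmul => //; exact: measure_Omega_le.
pose Q := quotient th p v; have mQ : measurable_fun (Om `*` Om) Q by exact: measurable_quotient.
have Qoo := lpE_integrable p1 mOO muOO mQ HE.
pose f (z : 'rV[R]_D * 'rV[R]_D) := v z.1 - v z.2.
have mf : measurable_fun (Om `*` Om) f by exact: measurable_fst_snd.
pose ka := (D%:R * m%:R^-1) `^ e : R; have ka0 : 0 <= ka by exact: powR_ge0.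
have fQ q z : B q z -> `|f z| <= ka * `|Q z|.
  move=> [z1 z2]; rewrite [X in _ * X]ger0_norm ?quotient_ge0// /Q /quotient -/e.
  have dz : `|z.1 - z.2| <= m%:R^-1 by apply: (grid_cube_dist m0); exact: middle_grid_cube.
  (* On the diagonal the difference vanishes, whatever value the quotient by 0 takes. *)
  have [z0|z0] := eqVneq (eucl_norm (z.1 - z.2)) 0.
    by have /eqP := eucl_norm_eq0 z0; rewrite subr_eq0 /f => /eqP ->; rewrite subrr normr0 mul0r mulr0.
  have en0 : 0 < eucl_norm (z.1 - z.2) by rewrite lt0r z0 sqrtr_ge0.
  rewrite mulrCA -[leLHS]mulr1; apply: ler_wpM2l => //.
  rewrite ler_pdivlMr ?powR_gt0// mul1r; apply: ge0_ler_powR => //; rewrite ?nnegrE ?sqrtr_ge0 ?mulr_ge0//.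
  by apply: le_trans (eucl_norm_le _) _; apply: ler_wpM2l.
have mAQ q : measurable_fun (B q) (fun z => `|Q z|%:E).
  by apply/measurable_EFinP; apply: measurableT_comp => //; exact: (measurable_funS mOO (BO q) mQ).
have mAf q : measurable_fun (B q) (fun z => `|f z|%:E).
  by apply/measurable_EFinP; apply: measurableT_comp => //; exact: (measurable_funS mOO (BO q) mf).
have QB q : (\int[(mu \x mu)%E]_(z in B q) `|Q z|%:E < +oo)%E.
  apply: le_lt_trans Qoo; apply: ge0_subset_integral => //.
  by apply/measurable_EFinP; apply: measurableT_comp.
have fB q : (\int[(mu \x mu)%E]_(z in B q) `|f z|%:E <= ka%:E * \int[(mu \x mu)%E]_(z in B q) `|Q z|%:E)%E.
  rewrite -ge0_integralZl//; apply: ge0_le_integral => //.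
  - by apply: measurable_funeM.
  - by move=> z Bz; rewrite -EFinM lee_fin (fQ q).
have foo q : (\int[(mu \x mu)%E]_(z in B q) `|f z|%:E < +oo)%E.
  apply: le_lt_trans (fB q) _; rewrite lte_mul_pinfty ?lee_fin//.
split => //.
have tB : trivIset setT B.
  apply/trivIsetP => i j _ _ ij; apply/seteqP; split => // z [[z1 _] [z2 _]].
  move/eqP: ij; apply; apply: grid_cube_unique; [exact: (middle_grid_cube z1)|exact: (middle_grid_cube z2)].
have HQ : lpb (V ^+ 2) p (fun q => mean (mu \x mu)%E (V ^+ 2) (B q) Q) E.
  by apply: (@lpb_mean _ _ _ (mu \x mu)%E _ (V ^+ 2) (Om `*` Om)) => //; rewrite exprn_gt0.
have mQ0 q : 0 <= mean (mu \x mu)%E (V ^+ 2) (B q) Q by apply: mean_ge0; rewrite exprn_gt0.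
have := lpb_sqr_volume m0 p1 mQ0 HQ => /(lpb_scale p1 _ E0) H2.
have c0 : 0 <= D%:R `^ e * m%:R^-1 `^ s :> R by rewrite mulr_ge0 ?powR_ge0.
have H3 := H2 _ c0 (fun q => mulr_ge0 (powR_ge0 _ _) (mQ0 q)).
rewrite mulrA; apply: lpb_le H3 => //; first by rewrite ltW.
  by rewrite mulr_ge0.
move=> q; apply/andP; split; first by apply: mulr_ge0; [exact: exprn_ge0|apply: mean_ge0; rewrite exprn_gt0].
apply: (@le_trans _ _ (m%:R^-1 ^+ int_part s * (ka * mean (mu \x mu)%E (V ^+ 2) (B q) Q))).
  apply: ler_wpM2l; first exact: exprn_ge0.
  have VV : 0 < V ^+ 2 by rewrite exprn_gt0.
  have Qfin : (\int[(mu \x mu)%E]_(z in B q) `|Q z|%:E)%E \is a fin_num.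
    by rewrite ge0_fin_numE//; apply: integral_ge0 => z _; rewrite lee_fin.
  have ffin : (\int[(mu \x mu)%E]_(z in B q) `|f z|%:E)%E \is a fin_num.
    by rewrite ge0_fin_numE//; apply: integral_ge0 => z _; rewrite lee_fin.
  rewrite /mean -/V [leRHS]mulrA ler_pM2r ?invr_gt0//.
  rewrite (_ : ka * _ = fine (ka%:E * \int[(mu \x mu)%E]_(z in B q) `|Q z|%:E)%E); last by rewrite fineM.
  by apply: fine_le => //; [rewrite fin_numM|exact: fB].
rewrite mulrA [leRHS]mulrA; apply: ler_wpM2r => //.
rewrite /ka powRM// /e [m%:R^-1 `^ (_ + _)]powRD; last by apply/implyP => _; rewrite invr_eq0 gt_eqF.
have -> : m%:R^-1 `^ s = m%:R^-1 ^+ int_part s * m%:R^-1 `^ th :> R.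
  rewrite -powR_mulrn// -powRD; last by apply/implyP => _; rewrite invr_eq0 gt_eqF.
  by rewrite /th /frac_part addrC subrK.
rewrite le_eqVlt; apply/orP; left; apply/eqP; ring.
Qed.

Lemma measure_Omega_fin : (mu Om < +oo)%E.
Proof. by apply: le_lt_trans (@measure_Omega_le R D) _; rewrite ltry. Qed.

Lemma lpE_Omega_integrable p u (E : R) : (1 <= p)%E -> measurable_fun Om u -> lpE mu Om p u E ->
  mu.-integrable Om (EFin \o u).
Proof.
move=> p1 mf H; have mO := @measurable_Omega R D.
apply/integrableP; split; first exact/measurable_EFinP.
exact: (lpE_integrable p1 mO measure_Omega_fin mf H).
Qed.

Lemma in_Lp_lpE p u : (1 <= p)%E -> in_Lp Om p u -> exists2 E : R, 0 <= E & lpE mu Om p u E.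
Proof.
move=> p1 [mf uoo]; exists (fine (Lp_norm Om p u)); first by apply: fine_ge0; exact: Lnorm_ge0.
apply/(lpEP mu _ _ p1); first by apply: fine_ge0; exact: Lnorm_ge0.
by rewrite fineK// ge0_fin_numE//; exact: Lnorm_ge0.
Qed.

Lemma in_Lp_in_L1 p u : (1 <= p)%E -> in_Lp Om p u -> in_Lp Om 1 u.
Proof.
move=> p1 up; have [mf _] := up; have [E E0 HE] := in_Lp_lpE p1 up; split => //.
have mO := @measurable_Omega R D.
have Ioo := lpE_integrable p1 mO measure_Omega_fin mf HE.
set I := (\int[mu]_(x in Om) `|u x|%:E)%E in Ioo.
have I0 : (0 <= I)%E by apply: integral_ge0.
have F0 : 0 <= fine I by exact: fine_ge0.
apply: (@le_lt_trans _ _ (fine I)%:E); last exact: ltry.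
apply/(lpEP mu Om u (lexx 1%E) F0); rewrite /lpE powRr1// fineK ?ge0_fin_numE//.
by rewrite /I le_eqVlt; apply/orP; left; apply/eqP/eq_integral => x _; rewrite powRr1.
Qed.

Lemma lpE0 p (E : R) : (1 <= p)%E -> 0 <= E -> lpE mu Om p (fun=> 0) E.
Proof.
case: p => [r||] //=; last by move=> _ E0; apply: aeW => x _; rewrite normr0.
rewrite lee_fin => r1 E0; rewrite integral0_eq ?lee_fin ?powR_ge0// => x _.
by rewrite normr0 powR0// gt_eqF// (lt_le_trans ltr01).
Qed.

(** The local errors are summed in l^p. The representatives of the weak derivatives are chosen
    globally, one for all cells, and multi-indices outside the lists get the function 0 so that the
    families are total. *)
Lemma coefficient_error (n : nat) (s : R) p : 0 <= s <= n%:R -> (1 <= p)%E -> exists2 C : R, 0 <= C &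
  forall m u g (E F : R), (0 < m)%N -> 0 <= E -> 0 <= F -> spline n.+1 m g -> in_Lp Om 1 u ->
  measurable_fun Om (g \- u) -> lpE mu Om p (g \- u) F ->
  (forall k (al : multi_index (D := D) k), (k <= int_part s)%N -> al \in multi_indices k ->
     exists2 v, weak_derivative Om al u v & (Lp_norm Om p v <= E%:E)%E) ->
  (forall al : multi_index (D := D) (int_part s), al \in multi_indices (int_part s) ->
     exists2 v, weak_derivative Om al u v & (derivative_norm Om s p v <= E%:E)%E) ->
  exists c : cell_index D m -> {ffun 'I_D -> 'I_n.+1} -> R, exists eps : cell_index D m -> R,
    [/\ forall q, {in cell q, g =1 cell_poly q (c q)}, forall q, 0 <= eps q, scaled_coefs c eps &
      lpb (cell_volume (R := R) (D := D) m) p eps (C * (F + m%:R^-1 `^ s * E))].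
Proof.
move=> sn p1; have /andP[s0 _] := sn.
have [C1 C10 HC1] := local_coefs (D := D) sn.
have [C2 C20 HC2] := osc_mean s0 p1.
pose S := int_part s.
pose mi k := multi_indices (D := D) k.
pose N := (\sum_(k < S.+1) size (mi k))%N.
pose K1 : R := 8 ^+ size (index_enum 'I_S.+1) * 8 ^+ N.
pose K2 : R := 8 ^+ size (mi S) * C2.
have K10 : 0 <= K1 by rewrite mulr_ge0 ?exprn_ge0.
have K20 : 0 <= K2 by rewrite mulr_ge0 ?exprn_ge0.
exists (C1 * (4 * (4 * (1 + K1) + K2))) => [|m u g E F m0 E0 F0 sg u1 mgu HF Hv Hvf].
  by rewrite !(mulr_ge0, addr_ge0).
have m0R : 0 < m%:R :> R by rewrite ltr0n.
have mO := @measurable_Omega R D.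
pose V : R := cell_volume (R := R) (D := D) m.
have V0 : 0 < V by rewrite exprn_gt0// invr_gt0.
have sE0 : 0 <= m%:R^-1 `^ s * E by rewrite mulr_ge0 ?powR_ge0.
have [c Hc] := cell_poly_of_spline m0 sg.
have /choice[v0 Hv0] : forall kal : {k : nat & multi_index (D := D) k}, exists v,
    [/\ measurable_fun Om v, lpE mu Om p v E &
      (projT1 kal <= S)%N -> projT2 kal \in mi (projT1 kal) -> weak_derivative Om (projT2 kal) u v].
  move=> [k al] /=; have [/andP[kS al_k]|h] := boolP ((k <= S)%N && (al \in mi k)).
    have [v wv vE] := Hv k al kS al_k; exists v; split => //; first by have [_ []] := wv.
    exact/(lpEP mu _ _ p1).
  exists (fun=> 0); split; [exact: measurable_cst|exact: lpE0|].
  by move=> kS al_k; move: h; rewrite kS al_k.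
pose v k (al : multi_index (D := D) k) := v0 (existT _ k al).
have vP k (al : multi_index (D := D) k) : [/\ measurable_fun Om (v k al), lpE mu Om p (v k al) E &
    (k <= S)%N -> al \in mi k -> weak_derivative Om al u (v k al)] := Hv0 (existT _ k al).
have /choice[vf Hvf'] : forall al : multi_index (D := D) S, exists v,
    measurable_fun Om v /\ (al \in mi S -> weak_derivative Om al u v /\ (derivative_norm Om s p v <= E%:E)%E) /\
    (al \notin mi S -> v = fun=> 0).
  move=> al; have [al_S|h] := boolP (al \in mi S).
    by have [w ww wE] := Hvf al al_S; exists w; split; [have [_ []] := ww|].
  by exists (fun=> 0); split => //; exact: measurable_cst.
pose o2 al (q : cell_index D m) := m%:R^-1 ^+ S *
     mean (mu \x mu)%E (V ^+ 2) (middle q `*` middle q) (fun z => vf al z.1 - vf al z.2).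
have o20 al q : 0 <= o2 al q by apply: mulr_ge0; [rewrite exprn_ge0 ?invr_ge0|apply: mean_ge0; rewrite exprn_gt0].
have osc (al : multi_index (D := D) S) : frac_part s != 0 ->
    (forall q : cell_index D m, (\int[(mu \x mu)%E]_(z in middle q `*` middle q) `|vf al z.1 - vf al z.2|%:E < +oo)%E) /\
    lpb V p (o2 al) (C2 * (m%:R^-1 `^ s * E)).
  move=> f0; have [mvf [H1 H2]] := Hvf' al; apply: HC2 => //.
  have [/H1[_]|/H2 ->] := boolP (al \in mi S).
    by move=> /(derivative_normP _ _ _ p1 E0); rewrite (negbTE f0).
  have -> : quotient (frac_part s) p (fun=> 0) = (fun=> 0) :> ('rV[R]_D * 'rV[R]_D -> R).
    by apply/funext => z; rewrite /quotient subrr normr0 mul0r.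
  case: (p) p1 => [r||] //=; last by move=> _; apply: aeW => x _; rewrite normr0.
  rewrite lee_fin => r1; rewrite integral0_eq ?lee_fin ?powR_ge0// => x _.
  by rewrite normr0 powR0// gt_eqF// (lt_le_trans ltr01).
pose eps (q : cell_index D m) := C1 * local_error q u g v vf.
have tB : trivIset setT (fun q : cell_index D m => @middle R D m q).
  apply/trivIsetP => i j _ _ ij; apply/seteqP; split => // z [z1 z2].
  move/eqP: ij; apply; apply: grid_cube_unique; [exact: (middle_grid_cube z1)|exact: (middle_grid_cube z2)].
have meanb f (G : R) : 0 <= G -> measurable_fun Om f -> lpE mu Om p f G ->
    lpb V p (fun q : cell_index D m => mean mu V (middle q) f) G.
  move=> G0 mf Hf; apply: (@lpb_mean _ _ _ mu _ V Om) => // q.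
  - exact: measurable_middle.
  - exact: (middle_Omega m0).
  - by apply: (measure_cell_le (q := q) m0 (measurable_middle q m0)); exact: middle_cell.
have mean0 f (q : cell_index D m) : 0 <= mean mu V (middle q) f by exact: mean_ge0.
pose T2 (q : cell_index D m) := \sum_(j < S.+1) \sum_(al <- mi j) mean mu V (middle q) (v j al).
have T20 q : 0 <= T2 q by apply: sumr_ge0 => j _; apply: sumr_ge0.
have HT2 : lpb V p T2 (K1 * E).
  rewrite /K1 -mulrA; apply: lpb_sum => //; [exact: ltW|by rewrite mulr_ge0 ?exprn_ge0|by move=> j q; apply: sumr_ge0|].
  move=> j; apply: (lpb_mono (E := 8 ^+ size (mi j) * E)) => //; [exact: ltW|by rewrite mulr_ge0 ?exprn_ge0| |by move=> q; apply: sumr_ge0|].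
    apply: ler_wpM2r => //; apply: ler_weXn2l; first by rewrite ler1n.
    by rewrite /N (bigD1 j)//= leq_addr.
  apply: lpb_sum => //; first exact: ltW.
  by move=> al; have [h1 h2 _] := vP j al; exact: meanb.
pose T3 (q : cell_index D m) := if frac_part s == 0 then 0 else \sum_(al <- mi S) o2 al q.
have T30 q : 0 <= T3 q by rewrite /T3; case: ifP => // _; apply: sumr_ge0.
have HT3 : lpb V p T3 (K2 * (m%:R^-1 `^ s * E)).
  rewrite /T3 /K2; have [f0|f0] := eqVneq (frac_part s) 0.
    have G0 : 0 <= 8 ^+ size (mi S) * C2 * (m%:R^-1 `^ s * E) by rewrite mulr_ge0// mulr_ge0 ?exprn_ge0.
    case: (p) p1 => [r||] //=; rewrite lee_fin => r1; rewrite big1 ?mulr0 ?powR_ge0// => i _.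
    by rewrite powR0// gt_eqF// (lt_le_trans ltr01).
  rewrite -mulrA; apply: lpb_sum => //; [exact: ltW|by rewrite mulr_ge0|].
  by move=> al; have [] := osc al f0.
have epsE (q : cell_index D m) : eps q = C1 * (mean mu V (middle q) (g \- u) + m%:R^-1 `^ s * T2 q + T3 q).
  rewrite /eps /local_error -/V /T3 /T2; congr (_ * (_ + _)); case: ifP => // _.
  by rewrite mulr_sumr.
have eps0 (q : cell_index D m) : 0 <= eps q by rewrite epsE mulr_ge0// !addr_ge0// mulr_ge0 ?powR_ge0.
exists c, eps; split => // [q b b0|].
  apply: (HC1 m q (c q) u g v vf m0 (Hc q)) => //.
  - by have [_ u1oo] := u1; have [G G0 HG] := in_Lp_lpE (lexx 1%E) u1; apply: (lpE_Omega_integrable (lexx 1%E) _ HG); have [] := u1.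
  - exact: (lpE_Omega_integrable p1 mgu HF).
  - by move=> j al jS al_j; have [_ _] := vP j al; exact.
  - move=> f0 al al_S; have [_ [H1 _]] := Hvf' al; have [w _] := H1 al_S.
    by split => //; have [h _] := osc al f0; exact: h.
have -> : eps = fun q => C1 * (mean mu V (middle q) (g \- u) + m%:R^-1 `^ s * T2 q + T3 q) by apply/funext.
have V0' := ltW V0.
have sT2 : lpb V p (fun q => m%:R^-1 `^ s * T2 q) (m%:R^-1 `^ s * (K1 * E)).
  by apply: lpb_scale => //; rewrite ?powR_ge0// mulr_ge0.
have sT20 (q : cell_index D m) : 0 <= m%:R^-1 `^ s * T2 q by rewrite mulr_ge0 ?powR_ge0.
have sK1 : 0 <= m%:R^-1 `^ s * (K1 * E) by rewrite mulr_ge0 ?powR_ge0// mulr_ge0.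
have K3 : 0 <= K2 * (m%:R^-1 `^ s * E) by rewrite mulr_ge0.
have K4 : 0 <= 4 * (F + m%:R^-1 `^ s * (K1 * E)) by rewrite mulr_ge0// addr_ge0.
have G0 : 0 <= 4 * (4 * (F + m%:R^-1 `^ s * (K1 * E)) + K2 * (m%:R^-1 `^ s * E)) by rewrite mulr_ge0// addr_ge0.
have A0 (q : cell_index D m) : 0 <= mean mu V (middle q) (g \- u) + m%:R^-1 `^ s * T2 q by rewrite addr_ge0.
have A1 (q : cell_index D m) : 0 <= mean mu V (middle q) (g \- u) + m%:R^-1 `^ s * T2 q + T3 q by rewrite addr_ge0.
rewrite -mulrA; apply: lpb_scale => //; first by rewrite mulr_ge0 ?addr_ge0// mulr_ge0// addr_ge0// mulr_ge0// addr_ge0.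
apply: (lpb_mono (E := 4 * (4 * (F + m%:R^-1 `^ s * (K1 * E)) + K2 * (m%:R^-1 `^ s * E)))) => //.
  move: (m%:R^-1 `^ s) sE0 K3 => w sE0 K3; rewrite -subr_ge0.
  rewrite (_ : _ - _ = 4 * (4 * (w * E) + 4 * (K1 * F) + K2 * F)); last by ring.
  have h1 := mulr_ge0 K10 F0; have h2 := mulr_ge0 K20 F0.
  by apply: mulr_ge0 => //; apply: addr_ge0 => //; apply: addr_ge0; apply: mulr_ge0.
apply: lpb_add => //; apply: lpb_add => //; exact: meanb.
Qed.

End coefficient_errors.

(** * Flow maps and the error estimate *)

Section flow_pullback.
Context {R : realType} {D : nat} (T : R) (a : 'rV[R]_D -> R -> 'rV[R]_D) (Phi : R -> R -> 'rV[R]_D -> 'rV[R]_D).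
Hypothesis T0 : 0 < T.
Hypothesis adm : admissible_velocity T a.
Hypothesis flowP : flow T a Phi.
Local Notation Om := (@Omega R D).

Lemma flow_bilipschitz : exists2 L : R, 1 <= L & forall t x y, 0 <= t <= T -> Om x -> Om y ->
  [/\ Om (Phi t 0 x), `|Phi t 0 x - Phi t 0 y| <= L * `|x - y| & `|x - y| <= L * `|Phi t 0 x - Phi t 0 y|].
Proof.
have [L L1 HL] := trajectory_gronwall T0 adm; exists L => // t x y tT Ox Oy.
have T00 : (0 : R) <= 0 <= T by rewrite lexx ltW.
have [xt trx] := flowP tT Ox; have [yt try_] := flowP tT Oy.
split; first exact: (trajectory_in trx T00).
  by have := HL _ _ t 0 trx try_ tT T00; rewrite xt yt.
by have := HL _ _ 0 t trx try_ T00 tT; rewrite xt yt.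
Qed.

Lemma measurable_flow t : 0 <= t <= T -> measurable_fun Om (Phi t 0).
Proof.
move=> tT; have [L L1 HL] := flow_bilipschitz; have L0 : 0 < L by rewrite (lt_le_trans ltr01).
apply: continuous_measurable_rV => x Ox; apply/(@cvgrPdist_lt R 'rV[R]_D 'rV[R]_D (nbhs x) _ (Phi t 0) (Phi t 0 x)) => e e0.
have nO : nbhs x Om by apply: open_nbhs_nbhs; split => //; exact: open_Omega.
have nB : nbhs x [set y : 'rV[R]_D | `|x - y| < e / L].
  have /(@cvgrPdist_lt R 'rV[R]_D 'rV[R]_D (nbhs x) _ id x) H : id @ nbhs x --> x by exact: cvg_id.
  by apply: H; rewrite divr_gt0.
near=> y; have Oy : Om y by near: y.
have [_ h _] := HL t x y tT Ox Oy; apply: le_lt_trans h _; rewrite mulrC -ltr_pdivlMr//.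
by near: y.
Unshelve. all: by end_near. Qed.

Lemma spline_measurable k m (u : 'rV[R]_D -> R) : spline k m u -> measurable_fun Om u.
Proof.
by move=> [cu _]; apply: continuous_measurable_Omega => x Ox; exact: (proj1 (cu [::]) _ x Ox).
Qed.

(** Existence and uniqueness of the discrete solution must also hold when the Sobolev norm of [u0]
    is infinite; for that purpose any [eps] will do. *)
Lemma trivial_scaled_coefs n m (c : cell_index D m -> {ffun 'I_D -> 'I_n.+1} -> R) :
  exists2 eps : cell_index D m -> R, (forall q, 0 <= eps q) & scaled_coefs c eps.
Proof.
exists (fun q => \sum_(b : {ffun 'I_D -> 'I_n.+1}) m%:R^-1 ^+ (n - total_degree b) * `|c q b|) => [q|q b _].
  by apply: sumr_ge0 => b _; rewrite mulr_ge0 ?exprn_ge0 ?invr_ge0.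
by rewrite [leRHS](bigD1 b)//= lerDl sumr_ge0// => b' _; rewrite mulr_ge0 ?exprn_ge0 ?invr_ge0.
Qed.

End flow_pullback.

Theorem theorem4p4 (R : realType) (D : nat) (T : R)
    (a : 'rV[R]_D -> R -> 'rV[R]_D) (Phi : R -> R -> 'rV[R]_D -> 'rV[R]_D)
    (n : nat) :
  (0 < D)%N -> 0 < T -> admissible_velocity T a -> flow T a Phi -> (2 <= n)%N ->
  exists2 d0 : R, 0 < d0 < 1 &
  forall P : nat -> ('rV[R]_D -> R) -> 'rV[R]_D -> R, quasi_interpolator n.+1 P ->
  forall d : R, 0 < d <= d0 ->
  forall p : \bar R, (1 <= p)%E ->
  forall s : R, 0 <= s <= n%:R ->
  exists2 C : R, 0 < C &
  forall (m M : nat) (sigma h : R), (0 < m)%N -> (0 < M)%N ->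
    sigma = m%:R^-1 -> h = M%:R^-1 -> h = d * sigma ->
  forall x : cell_index D M -> R -> 'rV[R]_D, particles T a x ->
  forall u0 : 'rV[R]_D -> R, in_Lp (@Omega R D) p u0 ->
  forall t : R, 0 <= t <= T ->
  exists u_hs : 'rV[R]_D -> R,
    let y := fun i => x i t in
    let c := fun i => P m u0 (x i 0) in
    [/\ regularization n m y c u_hs,
        forall w, regularization n m y c w -> {in @Omega R D, w =1 u_hs} &
        (Lp_norm (@Omega R D) p
           (u_hs \- (fun z => advection_solution Phi u0 z t))%R <=
         (C * sigma `^ s)%:E * sobolev_norm (@Omega R D) s p u0)%E].
Proof.
move=> _ T0 adm flowP n2.
have [xi [om [xi01 dual]]] := dual_nodes R n2.
have [d0 d01 Hd] := particle_error T0 adm flowP n2 xi01 dual.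
have [L L1 HL] := flow_bilipschitz T0 adm flowP.
exists d0 => // P qP d dd p p1 s sn.
have [C1 C10 HC1] := Hd d dd.
have sn1 : 0 <= s <= n.+1%:R by have /andP[-> sn'] := sn; rewrite (le_trans sn')// ler_nat.
have [C2 C20 HC2] := approximation_error qP sn1.
have [C3 C30 HC3] := coefficient_error (D := D) sn p1.
pose LD := (4 * L) ^+ D : R.
have LD0 : 0 <= LD by rewrite exprn_ge0// mulr_ge0// (le_trans ler01).
pose C := 4 * (C1 * (C3 * (C2 + 1)) + LD * C2) + 1.
have C0 : 0 < C by rewrite ltr_wpDl// mulr_ge0// addr_ge0// !mulr_ge0 ?(ltW C10)// addr_ge0.
exists C => // m M sigma h m0 M0 -> -> hd x px u0 u0p t tT.
pose Om := @Omega R D; pose mu := lebesgue_rV R D.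
have u1 := in_Lp_in_L1 p1 u0p; have [mu0 _] := u0p.
have mO : measurable Om by exact: measurable_Omega.
have sg : spline n.+1 m (P m u0) by have [/(_ m m0)[H _] _] := qP; exact: H.
set g := P m u0 in sg *; pose w z := g (Phi t 0 z).
have [c0 Hc0] := cell_poly_of_spline m0 sg.
have [e0 e00 He0] := trivial_scaled_coefs c0.
have [u_hs [reg uniq _]] := HC1 m M g c0 e0 x t m0 M0 hd sg Hc0 e00 He0 px tT.
exists u_hs; split => //.
have mU : measurable_fun Om u_hs by have [su _] := reg; exact: spline_measurable su.
have mphi := measurable_flow T0 adm flowP tT.
have phiO z : Om z -> Om (Phi t 0 z) by move=> Oz; have [] := HL t z z tT Oz Oz.
have lip y z : Om y -> Om z -> `|y - z| <= L * `|Phi t 0 y - Phi t 0 z|.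
  by move=> Oy Oz; have [] := HL t y z tT Oy Oz.
have mg : measurable_fun Om g by exact: spline_measurable sg.
have mw : measurable_fun Om w by apply: (measurable_pullback mphi phiO mg).
pose u z := advection_solution Phi u0 z t.
have mu_ : measurable_fun Om u by apply: (measurable_pullback mphi phiO mu0).
have sig0 : 0 < (m%:R^-1 : R) `^ s by rewrite powR_gt0// invr_gt0 ltr0n.
(* The strict inequality makes representatives of the weak derivatives available with bounds by
   [E]. *)
have main (E : R) : 0 <= E -> (sobolev_norm Om s p u0 < E%:E)%E ->
    (Lp_norm Om p (u_hs \- u)%R <= (C * (m%:R^-1 `^ s * E))%:E)%E.
  move=> E0 NE; have [Hv Hvf] := sobolev_norm_derivative p1 NE.
  have [mD appr] := HC2 m p u0 E m0 p1 E0 u1 Hvf.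
  set W := m%:R^-1 `^ s * E in appr *; have W0 : 0 <= W by rewrite mulr_ge0 ?(ltW sig0).
  have F0 : 0 <= C2 * W by exact: mulr_ge0.
  have mgu : measurable_fun Om (g \- u0) by exact: measurable_funB.
  have appr' : lpE mu Om p (g \- u0) (C2 * W).
    by apply: (lpE_le p1 mO mO mD mgu _ F0 (lexx _) _ appr) => // z _; rewrite /= distrC.
  have [c [eps [Hc eps0 sc Heps]]] := HC3 m u0 g E (C2 * W) m0 E0 F0 sg u1 mgu appr' Hv Hvf.
  have [u' [reg' _ [e [e_0 He Hle]]]] := HC1 m M g c eps x t m0 M0 hd sg Hc eps0 sc px tT.
  have V0 : 0 <= cell_volume (R := R) (D := D) m by rewrite exprn_ge0// invr_ge0.
  have E1 : 0 <= C3 * (C2 * W + W) by rewrite mulr_ge0// addr_ge0.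
  have err1 : lpE mu Om p (u_hs \- w) (C1 * (C3 * (C2 * W + W))).
    apply: (@lpE_cover_sup _ _ _ mu (cell_index D m) (cell_volume (R := R) (D := D) m) Om (@cell R D m) p _ e) => //.
    - by move=> i; exact: measurable_enlarged_cell.
    - by move=> i; apply: (measure_cell_le (q := i) m0) => //; exact: measurable_enlarged_cell.
    - by move=> i; exact: enlarged_cell_Omega.
    - by move=> z Oz; exact: cell_exists.
    - exact: measurable_funB.
    - move=> i z iz; have Oz : z \in Om by rewrite inE; case: iz.
      (* The solution obtained together with the quantitative [eps] agrees with [u_hs] on [Om] by
         uniqueness. *)
      by rewrite /= -(uniq _ reg' z Oz); exact: He.
    - exact: Hle.
  have err2 : lpE mu Om p ((g \- u0) \o Phi t 0) (LD * (C2 * W)).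
    exact: (pullback_lpE L1 mphi phiO lip p1 F0 mgu appr').
  have C1E : 0 <= C1 * (C3 * (C2 * W + W)) by rewrite mulr_ge0// ltW.
  have C2E : 0 <= LD * (C2 * W) by rewrite mulr_ge0.
  have CW : 0 <= C * W by rewrite mulr_ge0// ltW.
  have mf1 : measurable_fun Om (u_hs \- w) by exact: measurable_funB.
  have mf2 : measurable_fun Om ((g \- u0) \o Phi t 0) by exact: measurable_funB.
  have := lpE_add p1 mO mf1 mf2 C1E C2E err1 err2.
  set A := 4 * _ => H; have A0 : 0 <= A by rewrite mulr_ge0// addr_ge0.
  apply/(lpEP mu Om (u_hs \- u) p1 CW); apply: (lpE_le p1 mO mO _ _ _ A0 _ _ H) => //.
  - exact: measurable_funD.
  - exact: measurable_funB.
  - rewrite -subr_ge0 (_ : _ - _ = W)// /A /C; ring.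
  - by move=> z _; rewrite /= /w /u /advection_solution; rewrite addrA subrK.
have NN : (0 <= sobolev_norm Om s p u0)%E.
  by rewrite /sobolev_norm; case: (p) => [r||]; rewrite ?poweR_ge0//=; elim/big_rec: _ => // v w' _ w0; rewrite le_max w0 orbT.
have Cs0 : 0 < C * m%:R^-1 `^ s by rewrite mulr_gt0.
have [Noo|Nfin] := eqVneq (sobolev_norm Om s p u0) +oo%E.
  by rewrite -/Om Noo gt0_muley ?lte_fin// leey.
have Nf : sobolev_norm Om s p u0 \is a fin_num by rewrite ge0_fin_numE// ltey.
rewrite -/Om -(fineK Nf); set r := fine _; have r0 : 0 <= r by exact: fine_ge0.
(* [E] is taken above the norm by exactly the amount that costs [e] in the final bound. *)
apply/lee_addgt0Pr => e e_gt0; rewrite -EFinM -EFinD.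
have -> : C * m%:R^-1 `^ s * r + e = C * (m%:R^-1 `^ s * (r + e / (C * m%:R^-1 `^ s))).
  by field; rewrite !gt_eqF.
apply: main; first by rewrite addr_ge0// divr_ge0// ltW.
by rewrite -(fineK Nf) lte_fin ltrDl divr_gt0.
Qed.
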